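(* Let $(X_n)_{n\in\mathbb{N}}$ be a stationary real-valued process and let $h_2:\mathbb{R}^2\to\mathbb{R}$ be a degenerate, centered kernel with uniform $(2+\delta)$-moments for some $\delta>0$. Let $\tau\ge 0$ be such that one of the following three conditions holds: (1) $(X_n)_{n\in\mathbb{N}}$ is absolutely regular with coefficients $\beta(k)$, and $\sum_{k=0}^{n}k\,\beta^{\frac{\delta}{2+\delta}}(k)=O(n^{\tau})$. (2) $(X_n)_{n\in\mathbb{N}}$ is strongly mixing with coefficients $\alpha(k)$, $E|X_1|^{\gamma}<\infty$ for some $\gamma>0$, $h_2$ is $P$-Lipschitz-continuous or satisfies the variation condition, and $\sum_{k=0}^{n}k\,\alpha^{\frac{2\gamma\delta}{3\gamma\delta+\delta+5\gamma+2}}(k)=O(n^{\tau})$. (3) $(X_n)_{n\in\mathbb{N}}$ is a $1$-approximating functional with constants $(a_n)$ of an absolutely regular process $(Z_n)_{n\in\mathbb{Z}}$ with absolute regularity coefficients $\beta(k)$, $h_2$ is $P$-Lipschitz-continuous or satisfies the variation condition, and, with $\alpha_L:=\sqrt{2\sum_{i=L}^{\infty}a_i}$, $\sum_{k=0}^{n}k\left(\beta^{\frac{\delta}{2+\delta}}(k)+\alpha_k^{\frac{\delta}{2+\delta}}\right)=O(n^{\tau})$. Then, as $n\to\infty$, $$\frac{n^{1-\frac{\tau}{2}}}{\log^{\frac32}n\,\log\log n}\,U_n(h_2)\longrightarrow 0\quad\text{almost surely},$$ where $U_n(h_2)=\binom{n}{2}^{-1}\sum_{1\le i<j\le n}h_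2(X_i,X_j)$.
   Context: A kernel is a symmetric measurable function $h:\mathbb{R}^2\to\mathbb{R}$. Let $X,Y$ be independent, each with the law of $X_1$. A kernel $h$ is centered if $E\,h(X,Y)=0$, and degenerate if $E\,h(x,Y)=0$ for every $x\in\mathbb{R}$. Uniform $m$-moments: $h$ has uniform $m$-moments if there is a constant $M<\infty$ with $E|h(X,Y)|^m\le M$ for $X,Y$ independent with the law of $X_1$, and $E|h(X_1,X_k)|^m\le M$ for all $k$ (including $k=1$). Mixing: a stationary process indexed by $\mathbb{N}$ is regarded, when needed, as part of a two-sided stationary process. For a stationary process let $\mathcal{F}_a^l$ be the $\sigma$-field generated by its variables with indices from $a$ to $l$. The strong mixing coefficients are $\alpha(k)=\sup\{|P(A\cap B)-P(A)P(B)|: A\in\mathcal{F}_1^n, B\in\mathcal{F}_{n+k}^{\infty}, n\in\mathbb{N}\}$, and the absolute regularity coefficients are $\beta(k)=\sup_{n\in\mathbb{N}}E\sup\{|P(A\mid\mathcal{F}_{-\infty}^n)-P(A)|: A\in\mathcal{F}_{n+k}^{\infty}\}$ (the inner supremum understood as an essential supremum). The process is strongly mixing if $\alpha(k)\to0$ and absolutely regular if $\beta(k)\to0$ as $k\to\infty$. Functionals: given a stationary absolutely regular process $(Z_n)_{n\in\mathbb{Z}}$, the process $(X_n)$ is a (one-sided) functional of $(Z_n)$ if $X_n=f((Z_{n+k})_{k\ge0})$ for a measurable $f:\mathbb{R}^{\mathbb{N}}\to\mathbb{R}$. It is $r$-approximating ($r\ge1$) with constants $(a_l)$ if $\|X_1-E(X_1\mid\mathcal{F}_0^l)\|_r\le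 a_l$ for $l=0,1,2,\dots$, where $a_l\to0$, $\mathcal{F}_0^l=\sigma(Z_0,\dots,Z_l)$ and $\|Y\|_r=(E|Y|^r)^{1/r}$. The numbers $\alpha_L$ (subscript) are those defined in (3), not strong mixing coefficients. $P$-Lipschitz-continuity: $h$ is $P$-Lipschitz-continuous if there is a constant $L>0$ such that $E\left[|h(X,Y)-h(X',Y)|\,\mathbf{1}_{\{|X-X'|\le\epsilon\}}\right]\le L\epsilon$ for every $\epsilon>0$, every pair $(X,Y)$ whose joint distribution is the distribution of $(X_1,X_k)$ for some $k\in\mathbb{N}$ or the product $\mathcal{P}_{X_1}\times\mathcal{P}_{X_1}$ (with $\mathcal{P}_{X_1}$ the law of $X_1$), and every $X'$ such that $(X',Y)$ also has one of these joint distributions. Variation condition: $h$ satisfies the variation condition if there is a constant $L$ such that for every $\epsilon>0$, $E\left[\sup|h(x,y)-h(x',y')|\right]\le L\epsilon$, where the supremum is over all $(x,y),(x',y')\in\mathbb{R}^2$ with $\|(x,y)-(X,Y)\|\le\epsilon$ and $\|(x',y')-(X,Y)\|\le\epsilon$, $(X,Y)$ has distribution $\mathcal{P}_{X_1}\times\mathcal{P}_{X_1}$, and $\|\cdot\|$ is the Euclidean norm. *)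

(* Defs.v *)
From HB Require Import structures.
From mathcomp Require Import all_boot all_order all_algebra.
From mathcomp Require Import all_classical all_reals all_analysis.
From mathcomp Require Import measurable_realfun.

Set Implicit Arguments.
Unset Strict Implicit.
Unset Printing Implicit Defensive.

Import Order.TTheory GRing.Theory Num.Theory.
Import numFieldNormedType.Exports.

Local Open Scope classical_set_scope.
Local Open Scope ring_scope.

(* Convention: a process indexed by N = {1, 2, ...} is a function on [nat]
   whose value at 0 is never used. *)

Definition sigma_gen (R : realType) (S I : Type) (V : I -> S -> R)
    (J : set I) : set (set S) :=
  <<s [set A | exists i B, [/\ J i, measurable B & A = V i @^-1` B] ] >>.

(* The product sigma-algebra on R^I. *)
Definition cyl_sigma (R : realType) (I : Type) : set (set (I -> R)) :=
  sigma_gen (fun (i : I) (z : I -> R) => z i) setT.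

Section Processes.
Context (R : realType) (d : measure_display) (T : measurableType d).
Variable P : probability T R.

Definition stationary_nat (X : nat -> {RV P >-> R}) : Prop :=
  forall (s : nat) (A : set (nat -> R)), cyl_sigma A ->
    P [set w | A (fun k => X (k + s).+1 w)] = P [set w | A (fun k => X k.+1 w)].

Definition stationary_int (Z : int -> {RV P >-> R}) : Prop :=
  forall (s : int) (A : set (int -> R)), cyl_sigma A ->
    P [set w | A (fun i => Z (i + s) w)] = P [set w | A (fun i => Z i w)].

(* Y is a version of E(V | G). *)
Definition is_cond_exp (G : set (set T)) (V Y : T -> R) : Prop :=
  [/\ P.-integrable setT (EFin \o V),
      P.-integrable setT (EFin \o Y),
      forall B : set R, measurable B -> G (Y @^-1` B) &
      forall A, G A ->
        (\int[P]_(w in A) (Y w)%:E = \int[P]_(w in A) (V w)%:E)%E].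

(* A chosen version of E(V | G); versions exist whenever V is integrable and G
   is a sub-sigma-algebra. For non-integrable V the value is the junk 0. *)
Definition cond_exp (G : set (set T)) (V : T -> R) : T -> R :=
  xget (cst 0) [set Y | is_cond_exp G V Y].

Definition cond_prob (G : set (set T)) (A : set T) : T -> R :=
  cond_exp G (\1_A).

(* g is an essential supremum of the family F. *)
Definition is_ess_sup_family (F : set (T -> R)) (g : T -> \bar R) : Prop :=
  [/\ measurable_fun setT g,
      forall f, F f -> {ae P, forall w, ((f w)%:E <= g w)%E} &
      forall g' : T -> \bar R, measurable_fun setT g' ->
        (forall f, F f -> {ae P, forall w, ((f w)%:E <= g' w)%E}) ->
        {ae P, forall w, (g w <= g' w)%E}].

(* It exists for every family of random variables and is a.s. unique. *)
Definition ess_sup_family (F : set (T -> R)) : T -> \bar R :=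
  xget (cst 0%E) [set g | is_ess_sup_family F g].

(* The suprema in [alpha_mix] and [beta_reg] are of nonempty sets of reals
   bounded by 1, so [sup] takes no junk value. *)
Definition alpha_mix (X : nat -> {RV P >-> R}) (k : nat) : R :=
  sup [set r | exists (n : nat) (A B : set T),
    [/\ (1 <= n)%N,
        sigma_gen X [set i | (1 <= i <= n)%N] A,
        sigma_gen X [set i | (n + k <= i)%N] B &
        r = `| fine (P (A `&` B)) - fine (P A) * fine (P B) | ] ].

Definition strongly_mixing (X : nat -> {RV P >-> R}) : Prop :=
  alpha_mix X k @[k --> \oo] --> (0 : R).

Definition beta_reg (Z : int -> {RV P >-> R}) (k : nat) : R :=
  let past n := sigma_gen Z [set i | i <= n%:Z] in
  let future n := sigma_gen Z [set i | n%:Z <= i] in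
  let deviations n := [set f | exists2 A : set T, future (n + k)%N A &
    f = fun w => `| cond_prob (past n) A w - fine (P A) | ] in
  sup [set r | exists2 n : nat, (1 <= n)%N &
    r = fine (\int[P]_w ess_sup_family (deviations n) w)].

Definition absolutely_regular (Z : int -> {RV P >-> R}) : Prop :=
  beta_reg Z k @[k --> \oo] --> (0 : R).

Definition is_functional (X : nat -> {RV P >-> R}) (Z : int -> {RV P >-> R})
    : Prop :=
  exists2 f : (nat -> R) -> R,
    (forall B : set R, measurable B -> cyl_sigma (f @^-1` B)) &
    forall (n : nat) (w : T), (1 <= n)%N ->
      X n w = f (fun k => Z (n + k)%:Z w).

(* ||X_1 - E(X_1 | F_0^l)||_r <= a_l forces X_1 to be integrable: otherwise
   [cond_exp] is 0 and the norm is +oo. *)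
Definition approximating (r : R) (a : nat -> R)
    (X : nat -> {RV P >-> R}) (Z : int -> {RV P >-> R}) : Prop :=
  [/\ 1 <= r, is_functional X Z,
      a l @[l --> \oo] --> (0 : R) &
      forall l : nat,
        let F0l := sigma_gen Z [set i | (0 <= i <= l%:Z)] in
        ('N[P]_(r%:E)[EFin \o (X 1%N \- cond_exp F0l (X 1%N))%R]
           <= (a l)%:E)%E].

Definition centered (X : nat -> {RV P >-> R}) (h : R * R -> R) : Prop :=
  (\int[distribution P (X 1%N) \x distribution P (X 1%N)]_z (h z)%:E = 0)%E.

(* An extended-real integral equal to 0 is that of an integrable function,
   as +oo - +oo = -oo. *)
Definition degenerate (X : nat -> {RV P >-> R}) (h : R * R -> R) : Prop :=
  forall x : R, (\int[distribution P (X 1%N)]_y (h (x, y))%:E = 0)%E.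

Definition uniform_moments (m : R) (X : nat -> {RV P >-> R})
    (h : R * R -> R) : Prop :=
  exists M : R,
    (\int[distribution P (X 1%N) \x distribution P (X 1%N)]_z
        (`|h z| `^ m)%:E <= M%:E)%E /\
    (forall k : nat, (1 <= k)%N ->
      (\int[P]_w (`|h (X 1%N w, X k w)| `^ m)%:E <= M%:E)%E).

Definition admissible_law (X : nat -> {RV P >-> R})
    (mu : set (R * R) -> \bar R) : Prop :=
  (exists2 k : nat, (1 <= k)%N &
     forall A, measurable A -> mu A = P [set w | A (X 1%N w, X k w)]) \/
  (forall A, measurable A ->
     mu A = (distribution P (X 1%N) \x distribution P (X 1%N))%E A).

Definition P_Lipschitz (X : nat -> {RV P >-> R}) (h : R * R -> R) : Prop :=
  exists2 L : R, 0 < L &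
    forall eps : R, 0 < eps ->
    forall (d' : measure_display) (T' : measurableType d')
      (Q : probability T' R) (U V U' : {RV Q >-> R}),
      admissible_law X (fun A => Q [set w | A (U w, V w)]) ->
      admissible_law X (fun A => Q [set w | A (U' w, V w)]) ->
      (\int[Q]_w (`| h (U w, V w) - h (U' w, V w) |
                  * \1_[set w' | `|U w' - U' w'| <= eps] w)%:E
         <= (L * eps)%:E)%E.

End Processes.

Definition kernel_fun (R : realType) (h : R * R -> R) : Prop :=
  measurable_fun setT h /\ forall x y, h (x, y) = h (y, x).

(* The norm of the library on R * R is the sup norm. *)
Definition eucl_dist (R : realType) (p q : R * R) : R :=
  Num.sqrt ((p.1 - q.1) ^+ 2 + (p.2 - q.2) ^+ 2).

Definition oscillation (R : realType) (h : R * R -> R) (eps : R) (z : R * R)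
    : \bar R :=
  ereal_sup [set r | exists p q : R * R,
    [/\ eucl_dist p z <= eps, eucl_dist q z <= eps &
        r = (`|h p - h q|)%:E] ].

(* The oscillation is nonnegative and universally measurable; on nonnegative
   functions the integral of the library is the supremum of the integrals of
   the simple functions below, hence here the integral for the completed
   measure. *)
Definition variation_condition (R : realType) (d : measure_display)
    (T : measurableType d) (P : probability T R) (X : nat -> {RV P >-> R})
    (h : R * R -> R) : Prop :=
  exists L : R, forall eps : R, 0 < eps ->
    (\int[distribution P (X 1%N) \x distribution P (X 1%N)]_z
        oscillation h eps z <= (L * eps)%:E)%E.

(* X' is a two-sided stationary process, possibly on another probability space,
   of which X is (in law) the part with indices 1, 2, ... The coefficients
   [beta_reg X'] depend on the law of X' only, hence on that of X only. *)
Definition two_sided_extension (R : realType)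
    (d : measure_display) (T : measurableType d) (P : probability T R)
    (X : nat -> {RV P >-> R})
    (d' : measure_display) (T' : measurableType d') (P' : probability T' R)
    (X' : int -> {RV P' >-> R}) : Prop :=
  stationary_int X' /\
  forall A : set (nat -> R), cyl_sigma A ->
    P' [set w | A (fun k => X' k.+1%:Z w)] = P [set w | A (fun k => X k.+1 w)].

(* To be used with a summable only. *)
Definition alpha_sub (R : realType) (a : nat -> R) (L : nat) : R :=
  Num.sqrt (2 * \big[+%R/0]_(L <= i <oo) a i).

Definition Ustat (R : realType) (h : R * R -> R) (x : nat -> R) (n : nat) : R :=
  ('C(n, 2))%:R^-1 *
  \sum_(1 <= i < n.+1) \sum_(i.+1 <= j < n.+1) h (x i, x j).

Section Conditions.
Context (R : realType) (d : measure_display) (T : measurableType d).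
Variables (P : probability T R) (X : nat -> {RV P >-> R}) (h : R * R -> R).
Variables (delta tau : R).

Definition cond_abs_reg : Prop :=
  exists (d' : measure_display) (T' : measurableType d')
    (P' : probability T' R) (X' : int -> {RV P' >-> R}),
    [/\ two_sided_extension X X', absolutely_regular X' &
        (fun n : nat => \sum_(0 <= k < n.+1)
           k%:R * beta_reg X' k `^ (delta / (2 + delta)))
        =O_\oo (fun n : nat => n%:R `^ tau)].

Definition cond_strong_mix : Prop :=
  strongly_mixing X /\
  exists gamma : R,
    [/\ 0 < gamma,
        (\int[P]_w (`|X 1%N w| `^ gamma)%:E < +oo)%E,
        P_Lipschitz X h \/ variation_condition X h &
        (fun n : nat => \sum_(0 <= k < n.+1)
           k%:R * alpha_mix X k `^
             (2 * gamma * delta /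
              (3 * gamma * delta + delta + 5 * gamma + 2)))
        =O_\oo (fun n : nat => n%:R `^ tau)].

(* Summability of a makes the alpha_L finite; without it the growth condition
   would fail. *)
Definition cond_functional : Prop :=
  exists (Z : int -> {RV P >-> R}) (a : nat -> R),
    [/\ stationary_int Z /\ absolutely_regular Z,
        approximating 1 a X Z,
        P_Lipschitz X h \/ variation_condition X h,
        cvgn (series a) &
        (fun n : nat => \sum_(0 <= k < n.+1)
           k%:R * (beta_reg Z k `^ (delta / (2 + delta))
                   + alpha_sub a k `^ (delta / (2 + delta))))
        =O_\oo (fun n : nat => n%:R `^ tau)].

End Conditions.

(* Main.v *)
Require Import Defs.
From HB Require Import structures.
From mathcomp Require Import all_boot all_order all_algebra.
From mathcomp Require Import all_classical all_reals all_analysis.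
From mathcomp Require Import measurable_realfun.
From mathcomp Require Import ring lra zify.

Set Implicit Arguments.
Unset Strict Implicit.
Unset Printing Implicit Defensive.

Import Order.TTheory GRing.Theory Num.Theory.
Import numFieldNormedType.Exports.

Local Open Scope classical_set_scope.
Local Open Scope ring_scope.

(** All three dependence conditions bound, for a function [J] of the past with
    finitely many values and a future [phi], the sum over [j] of
    [P (J = j, phi in A j) - P (J = j) P (phi in A j)]; for strong mixing this
    costs a factor of the order of the square root of the number of values, by
    Khintchine's inequality. Such a bound yields a coupling of [(U, V)], [U]
    past and [V] future, with [(U', V)], where [U'] is independent of [V] and
    close to [U]. Degeneracy kills the mean of [h (U', V)], and truncation at
    a level [K] turns this into bounds on [E [h (X_i, X_j) h (X_i', X_j')]]
    that decay with the first or the last gap between the four indices. For a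
    functional of an absolutely regular process, [h (X_i, X_j)] is first
    replaced by a finite-valued function of two windows of the underlying
    process, and the remainder is summed absolutely.

    Summing over quadruples gives second moments of the order of [n ^ (2 + tau)],
    and the maximal inequality of Rademacher and Menshov over dyadic blocks
    turns these into almost sure convergence. *)

(** The kernel is regular at most in the mean, and only under the laws of [(X_1, X_k)] and the
    product law, so [h] may not be compared at points of uncontrolled law. A coupling for which
    [(U', V)] has exactly the product law respects this. Restricting the past to finitely many
    values makes its conditional law an explicit vector of densities; the coupling is then a density
    on [T * T], and the finer structure of [U] is recovered through partitions of the line.

    The level [K] balances the decoupling cost [K * theta] against the truncation error
    [K ^ -(1 + delta)] of a degenerate kernel. The other factor of the product, bounded by [K],
    turns the result into [K ^ -delta], which is the power [delta / (2 + delta)] of [theta]. Under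
    strong mixing [theta] carries the square root of the number of cells of a bounded interval,
    whose length is dictated by the moment of order [gamma]; this accounts for the more involved
    exponent.

    The logarithms come from the scale [2 ^ k]: in mean square the maximal inequality costs [k ^ 2],
    and summability over [k] costs [k * (ln k) ^ 2] more. *)

Lemma indic_setT (R : realType) (T : Type) (x : T) : \1_[set: T] x = 1 :> R.
Proof. by rewrite indicE in_setT. Qed.

(** * Indicators, bounded measurable functions and their means *)

Section indicators.
Context (R : realType) (T U : Type).

Lemma indic_preimage (f : T -> U) (A : set U) x :
  \1_(f @^-1` A) x = \1_A (f x) :> R.
Proof. by []. Qed.

Lemma indic_setC (A : set T) x : \1_(~` A) x = 1 - \1_A x :> R.
Proof. by rewrite !indicE in_setC; case: (_ \in _); rewrite ?subrr ?subr0. Qed.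

Lemma indic_setI (A B : set T) x : \1_(A `&` B) x = \1_A x * \1_B x :> R.
Proof. by rewrite !indicE in_setI -natrM mulnb. Qed.

Lemma indic_le1 (A : set T) x : \1_A x <= 1 :> R.
Proof. by rewrite indicE; case: (_ \in _). Qed.

Lemma indic_ge0 (A : set T) x : 0 <= \1_A x :> R.
Proof. by rewrite indicE. Qed.

End indicators.

Section bounded_functions.
Context (R : realType).

Definition bdd d (T : measurableType d) (f : T -> R) : Prop :=
  measurable_fun [set: T] f /\ exists M : R, forall x, `|f x| <= M.

Context d (T : measurableType d).
Implicit Types f g : T -> R.

Lemma bdd_meas f : bdd f -> measurable_fun [set: T] f.
Proof. by case. Qed.

Lemma bdd_bound f : bdd f -> exists2 M : R, 0 < M & forall x, `|f x| <= M.
Proof.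
move=> [_ [M fM]]; exists (`|M| + 1) => [|x]; first by rewrite ltr_wpDl.
by rewrite (le_trans (fM x))// (le_trans (ler_norm _))// lerDl.
Qed.

Lemma bdd_cst (r : R) : bdd (fun _ : T => r).
Proof. by split; [exact: measurable_cst|exists `|r|]. Qed.

Lemma bdd_indic (A : set T) : measurable A -> bdd (\1_A : T -> R).
Proof.
move=> mA; split; first exact: measurable_indic.
by exists 1 => x; rewrite indicE; case: (_ \in _); rewrite ?normr1 ?normr0.
Qed.

Lemma bddD f g : bdd f -> bdd g -> bdd (fun x => f x + g x).
Proof.
move=> [mf [M fM]] [mg [N gN]]; split; first exact: measurable_funD.
by exists (M + N) => x; rewrite (le_trans (ler_normD _ _))// lerD.
Qed.

Lemma bddN f : bdd f -> bdd (fun x => - f x).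
Proof.
move=> [mf [M fM]]; split; first exact: measurableT_comp.
by exists M => x; rewrite normrN.
Qed.

Lemma bddB f g : bdd f -> bdd g -> bdd (fun x => f x - g x).
Proof. by move=> bf bg; apply: bddD => //; exact: bddN. Qed.

Lemma bddM f g : bdd f -> bdd g -> bdd (fun x => f x * g x).
Proof.
move=> [mf [M fM]] [mg [N gN]]; split; first exact: measurable_funM.
by exists (M * N) => x; rewrite normrM ler_pM.
Qed.

Lemma bddZ (r : R) f : bdd f -> bdd (fun x => r * f x).
Proof. by apply: bddM; exact: bdd_cst. Qed.

Lemma bdd_norm f : bdd f -> bdd (fun x => `|f x|).
Proof.
move=> [mf [M fM]]; split; first exact: measurableT_comp.
by exists M => x; rewrite normr_id.
Qed.

Lemma bdd_sum (I : Type) (s : seq I) (Q : pred I) (F : I -> T -> R) :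
  (forall i, bdd (F i)) -> bdd (fun x => \sum_(i <- s | Q i) F i x).
Proof.
move=> bF; elim: s => [|i s IH].
  by under eq_fun do rewrite big_nil; exact: bdd_cst.
under eq_fun do rewrite big_cons; case: (Q i) => //.
exact: bddD.
Qed.

Lemma bdd_min f g : bdd f -> bdd g -> bdd (fun x => Num.min (f x) (g x)).
Proof.
move=> [mf [M fM]] [mg [N gN]]; split; first exact: measurable_minr.
exists (M + N) => x; have := fM x; have := gN x.
have := normr_ge0 (f x); have := normr_ge0 (g x).
by rewrite /Num.min; case: ifP => _; lra.
Qed.

Lemma bdd_ext f g : f =1 g -> bdd f -> bdd g.
Proof. by move=> /funext ->. Qed.

Lemma bdd_le f (M : R) : measurable_fun setT f -> (forall x, `|f x| <= M) ->
  bdd f.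
Proof. by move=> mf fM; split => //; exists M. Qed.

Lemma bdd01 f : measurable_fun setT f -> (forall x, 0 <= f x <= 1) -> bdd f.
Proof.
move=> mf f01; apply: (@bdd_le _ 1) => // x.
by have /andP[? ?] := f01 x; rewrite ger0_norm.
Qed.

End bounded_functions.

Ltac bdd_tac := repeat first [ solve [trivial] | exact: bdd_cst
  | (apply: bdd_indic; assumption) | exact: bdd_indic
  | apply: bddB | apply: bddD | apply: bddN | apply: bddM | apply: bdd_norm
  | (apply: bdd_sum => ?) ].

Lemma bdd_comp (R : realType) d (T : measurableType d) d' (S : measurableType d')
    (f : S -> R) (g : T -> S) :
  measurable_fun setT g -> bdd f -> bdd (fun x => f (g x)).
Proof.
move=> mg [mf [M fM]]; split; first exact: measurableT_comp.
by exists M.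
Qed.

Section mean.
Context (R : realType) d (T : measurableType d).
Implicit Types (P : probability T R) (f g : T -> R).

Definition mean P f : R := \int[P]_x f x.

Definition pr P (A : set T) : R := fine (P A).

Lemma prE P A : measurable A -> (pr P A)%:E = P A.
Proof. by move=> mA; rewrite /pr fineK// fin_num_measure. Qed.

Lemma pr_ge0 P A : 0 <= pr P A.
Proof. by rewrite /pr fine_ge0. Qed.

Lemma pr_le1 P A : measurable A -> pr P A <= 1.
Proof. by move=> mA; rewrite -lee_fin prE// probability_le1. Qed.

Lemma le_pr P A B : measurable A -> measurable B -> A `<=` B -> pr P A <= pr P B.
Proof. by move=> mA mB AB; rewrite -lee_fin !prE// le_measure// inE. Qed.

Lemma pr_setT P : pr P setT = 1.
Proof. by rewrite /pr probability_setT. Qed.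

Lemma bdd_integrable P f : bdd f -> P.-integrable setT (EFin \o f).
Proof.
move=> [mf [M fM]]; apply: measurable_bounded_integrable => //.
  by rewrite (le_lt_trans (probability_le1 P _))// ltry.
by exists M; split=> [|x Mx y _ /=]; [exact: num_real|rewrite (le_trans (fM _))// ltW].
Qed.

Lemma meanE P f : bdd f -> (mean P f)%:E = (\int[P]_x (f x)%:E)%E.
Proof.
move=> bf; rewrite /mean /Rintegral fineK//.
exact: integrable_fin_num (bdd_integrable P bf).
Qed.

Lemma eq_mean P f g : f =1 g -> mean P f = mean P g.
Proof. by move=> /funext ->. Qed.

Lemma meanD P f g : bdd f -> bdd g ->
  mean P (fun x => f x + g x) = mean P f + mean P g.
Proof. by move=> bf bg; rewrite /mean RintegralD//; exact: bdd_integrable. Qed.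

Lemma meanB P f g : bdd f -> bdd g ->
  mean P (fun x => f x - g x) = mean P f - mean P g.
Proof. by move=> bf bg; rewrite /mean RintegralB//; exact: bdd_integrable. Qed.

Lemma meanZ P (r : R) f : bdd f -> mean P (fun x => r * f x) = r * mean P f.
Proof. by move=> bf; rewrite /mean RintegralZl//; exact: bdd_integrable. Qed.

Lemma mean_cst P (r : R) : mean P (fun=> r) = r.
Proof. by rewrite /mean Rintegral_cst// [fine _](pr_setT P) mulr1. Qed.

Lemma mean_sum P (I : Type) (s : seq I) (Q : pred I) (F : I -> T -> R) :
  (forall i, bdd (F i)) ->
  mean P (fun x => \sum_(i <- s | Q i) F i x) =
  \sum_(i <- s | Q i) mean P (F i).
Proof.
move=> bF; elim: s => [|i s IH].
  by under eq_mean do rewrite big_nil; rewrite big_nil mean_cst.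
under eq_mean do rewrite big_cons; rewrite big_cons; case: (Q i) => //.
by rewrite meanD ?IH//; exact: bdd_sum.
Qed.

Lemma le_mean P f g : bdd f -> bdd g -> (forall x, f x <= g x) ->
  mean P f <= mean P g.
Proof.
by move=> bf bg fg; apply: le_Rintegral => //; exact: bdd_integrable.
Qed.

Lemma mean_abs P f : bdd f -> `|mean P f| <= mean P (fun x => `|f x|).
Proof. by move=> bf; apply: le_normr_Rintegral => //; exact: bdd_integrable. Qed.

Lemma mean_indic P A : measurable A -> mean P \1_A = pr P A.
Proof.
by move=> mA; rewrite /mean /Rintegral/= integral_indic// setIT.
Qed.

Lemma prC P A : measurable A -> pr P (~` A) = 1 - pr P A.
Proof.
move=> mA; rewrite -!mean_indic//; last exact: measurableC.
rewrite -(mean_cst P 1) -meanB//; [|exact: bdd_cst|exact: bdd_indic].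
by apply: eq_mean => x; rewrite indic_setC.
Qed.

Lemma mean_indicM P f A : measurable A -> bdd f ->
  mean P (fun x => \1_A x * f x) = \int[P]_(x in A) f x.
Proof.
move=> mA bf; rewrite /mean [RHS]Rintegral_mkcond; congr fine.
apply: eq_integral => x _; rewrite patchE indicE.
by case: ifP => _ ; rewrite ?mul1r ?mul0r.
Qed.

Lemma mean_le_cst P f (r : R) : bdd f -> (forall x, f x <= r) -> mean P f <= r.
Proof. by move=> bf fr; rewrite -(mean_cst P r) le_mean//; exact: bdd_cst. Qed.

Lemma mean_ae0 P f : bdd f -> (forall x, 0 <= f x) -> mean P f = 0 ->
  {ae P, forall x, f x = 0}.
Proof.
move=> bf f0 m0.
have : (\int[P]_x `|(f x)%:E| = 0)%E.
  by under eq_integral do rewrite gee0_abs ?lee_fin//; rewrite -meanE// m0.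
have mf : measurable_fun setT (EFin \o f) by apply/measurable_EFinP; case: bf.
move=> /(ae_eq_integral_abs P measurableT mf).
by apply: filterS => x /(_ I)[].
Qed.

Lemma ae_mean P f g : bdd f -> bdd g -> {ae P, forall x, f x = g x} ->
  mean P f = mean P g.
Proof.
move=> bf bg fg; rewrite /mean /Rintegral; congr fine.
apply: ae_eq_integral => //; [by apply/measurable_EFinP; case: bf|
  by apply/measurable_EFinP; case: bg|].
by apply: filterS fg => x -> _.
Qed.

Lemma le_mean_ae P f g : bdd f -> bdd g -> {ae P, forall x, f x <= g x} ->
  mean P f <= mean P g.
Proof.
move=> bf bg fg; rewrite (@ae_mean P f (fun x => Num.min (f x) (g x)))//.
- by apply: le_mean => // [|x]; [exact: bdd_min|rewrite ge_min lexx orbT].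
- exact: bdd_min.
- by apply: filterS fg => x fgx; rewrite min_l.
Qed.

End mean.

(** * Changes of variables and decomposition into layers *)

Section transfer.
Context (R : realType).

Lemma mean_map d (T : measurableType d) d' (S : measurableType d')
    (P : probability T R) (Q : probability S R) (phi : T -> S) (f : S -> R) :
  measurable_fun setT phi ->
  (forall B, measurable B -> Q B = P (phi @^-1` B)) ->
  bdd f -> mean Q f = mean P (fun x => f (phi x)).
Proof.
move=> mphi QP bf; rewrite /mean /Rintegral; congr fine.
rewrite (eq_measure_integral (pushforward P phi)); last first.
  by move=> A mA _; exact: QP.
rewrite integral_pushforward//; first by apply/measurable_EFinP; case: bf.
exact: (bdd_integrable P (bdd_comp mphi bf)).
Qed.

Lemma ge0_integral_map d (T : measurableType d) d' (S : measurableType d')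
    (P : probability T R) (Q : probability S R) (phi : T -> S) (f : S -> \bar R) :
  measurable_fun setT phi ->
  (forall B, measurable B -> Q B = P (phi @^-1` B)) ->
  measurable_fun setT f -> (forall x, (0 <= f x)%E) ->
  (\int[Q]_x f x = \int[P]_x f (phi x))%E.
Proof.
move=> mphi QP mf f0.
rewrite (eq_measure_integral (pushforward P phi)); last first.
  by move=> A mA _; exact: QP.
by rewrite ge0_integral_pushforward.
Qed.

Lemma mean_prod d (T : measurableType d) d' (S : measurableType d')
    (P : probability T R) (Q : probability S R) (f : T * S -> R) : bdd f ->
  mean (P \x Q)%E f = mean P (fun x => mean Q (fun y => f (x, y))) /\
  mean (P \x Q)%E f = mean Q (fun y => mean P (fun x => f (x, y))).
Proof.
move=> bf.
have if_ := bdd_integrable (P \x Q)%E bf.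
split; rewrite /mean /Rintegral; congr fine.
  rewrite -(integral12_prod_meas1 if_); apply: eq_integral => x _.
  rewrite /= fineK//.
  apply: (integrable_fin_num measurableT (bdd_integrable Q _)).
  exact: (bdd_comp (pair1_measurable x)).
rewrite -(integral21_prod_meas1 if_); apply: eq_integral => y _.
rewrite /= fineK//.
apply: (integrable_fin_num measurableT (bdd_integrable P _)).
exact: (bdd_comp (pair2_measurable y)).
Qed.

Lemma bdd_mean1 d (T : measurableType d) d' (S : measurableType d')
    (Q : probability S R) (f : T * S -> R) : bdd f ->
  bdd (fun x => mean Q (fun y => f (x, y))).
Proof.
move=> [mf [M fM]].
have bx x : bdd (fun y => f (x, y)).
  by apply: (bdd_comp (pair1_measurable x)); split => //; exists M.
apply: (@bdd_le _ _ _ _ M); last first.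
  move=> x; rewrite (le_trans (mean_abs Q (bx x)))//.
  by apply: mean_le_cst; [exact: bdd_norm|].
apply: (@eq_measurable_fun _ _ _ _ _
    (fun x => fine (fubini_F Q (fun z => (f z + M)%:E) x) - M)).
  move=> x _; rewrite [X in X - M](_ : _ = mean Q (fun y => f (x, y) + M))//.
  by rewrite meanD ?mean_cst ?addrK//; exact: bdd_cst.
apply: measurable_funB => //.
apply: (measurableT_comp (fine_measurable measurableT)).
apply: measurable_fun_fubini_tonelli_F.
  by apply/measurable_EFinP; apply: measurable_funD.
move=> z; rewrite lee_fin.
by have := fM z; rewrite ler_norml => /andP[]; lra.
Qed.

Lemma bdd_mean2 d (T : measurableType d) d' (S : measurableType d')
    (P : probability T R) (f : T * S -> R) : bdd f ->
  bdd (fun y => mean P (fun x => f (x, y))).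
Proof.
move=> bf.
apply: (@bdd_mean1 _ _ _ _ P (fun z : S * T => f (z.2, z.1))).
exact: (bdd_comp (g := fun z : S * T => (z.2, z.1))
  (measurable_fun_pair measurable_snd measurable_fst) bf).
Qed.

End transfer.

Section layers.
Context (R : realType).

(** The sum counts the positive integers up to [y], so it is the floor of [y]. *)
Lemma sum_thresholds (n : nat) (y : R) : 0 <= y <= n%:R ->
  y - 1 <= \sum_(i < n) ((i.+1%:R <= y)%R%:R : R) <= y.
Proof.
elim: n => [|n IH] /andP[y0 yn].
  by rewrite big_ord0; apply/andP; split; lra.
rewrite big_ord_recr/=.
have [yn'|ny] := leP y n%:R.
  have -> : (n.+1%:R <= y) = false.
    by apply/negbTE; rewrite -ltNge (le_lt_trans yn')// ltr_nat.
  by rewrite addr0; apply: IH; rewrite y0.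
rewrite (eq_bigr (fun=> 1)); last first.
  move=> i _; rewrite (_ : _ <= _)// (le_trans _ (ltW ny))// ler_nat.
  exact: ltn_ord.
rewrite sumr_const card_ord.
have [h|h] := boolP (n.+1%:R <= y); rewrite /= ?addr0.
  by move: yn h; rewrite -natr1 => ? ?; apply/andP; split; lra.
by move: yn h ny; rewrite -natr1 -ltNge => ? ? ?; apply/andP; split; lra.
Qed.

Context d (T : measurableType d) (P : probability T R).

Lemma measurable_ge (c : T -> R) (t : R) : measurable_fun setT c ->
  measurable [set x | t <= c x].
Proof.
move=> mc; rewrite (_ : [set x | _] = c @^-1` `[t, +oo[%classic).
  by rewrite -[X in measurable X]setTI; exact: mc.
by apply/seteqP; split => x /=; rewrite in_itv/= andbT.
Qed.

(** A function with values in [0, 1] is within [1 / (n + 1)] of an average of indicators of its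
    superlevel sets, so a bound on events passes to it with the same constant. *)
Lemma layer_transfer (c xi : T -> R) (b : R) :
  measurable_fun setT c -> (forall x, 0 <= c x <= 1) -> bdd xi ->
  (forall t : R, `|mean P (fun x => \1_[set x | t <= c x] x * xi x)| <= b) ->
  `|mean P (fun x => c x * xi x)| <= b.
Proof.
move=> mc c01 bxi hb.
have [M M0 xiM] := bdd_bound bxi.
have bc := bdd01 mc c01.
apply/ler_addgt0Pr => e e0.
have [n nM] : exists n : nat, M / e < n.+1%:R.
  exists (Num.Def.archi_bound (M / e)).
  apply: (lt_trans (archi_boundP _)); last by rewrite ltr_nat.
  by rewrite divr_ge0 ?ltW.
have bI (t : R) : bdd (fun x => \1_[set x | t <= c x] x * xi x).
  by apply: bddM => //; apply: bdd_indic; exact: measurable_ge.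
pose L x := n.+1%:R^-1 * \sum_(i < n.+1) (\1_[set x | i.+1%:R / n.+1%:R <= c x] x * xi x).
have bL : bdd L by apply: bddZ; apply: bdd_sum => i; exact: bI.
have -> : mean P (fun x => c x * xi x) = mean P L + mean P (fun x => c x * xi x - L x).
  by rewrite meanB ?subrKC//; exact: bddM.
rewrite (le_trans (ler_normD _ _))// lerD//.
  rewrite /L meanZ ?mean_sum//; last by apply: bdd_sum => i; exact: bI.
  rewrite normrM ger0_norm ?invr_ge0// ler_pdivrMl//.
  rewrite (le_trans (ler_norm_sum _ _ _))//.
  rewrite (le_trans (ler_sum _ (fun i _ => hb _)))//.
  by rewrite sumr_const card_ord mulr_natl.
rewrite (le_trans (mean_abs _ _))//; first by apply: bddB => //; exact: bddM.
apply: mean_le_cst.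
  by apply: bdd_norm; apply: bddB => //; exact: bddM.
move=> x; rewrite /L -mulr_suml mulrA -mulrBl normrM.
have /andP[c0 c1] := c01 x.
have := @sum_thresholds n.+1 (n.+1%:R * c x).
rewrite mulr_ge0//= ler_piMr// => /(_ isT).
rewrite (eq_bigr (fun i : 'I_n.+1 => (\1_[set x | i.+1%:R / n.+1%:R <= c x] x : R))); last first.
  move=> i _; rewrite indicE; congr (nat_of_bool _)%:R.
  by apply/idP/idP; rewrite inE/= ler_pdivrMr// mulrC.
set s := \sum_(i < _) _ => /andP[s1 s2].
have n0 : 0 < n.+1%:R :> R by [].
have h1 : `|c x - n.+1%:R^-1 * s| <= n.+1%:R^-1.
  rewrite -(ler_pM2l n0) -[X in X * `|_|](gtr0_norm n0) -normrM mulrBr !mulrA divff// mul1r.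
  by rewrite ger0_norm; lra.
rewrite (le_trans (ler_pM _ _ h1 (xiM x)))//.
by rewrite mulrC ler_pdivrMr// mulrC -ler_pdivrMr// ltW.
Qed.

End layers.

(** * Conditional densities, essential suprema and conditional probabilities *)

Section conditional_density.
Context (R : realType) d (T : measurableType d) d' (S : measurableType d').

(** Its density with respect to the law of [phi] is the conditional probability of [D] given
    [phi]. *)
Definition trace_map (P : probability T R) (D : set T) (mD : measurable D)
  (phi : {mfun T >-> S}) : set S -> \bar R := pushforward (mrestr P mD) phi.

Section trace_map.
Variables (P : probability T R) (D : set T) (mD : measurable D).
Variable phi : {mfun T >-> S}.

Let trace_map0 : trace_map P mD phi set0 = 0%E.
Proof. exact: measure0. Qed.

Let trace_map_ge0 A : (0 <= trace_map P mD phi A)%E.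
Proof. exact: measure_ge0. Qed.

Let trace_map_sigma : semi_sigma_additive (trace_map P mD phi).
Proof. exact: (@measure_semi_sigma_additive _ _ _ (pushforward (mrestr P mD) phi)). Qed.

HB.instance Definition _ := isMeasure.Build _ _ _ (trace_map P mD phi)
  trace_map0 trace_map_ge0 trace_map_sigma.

Let trace_map_fin : fin_num_fun (trace_map P mD phi).
Proof.
move=> A mA; rewrite /trace_map /pushforward /mrestr fin_num_measure//.
by apply: measurableI => //; exact: measurable_funPTI.
Qed.

HB.instance Definition _ := @Measure_isFinite.Build _ _ _
  (trace_map P mD phi) trace_map_fin.
End trace_map.

Variables (P : probability T R) (phi : T -> S).
Hypothesis mphi : measurable_fun setT phi.
Let phi' : {mfun T >-> S} := mfun_Sub (mem_set mphi).
Let nu : probability S R := distribution P phi'.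
Variables (D : set T) (mD : measurable D).
Let nuD : {finite_measure set S -> \bar R} := trace_map P mD phi'.

(** The function [f] is the Radon-Nikodym derivative of the trace measure, cut off at 1. It
    represents the conditional probability of [D] given [phi] as a function of the value of [phi],
    with bounds that hold at every point. *)
Lemma cond_density : exists f : S -> R,
  [/\ measurable_fun setT f, forall s, 0 <= f s <= 1 &
    forall c : S -> R, bdd c ->
      mean P (fun x => \1_D x * c (phi x)) = mean P (fun x => f (phi x) * c (phi x))].
Proof.
have nuDnu A : measurable A -> (nuD A <= nu A)%E.
  move=> mA; apply: le_measure; rewrite ?inE//; last exact: measurable_funPTI.
  by apply: measurableI => //; exact: measurable_funPTI.
have dom : nuD `<< nu.
  apply/null_content_dominatesP => A mA nuA0; apply/eqP.
  by rewrite eq_le measure_ge0 andbT -nuA0 nuDnu.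
pose g := Radon_Nikodym_SigmaFinite.f nuD nu.
have g0 s : (0 <= g s)%E by exact: Radon_Nikodym_SigmaFinite.f_ge0.
have gfin s : g s \is a fin_num by exact: Radon_Nikodym_SigmaFinite.f_fin_num.
have ig : nu.-integrable setT g by exact: Radon_Nikodym_SigmaFinite.f_integrable.
have mg := measurable_int _ ig.
pose B := [set s | 1 < fine (g s)].
have mfg : measurable_fun setT (fine \o g).
  exact: (measurableT_comp (fine_measurable measurableT)).
have mB : measurable B.
  rewrite (_ : B = (fine \o g) @^-1` `]1, +oo[%classic).
    by rewrite -[X in measurable X]setTI; exact: mfg.
  by apply/seteqP; split => x /=; rewrite /B/= in_itv/= andbT.
have gB x : B x -> (0 <= g x - 1)%E.
  by rewrite /B/= -[in X in _ -> X](fineK (gfin x)) -EFinB lee_fin subr_ge0; exact: ltW.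
have mg1 : measurable_fun B (fun x => g x - 1)%E.
  by apply: emeasurable_funB; [exact: measurable_funTS|exact: measurable_cst].
(* On [B] the integral of [g - 1] is [nuD B - nu B], at most 0, while the integrand is positive;
   this makes [B] a null set. *)
have B0 : (\int[nu]_(x in B) (g x - 1) = 0)%E.
  apply/eqP; rewrite eq_le; apply/andP; split; last exact: integral_ge0.
  have : (\int[nu]_(x in B) (g x - 1) + \int[nu]_(x in B) 1 <= \int[nu]_(x in B) 1)%E.
    rewrite -ge0_integralD//.
    rewrite (eq_integral g); last by move=> x _; rewrite subeK.
    rewrite -Radon_Nikodym_SigmaFinite.f_integral// integral_cst// mul1e.
    exact: nuDnu.
  rewrite integral_cst// mul1e.
  have nuBfin : nu B \is a fin_num by rewrite fin_num_measure.
  by rewrite -leeBrDr// subee.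
have Bnull : {ae nu, forall x, fine (g x) <= 1}.
  have : ae_eq nu B (fun x => g x - 1)%E (cst 0%E).
    apply/(ae_eq_integral_abs nu mB mg1).
    by rewrite -[RHS]B0; apply: eq_integral => x /set_mem Bx; rewrite gee0_abs// gB.
  apply: filterS => x Bx; rewrite leNgt; apply/negP => gx.
  have /= /eqP := Bx gx.
  by rewrite -(fineK (gfin x)) -EFinD eqe subr_eq0 gt_eqF.
pose f s := Num.min (fine (g s)) 1.
have mf : measurable_fun setT f.
  exact: measurable_minr.
have f01 s : 0 <= f s <= 1.
  by rewrite /f le_min ge_min fine_ge0//= ler01 lexx orbT.
have gf : ae_eq nu setT g (EFin \o f).
  by apply: filterS Bnull => x gx _ /=; rewrite /f min_l// fineK.
have bf : bdd f := bdd01 mf f01.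
exists f; split => // c bc.
have mphiA A : measurable A -> measurable (phi @^-1` A).
  by move=> mA; rewrite -[X in measurable X]setTI; exact: mphi.
have bD : bdd (\1_D : T -> R) := bdd_indic R mD.
have bfphi : bdd (fun x => f (phi x)) := bdd_comp mphi bf.
have bcphi : bdd (fun x => c (phi x)) := bdd_comp mphi bc.
pose xi x := \1_D x - f (phi x).
have bxi : bdd xi by exact: bddB.
have key A : measurable A -> mean P (fun x => \1_(phi @^-1` A) x * xi x) = 0.
  move=> mA; rewrite mean_indicM//; last exact: mphiA.
  rewrite RintegralB//; last 3 first.
  - exact: mphiA.
  - by apply: integrableS (bdd_integrable P bD) => //; exact: mphiA.
  - by apply: integrableS (bdd_integrable P bfphi) => //; exact: mphiA.
  apply/eqP; rewrite subr_eq0; apply/eqP; rewrite /Rintegral; congr fine.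
  rewrite integral_indic//; last exact: mphiA.
  transitivity (nuD A); first by rewrite /nuD/= /trace_map /pushforward /mrestr setIC.
  rewrite (@Radon_Nikodym_SigmaFinite.f_integral _ _ _ _ _ dom _ mA).
  rewrite (@ae_eq_integral _ _ _ nu A (EFin \o f))//; first last.
  - by apply: filterS gf => x gx _; exact: gx.
  - by apply/measurable_EFinP; exact: measurable_funTS.
  - exact: measurable_funTS.
  rewrite ge0_integral_pushforward//.
    by apply/measurable_EFinP; exact: measurable_funTS.
  by move=> y _; rewrite lee_fin; have /andP[] := f01 y.
have [M M0 cM] := bdd_bound bc.
suff : `|mean P (fun x => ((c (phi x) + M) / (2 * M)) * xi x)| <= 0.
  rewrite normr_le0 => /eqP.
  rewrite (@eq_mean _ _ _ _ _ (fun x => (2 * M)^-1 * (\1_D x * c (phi x) - f (phi x) * c (phi x)) +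
     2^-1 * (\1_(phi @^-1` setT) x * xi x))); last first.
    by move=> x; rewrite preimage_setT indic_setT /xi; field; rewrite gt_eqF.
  have mT : measurable (phi @^-1` setT) by exact: mphiA.
  rewrite meanD ?meanZ ?meanB ?key//; try by bdd_tac.
  rewrite mulr0 addr0 => /eqP; rewrite mulf_eq0 => /orP[|].
    by rewrite invr_eq0 gt_eqF// mulr_gt0.
  by rewrite subr_eq0 => /eqP.
apply: layer_transfer => //.
- apply: measurable_funM => //; apply: measurable_funD => //.
  by have [] := bcphi.
- move=> x; have := cM (phi x); rewrite ler_norml => /andP[? ?].
  by rewrite divr_ge0 ?ler_pdivrMr; lra.
move=> t; rewrite (_ : [set x | _] = phi @^-1` [set s | t <= (c s + M) / (2 * M)])//.
rewrite key ?normr0//; apply: (measurable_ge _).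
apply: measurable_funM => //; apply: measurable_funD => //.
by have [] := bc.
Qed.
End conditional_density.

Section essential_supremum.
Context (R : realType) d (T : measurableType d) (P : probability T R).

Let clip01 (x : R) := Num.min (Num.max x 0) 1.

Let clip01P x : 0 <= clip01 x <= 1.
Proof. by rewrite /clip01 le_min ge_min le_max lexx orbT ler01 lexx orbT. Qed.

Let clip01_id x : 0 <= x <= 1 -> clip01 x = x.
Proof. by move=> /andP[x0 x1]; rewrite /clip01 max_l// min_l. Qed.

(** Exhaustion: among the suprema of countable subfamilies, take one of maximal mean. Adjoining a
    further member cannot raise the mean, so this supremum already dominates it almost surely.
    Members lie in [0, 1] only almost surely, hence the clipping. *)
Lemma ess_sup_family_exists (F : set (T -> R)) :
  F !=set0 -> (forall f, F f -> measurable_fun setT f) ->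
  (forall f, F f -> {ae P, forall x, 0 <= f x <= 1}) ->
  exists g : T -> R, [/\ measurable_fun setT g, forall x, 0 <= g x <= 1 &
    is_ess_sup_family P F (EFin \o g)].
Proof.
move=> [f0 Ff0] mF F01.
pose G (s : nat -> T -> R) x := sups (fun n => clip01 (s n x)) 0.
have mclip f : F f -> measurable_fun setT (fun x => clip01 (f x)).
  by move=> Ff; apply: measurable_minr => //; apply: measurable_maxr => //; exact: mF.
have ub (s : nat -> T -> R) x : has_ubound (range (fun n => clip01 (s n x))).
  by exists 1 => _ [n _ <-]; have /andP[] := clip01P (s n x).
have hs (s : nat -> T -> R) x : has_sup (sdrop (fun n => clip01 (s n x)) 0).
  split; first by exists (clip01 (s 0%N x)); exists 0%N.
  by exists 1 => _ [n _ <-]; have /andP[] := clip01P (s n x).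
have leG (s : nat -> T -> R) n x : clip01 (s n x) <= G s x.
  by apply: sup_upper_bound => //; exists n.
have Gle (s : nat -> T -> R) x r : (forall n, clip01 (s n x) <= r) -> G s x <= r.
  move=> h; apply: ge_sup; first by have [] := hs s x.
  by move=> _ [n _ <-].
have G01 s x : 0 <= G s x <= 1.
  apply/andP; split; last by apply: Gle => n; have /andP[] := clip01P (s n x).
  by apply: le_trans (leG s 0%N x); have /andP[] := clip01P (s 0%N x).
have mG (s : nat -> T -> R) : (forall n, F (s n)) -> measurable_fun setT (G s).
  by move=> Fs; apply: measurable_fun_sups => [x _|m]; [exact: ub|exact: mclip].
have bG (s : nat -> T -> R) : (forall n, F (s n)) -> bdd (G s).
  by move=> Fs; apply: bdd01; [exact: mG|exact: G01].
pose E := [set mean P (G s) | s in [set s | forall n, F (s n)]].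
have E1 : has_sup E.
  split; first by exists (mean P (G (fun=> f0))); exists (fun=> f0).
  by exists 1 => _ [s Fs <-]; apply: mean_le_cst; [exact: bG|move=> x; have /andP[] := G01 s x].
have /choice [S HS] : forall k : nat, exists s, (forall n, F (s n)) /\ sup E - k.+1%:R^-1 < mean P (G s).
  move=> k; have k0 : 0 < k.+1%:R^-1 :> R by [].
  by have [_ [s Fs <-] h] := sup_adherent k0 E1; exists s.
(* The near-optimal sequences are merged along pairs of integers, and the merged one attains
   [sup E]. *)
pose s n := if unpickle n is Some (k, m) then S k m else f0.
have Fs n : F (s n).
  by rewrite /s; case: unpickle => // -[k m]; have [] := HS k.
have sE k m : s (pickle (k, m)) = S k m by rewrite /s pickleK.
have GS k x : G (S k) x <= G s x.
  by apply: Gle => m; rewrite -sE; exact: leG.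
have meanG : mean P (G s) = sup E.
  apply/eqP; rewrite eq_le; apply/andP; split.
    by apply: sup_upper_bound => //; exists s.
  apply/ler_addgt0Pr => e e0.
  have [k ke] : exists k : nat, e^-1 < k.+1%:R.
    exists (Num.Def.archi_bound e^-1).
    by apply: (lt_trans (archi_boundP _)); [rewrite invr_ge0 ltW|rewrite ltr_nat].
  have [FSk hk] := HS k.
  rewrite -lerBlDr; apply: le_trans (le_mean P (bG _ FSk) (bG _ Fs) (GS k)).
  apply: le_trans (ltW hk); rewrite lerB// invf_ple ?posrE// ltW//.
exists (G s); split; [exact: mG|exact: G01|].
split; first by apply/measurable_EFinP; exact: mG.
- move=> f Ff.
  pose s' n := if n is n'.+1 then s n' else f.
  have Fs' n : F (s' n) by case: n.
  have ss' x : G s x <= G s' x by apply: Gle => n; exact: (leG s' n.+1).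
  have m0 : mean P (fun x => G s' x - G s x) = 0.
    rewrite meanB; [|exact: bG|exact: bG].
    apply/eqP; rewrite subr_eq0 eq_le; apply/andP; split; last by apply: le_mean => //; exact: bG.
    by rewrite meanG; apply: sup_upper_bound => //; exists s'.
  have := mean_ae0 (bddB (bG _ Fs') (bG _ Fs)) (fun x => _) m0.
  move=> /(_ (fun x => ltac:(by rewrite subr_ge0))).
  apply: filterS2 (F01 _ Ff) => x f01 h.
  rewrite lee_fin -(clip01_id f01) (le_trans (leG s' 0%N x))//.
  by rewrite -subr_le0 h.
- move=> g mg hg.
  have h0 : {ae P, forall x, forall n, 0 <= s n x <= 1 /\ ((s n x)%:E <= g x)%E}.
    apply: (ae_foralln (mu := P) (P := fun n x => 0 <= s n x <= 1 /\ ((s n x)%:E <= g x)%E)) => n.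
    by apply: filterS2 (F01 _ (Fs n)) (hg _ (Fs n)) => x.
  apply: filterS h0 => x h /=.
  case: (g x) h => [r| |] h; rewrite ?leey//.
    rewrite lee_fin; apply: Gle => n; have [h1 h2] := h n.
    by rewrite clip01_id.
  by have [_] := h 0%N.
Qed.

End essential_supremum.
Section conditional_probability.
Context (R : realType) d (T : measurableType d) (P : probability T R).
Variables (C : set (set T)).
Hypothesis mC : forall A, C A -> measurable A.

Let S : measurableType _ := g_sigma_algebraType C.

Lemma sub_sigma_measurable A : <<s C >> A -> measurable A.
Proof. by apply: smallest_sub => //; exact: sigma_algebra_measurable. Qed.

Let mid : measurable_fun [set: T] (fun x : T => x : S).
Proof. by move=> _ B mB; rewrite setTI; exact: sub_sigma_measurable. Qed.

Lemma cond_prob_version (A : set T) : measurable A -> exists f : T -> R,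
  [/\ bdd f, forall x, 0 <= f x <= 1, measurable_fun setT (cond_prob P <<s C >> A),
   {ae P, forall x, cond_prob P <<s C >> A x = f x} &
      forall D, <<s C >> D -> mean P (fun x => \1_D x * f x) = pr P (D `&` A)].
Proof.
move=> mA; have [f [mf f01 fc]] := cond_density P mid mA.
have bfS : bdd (T := S) f := bdd01 mf f01.
have bf : bdd (T := T) f := bdd_comp mid bfS.
have b1 : bdd (\1_A : T -> R) by exact: bdd_indic.
have meanfD D : <<s C >> D -> mean P (fun x => \1_D x * f x) = pr P (D `&` A).
  move=> GD; have mD := sub_sigma_measurable GD.
  transitivity (mean P (fun x => f x * \1_D x)).
    by apply: eq_mean => x; rewrite mulrC.
  rewrite -(fc \1_D (bdd_indic (T := S) R GD)) -mean_indic; last exact: measurableI.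
  by apply: eq_mean => x; rewrite indicI/= mulrC.
suff [h1 h2] : measurable_fun setT (cond_prob P <<s C >> A) /\
    {ae P, forall x, cond_prob P <<s C >> A x = f x} by exists f.
have fexp : is_cond_exp P <<s C >> \1_A f.
  split; [exact: bdd_integrable|exact: bdd_integrable| |].
    by move=> B mB; have := mf measurableT B mB; rewrite setTI.
  move=> D GD; have mD := sub_sigma_measurable GD.
  rewrite integral_indic// setIC; transitivity (pr P (D `&` A))%:E; last first.
    by rewrite /pr fineK// fin_num_measure//; exact: measurableI.
  rewrite -(meanfD D GD) meanE; last by bdd_tac.
  rewrite [LHS]integral_mkcond; apply: eq_integral => x _.
  by rewrite patchE indicE; case: ifP; rewrite ?mul1r ?mul0r.
have [_ iY mY YD] : is_cond_exp P <<s C >> \1_A (cond_prob P <<s C >> A).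
  by rewrite /cond_prob /cond_exp; apply: (xgetPex _ (ex_intro _ f fexp)).
set Y := cond_prob P <<s C >> A in iY mY YD *.
have mYS : measurable_fun [set: S] Y.
  by move=> _ B mB; rewrite setTI; exact: mY.
(* The set where [Y2 < Y1] belongs to the smaller sigma-algebra, so both versions have the same
   integral over it, which forces it to be null. *)
have half (Y1 Y2 : T -> R) : measurable_fun [set: S] Y1 -> measurable_fun [set: S] Y2 ->
    P.-integrable setT (EFin \o Y1) -> P.-integrable setT (EFin \o Y2) ->
    (forall D, <<s C >> D -> \int[P]_(x in D) (Y1 x)%:E = \int[P]_(x in D) (Y2 x)%:E)%E ->
    {ae P, forall x, Y1 x <= Y2 x}.
  move=> mY1 mY2 i1 i2 h.
  pose D := [set x | Y2 x < Y1 x].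
  have GD : <<s C >> D.
    have mY12 : measurable_fun [set: S] (fun x => Y1 x - Y2 x) by exact: measurable_funB.
    have := mY12 measurableT `]0, +oo[%classic (measurable_itv _).
    rewrite setTI; congr (<<s C >> _); apply/seteqP.
    by split => x; rewrite /D /= in_itv/= andbT subr_gt0.
  have mD := sub_sigma_measurable GD.
  have i1D := integrableS measurableT mD (@subsetT _ _) i1.
  have i2D := integrableS measurableT mD (@subsetT _ _) i2.
  have I0 : (\int[P]_(x in D) ((Y1 x)%:E - (Y2 x)%:E) = 0)%E.
    rewrite integralB//= h// subee//.
    exact: integrable_fin_num i2D.
  have : ae_eq P D (fun x => (Y1 x)%:E - (Y2 x)%:E)%E (cst 0%E).
    apply/(ae_eq_integral_abs P mD).
      by apply: emeasurable_funB; [exact: measurable_int i1D|exact: measurable_int i2D].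
    rewrite -[RHS]I0; apply: eq_integral => x /set_mem Dx.
    by rewrite gee0_abs// -EFinB lee_fin subr_ge0 ltW.
  apply: filterS => x Dx; rewrite leNgt; apply/negP => lt21.
  by have /eqP := Dx lt21; rewrite -EFinB eqe subr_eq0 gt_eqF.
have if_ := bdd_integrable P bf.
have fD D : <<s C >> D -> (\int[P]_(x in D) (Y x)%:E = \int[P]_(x in D) (f x)%:E)%E.
  by move=> GD; rewrite YD//; case: fexp => _ _ _ ->.
have h1 := half Y f mYS mf iY if_ fD.
have h2 := half f Y mf mYS if_ iY (fun D GD => esym (fD D GD)).
split; last by apply: filterS2 h1 h2 => x ? ?; apply/eqP; rewrite eq_le; apply/andP.
by move=> _ B mB; rewrite setTI; apply: sub_sigma_measurable; exact: mY.
Qed.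

End conditional_probability.

Lemma sigma_gen_measurable (R : realType) d (T : measurableType d) (I : Type)
    (P : probability T R) (V : I -> {RV P >-> R}) (J : set I) A :
  sigma_gen V J A -> measurable A.
Proof.
apply: sub_sigma_measurable => B [i [E [_ mE ->]]].
exact: measurable_funPTI.
Qed.

Lemma sigma_gen_sub (R : realType) (S I : Type) (V : I -> S -> R) (J J' : set I) A :
  J `<=` J' -> sigma_gen V J A -> sigma_gen V J' A.
Proof.
move=> JJ'; apply: smallest_sub; first exact: smallest_sigma_algebra.
move=> B [i [E [Ji mE ->]]]; apply: sub_sigma_algebra.
by exists i, E; split => //; exact: JJ'.
Qed.

(** * Dependence between past and future under absolute regularity *)

Section absolute_regularity.
Context (R : realType) d (T : measurableType d) (P : probability T R).
Variable Z : int -> {RV P >-> R}.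

Let past (n : nat) := sigma_gen Z [set i | i <= n%:Z].
Let future (n : nat) := sigma_gen Z [set i | n%:Z <= i].

Let dev n k := [set f | exists2 A : set T, future (n + k)%N A &
    f = fun w => `| cond_prob P (past n) A w - fine (P A) | ].

Let cond_prob_past n B : measurable B -> exists f : T -> R,
  [/\ bdd f, forall x, 0 <= f x <= 1, measurable_fun setT (cond_prob P (past n) B),
      {ae P, forall x, cond_prob P (past n) B x = f x} &
      forall D, past n D -> mean P (fun x => \1_D x * f x) = pr P (D `&` B)].
Proof.
move=> mB; apply: cond_prob_version => // A [i [E [_ mE ->]]].
exact: measurable_funPTI.
Qed.

(** The essential supremum has a version with values in [0, 1], so [fine] in [beta_reg] is applied
    to a finite number. *)
Let dev_sup n k : exists g : T -> R, [/\ bdd g, forall x, 0 <= g x <= 1,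
  forall f, dev n k f -> {ae P, forall x, f x <= g x} &
  mean P g = fine (\int[P]_w ess_sup_family P (dev n k) w)].
Proof.
have [//| | |g [mg g01 gsup]] := @ess_sup_family_exists _ _ _ P (dev n k).
- exists (fun w => `| cond_prob P (past n) setT w - fine (P setT) |), setT => //.
  rewrite -(preimage_setT (Z (n + k)%:Z)); apply: sub_sigma_algebra.
  by exists (n + k)%:Z, setT; split; [exact: lexx|exact: measurableT|].
- move=> f [A fA ->]; have mA := sigma_gen_measurable fA.
  have [_ [_ _ mc _ _]] := cond_prob_past n mA.
  by apply: measurableT_comp => //; exact: measurable_funB.
- move=> f [A fA ->]; have mA := sigma_gen_measurable fA.
  have [f' [_ f01 _ ff' _]] := cond_prob_past n mA.
  apply: filterS ff' => x ->; rewrite normr_ge0/= ler_norml.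
  have /andP[? ?] := f01 x; have : 0 <= pr P A <= 1 by rewrite pr_ge0 pr_le1.
  by rewrite /pr => /andP[? ?]; apply/andP; split; lra.
exists g; split => //; first exact: bdd01.
  move=> f ff; have [_ h _] := gsup.
  by apply: filterS (h _ ff) => x; rewrite lee_fin.
have [mE E1 E2] : is_ess_sup_family P (dev n k) (ess_sup_family P (dev n k)).
  exact: (xgetPex _ (ex_intro _ _ gsup)).
have [mg' g1 g2] := gsup.
rewrite /mean /Rintegral; congr fine; apply: ae_eq_integral => //.
have h1 := E2 _ mg' g1; have h2 := g2 _ mE E1.
by apply: filterS2 h1 h2 => x ? ? _; apply/eqP; rewrite eq_le; apply/andP.
Qed.

(** Given the past, the probability of [A j] exceeds its unconditional value by at most the
    essential supremum [g] of the deviations. The events [D j] are disjoint, so their contributions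
    add up to at most the mean of [g]. *)
Lemma beta_reg_dependence (n k N : nat) (D A : 'I_N -> set T) : (1 <= n)%N ->
  (forall j, sigma_gen Z [set i | i <= n%:Z] (D j)) ->
  (forall j, sigma_gen Z [set i | (n + k)%:Z <= i] (A j)) ->
  (forall i j, i != j -> D i `&` D j = set0) ->
  \sum_j (pr P (D j `&` A j) - pr P (D j) * pr P (A j)) <= beta_reg Z k.
Proof.
move=> n1 pD fA Dij.
have mA j : measurable (A j) by exact: sigma_gen_measurable (fA j).
have mD j : measurable (D j) by exact: sigma_gen_measurable (pD j).
have [g [bg g01 gdev gE]] := dev_sup n k.
suff : \sum_j (pr P (D j `&` A j) - pr P (D j) * pr P (A j)) <= mean P g.
  move=> /le_trans; apply; apply: sup_upper_bound; last by exists n => //; rewrite gE.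
  split; first by exists (mean P g), n => //; rewrite gE.
  exists 1 => _ [m _ ->]; have [g' [bg' g'01 _ <-]] := dev_sup m k.
  by apply: mean_le_cst => // x; have /andP[] := g'01 x.
rewrite (@le_trans _ _ (\sum_j mean P (fun x => \1_(D j) x * g x)))//.
  apply: ler_sum => j _; have [a [ba a01 _ aE aD]] := cond_prob_past n (mA j).
  rewrite -(aD _ (pD j)) [pr P (D j) * _]mulrC -(mean_indic P (mD j)) -meanZ; last by bdd_tac.
  rewrite -meanB; [|by bdd_tac|by bdd_tac].
  apply: le_mean_ae; [by bdd_tac|by bdd_tac|].
  have hd := gdev _ (ex_intro2 _ _ _ (fA j) erefl).
  apply: filterS2 aE hd => x ax; rewrite ax => h.
  rewrite mulrC -mulrBl mulrC ler_wpM2l//.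
  exact: le_trans (ler_norm _) h.
rewrite -mean_sum; last by move=> j; bdd_tac.
apply: le_mean => //; first by bdd_tac.
move=> x; rewrite -mulr_suml ler_piMl//; first by have /andP[] := g01 x.
have [[j0 Dj0]|nD] := pselect (exists j, D j x).
  rewrite (bigD1 j0)//= big1 ?addr0; first by rewrite indicE mem_set.
  move=> j jj0; rewrite indicE memNset// => Dj.
  by have : (D j `&` D j0) x by []; rewrite Dij.
rewrite big1// => j _; rewrite indicE memNset// => Dj.
by apply: nD; exists j.
Qed.

End absolute_regularity.

(** The inverse and the power with exponent -1 agree even at 0, where both are 0. *)
Lemma measurable_inv_ge0 (R : realType) d (T : measurableType d) (f : T -> R) :
  measurable_fun setT f -> (forall x, 0 <= f x) ->
  measurable_fun setT (fun x => (f x)^-1).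
Proof.
move=> mf f0; apply: (eq_measurable_fun (fun x => f x `^ (-1))).
  by move=> x _; rewrite powR_inv1.
exact: (measurableT_comp (measurable_powR _)).
Qed.

(** * Coupling of a finite-valued past with the future *)

Section coupling.
Context (R : realType) d (T : measurableType d) d' (S : measurableType d').
Variables (P : probability T R) (N : nat) (J : T -> 'I_N) (phi : T -> S).
Hypothesis mphi : measurable_fun setT phi.
Hypothesis mJ : forall j, measurable [set x | J x = j].

Let Js j := [set x | J x = j].
Let p j := pr P (Js j).

Let indJ i x : \1_(Js i) x = (J x == i)%:R :> R.
Proof.
rewrite indicE; congr (nat_of_bool _)%:R.
by apply/idP/eqP; rewrite inE.
Qed.

Let sum_indJ (F : 'I_N -> R) x : \sum_i \1_(Js i) x * F i = F (J x).
Proof.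
rewrite (bigD1 (J x))//= indJ eqxx mul1r big1 ?addr0// => i iJ.
by rewrite indJ eq_sym (negbTE iJ) mul0r.
Qed.

Let mJs j : measurable (Js j).
Proof. exact: mJ. Qed.

Let b1J j : bdd (\1_(Js j) : T -> R).
Proof. by apply: bdd_indic. Qed.

Lemma sum_pr_fibers : \sum_j p j = 1.
Proof.
rewrite /p; under eq_bigr => j _ do rewrite -(mean_indic P (mJs j)).
rewrite -mean_sum//; rewrite -[RHS](mean_cst P); apply: eq_mean => x.
by rewrite -[RHS](sum_indJ (fun=> 1) x); apply: eq_bigr => i _; rewrite mulr1.
Qed.

(** The densities of the separate fibers sum to 1 only almost surely. On the exceptional set they
    are replaced by the probabilities [p j], which makes [f] a conditional law at every point. *)
Lemma cond_density_fibers : exists f : 'I_N -> S -> R,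
  [/\ forall j, measurable_fun setT (f j), forall j s, 0 <= f j s,
      forall s, \sum_j f j s = 1 &
      forall j (c : S -> R), bdd c ->
      mean P (fun x => \1_(Js j) x * c (phi x)) =
      mean P (fun x => f j (phi x) * c (phi x))].
Proof.
have /choice [f0 Hf0] := fun j => cond_density P mphi (mJ j).
have bf0 j : bdd (f0 j) by have [m0 m1 _] := Hf0 j; exact: bdd01.
pose psi s : R := \sum_j f0 j s - 1.
have bpsi : bdd psi by rewrite /psi; bdd_tac.
have psi0 : {ae P, forall x, psi (phi x) = 0}.
  have b2 : bdd (fun x => psi (phi x) * psi (phi x)).
    by apply: bddM; exact: (bdd_comp mphi).
  have := @mean_ae0 _ _ _ P _ b2 (fun x => sqr_ge0 _).
  suff -> : mean P (fun x => psi (phi x) * psi (phi x)) = 0.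
    by move=> /(_ erefl); apply: filterS => x /eqP; rewrite mulf_eq0 orbb => /eqP.
  have bpp : bdd (fun x => psi (phi x)) by exact: (bdd_comp mphi).
  have bfp j : bdd (fun x => f0 j (phi x)) by exact: (bdd_comp mphi).
  (* Each [f0 j (phi x)] and the indicator of its fiber have the same mean against functions of
     [phi], here against [psi]; hence [psi] has mean square 0. *)
  transitivity (mean P (fun x => \sum_j f0 j (phi x) * psi (phi x) - \sum_j \1_(Js j) x * psi (phi x))).
    apply: eq_mean => x; rewrite (sum_indJ (fun=> _)) -mulr_suml -[X in _ = _ - X]mul1r -mulrBl.
    by [].
  rewrite meanB; [|by bdd_tac|by bdd_tac].
  rewrite !mean_sum; [|by move=> j; bdd_tac|by move=> j; bdd_tac].
  apply/eqP; rewrite subr_eq0; apply/eqP; apply: eq_bigr => j _.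
  by have [_ _ ->] := Hf0 j.
pose G := [set s | psi s = 0].
have mG : measurable G.
  have := (bdd_meas bpsi) measurableT [set 0] (measurable_set1 _).
  by rewrite setTI.
pose f j s := \1_G s * f0 j s + (1 - \1_G s) * p j.
have bf j : bdd (f j) by rewrite /f; bdd_tac.
exists f; split.
- by move=> j; have [] := bf j.
- move=> j s; have [_ /(_ s)/andP[f00 _] _] := Hf0 j.
  rewrite /f indicE; case: (_ \in _); rewrite ?mul1r ?mul0r ?subrr ?mul0r ?addr0// subr0 mul1r add0r.
  exact: pr_ge0.
- move=> s; rewrite /f big_split/= -!mulr_sumr sum_pr_fibers indicE.
  have [/set_mem Gs|_] := boolP (s \in G); last by rewrite mul0r subr0 mul1r add0r.
  by rewrite subrr mul0r addr0 mul1r; move/eqP: Gs; rewrite /psi subr_eq0 => /eqP.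
- move=> j c bc; have [_ _ ->//] := Hf0 j; apply: ae_mean.
  + by apply: bddM; exact: (bdd_comp mphi).
  + by apply: bddM; exact: (bdd_comp mphi).
  + apply: filterS psi0 => x px; congr (_ * _).
    by rewrite /f indicE mem_set// mul1r subrr mul0r addr0.
Qed.

Variable theta : R.
Hypothesis dep : forall A : 'I_N -> set S, (forall j, measurable (A j)) ->
  \sum_j (pr P (Js j `&` phi @^-1` (A j)) - p j * pr P (phi @^-1` (A j))) <= theta.

(* The maximal coupling of the conditional law of [J] given [phi] with its
   unconditional law; [k j] is the density of the point, given that the second
   copy of [J] is [j]. *)
Lemma coupling_density : exists k : 'I_N -> T -> R,
  [/\ forall j, bdd (k j), forall j x, 0 <= k j x,
    forall f, bdd f -> mean P (fun x => f x * \sum_j p j * k j x) = mean P f,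
    forall (c : S -> R) j, bdd c -> p j != 0 ->
      mean P (fun x => c (phi x) * k j x) = mean P (fun x => c (phi x)) &
    1 - theta <= \sum_j p j * mean P (fun x => \1_(Js j) x * k j x)].
Proof.
have [f [mf f0 fsum fc]] := cond_density_fibers.
have f1 j s : f j s <= 1.
  rewrite -(fsum s) (bigD1 j)//= lerDl sumr_ge0// => i _; exact: f0.
have bf j : bdd (f j) by apply: bdd01 => // s; rewrite f0 f1.
have bfp j : bdd (fun x => f j (phi x)) by exact: (bdd_comp mphi).
have p0 j : 0 <= p j := pr_ge0 _ _.
(* The mass common to the conditional law [f] and the law [p]. A point with [J = i] keeps its value
   with probability [r i s], the share of the common mass in [f i s]. *)
pose m i s : R := Num.min (f i s) (p i).
have bm i : bdd (m i) by apply: bdd_min => //; exact: bdd_cst.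
have m0 i s : 0 <= m i s by rewrite le_min f0 p0.
have mp i s : m i s <= p i by rewrite ge_min lexx orbT.
have mfi i s : m i s <= f i s by rewrite ge_min lexx.
pose r i s : R := m i s / f i s.
have r01 i s : 0 <= r i s <= 1.
  rewrite /r divr_ge0//=; have [->|fn0] := eqVneq (f i s) 0; first by rewrite invr0 mulr0.
  by rewrite ler_pdivrMr ?mul1r// lt_def fn0 f0.
have fr i s : f i s * r i s = m i s.
  rewrite /r; have [fz|fn0] := eqVneq (f i s) 0; last by rewrite mulrC divfK.
  by rewrite fz mul0r; apply/eqP; rewrite eq_le m0 -[X in _ <= X]fz mfi.
have br i : bdd (r i).
  apply: bdd01 => //; apply: measurable_funM; first by have [] := bm i.
  exact: measurable_inv_ge0.
pose D s : R := 1 - \sum_i m i s.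
have DE s : D s = \sum_i (p i - m i s) by rewrite sumrB sum_pr_fibers.
(* The law of the second copy when the value is not kept: the excess of [p] over the common mass,
   normalized by the missing mass [D]. *)
pose q j s : R := (p j - m j s) / D s.
have pm0 j s : 0 <= p j - m j s by rewrite subr_ge0.
have D0 s : 0 <= D s by rewrite DE sumr_ge0.
have q01 j s : 0 <= q j s <= 1.
  rewrite /q divr_ge0//=; have [->|Dn0] := eqVneq (D s) 0; first by rewrite invr0 mulr0.
  rewrite ler_pdivrMr ?mul1r; last by rewrite lt_def Dn0 D0.
  by rewrite DE (bigD1 j)//= lerDl sumr_ge0.
have bD : bdd D by rewrite /D; bdd_tac.
have bq i : bdd (q i).
  apply: bdd01 => //; apply: measurable_funM; first by apply: measurable_funB => //; have [] := bm i.
  by apply: measurable_inv_ge0 => //; have [] := bD.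
(* The probability that the second copy equals [j], given [J = i] and [phi = s], divided by
   [p j]. *)
pose kap i j s : R := (i == j)%:R * (r i s / p i) + (1 - r i s) * (q j s / p j).
have bkap i j : bdd (kap i j) by rewrite /kap; bdd_tac.
have kap0 i j s : 0 <= kap i j s.
  have /andP[r0 r1] := r01 i s; have /andP[q0 _] := q01 j s.
  apply: addr_ge0; apply: mulr_ge0; rewrite ?subr_ge0//; first exact: divr_ge0.
  exact: divr_ge0.
pose k j x := \sum_i \1_(Js i) x * kap i j (phi x).
have bkapp i j : bdd (fun x => kap i j (phi x)) by exact: (bdd_comp mphi).
have bk j : bdd (k j) by rewrite /k; bdd_tac.
have kE j x : k j x = kap (J x) j (phi x) by rewrite /k sum_indJ.
exists k; split => //.
- by move=> j x; rewrite kE.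
- move=> g bg.
  (* The ratio [r] is meaningful only where the density of the actual value of [J] is nonzero, which
     is almost everywhere. *)
  have aef : {ae P, forall x, f (J x) (phi x) != 0}.
    have : {ae P, forall x, \sum_i \1_(Js i) x * \1_[set s | f i s = 0] (phi x) = 0 :> R}.
      have mz i : measurable [set s | f i s = 0].
        by have := mf i measurableT [set 0] (measurable_set1 _); rewrite setTI.
      have bz i : bdd (\1_[set s | f i s = 0] : S -> R) by exact: bdd_indic.
      have bzp i : bdd (fun x => \1_[set s | f i s = 0] (phi x) : R) by exact: (bdd_comp mphi).
      apply: mean_ae0; first by bdd_tac.
        by move=> x; rewrite sumr_ge0// => i _; rewrite mulr_ge0// indicE.
      rewrite mean_sum; last by move=> i; bdd_tac.
      rewrite big1// => i _; rewrite fc// (@eq_mean _ _ _ _ _ (fun=> 0)) ?mean_cst// => x.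
      rewrite indicE; have [/set_mem /= ->|] := boolP (_ \in _); rewrite ?mul0r//.
      by rewrite mulr0.
    apply: filterS => x; rewrite (sum_indJ (fun i => \1_[set s | f i s = 0] (phi x))) => h.
    by apply/eqP => fz; move: h => /eqP; rewrite indicE mem_set// oner_eq0.
  have bsum : bdd (fun x => \sum_j p j * k j x) by bdd_tac.
  apply: ae_mean => //; first by bdd_tac.
  apply: filterS aef => x fn0; rewrite -[RHS]mulr1; congr (_ * _).
  under eq_bigr do rewrite kE /kap mulrDr.
  set i := J x in fn0 *; set s := phi x in fn0 *.
  rewrite big_split/= (bigD1 i)//= eqxx mul1r big1 ?addr0; last first.
    by move=> j /negbTE ji; rewrite eq_sym ji mul0r mulr0.
  have -> : p i * (r i s / p i) = r i s.
    have [pz|pn0] := eqVneq (p i) 0; last by rewrite mulrC divfK.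
    rewrite pz mul0r /r (_ : m i s = 0) ?mul0r//.
    by apply/eqP; rewrite eq_le m0 -pz mp.
  have -> : \sum_j p j * ((1 - r i s) * (q j s / p j)) = (1 - r i s) * \sum_j q j s.
    rewrite mulr_sumr; apply: eq_bigr => j _.
    have [pz|pn0] := eqVneq (p j) 0; last by rewrite mulrCA (mulrC (p j)) divfK.
    rewrite /q pz (_ : m j s = 0) ?subrr ?mul0r ?mulr0//.
    by apply/eqP; rewrite eq_le m0 -pz mp.
  rewrite -mulr_suml -DE; have [Dz|Dn0] := eqVneq (D s) 0; last by rewrite divff// mulr1 subrKC.
  rewrite Dz mul0r mulr0 addr0 /r.
  suff -> : m i s = f i s by rewrite divff.
  apply/eqP; rewrite eq_le mfi/=.
  have : \sum_j (f j s - m j s) = 0.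
    by rewrite sumrB fsum.
  move/eqP; rewrite psumr_eq0; last by move=> j _; rewrite subr_ge0.
  by move=> /allP /(_ i (mem_index_enum _)); rewrite subr_eq0 => /eqP ->.
- move=> c j bc pn0.
  have bcp : bdd (fun x => c (phi x)) by exact: (bdd_comp mphi).
  transitivity (mean P (fun x => \sum_i \1_(Js i) x * (c (phi x) * kap i j (phi x)))).
    apply: eq_mean => x; rewrite /k mulr_sumr; apply: eq_bigr => i _.
    by rewrite mulrCA.
  rewrite mean_sum; last by move=> i; bdd_tac.
  rewrite (eq_bigr (fun i => mean P (fun x => f i (phi x) * (c (phi x) * kap i j (phi x))))); last first.
    by move=> i _; apply: (fc i (fun s => c s * kap i j s)); exact: bddM.
  rewrite -mean_sum; last by move=> i; bdd_tac.
  apply: eq_mean => x; set s := phi x.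
  under eq_bigr do rewrite mulrCA /kap mulrDr (mulrA (f _ _) (1 - _)) mulrBr mulr1 fr.
  rewrite -mulr_sumr -[RHS]mulr1; congr (_ * _).
  rewrite big_split/= (bigD1 j)//= eqxx mul1r big1 ?addr0; last first.
    by move=> i /negbTE ->; rewrite mul0r mulr0.
  rewrite mulrA fr -mulr_suml sumrB fsum -/(D s) /q mulrA.
  have [Dz|Dn0] := eqVneq (D s) 0.
    rewrite Dz !mul0r addr0 (_ : m j s = p j) ?divff//.
    apply/eqP; rewrite eq_le mp/=; move: Dz; rewrite DE => /eqP.
    rewrite psumr_eq0// => /allP /(_ j (mem_index_enum _)).
    by rewrite subr_eq0 => /eqP ->.
  by rewrite mulrCA mulrA mulfK// -mulrDl subrKC divff.
- have -> : 1 - theta = \sum_j p j - theta by rewrite sum_pr_fibers.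
  rewrite lerBlDr -lerBlDl -sumrB.
  (* The complements of the [B j] carry the positive part of [f j - p j], whose total integral is
     the mass missing from the common part; [dep] on these sets therefore gives the full bound. *)
  pose B j := [set s | f j s < p j].
  have mB j : measurable (B j).
    have := mf j measurableT `]-oo, (p j)[%classic (measurable_itv _).
    by rewrite setTI; congr (measurable _).
  apply: le_trans (dep (A := fun j => ~` B j) (fun j => measurableC (mB j))).
  apply: ler_sum => j _.
  have bBp : bdd (fun x => \1_(B j) (phi x) : R) by apply: (bdd_comp mphi); exact: bdd_indic.
  have mphiB (A : set S) : measurable A -> measurable (phi @^-1` A).
    by move=> mA; rewrite -[X in measurable X]setTI; exact: mphi.
  have -> : pr P (Js j `&` phi @^-1` (~` B j)) = p j - mean P (fun x => f j (phi x) * \1_(B j) (phi x)).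
    rewrite -(fc j _ (bdd_indic R (mB j))) /p -!mean_indic//; last first.
      by apply: measurableI => //; apply: mphiB; exact: measurableC.
    rewrite -meanB//; last by bdd_tac.
    apply: eq_mean => x; rewrite indic_setI preimage_setC indic_setC indic_preimage.
    by rewrite mulrBr mulr1.
  have -> : pr P (phi @^-1` (~` B j)) = 1 - mean P (fun x => \1_(B j) (phi x)).
    by rewrite preimage_setC (prC P (mphiB _ (mB j))) -(mean_indic P (mphiB _ (mB j))).
  set X := mean P (fun x => f j _ * _); set Y := mean P (fun x => \1_(B j) _).
  have mE : mean P (fun x => m j (phi x)) = p j - (p j * Y - X).
    rewrite /X /Y -meanZ; last by bdd_tac.
    rewrite -meanB; [|by bdd_tac|by bdd_tac].
    rewrite -[X in X - _](mean_cst P) -meanB; [|by bdd_tac|by bdd_tac].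
    apply: eq_mean => x; rewrite -mulrBl indicE /m /Num.min.
    have [/set_mem /= ->|/negP nB] := boolP (phi x \in B j); first by rewrite mulr1 subKr.
    by rewrite ifF ?mulr0 ?subr0//; apply/negP => h; apply: nB; rewrite inE.
  suff : mean P (fun x => m j (phi x)) <= p j * mean P (fun x => \1_(Js j) x * k j x).
    by rewrite mE mulrBr mulr1; lra.
  have brp : bdd (fun x => r j (phi x)) by exact: (bdd_comp mphi).
  have [pz|pn0] := eqVneq (p j) 0.
    rewrite pz mul0r mean_le_cst//; first exact: (bdd_comp mphi).
    by move=> x; rewrite -pz.
  have -> : mean P (fun x => m j (phi x)) = mean P (fun x => \1_(Js j) x * r j (phi x)).
    by rewrite (fc j _ (br j)); apply: eq_mean => x; rewrite fr.
  rewrite -meanZ; last by bdd_tac.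
  apply: le_mean; [by bdd_tac|by bdd_tac|move=> x].
  rewrite indJ kE; have [->|_] := eqVneq (J x) j; last by rewrite !mul0r mulr0.
  rewrite !mul1r /kap eqxx mul1r mulrDr mulrCA divff// mulr1 lerDl.
  have /andP[_ r1] := r01 j (phi x); have /andP[q0 _] := q01 j (phi x).
  by apply: mulr_ge0 => //; apply: mulr_ge0; rewrite ?subr_ge0//; exact: divr_ge0.
Qed.

End coupling.

Section two_measures.
Context (R : realType) d (T : measurableType d).

Lemma mean_density (P Q : probability T R) (k : T -> R) : bdd k ->
  (forall A, measurable A -> pr Q A = mean P (fun x => \1_A x * k x)) ->
  forall f, bdd f -> mean Q f = mean P (fun x => f x * k x).
Proof.
move=> bk QP.
have key (c : T -> R) : measurable_fun setT c -> (forall x, 0 <= c x <= 1) ->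
    mean Q c = mean P (fun x => c x * k x).
  move=> mc c01; have bc := bdd01 mc c01.
  have [K K0 kK] := bdd_bound bk.
  apply/eqP; rewrite -subr_eq0 -normr_le0; apply/ler_addgt0Pr => e e0.
  have [n nM] : exists n : nat, (1 + K) / e < n.+1%:R.
    exists (Num.Def.archi_bound ((1 + K) / e)).
    apply: (lt_trans (archi_boundP _)); last by rewrite ltr_nat.
    by rewrite divr_ge0 ?ltW// addr_gt0.
  pose A (i : nat) := [set x | i.+1%:R / n.+1%:R <= c x].
  have mA i : measurable (A i) by exact: measurable_ge.
  pose L x : R := n.+1%:R^-1 * \sum_(i < n.+1) \1_(A i) x.
  have bL : bdd L by apply: bddZ; apply: bdd_sum => i; exact: bdd_indic.
  have cL x : `|c x - L x| <= n.+1%:R^-1.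
    have := @sum_thresholds _ n.+1 (n.+1%:R * c x).
    have /andP[c0 c1] := c01 x.
    rewrite mulr_ge0//= ler_piMr// => /(_ isT).
    rewrite (eq_bigr (fun i : 'I_n.+1 => (\1_(A i) x : R))); last first.
      move=> i _; rewrite indicE; congr (nat_of_bool _)%:R.
      by apply/idP/idP; rewrite inE/= /A/= ler_pdivrMr// mulrC.
    rewrite /L; set s := \sum_(i < _) _ => /andP[s1 s2].
    have n0 : 0 < n.+1%:R :> R by [].
    rewrite -(ler_pM2l n0) -[X in X * `|_|](gtr0_norm n0) -normrM mulrBr !mulrA divff// mul1r.
    by rewrite ger0_norm; lra.
  have LE : mean Q L = mean P (fun x => L x * k x).
    have b1 (i : nat) : bdd (\1_(A i) : T -> R) by exact: bdd_indic.
    rewrite /L meanZ; last by bdd_tac.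
    rewrite mean_sum//.
    transitivity (mean P (fun x => n.+1%:R^-1 * \sum_(i < n.+1) (\1_(A i) x * k x))).
      rewrite meanZ; last by bdd_tac.
      rewrite mean_sum; last by move=> i; bdd_tac.
      by congr (_ * _); apply: eq_bigr => i _; rewrite mean_indic// QP.
    by apply: eq_mean => x; rewrite -mulr_suml mulrA.
  have -> : mean Q c - mean P (fun x => c x * k x) =
      mean Q (fun x => c x - L x) - mean P (fun x => (c x - L x) * k x).
    have -> : mean P (fun x => (c x - L x) * k x) =
        mean P (fun x => c x * k x) - mean P (fun x => L x * k x).
      by rewrite -meanB; [apply: eq_mean => x; rewrite mulrBl|bdd_tac|bdd_tac].
    by rewrite meanB// LE; lra.
  rewrite add0r; apply: (le_trans (ler_normB _ _)).
  have h1 : `|mean Q (fun x => c x - L x)| <= n.+1%:R^-1.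
    by apply: (le_trans (mean_abs _ _)); [bdd_tac|apply: mean_le_cst => //; bdd_tac].
  have h2 : `|mean P (fun x => (c x - L x) * k x)| <= n.+1%:R^-1 * K.
    apply: (le_trans (mean_abs _ _)); first by bdd_tac.
    by apply: mean_le_cst => [|x]; [bdd_tac|rewrite normrM ler_pM].
  apply: (le_trans (lerD h1 h2)).
  rewrite -[X in X + _]mulr1 -mulrDr mulrC ler_pdivrMr// mulrC -ler_pdivrMr//.
  exact: ltW.
move=> f bf; have [M M0 fM] := bdd_bound bf.
have mf := bdd_meas bf.
have := key (fun x => (f x + M) / (2 * M)).
have -> : mean Q (fun x => (f x + M) / (2 * M)) = (2 * M)^-1 * mean Q f + 2^-1.
  rewrite -[X in _ + X](mean_cst Q) -meanZ// -meanD; [|by bdd_tac|by bdd_tac].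
  by apply: eq_mean => x; field; rewrite gt_eqF.
have -> : mean P (fun x => (f x + M) / (2 * M) * k x) =
    (2 * M)^-1 * mean P (fun x => f x * k x) + 2^-1 * mean P k.
  rewrite -!meanZ//; last by bdd_tac.
  rewrite -meanD; [|by bdd_tac|by bdd_tac].
  by apply: eq_mean => x; field; rewrite gt_eqF.
have -> : mean P k = 1.
  by rewrite -(pr_setT Q) QP//; apply: eq_mean => x; rewrite indic_setT mul1r.
move=> h; have : (2 * M)^-1 * mean Q f = (2 * M)^-1 * mean P (fun x => f x * k x).
  apply: (addIr 2^-1); rewrite -[X in _ = _ + X]mulr1; apply: h.
    apply: measurable_funM => //; exact: measurable_funD.
  move=> x; have := fM x; rewrite ler_norml => /andP[? ?].
  by rewrite divr_ge0 ?ler_pdivrMr; lra.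
by apply: mulfI; rewrite invr_eq0 gt_eqF// mulr_gt0.
Qed.

End two_measures.

Section density_measure.
Context (R : realType) d (T : measurableType d) (P : probability T R).

(** The proofs are parameters so that the measure and probability instances below can be attached to
    this name. *)
Definition density_measure (k : T -> R) (bk : bdd k) (k0 : forall x, 0 <= k x)
  (k1 : mean P k = 1) (A : set T) : \bar R := (\int[P]_(x in A) (k x)%:E)%E.

Variables (k : T -> R) (bk : bdd k) (k0 : forall x, 0 <= k x) (k1 : mean P k = 1).
Let Q := density_measure bk k0 k1.

Let Q0 : Q set0 = 0%E.
Proof. exact: integral_set0. Qed.

Let Q_ge0 A : (0 <= Q A)%E.
Proof. by apply: integral_ge0 => x _; rewrite lee_fin. Qed.

Let Q_sigma : semi_sigma_additive Q.
Proof.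
move=> F mF tF mUF; rewrite /Q /density_measure ge0_integral_bigcup//.
- by apply: is_cvg_ereal_nneg_natsum => n _; apply: integral_ge0 => x _; rewrite lee_fin.
- by apply/measurable_EFinP; apply: measurable_funTS; have [] := bk.
- by move=> x _; rewrite lee_fin.
Qed.

HB.instance Definition _ := isMeasure.Build _ _ _ Q Q0 Q_ge0 Q_sigma.

Let Q_setT : Q setT = 1%E.
Proof. by rewrite /Q /density_measure -meanE// k1. Qed.

HB.instance Definition _ := @Measure_isProbability.Build _ _ _ Q Q_setT.

Lemma density_probability : exists Q' : probability T R,
  forall f, bdd f -> mean Q' f = mean P (fun x => f x * k x).
Proof.
exists Q; apply: mean_density => // A mA.
by rewrite mean_indicM.
Qed.

End density_measure.

Section mean_value.
Context (R : realType) d (T : measurableType d) (P : probability T R).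

(** If [pr P A * H x] exceeded the integral over [A] for all [x], integrating the excess over [A]
    would make [A] null, and then both sides vanish. The product form covers null sets; the point
    may lie outside [A]. *)
Lemma mean_value_le (A : set T) (H : T -> R) : measurable A -> bdd H ->
  exists x, pr P A * H x <= mean P (fun x => \1_A x * H x).
Proof.
move=> mA bH; apply: contrapT => /forallNP nH.
have b1 : bdd (\1_A : T -> R) by exact: bdd_indic.
set m := mean P _ in nH.
have Hm x : m < pr P A * H x by rewrite ltNge; apply/negP/nH.
have m0 : mean P (fun x => \1_A x * (pr P A * H x - m)) = 0.
  transitivity (pr P A * m - m * pr P A); last by rewrite mulrC subrr.
  rewrite /m -(mean_indic P mA) -!meanZ; [|by bdd_tac|by bdd_tac].
  rewrite -meanB; [|by bdd_tac|by bdd_tac].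
  by apply: eq_mean => x; rewrite mulrBr; congr (_ - _); [rewrite mulrCA|rewrite mulrC].
have b2 : bdd (fun x => \1_A x * (pr P A * H x - m)) by bdd_tac.
have h0 x : 0 <= \1_A x * (pr P A * H x - m).
  by rewrite mulr_ge0// ?indic_ge0// subr_ge0 ltW.
have h : {ae P, forall x, \1_A x = 0 :> R}.
  apply: filterS (@mean_ae0 _ _ _ P _ b2 h0 m0) => x /eqP.
  by rewrite mulf_eq0 subr_eq0 => /orP[/eqP//|]; rewrite gt_eqF.
have pA : pr P A = 0.
  by rewrite -mean_indic// -(mean_cst P 0); apply: ae_mean => //; bdd_tac.
apply: (nH point); rewrite pA mul0r /m -(mean_cst P 0).
apply: le_mean_ae; [by bdd_tac|by bdd_tac|].
by apply: filterS h => x ->; rewrite mul0r.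
Qed.

End mean_value.

Lemma mean_indicZ (R : realType) d (T : measurableType d) (P : probability T R)
    (A : set T) (r : R) : measurable A ->
  mean P (fun x => \1_A x * r) = pr P A * r.
Proof.
move=> mA; rewrite -mean_indic// mulrC -meanZ; last exact: bdd_indic.
by apply: eq_mean => x; rewrite mulrC.
Qed.

Section coupling_measure.
Context (R : realType) d (T : measurableType d) d' (S : measurableType d').
Variables (P : probability T R) (N : nat) (J : T -> 'I_N) (phi : T -> S).
Hypothesis mphi : measurable_fun setT phi.
Hypothesis mJ : forall j, measurable [set x | J x = j].
Variable theta : R.
Hypothesis dep : forall A : 'I_N -> set S, (forall j, measurable (A j)) ->
  \sum_j (pr P ([set x | J x = j] `&` phi @^-1` (A j)) -
          pr P [set x | J x = j] * pr P (phi @^-1` (A j))) <= theta.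

Let Js j := [set x | J x = j].
Let p j := pr P (Js j).

Let indJ i x : \1_(Js i) x = (J x == i)%:R :> R.
Proof.
rewrite indicE; congr (nat_of_bool _)%:R.
by apply/idP/eqP; rewrite inE.
Qed.

Let sum_indJ (F : 'I_N -> R) x : \sum_i \1_(Js i) x * F i = F (J x).
Proof.
rewrite (bigD1 (J x))//= indJ eqxx mul1r big1 ?addr0// => i iJ.
by rewrite indJ eq_sym (negbTE iJ) mul0r.
Qed.

Let mJs j : measurable (Js j).
Proof. exact: mJ. Qed.

Let b1J j : bdd (\1_(Js j) : T -> R).
Proof. by apply: bdd_indic. Qed.

Lemma bdd_fst (f : T -> R) : bdd f -> bdd (fun z : T * T => f z.1).
Proof. by move=> bf; exact: (bdd_comp measurable_fst). Qed.

Lemma bdd_snd (f : T -> R) : bdd f -> bdd (fun z : T * T => f z.2).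
Proof. by move=> bf; exact: (bdd_comp measurable_snd). Qed.

(** The density of [Q] with respect to the product is [k (J z.2) z.1]: the second point is drawn
    from [P], and the first one given the value of [J] there. The second clause expresses that [z.2]
    is independent of the future [phi z.1]. The last clause trades the random second point for one
    fixed point per value of [J], chosen so as to control a second functional [F2] at the same
    time. *)
Lemma coupling_measure : exists Q : probability (T * T)%type R,
  [/\ forall f : T -> R, bdd f -> mean Q (fun z => f z.1) = mean P f,
    forall G : S * T -> R, bdd G ->
      mean Q (fun z => G (phi z.1, z.2)) =
      mean (P \x P)%E (fun z => G (phi z.1, z.2)),
    mean Q (fun z => (J z.1 != J z.2)%:R) <= theta &
    forall (F : T * T -> R) (F2 : T -> R) (K : R), bdd F -> bdd F2 ->
      (forall z, 0 <= F z <= K) ->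
      exists rep : 'I_N -> T,
        mean P (fun x => F (x, rep (J x))) + \sum_j p j * F2 (rep j) <=
        mean Q (fun z => (J z.1 == J z.2)%:R * F z) + mean P F2 + K * theta].
Proof.
have [k [bk k0 ksum kphi ktheta]] := coupling_density mphi mJ dep.
pose kap (z : T * T) := \sum_j k j z.1 * \1_(Js j) z.2.
have b1 j : bdd (fun z : T * T => k j z.1) by exact: bdd_fst.
have b2 j : bdd (fun z : T * T => \1_(Js j) z.2 : R) by exact: (bdd_snd (b1J j)).
have bkap : bdd kap by rewrite /kap; bdd_tac.
have kap0 z : 0 <= kap z.
  by rewrite sumr_ge0// => j _; rewrite mulr_ge0// ?indic_ge0.
have mkap (F : T * T -> R) : bdd F -> mean (P \x P)%E (fun z => F z * kap z) =
    \sum_j mean P (fun y => \1_(Js j) y * mean P (fun x => F (x, y) * k j x)).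
  move=> bF.
  transitivity (mean (P \x P)%E (fun z => \sum_j F z * (k j z.1 * \1_(Js j) z.2))).
    by apply: eq_mean => z; rewrite mulr_sumr.
  rewrite mean_sum; last by move=> j; bdd_tac.
  apply: eq_bigr => j _.
  have bb : bdd (fun z : T * T => F z * (k j z.1 * \1_(Js j) z.2)) by bdd_tac.
  have [_ ->] := mean_prod P P bb; apply: eq_mean => y.
  have bFy : bdd (fun x => F (x, y)) by exact: (bdd_comp (pair2_measurable y) bF).
  rewrite -meanZ; last by bdd_tac.
  by apply: eq_mean => x /=; rewrite mulrA mulrC.
have kap1 : mean (P \x P)%E kap = 1.
  transitivity (mean (P \x P)%E (fun z => 1 * kap z)).
    by apply: eq_mean => z; rewrite mul1r.
  rewrite mkap; last by bdd_tac.
  transitivity (\sum_j p j * mean P (fun x => 1 * k j x)).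
    by apply: eq_bigr => j _; rewrite mean_indicZ.
  rewrite -[RHS](mean_cst P) -(ksum (fun=> 1)); last by bdd_tac.
  under [RHS]eq_mean do rewrite mul1r.
  rewrite mean_sum; last by move=> j; bdd_tac.
  apply: eq_bigr => j _; rewrite [RHS]meanZ//; congr (_ * _).
  by apply: eq_mean => x; rewrite mul1r.
have [Q HQ] := density_probability bkap kap0 kap1.
have eqE z : (J z.1 == J z.2)%:R = \sum_j \1_(Js j) z.1 * \1_(Js j) z.2 :> R.
  by rewrite (sum_indJ (fun j => \1_(Js j) z.2)) indJ eq_sym.
have bf1 j : bdd (fun z : T * T => \1_(Js j) z.1 : R) by exact: (bdd_fst (b1J j)).
have beq : bdd (fun z => (J z.1 == J z.2)%:R : R).
  by apply: bdd_ext (fun z => esym (eqE z)) _; bdd_tac.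
have QeqE (F : T * T -> R) : bdd F -> mean Q (fun z => (J z.1 == J z.2)%:R * F z) =
    \sum_j mean P (fun y => \1_(Js j) y * mean P (fun x => \1_(Js j) x * k j x * F (x, y))).
  move=> bF; have bF' : bdd (fun z => (J z.1 == J z.2)%:R * F z) by exact: bddM.
  rewrite HQ// mkap//; apply: eq_bigr => j _; apply: eq_mean => y.
  rewrite indJ; have [<-|_] := eqVneq (J y) j; last by rewrite !mul0r.
  by rewrite !mul1r; apply: eq_mean => x /=; rewrite indJ; lra.
have Qeq1 : mean Q (fun z => (J z.1 == J z.2)%:R) =
    \sum_j p j * mean P (fun x => \1_(Js j) x * k j x).
  transitivity (mean Q (fun z => (J z.1 == J z.2)%:R * 1)).
    by apply: eq_mean => z; rewrite mulr1.
  rewrite QeqE; last by bdd_tac.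
  apply: eq_bigr => j _; rewrite mean_indicZ//; congr (_ * _).
  by apply: eq_mean => x; rewrite mulr1.
exists Q; split.
- move=> f bf; have bff := bdd_fst bf.
  rewrite HQ// (mkap (fun z => f z.1))//=.
  transitivity (\sum_j p j * mean P (fun x => f x * k j x)).
    by apply: eq_bigr => j _; rewrite mean_indicZ.
  rewrite -(ksum f bf).
  transitivity (mean P (fun x => \sum_j p j * (f x * k j x))).
    rewrite mean_sum; last by move=> j; bdd_tac.
    by apply: eq_bigr => j _; rewrite meanZ//; bdd_tac.
  by apply: eq_mean => x; rewrite mulr_sumr; apply: eq_bigr => j _; rewrite mulrCA.
- move=> G bG.
  have mg : measurable_fun setT (fun z : T * T => (phi z.1, z.2)).
    apply: measurable_fun_pair; last exact: measurable_snd.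
    exact: (measurableT_comp mphi measurable_fst).
  have bG' : bdd (fun z : T * T => G (phi z.1, z.2)) by exact: (bdd_comp mg bG).
  rewrite HQ// (mkap (fun z => G (phi z.1, z.2)))//=.
  have [_ ->] := mean_prod P P bG'.
  have bGy y : bdd (fun s => G (s, y)) by exact: (bdd_comp (pair2_measurable y) bG).
  have bm : bdd (fun y => mean P (fun x => G (phi x, y))).
    exact: (bdd_mean2 (f := fun z => G (phi z.1, z.2)) P bG').
  transitivity (\sum_j mean P (fun y => \1_(Js j) y * mean P (fun x => G (phi x, y)))).
    apply: eq_bigr => j _; have [pz|pn0] := eqVneq (p j) 0.
      have z0 : {ae P, forall x, \1_(Js j) x = 0 :> R}.
        exact: (@mean_ae0 _ _ _ P _ (b1J j) (indic_ge0 R (Js j)) (etrans (mean_indic P (mJs j)) pz)).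
      apply: ae_mean.
      + apply: bddM => //; apply: (bdd_mean2 (f := fun z => G (phi z.1, z.2) * k j z.1) P).
        by bdd_tac.
      + by bdd_tac.
      + by apply: filterS z0 => x ->; rewrite !mul0r.
    apply: eq_mean => y; congr (_ * _).
    exact: (kphi (fun s => G (s, y))).
  rewrite -mean_sum; last by move=> j; bdd_tac.
  by apply: eq_mean => y; rewrite (sum_indJ (fun=> _)).
- have -> : mean Q (fun z => (J z.1 != J z.2)%:R) = 1 - mean Q (fun z => (J z.1 == J z.2)%:R).
    rewrite -[X in _ = X - _](mean_cst Q) -meanB; [|by bdd_tac|by bdd_tac].
    by apply: eq_mean => z; case: eqP; rewrite ?subrr ?subr0.
  by rewrite Qeq1; move: ktheta; rewrite -/p; lra.
- move=> F F2 K bF bF2 F0K.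
  have bFy y : bdd (fun x => F (x, y)) by exact: (bdd_comp (pair2_measurable y) bF).
  pose H j y := mean P (fun x => \1_(Js j) x * k j x * F (x, y)) + F2 y.
  have bkF j : bdd (fun z : T * T => \1_(Js j) z.1 * k j z.1 * F z) by bdd_tac.
  have bH1 j : bdd (fun y => mean P (fun x => \1_(Js j) x * k j x * F (x, y))).
    exact: (bdd_mean2 (f := fun z => \1_(Js j) z.1 * k j z.1 * F z) P).
  have bH j : bdd (H j) by exact: bddD.
  (* The point for [j] does at least as well as the average over the fiber of [j] for the sum of
     both functionals; this is where they are controlled together. *)
  have /choice [rep Hrep] := fun j => mean_value_le P (mJs j) (bH j).
  exists rep.
  have sumH : \sum_j mean P (fun x => \1_(Js j) x * H j x) =
      mean Q (fun z => (J z.1 == J z.2)%:R * F z) + mean P F2.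
    rewrite QeqE//.
    have -> : mean P F2 = \sum_j mean P (fun x => \1_(Js j) x * F2 x).
      rewrite -mean_sum; last by move=> j; bdd_tac.
      by apply: eq_mean => x; rewrite (sum_indJ (fun=> F2 x)).
    rewrite -big_split/=; apply: eq_bigr => j _.
    rewrite -meanD; [|by bdd_tac|by bdd_tac].
    by apply: eq_mean => x; rewrite /H mulrDr.
  have h1 : \sum_j p j * H j (rep j) <= mean Q (fun z => (J z.1 == J z.2)%:R * F z) + mean P F2.
    by rewrite -sumH; apply: ler_sum => j _; exact: Hrep.
  (* The mean of [F (x, rep j)] over [J x = j] is split by the value [i] of the second copy. The
     terms with [i = j] are controlled by the choice of [rep]; the others carry total mass at most
     [theta]. *)
  pose a j i := mean P (fun x => \1_(Js j) x * k i x * F (x, rep j)).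
  have bjk j i : bdd (fun x => \1_(Js j) x * k i x) by bdd_tac.
  have h2 : mean P (fun x => F (x, rep (J x))) = \sum_j \sum_i p i * a j i.
    transitivity (mean P (fun x => \sum_j \1_(Js j) x * F (x, rep j))).
      by apply: eq_mean => x; rewrite (sum_indJ (fun j => F (x, rep j))).
    rewrite mean_sum; last by move=> j; apply: bddM.
    apply: eq_bigr => j _; have bjF : bdd (fun x => \1_(Js j) x * F (x, rep j)) by exact: bddM.
    rewrite -(ksum _ bjF).
    transitivity (mean P (fun x => \sum_i p i * (\1_(Js j) x * k i x * F (x, rep j)))).
      apply: eq_mean => x; rewrite mulr_sumr; apply: eq_bigr => i _.
      by rewrite /p /Js; ring.
    have b3 i : bdd (fun x => \1_(Js j) x * k i x * F (x, rep j)) by apply: bddM.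
    rewrite mean_sum; last by move=> i; exact: bddZ.
    by apply: eq_bigr => i _; rewrite meanZ.
  pose e j i := mean P (fun x => \1_(Js j) x * k i x).
  have he : \sum_j \sum_i p i * e j i = 1.
    rewrite -(sum_pr_fibers P mJ); apply: eq_bigr => j _.
    rewrite -mean_indic// -(ksum _ (b1J j)).
    transitivity (mean P (fun x => \sum_i p i * (\1_(Js j) x * k i x))).
      by rewrite mean_sum; [apply: eq_bigr => i _; rewrite meanZ|move=> i; exact: bddZ].
    apply: eq_mean => x; rewrite mulr_sumr; apply: eq_bigr => i _.
    by rewrite /p /Js; ring.
  have ae j i : a j i <= K * e j i.
    rewrite /a /e -meanZ//; apply: le_mean; [by apply: bddM|exact: bddZ|move=> x].
    have /andP[F0 FK] := F0K (x, rep j).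
    by rewrite mulrC ler_wpM2r// mulr_ge0// indic_ge0.
  have p0 i : 0 <= p i := pr_ge0 _ _.
  have h3 : \sum_j \sum_i p i * a j i <= \sum_j p j * a j j + K * (1 - \sum_j p j * e j j).
    rewrite -he mulrBr !mulr_sumr -sumrB -big_split/=; apply: ler_sum => j _.
    rewrite (bigD1 j)//= lerD2l [in leRHS](bigD1 j)//= mulrDr addrAC subrr add0r mulr_sumr.
    by apply: ler_sum => i _; rewrite mulrCA ler_wpM2l.
  have h4 : \sum_j p j * H j (rep j) = \sum_j p j * a j j + \sum_j p j * F2 (rep j).
    by rewrite -big_split/=; apply: eq_bigr => j _; rewrite -mulrDr.
  have K0 : 0 <= K by have /andP[] := F0K point; exact: le_trans.
  have h5 : K * (1 - \sum_j p j * e j j) <= K * theta.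
    by rewrite ler_wpM2l//; move: ktheta; rewrite -/p /e; lra.
  by rewrite h2; lra.
Qed.

End coupling_measure.

(** * Khintchine's inequality and finite-valued pasts under a bound on pairs of events *)

Section khintchine.
Context (R : realType).

(** The expectation of [g] at [x] plus a Rademacher sum with coefficients [cs]; each step of the
    recursion averages over one sign. *)
Fixpoint sign_average (g : R -> R) (cs : seq R) (x : R) : R :=
  if cs is c :: cs' then (sign_average g cs' (x + c) + sign_average g cs' (x - c)) / 2
  else g x.

Lemma le_sign_average g1 g2 cs x : (forall y, g1 y <= g2 y) ->
  sign_average g1 cs x <= sign_average g2 cs x.
Proof.
by move=> h; elim: cs x => [|c cs IH] x //=; rewrite ler_pM2r// lerD.
Qed.

Lemma sign_average_lin (a b : R) g1 g2 cs x :
  sign_average (fun y => a * g1 y + b * g2 y) cs x =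
  a * sign_average g1 cs x + b * sign_average g2 cs x.
Proof. by elim: cs x => [|c cs IH] x //=; rewrite !IH; field. Qed.

Lemma sign_average_sqr cs x :
  sign_average (fun y => y ^+ 2) cs x = x ^+ 2 + \sum_(c <- cs) c ^+ 2.
Proof.
elim: cs x => [|c cs IH] x /=; first by rewrite big_nil addr0.
by rewrite !IH big_cons; field.
Qed.

Lemma sign_average_4 cs x : let S := \sum_(c <- cs) c ^+ 2 in
  sign_average (fun y => y ^+ 4) cs x <= x ^+ 4 + 6 * x ^+ 2 * S + 3 * S ^+ 2.
Proof.
elim: cs x => [|c cs IH] x /=; first by rewrite big_nil expr0n/= !mulr0 !addr0.
rewrite big_cons; set S := \sum_(_ <- cs) _.
have S0 : 0 <= S by rewrite sumr_ge0// => i _; exact: sqr_ge0.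
have h1 := IH (x + c); have h2 := IH (x - c).
rewrite ler_pdivrMr//; apply: le_trans (lerD h1 h2) _; rewrite -/S.
rewrite -subr_ge0; set d := (X in 0 <= X).
have -> : d = 4 * (c ^+ 2) ^+ 2 by rewrite /d; ring.
by rewrite mulr_ge0// sqr_ge0.
Qed.

(** With [s] the root of the second moment, [|y|] dominates [y ^ 2 / (2 s) - y ^ 4 / (32 s ^ 3)]. As
    the fourth moment is at most [3 s ^ 4], averaging gives at least [s / 2 - 3 s / 32 = 13 s / 32],
    and 13/32 exceeds 2/5. *)
Lemma khintchine_l1 (cs : seq R) :
  2 / 5 * Num.sqrt (\sum_(c <- cs) c ^+ 2) <= sign_average Num.norm cs 0.
Proof.
set S := \sum_(_ <- _) _.
have S0 : 0 <= S by rewrite sumr_ge0// => i _; exact: sqr_ge0.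
have [Sz|Sn0] := eqVneq S 0.
  rewrite Sz sqrtr0 mulr0.
  have nn : forall cs' x, 0 <= sign_average Num.norm cs' x.
    by elim=> [|c cs' IH] x //=; rewrite divr_ge0// addr_ge0.
  exact: nn.
set s := Num.sqrt S.
have s0 : 0 < s by rewrite sqrtr_gt0 lt_def Sn0.
have sS : s ^+ 2 = S by rewrite sqr_sqrtr.
have h : sign_average (fun y => (2 * s)^-1 * y ^+ 2 + (- (32 * s ^+ 3)^-1) * y ^+ 4) cs 0
    <= sign_average Num.norm cs 0.
  apply: le_sign_average => y.
  have -> : (2 * s)^-1 * y ^+ 2 + (- (32 * s ^+ 3)^-1) * y ^+ 4 =
      `|y| * ((2 * s)^-1 * `|y| - (32 * s ^+ 3)^-1 * `|y| ^+ 3).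
    have -> : y ^+ 4 = (`|y| ^+ 2) ^+ 2 by rewrite real_normK ?num_real// -exprM.
    have -> : y ^+ 2 = `|y| ^+ 2 by rewrite real_normK ?num_real.
    by ring.
  rewrite -[leRHS]mulr1 ler_wpM2l// -subr_ge0.
  have -> : 1 - ((2 * s)^-1 * `|y| - (32 * s ^+ 3)^-1 * `|y| ^+ 3) =
     1 - (`|y| / (2 * s)) + (`|y| / (2 * s)) ^+ 3 / 4.
    by field; rewrite gt_eqF.
  set z := `|y| / (2 * s).
  have z0 : 0 <= z by rewrite divr_ge0// mulr_ge0// ltW.
  (* A polynomial with a double root at 6/5, close to the minimizer [2 / sqrt 3] of
     [1 - z + z ^ 3 / 4], certifies that this cubic is nonnegative. *)
  have : 0 <= (z - 6 / 5) ^+ 2 * (z + 12 / 5) by rewrite mulr_ge0 ?sqr_ge0// addr_ge0.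
  have -> : (z - 6 / 5) ^+ 2 * (z + 12 / 5) = z ^+ 3 - 108 / 25 * z + 432 / 125 by field.
  lra.
apply: le_trans h; rewrite sign_average_lin sign_average_sqr.
have h4 := sign_average_4 cs 0; rewrite /= -/S !expr0n/= mulr0 mul0r !add0r in h4.
rewrite expr0n/= add0r -/S.
have h5 : (32 * s ^+ 3)^-1 * sign_average (fun y => y ^+ 4) cs 0 <= (32 * s ^+ 3)^-1 * (3 * S ^+ 2).
  by rewrite ler_wpM2l ?invr_ge0 ?mulr_ge0 ?exprn_ge0// ltW.
have e1 : (2 * s)^-1 * S = s / 2 by rewrite -sS; field; rewrite gt_eqF.
have e2 : (32 * s ^+ 3)^-1 * (3 * S ^+ 2) = 3 / 32 * s by rewrite -sS; field; rewrite gt_eqF.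
rewrite e2 in h5; rewrite e1 mulNr.
move: h5; set u := (_ * sign_average _ _ _) => h5.
lra.
Qed.

Lemma sum_norm_le_sqrt (N : nat) (c : 'I_N -> R) :
  \sum_i `|c i| <= Num.sqrt N%:R * Num.sqrt (\sum_i c i ^+ 2).
Proof.
rewrite -sqrtrM// -(ler_pXn2r (n := 2))// ?nnegrE ?sumr_ge0 ?sqrtr_ge0//.
rewrite sqr_sqrtr; last by rewrite mulr_ge0// sumr_ge0// => i _; exact: sqr_ge0.
rewrite expr2 mulr_suml.
have -> : \sum_i `|c i| * \sum_j `|c j| = \sum_i \sum_j `|c i| * `|c j|.
  by apply: eq_bigr => i _; rewrite mulr_sumr.
apply: (@le_trans _ _ (\sum_(i < N) \sum_(j < N) (c i ^+ 2 + c j ^+ 2) / 2)).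
  apply: ler_sum => i _; apply: ler_sum => j _.
  rewrite -[c i ^+ 2]real_normK ?num_real// -[c j ^+ 2]real_normK ?num_real//.
  rewrite -subr_ge0 (_ : _ - _ = (`|c i| - `|c j|) ^+ 2 / 2); last by field.
  by rewrite divr_ge0// sqr_ge0.
set s := \sum_i c i ^+ 2.
rewrite (eq_bigr (fun i => (N%:R * c i ^+ 2 + s) / 2)); last first.
  move=> i _; rewrite -mulr_suml big_split/= sumr_const card_ord mulr_natl.
  by [].
rewrite -mulr_suml big_split/= -mulr_sumr sumr_const card_ord -/s -[s *+ N]mulr_natl.
lra.
Qed.

End khintchine.

Section sign_average_mean.
Context (R : realType) d (T : measurableType d) (P : probability T R).
Variables (N : nat) (c : 'I_N -> T -> R).
Hypothesis bc : forall i, bdd (c i).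

Lemma bdd_sign_average (s : seq 'I_N) (acc : T -> R) : bdd acc ->
  bdd (fun x => sign_average Num.norm [seq c i x | i <- s] (acc x)).
Proof.
elim: s acc => [|i s IH] acc bacc /=; first exact: bdd_norm.
apply: bddM; last exact: bdd_cst.
by apply: bddD; [apply: (IH (fun x => acc x + c i x))|apply: (IH (fun x => acc x - c i x))]; bdd_tac.
Qed.

(** The sign average is a mean over sign vectors, for each of which the bound is assumed. The
    induction fixes the signs one at a time, [e] being 0 at the indices that are still averaged. *)
Lemma mean_sign_average_le (b : R) :
  (forall e : 'I_N -> R, (forall i, e i = 1 \/ e i = -1) ->
     mean P (fun x => `|\sum_i e i * c i x|) <= b) ->
  mean P (fun x => sign_average Num.norm [seq c i x | i <- enum 'I_N] 0) <= b.
Proof.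
move=> hb.
have gen : forall (s : seq 'I_N) (e : 'I_N -> R), uniq s ->
    (forall i, i \notin s -> e i = 1 \/ e i = -1) -> (forall i, i \in s -> e i = 0) ->
    mean P (fun x => sign_average Num.norm [seq c i x | i <- s] (\sum_i e i * c i x)) <= b.
  elim=> [|i s IH] e us e1 e0 /=; first by apply: hb => i; exact: e1.
  move: us => /= /andP[nis us].
  have upd (v : R) : (fun x => \sum_j e j * c j x + v * c i x) =
      (fun x => \sum_j (if j == i then v else e j) * c j x).
    apply/funext => x; rewrite (bigD1 i)//= [in RHS](bigD1 i)//= eqxx e0 ?mem_head//.
    rewrite mul0r add0r addrC; congr (_ + _); apply: eq_bigr => j ji.
    by rewrite (negbTE ji).
  have bs e' : bdd (fun x => \sum_j e' j * c j x) by bdd_tac.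
  have side v : v = 1 \/ v = -1 ->
      mean P (fun x => sign_average Num.norm [seq c i x | i <- s]
        (\sum_j (if j == i then v else e j) * c j x)) <= b.
    move=> v1; apply: IH => // j js.
      have [_|ji] := eqVneq j i; first exact: v1.
      by apply: e1; rewrite inE negb_or ji.
    have [ji|ji] := eqVneq j i; first by rewrite ji (negbTE nis) in js.
    by apply: e0; rewrite inE js orbT.
  have bE v : bdd (fun x => sign_average Num.norm [seq c i x | i <- s]
        (\sum_j (if j == i then v else e j) * c j x)).
    exact: (bdd_sign_average _ (bs _)).
  rewrite (@eq_mean _ _ _ _ _ (fun x => 2^-1 *
     (sign_average Num.norm [seq c i x | i <- s] (\sum_j (if j == i then 1 else e j) * c j x)) +
     2^-1 * (sign_average Num.norm [seq c i x | i <- s]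
        (\sum_j (if j == i then -1 else e j) * c j x)))); last first.
    move=> x; have /(congr1 (@^~ x)) /= <- := upd 1; have /(congr1 (@^~ x)) /= <- := upd (-1).
    by rewrite mul1r mulN1r -mulrDr mulrC.
  rewrite meanD ?meanZ//; [|exact: bddZ|exact: bddZ].
  by have := side 1 (or_introl erefl); have := side (-1) (or_intror erefl); lra.
have := gen (enum 'I_N) (fun=> 0) (enum_uniq _).
rewrite (@eq_mean _ _ _ _ _ (fun x => sign_average Num.norm [seq c i x | i <- enum 'I_N] 0)).
  by apply=> // i; rewrite mem_enum.
by move=> x; rewrite big1// => i _; rewrite mul0r.
Qed.

End sign_average_mean.

Section alpha_dependence.
Context (R : realType) d (T : measurableType d) d' (S : measurableType d').
Variables (P : probability T R) (N : nat) (J : T -> 'I_N) (phi : T -> S).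
Hypothesis mphi : measurable_fun setT phi.
Hypothesis mJ : forall j, measurable [set x | J x = j].
Variable a : R.
Hypothesis dep : forall (D : set 'I_N) (B : set S), measurable B ->
  `|pr P (J @^-1` D `&` phi @^-1` B) - pr P (J @^-1` D) * pr P (phi @^-1` B)| <= a.

Let Js j := [set x | J x = j].
Let p j := pr P (Js j).
Let mJs j : measurable (Js j).
Proof. exact: mJ. Qed.

Lemma measurable_preimage_fibers (D : set 'I_N) : measurable (J @^-1` D).
Proof.
have -> : J @^-1` D = \big[setU/set0]_(j <- enum 'I_N | j \in D) Js j.
  apply/seteqP; split => x /=.
    move=> Dx; rewrite -bigcup_seq_cond/=; exists (J x) => //=.
    by rewrite mem_enum/= inE.
  by rewrite -bigcup_seq_cond/= => -[j /= /andP[_ jD]]; rewrite inE in jD; rewrite /Js/= => ->.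
by apply: bigsetU_measurable => j _.
Qed.

(* The square root of the number of atoms, instead of the number itself, comes
   from averaging over random signs (Khintchine's inequality). *)
Lemma alpha_dependence_fibers (A : 'I_N -> set S) : (forall j, measurable (A j)) ->
  \sum_j (pr P (Js j `&` phi @^-1` (A j)) - p j * pr P (phi @^-1` (A j)))
  <= 10 * Num.sqrt N%:R * a.
Proof.
move=> mA; have [f [mf f0 fsum fc]] := cond_density_fibers P mphi mJ.
have f1 j s : f j s <= 1.
  by rewrite -(fsum s) (bigD1 j)//= lerDl sumr_ge0// => i _; exact: f0.
have bf j : bdd (f j) by apply: bdd01 => // s; rewrite f0 f1.
pose c i x : R := f i (phi x) - p i.
have bc i : bdd (c i) by apply: bddB; [exact: (bdd_comp mphi)|exact: bdd_cst].
have mphiB (B : set S) : measurable B -> measurable (phi @^-1` B).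
  by move=> mB; rewrite -[X in measurable X]setTI; exact: mphi.
have cB (i : 'I_N) (B : set S) : measurable B -> mean P (fun x => \1_B (phi x) * c i x) =
    pr P (Js i `&` phi @^-1` B) - p i * pr P (phi @^-1` B).
  move=> mB; have bB : bdd (\1_B : S -> R) by exact: bdd_indic.
  have bBp : bdd (fun x => \1_B (phi x) : R) by exact: (bdd_comp mphi).
  have bfp : bdd (fun x => f i (phi x)) by exact: (bdd_comp mphi).
  have bJ : bdd (\1_(Js i) : T -> R) by exact: bdd_indic.
  transitivity (mean P (fun x => f i (phi x) * \1_B (phi x)) - p i * mean P (fun x => \1_B (phi x))).
    rewrite -meanZ// -meanB; [|by bdd_tac|by bdd_tac].
    by apply: eq_mean => x; rewrite /c; ring.
  rewrite -(fc i _ bB); congr (_ - _ * _); last by rewrite -mean_indic//; exact: mphiB.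
  rewrite -mean_indic//; last by apply: measurableI => //; exact: mphiB.
  by apply: eq_mean => x; rewrite indic_setI.
have csum x : \sum_i c i x = 0.
  by rewrite sumrB fsum (sum_pr_fibers P mJ) subrr.
(* Since the [c i] sum to 0, a signed sum is twice the sum over the indices with sign 1. Its
   positive and negative parts are integrals over an event of the future and over its complement,
   each at most [a] by [dep]; with the factor 2 this gives [4 * a]. *)
have signs (e : 'I_N -> R) : (forall i, e i = 1 \/ e i = -1) ->
    mean P (fun x => `|\sum_i e i * c i x|) <= 4 * a.
  move=> e1; pose D := [set i | e i = 1].
  pose g s := \sum_i \1_D i * (f i s - p i).
  have bg : bdd g by rewrite /g; bdd_tac.
  pose B := [set s | 0 <= g s].
  have mB : measurable B by apply: measurable_ge; have [] := bg.
  have gE x : \sum_i e i * c i x = 2 * g (phi x).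
    transitivity (\sum_i e i * c i x + \sum_i c i x); first by rewrite csum addr0.
    rewrite -big_split/= /g mulr_sumr; apply: eq_bigr => i _.
    rewrite /c indicE; case: (e1 i) => ei; rewrite ei.
      by rewrite mem_set//= ; ring.
    rewrite memNset/=; first by ring.
    by rewrite /D/= ei => /eqP; rewrite lt_eqF// (lt_trans (ltrN10 R)).
  have half (B' : set S) : measurable B' -> `|mean P (fun x => \1_B' (phi x) * g (phi x))| <= a.
    move=> mB'; have bB : bdd (fun x => \1_B' (phi x) : R).
      by apply: (bdd_comp mphi); exact: bdd_indic.
    have bD i : bdd (fun _ : T => \1_D i : R) by exact: bdd_cst.
    have -> : mean P (fun x => \1_B' (phi x) * g (phi x)) =
        \sum_i \1_D i * (pr P (Js i `&` phi @^-1` B') - p i * pr P (phi @^-1` B')).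
      transitivity (mean P (fun x => \sum_i \1_D i * (\1_B' (phi x) * c i x))).
        by apply: eq_mean => x; rewrite mulr_sumr; apply: eq_bigr => i _; rewrite mulrCA.
      rewrite mean_sum; last by move=> i; bdd_tac.
      by apply: eq_bigr => i _; rewrite meanZ ?cB//; bdd_tac.
    suff : \sum_i \1_D i * (pr P (Js i `&` phi @^-1` B') - p i * pr P (phi @^-1` B')) =
       pr P (J @^-1` D `&` phi @^-1` B') - pr P (J @^-1` D) * pr P (phi @^-1` B').
      by move=> ->; exact: dep.
    have sumD (E : set T) : measurable E ->
        pr P (J @^-1` D `&` E) = \sum_i \1_D i * pr P (Js i `&` E).
      move=> mE; rewrite -mean_indic; last first.
        by apply: measurableI => //; exact: measurable_preimage_fibers.
      have bJE i : bdd (\1_(Js i `&` E) : T -> R) by apply: bdd_indic; exact: measurableI.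
      transitivity (mean P (fun x => \sum_i \1_D i * \1_(Js i `&` E) x)).
        apply: eq_mean => x; rewrite indic_setI indic_preimage (bigD1 (J x))//= big1 ?addr0.
          by rewrite indic_setI [\1_(Js _) x]indicE mem_set// mul1r.
        move=> i iJ; rewrite indic_setI [\1_(Js _) x]indicE memNset ?mul0r ?mulr0//.
        by rewrite /Js/= => h; rewrite h eqxx in iJ.
      rewrite mean_sum; last by move=> i; bdd_tac.
      by apply: eq_bigr => i _; rewrite meanZ// mean_indic//; exact: measurableI.
    rewrite (sumD _ (mphiB _ mB')) -[J @^-1` D]setIT (sumD _ measurableT).
    rewrite mulr_suml -sumrB; apply: eq_bigr => i _.
    by rewrite setIT mulrBr mulrA.
  have h1 := half B mB; have h2 := half (~` B) (measurableC mB).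
  have bB : bdd (fun x => \1_B (phi x) : R) by apply: (bdd_comp mphi); exact: bdd_indic.
  have bBC : bdd (fun x => \1_(~` B) (phi x) : R).
    by apply: (bdd_comp mphi); apply: bdd_indic; exact: measurableC.
  have bgp : bdd (fun x => g (phi x)) by exact: (bdd_comp mphi).
  have -> : mean P (fun x => `|\sum_i e i * c i x|) =
     2 * mean P (fun x => \1_B (phi x) * g (phi x)) +
     (- 2) * mean P (fun x => \1_(~` B) (phi x) * g (phi x)).
    rewrite -!meanZ; [|by bdd_tac|by bdd_tac].
    rewrite -meanD; [|by bdd_tac|by bdd_tac].
    apply: eq_mean => x; rewrite gE indic_setC indicE.
    have [/set_mem/= gx|/negP gx] := boolP (phi x \in B).
      by rewrite ger0_norm ?mulr_ge0//=; ring.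
    rewrite ltr0_norm/=; first by ring.
    by rewrite pmulr_rlt0// ltNge; apply/negP => h; apply: gx; rewrite inE.
  move: h1 h2; rewrite !ler_norml => /andP[? ?] /andP[? ?]; lra.
have hmean := mean_sign_average_le bc signs.
have bav : bdd (fun x => sign_average Num.norm [seq c i x | i <- enum 'I_N] 0).
  exact: (bdd_sign_average bc (enum 'I_N) (@bdd_cst R _ T 0)).
(* The factor 5/2 inverts the constant of [khintchine_l1]; multiplied by the 4 of [signs] it yields
   the 10 of the statement. *)
have pt x : \sum_i `|c i x| <= 5 / 2 * Num.sqrt N%:R *
    sign_average Num.norm [seq c i x | i <- enum 'I_N] 0.
  apply: le_trans (sum_norm_le_sqrt (fun i => c i x)) _.
  have := khintchine_l1 [seq c i x | i <- enum 'I_N].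
  rewrite big_map big_enum/= => h.
  rewrite [5 / 2 * _]mulrC -mulrA ler_wpM2l ?sqrtr_ge0//; lra.
apply: (@le_trans _ _ (mean P (fun x => \sum_i `|c i x|))).
  rewrite mean_sum; last by move=> i; exact: bdd_norm.
  apply: ler_sum => i _; rewrite -cB//.
  have bAi : bdd (fun x => \1_(A i) (phi x) : R).
    by apply: (bdd_comp mphi); exact: bdd_indic.
  apply: le_mean; [by bdd_tac|by bdd_tac|move=> x].
  apply: le_trans (ler_norm _) _; rewrite normrM ger0_norm ?indic_ge0//.
  by rewrite ler_piMl// indic_le1.
apply: le_trans (le_mean P _ _ pt) _; [by bdd_tac|exact: bddZ|].
rewrite meanZ//.
have s0 : 0 <= 5 / 2 * Num.sqrt N%:R :> R by rewrite mulr_ge0 ?divr_ge0 ?sqrtr_ge0.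
apply: le_trans (ler_wpM2l s0 hmean) _.
have -> : 5 / 2 * Num.sqrt N%:R * (4 * a) = 10 * Num.sqrt N%:R * a by field.
exact: lexx.
Qed.

End alpha_dependence.

(** * Truncation and degeneracy *)

Section truncation.
Context (R : realType).

Definition trunc (K x : R) : R := Num.max (- K) (Num.min x K).

Lemma trunc_le (K x : R) : 0 <= K -> `|trunc K x| <= K.
Proof.
move=> K0; rewrite ler_norml /trunc le_max lexx/= ge_max ge_min lexx orbT andbT.
by rewrite (le_trans _ K0)// oppr_le0.
Qed.

Lemma trunc_id (K x : R) : `|x| <= K -> trunc K x = x.
Proof.
by rewrite ler_norml => /andP[? ?]; rewrite /trunc min_l// max_r.
Qed.

Lemma trunc_lip (K x y : R) : `|trunc K x - trunc K y| <= `|x - y|.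
Proof.
rewrite /trunc /Num.max /Num.min.
do ! case: ifP; rewrite ?ltNge => *; rewrite ler_norml;
  have := ler_norm (x - y); have := ler_norm (- (x - y)); rewrite normrN;
  repeat match goal with H : (~~ (_ <= _)) = true |- _ => rewrite -ltNge in H
   | H : (~~ (_ <= _)) = false |- _ => move/negbFE : H => H end; move=> ? ?; apply/andP; split; lra.
Qed.

Lemma measurable_trunc (K : R) : measurable_fun setT (trunc K).
Proof. by apply: measurable_maxr => //; exact: measurable_minr. Qed.

Lemma bdd_trunc d (T : measurableType d) (K : R) (f : T -> R) :
  0 <= K -> measurable_fun setT f -> bdd (fun x => trunc K (f x)).
Proof.
move=> K0 mf; apply: (@bdd_le _ _ _ _ K) => [|x]; last exact: trunc_le.
exact: (measurableT_comp (measurable_trunc K)).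
Qed.

Lemma trunc_factor (K x : R) : 0 <= K -> exists2 s, 0 <= s <= 1 & trunc K x = s * x.
Proof.
move=> K0; have [xK|xK] := leP `|x| K.
  by exists 1; rewrite ?ler01 ?lexx// mul1r trunc_id.
have x0 : 0 < `|x| := le_lt_trans K0 xK.
exists (K / `|x|).
  by rewrite divr_ge0//= ler_pdivrMr// mul1r ltW.
have [x00|x00] := leP 0 x.
  rewrite ger0_norm// in xK x0 *; rewrite divfK ?gt_eqF//.
  by rewrite /trunc min_r ?(ltW xK)// max_r// (le_trans _ K0)// oppr_le0.
rewrite ltr0_norm// in xK x0 *; rewrite invrN mulrN mulNr divfK ?lt_eqF//.
by rewrite /trunc min_l ?max_l//; lra.
Qed.

Lemma powR_tail (K a e r : R) : 0 < K -> K <= a -> 0 <= e ->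
  a `^ r <= K `^ (- e) * a `^ (r + e).
Proof.
move=> K0 Ka e0; have a0 : 0 < a := lt_le_trans K0 Ka.
have an0 : a != 0 by rewrite gt_eqF.
rewrite powRD; last by rewrite an0 implybT.
rewrite mulrCA ler_peMr ?powR_ge0// powRN.
by rewrite ler_pdivlMl ?powR_gt0// mulr1 ge0_ler_powR// nnegrE ltW.
Qed.

Variable delta : R.
Hypothesis d0 : 0 < delta.

Lemma trunc_tail (K x : R) : 0 < K ->
  `|x - trunc K x| <= K `^ (- (1 + delta)) * `|x| `^ (2 + delta).
Proof.
move=> K0; have [xK|xK] := leP `|x| K.
  by rewrite trunc_id// subrr normr0 mulr_ge0// powR_ge0.
apply: (@le_trans _ _ `|x|).
  have [s /andP[s0 s1] ->] := trunc_factor x (ltW K0).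
  rewrite -[X in `|X - _|]mul1r -mulrBl normrM ler_piMl// ger0_norm; lra.
rewrite -[leLHS]powRr1//; rewrite (_ : 2 + delta = 1 + (1 + delta)); last by lra.
by apply: powR_tail => //; [exact: ltW|rewrite addr_ge0// ltW].
Qed.

Lemma sqr_tail (K x : R) : 0 < K -> K <= `|x| ->
  `|x| ^+ 2 <= K `^ (- delta) * `|x| `^ (2 + delta).
Proof.
move=> K0 Kx; rewrite -powR_mulrn//.
by apply: powR_tail => //; exact: ltW.
Qed.

(** If some factor exceeds [K], then so does the larger one, and its square, which dominates the
    product, is bounded by [sqr_tail]. *)
Lemma trunc_prod (K x y : R) : 0 < K ->
  `|x * y - trunc K x * trunc K y| <=
  K `^ (- delta) * (`|x| `^ (2 + delta) + `|y| `^ (2 + delta)).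
Proof.
move=> K0; have rhs0 (z : R) : 0 <= K `^ (- delta) * `|z| `^ (2 + delta).
  by rewrite mulr_ge0// powR_ge0.
have le_xy : `|x * y - trunc K x * trunc K y| <= `|x| * `|y|.
  have [s /andP[s0 s1] ->] := trunc_factor x (ltW K0).
  have [t /andP[t0 t1] ->] := trunc_factor y (ltW K0).
  rewrite -normrM (_ : x * y - _ = (1 - s * t) * (x * y)); last by ring.
  have st0 : 0 <= s * t by rewrite mulr_ge0.
  have st1 : s * t <= 1 by rewrite mulr_ile1.
  by rewrite [leLHS]normrM ler_piMl// ger0_norm; lra.
have [xK|xK] := leP `|x| K; have [yK|yK] := leP `|y| K.
- by rewrite !trunc_id// subrr normr0 mulrDr addr_ge0.
all: rewrite mulrDr; apply: le_trans le_xy _.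
- apply: (@le_trans _ _ (`|y| ^+ 2)); last by rewrite (le_trans (sqr_tail K0 (ltW yK)))// lerDr.
  by rewrite expr2 ler_wpM2r// (le_trans xK)// ltW.
- apply: (@le_trans _ _ (`|x| ^+ 2)); last by rewrite (le_trans (sqr_tail K0 (ltW xK)))// lerDl.
  by rewrite expr2 ler_wpM2l// (le_trans yK)// ltW.
- have [xy|xy] := leP `|x| `|y|.
    apply: (@le_trans _ _ (`|y| ^+ 2)); last by rewrite (le_trans (sqr_tail K0 (ltW yK)))// lerDr.
    by rewrite expr2 ler_wpM2r.
  apply: (@le_trans _ _ (`|x| ^+ 2)); last by rewrite (le_trans (sqr_tail K0 (ltW xK)))// lerDl.
  by rewrite expr2 ler_wpM2l// ltW.
Qed.

End truncation.

Section laws.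
Context (R : realType) (mu : probability R R).

Definition has_law d (T : measurableType d) (P : probability T R) (U : T -> R) :=
  measurable_fun setT U /\ forall B : set R, measurable B -> P (U @^-1` B) = mu B.

Lemma has_law_prod d (T : measurableType d) (P : probability T R)
    d' (T' : measurableType d') (P' : probability T' R) (U : T -> R) (V : T' -> R) :
  has_law P U -> has_law P' V ->
  measurable_fun setT (fun z : T * T' => (U z.1, V z.2)) /\
  forall B : set (R * R), measurable B ->
    (mu \x mu)%E B = (P \x P')%E [set z | B (U z.1, V z.2)].
Proof.
move=> [mU UE] [mV VE].
have mUV : measurable_fun setT (fun z : T * T' => (U z.1, V z.2)).
  apply: measurable_fun_pair.
    exact: (measurableT_comp mU measurable_fst).
  exact: (measurableT_comp mV measurable_snd).
split => // B mB.
pose f : {mfun (T * T')%type >-> (R * R)%type} := mfun_Sub (mem_set mUV).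
pose m' : probability (R * R)%type R := distribution (P \x P')%E f.
rewrite -[RHS]/(m' B); apply: product_measure_unique => //.
move=> A1 A2 mA1 mA2; rewrite /m' /= /distribution /pushforward.
transitivity ((P \x P')%E ((U @^-1` A1) `*` (V @^-1` A2))) => //.
have mUA : measurable (U @^-1` A1) by rewrite -[X in measurable X]setTI; exact: mU.
have mVA : measurable (V @^-1` A2) by rewrite -[X in measurable X]setTI; exact: mV.
have := product_measure1E P P' mUA mVA => ->.
by congr (_ * _)%E; [exact: UE|exact: VE].
Qed.

Variable (h : R * R -> R).
Hypothesis mh : measurable_fun setT h.
Hypothesis hdeg : forall x : R, (\int[mu]_y (h (x, y))%:E = 0)%E.
Variables (delta M : R).
Hypothesis d0 : 0 < delta.
Hypothesis hmom : (\int[(mu \x mu)%E]_z (`|h z| `^ (2 + delta))%:E <= M%:E)%E.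

(** The positive and negative parts have finite integrals, as their difference would otherwise be
    infinite. *)
Lemma integral0_integrable d (T : measurableType d) (P : probability T R) (f : T -> R) :
  measurable_fun setT f -> (\int[P]_x (f x)%:E = 0)%E -> P.-integrable setT (EFin \o f).
Proof.
move=> mf f0; have mf' : measurable_fun setT (EFin \o f) by exact/measurable_EFinP.
have ip : (0 <= \int[P]_x ((EFin \o f)^\+ x))%E by apply: integral_ge0 => x _.
have in_ : (0 <= \int[P]_x ((EFin \o f)^\- x))%E by apply: integral_ge0 => x _.
move: f0; rewrite integralE => f0.
apply/integrableP; split => //.
have -> : (\int[P]_x `|(EFin \o f) x| =
    \int[P]_x ((EFin \o f)^\+ x) + \int[P]_x ((EFin \o f)^\- x))%E.
  rewrite -ge0_integralD//; [|exact: measurable_funepos|exact: measurable_funeneg].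
  by apply: eq_integral => x _; rewrite -/((abse \o (EFin \o f)) x) fune_abse.
by move: f0 ip in_; case: (\int[P]_x _)%E => [r| |]; case: (\int[P]_x _)%E => [s| |]; rewrite ?ltry.
Qed.

Lemma mean_degenerate d (T : measurableType d) (P : probability T R) (t f : T -> R) :
  bdd t -> measurable_fun setT f -> (\int[P]_x (f x)%:E = 0)%E ->
  (`|mean P t|%:E <= \int[P]_x `|t x - f x|%:E)%E.
Proof.
move=> bt mf f0; have if_ := integral0_integrable mf f0.
have it := bdd_integrable P bt.
have -> : mean P t = \int[P]_x (t x - f x).
  by rewrite RintegralB// [X in _ - X](_ : _ = 0) ?subr0// /Rintegral f0.
have itf : P.-integrable setT (EFin \o (fun x => t x - f x)) by exact: (integrableB measurableT it if_).
rewrite EFin_normr_Rintegral//; apply: le_abse_integral => //.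
exact: measurable_int itf.
Qed.

Lemma measurable_section1 (x : R) : measurable_fun setT (fun y => h (x, y)).
Proof. exact: (measurableT_comp mh (pair1_measurable x)). Qed.

Lemma measurable_powR_norm d (T : measurableType d) (f : T -> R) (r : R) :
  measurable_fun setT f -> measurable_fun setT (fun x => `|f x| `^ r).
Proof.
move=> mf; apply: (measurableT_comp (measurable_powR r)).
exact: (measurableT_comp (@normr_measurable R setT)).
Qed.

(** The weight depends on the first coordinate alone and leaves the inner mean. There degeneracy
    allows the section of [h] to be subtracted from its truncation, and only the truncation error
    remains. *)
Lemma degenerate_tail d (T : measurableType d) (P : probability T R)
    d' (T' : measurableType d') (P' : probability T' R) (A U : T -> R) (V : T' -> R)
    (K : R) : 0 < K -> bdd A -> (forall x, `|A x| <= 1) ->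
  has_law P U -> has_law P' V ->
  `|mean (P \x P')%E (fun z => A z.1 * trunc K (h (U z.1, V z.2)))|
  <= K `^ (- (1 + delta)) * M.
Proof.
move=> K0 bA A1 lU lV.
have [mUV lUV] := has_law_prod lU lV.
have bF : bdd (fun z : T * T' => A z.1 * trunc K (h (U z.1, V z.2))).
  apply: bddM; first exact: (bdd_comp measurable_fst bA).
  by apply: bdd_trunc; [exact: ltW|exact: (measurableT_comp mh mUV)].
have [-> _] := mean_prod P P' bF; rewrite /=.
have bx x : bdd (fun y => trunc K (h (U x, V y))).
  apply: bdd_trunc; first exact: ltW.
  by apply: (measurableT_comp (measurable_section1 _)); have [] := lV.
have bm := bdd_mean1 P' bF.
apply: le_trans (mean_abs _ bm) _.
rewrite -lee_fin meanE; last exact: bdd_norm.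
have Kp0 : 0 <= K `^ (- (1 + delta)) by exact: powR_ge0.
pose F x := (\int[mu]_y (K `^ (- (1 + delta)) * `|h (x, y)| `^ (2 + delta))%:E)%E.
have mpow : measurable_fun setT (fun z : R * R =>
    (K `^ (- (1 + delta)) * `|h z| `^ (2 + delta))%:E).
  apply/measurable_EFinP; apply: measurable_funM => //.
  exact: measurable_powR_norm.
have mF : measurable_fun setT F.
  exact: (@measurable_fun_fubini_tonelli_F _ _ _ _ _ mu
    (fun z => (K `^ (- (1 + delta)) * `|h z| `^ (2 + delta))%:E) mpow
    (fun z => ltac:(by rewrite lee_fin mulr_ge0// powR_ge0))).
have F0 x : (0 <= F x)%E.
  by apply: integral_ge0 => y _; rewrite lee_fin mulr_ge0// powR_ge0.
have key x : (`|mean P' (fun y => A x * trunc K (h (U x, V y)))|%:E <= F (U x))%E.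
  rewrite meanZ// normrM.
  apply: (@le_trans _ _ `|mean P' (fun y => trunc K (h (U x, V y)))|%:E).
    by rewrite lee_fin ler_piMl.
  have [mV VE] := lV.
  have mhx : measurable_fun setT (fun y => h (U x, y)) := measurable_section1 _.
  have bt : bdd (fun y => trunc K (h (U x, y))) by apply: bdd_trunc => //; exact: ltW.
  rewrite -(mean_map (P := P') (Q := mu) mV _ bt); last by move=> B mB; rewrite VE.
  apply: le_trans (mean_degenerate bt mhx (hdeg (U x))) _.
  apply: ge0_le_integral => //.
  - apply/measurable_EFinP; apply: measurableT_comp => //.
    by apply: measurable_funB => //; have [] := bt.
  - apply/measurable_EFinP; apply: measurable_funM => //.
    exact: measurable_powR_norm.
  - by move=> y _; rewrite lee_fin distrC trunc_tail.
have [mU UE] := lU.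
apply: (@le_trans _ _ (\int[P]_x F (U x))%E).
  apply: ge0_le_integral => //.
  - by apply/measurable_EFinP; have [] := bdd_norm bm.
  - exact: (measurableT_comp mF mU).
  - by move=> x _; exact: key.
rewrite -(ge0_integral_map (P := P) (Q := mu) mU _ mF F0); last by move=> B mB; rewrite UE.
have -> : (\int[mu]_x F x = \int[(mu \x mu)%E]_z
    (K `^ (- (1 + delta)) * `|h z| `^ (2 + delta))%:E)%E.
  rewrite (@fubini_tonelli1 _ _ _ _ _ mu mu _ mpow)// => z.
  by rewrite lee_fin mulr_ge0// powR_ge0.
under eq_integral do rewrite EFinM.
rewrite ge0_integralZl//; last first.
  by apply/measurable_EFinP; exact: measurable_powR_norm.
by rewrite EFinM lee_pmul// integral_ge0// => z _; rewrite lee_fin powR_ge0.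
Qed.

End laws.

(** * The truncated kernel on events of the past or of the future *)

Section event_bound.
Context (R : realType) (mu : probability R R) (h : R * R -> R).
Hypothesis mh : measurable_fun setT h.
Hypothesis hsym : forall x y, h (x, y) = h (y, x).
Hypothesis hdeg : forall x : R, (\int[mu]_y (h (x, y))%:E = 0)%E.
Variables (delta M : R).
Hypothesis d0 : 0 < delta.
Hypothesis hmom : (\int[(mu \x mu)%E]_z (`|h z| `^ (2 + delta))%:E <= M%:E)%E.

Context d (T : measurableType d) d' (S : measurableType d').
Variables (P : probability T R) (N : nat) (J : T -> 'I_N) (phi : T -> S).
Hypothesis mphi : measurable_fun setT phi.
Hypothesis mJ : forall j, measurable [set x | J x = j].

Lemma bdd_fibers (g : 'I_N -> R) : bdd (fun x => g (J x)).
Proof.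
apply: (@bdd_ext _ _ _ (fun x => \sum_j \1_[set x | J x = j] x * g j)).
  move=> x; rewrite (bigD1 (J x))//= indicE mem_set// mul1r big1 ?addr0// => i iJ.
  by rewrite indicE memNset ?mul0r//= => e; rewrite e eqxx in iJ.
apply: bdd_sum => j; apply: bddM; last exact: bdd_cst.
by apply: bdd_indic; exact: mJ.
Qed.

Lemma bdd_fibers2 (g : 'I_N -> 'I_N -> R) : bdd (fun z : T * T => g (J z.1) (J z.2)).
Proof.
have b1 j : bdd (fun z : T * T => (J z.1 == j)%:R : R).
  exact: (bdd_fst (bdd_fibers (fun i => (i == j)%:R))).
have b2 j : bdd (fun z : T * T => (J z.2 == j)%:R : R).
  exact: (bdd_snd (bdd_fibers (fun i => (i == j)%:R))).
apply: (@bdd_ext _ _ _ (fun z => \sum_i \sum_j (J z.1 == i)%:R * ((J z.2 == j)%:R * g i j))); last by bdd_tac.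
move=> z; rewrite (bigD1 (J z.1))//= [X in _ + X]big1 ?addr0; last first.
  by move=> i iJ; rewrite big1// => j _; rewrite eq_sym (negbTE iJ) mul0r.
rewrite (bigD1 (J z.2))//= [X in _ + X]big1 ?addr0; last first.
  by move=> i iJ; rewrite [J z.2 == i]eq_sym (negbTE iJ) mul0r mulr0.
by rewrite !eqxx !mul1r.
Qed.

(** The part of the coupling that does not involve [J]: the second point is a copy of the first that
    is independent of [phi z.1]. *)
Definition half_product (Q : probability (T * T)%type R) : Prop :=
  (forall f : T -> R, bdd f -> mean Q (fun z => f z.1) = mean P f) /\
  (forall G : S * T -> R, bdd G ->
     mean Q (fun z => G (phi z.1, z.2)) = mean (P \x P)%E (fun z => G (phi z.1, z.2))).

Variables (U : T -> R) (v : S -> R).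
Let V x := v (phi x).
Hypothesis lU : has_law mu P U.
Hypothesis mv : measurable_fun setT v.
Hypothesis lV : has_law mu P V.
Variables (K : R).
Hypothesis K0 : 0 < K.
Let xi x y := trunc K (h (x, y)).

Lemma measurable_pairU : measurable_fun setT (fun x : T => (U x, V x)).
Proof. by apply: measurable_fun_pair; [case: lU|case: lV]. Qed.

(** Passing from [U z.1] to [U z.2], in the weight as well, costs at most [2 * K] where the values
    of [J] differ and [eta] where they agree. Afterwards the two arguments are independent, and
    [degenerate_tail] applies because one of the two weights is identically 1. *)
Lemma event_bound (theta eta : R) (Q : probability (T * T)%type R)
    (Dp : 'I_N -> R) (Df : S -> R) : half_product Q ->
  mean Q (fun z => (J z.1 != J z.2)%:R) <= theta ->
  (forall j, 0 <= Dp j <= 1) -> bdd Df -> (forall s, 0 <= Df s <= 1) ->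
  (forall j, Dp j = 1) \/ (forall s, Df s = 1) ->
  mean Q (fun z => (J z.1 == J z.2)%:R * `|xi (U z.1) (V z.1) - xi (U z.2) (V z.1)|) <= eta ->
  `|mean P (fun x => Dp (J x) * Df (phi x) * xi (U x) (V x))| <=
    K * theta *+ 2 + eta + K `^ (- (1 + delta)) * M.
Proof.
move=> [Q1 Q2] Q3 Dp01 bDf Df01 triv Heta.
have [mU _] := lU; have [mV _] := lV.
have bxi : bdd (fun x => xi (U x) (V x)).
  by apply: bdd_trunc; [exact: ltW|exact: (measurableT_comp mh measurable_pairU)].
have mUV : measurable_fun setT (fun z : T * T => (U z.2, V z.1)).
  apply: measurable_fun_pair; first exact: (measurableT_comp mU measurable_snd).
  exact: (measurableT_comp mV measurable_fst).
have bxi1 : bdd (fun z : T * T => xi (U z.1) (V z.1)) := bdd_fst bxi.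
have bxi2 : bdd (fun z : T * T => xi (U z.2) (V z.1)).
  by apply: bdd_trunc; [exact: ltW|exact: (measurableT_comp mh mUV)].
have bDp := bdd_fibers Dp.
have bDp1 := bdd_fst bDp; have bDp2 := bdd_snd bDp.
have bDfp : bdd (fun x => Df (phi x)) by exact: (bdd_comp mphi).
have bDf1 := bdd_fst bDfp; have bDf2 := bdd_snd bDfp.
pose A (z : T * T) := Dp (J z.1) * Df (phi z.1) * xi (U z.1) (V z.1).
pose B (z : T * T) := Dp (J z.2) * Df (phi z.1) * xi (U z.2) (V z.1).
have bA : bdd A by rewrite /A; bdd_tac.
have bB : bdd B by rewrite /B; bdd_tac.
have QA : mean Q A = mean P (fun x => Dp (J x) * Df (phi x) * xi (U x) (V x)).
  by apply: Q1; bdd_tac.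
have QB : mean Q B = mean (P \x P)%E B.
  apply: (Q2 (fun z => Dp (J z.2) * Df z.1 * xi (U z.2) (v z.1))).
  apply: bddM.
    apply: bddM; first exact: (bdd_comp measurable_snd bDp).
    exact: (bdd_comp measurable_fst bDf).
  apply: bdd_trunc; first exact: ltW.
  apply: (measurableT_comp mh); apply: measurable_fun_pair.
    exact: (measurableT_comp mU measurable_snd).
  exact: (measurableT_comp mv measurable_fst).
have PB : `|mean (P \x P)%E B| <= K `^ (- (1 + delta)) * M.
  have [e1 e2] := mean_prod P P bB.
  (* When the remaining weight is a function of the future, the symmetry of [h] makes [V] the first
     variable. *)
  case: triv => [Dp1|Df1].
    apply: le_trans (degenerate_tail mh hdeg d0 hmom K0 bDfp _ lV lU).
      rewrite le_eqVlt; apply/orP; left; apply/eqP; congr (`|_|).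
      apply: eq_mean => z; rewrite /B Dp1 mul1r; congr (_ * _).
      by rewrite /xi hsym.
    by move=> x; have /andP[? ?] := Df01 (phi x); rewrite ger0_norm.
  apply: le_trans (degenerate_tail mh hdeg d0 hmom K0 bDp _ lU lV).
    rewrite le_eqVlt; apply/orP; left; apply/eqP; congr (`|_|).
    have bB' : bdd (fun z : T * T => Dp (J z.1) * trunc K (h (U z.1, V z.2))).
      apply: bddM => //; apply: bdd_trunc; first exact: ltW.
      apply: (measurableT_comp mh); apply: measurable_fun_pair.
        exact: (measurableT_comp mU measurable_fst).
      exact: (measurableT_comp mV measurable_snd).
    have [-> _] := mean_prod P P bB'; rewrite e2; apply: eq_mean => x; apply: eq_mean => y.
    by rewrite /B/= Df1 mulr1.
  by move=> x; have /andP[? ?] := Dp01 (J x); rewrite ger0_norm.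
have bne : bdd (fun z : T * T => (J z.1 != J z.2)%:R : R) := bdd_fibers2 (fun i j => (i != j)%:R).
have beq : bdd (fun z : T * T => (J z.1 == J z.2)%:R : R) := bdd_fibers2 (fun i j => (i == j)%:R).
have diff z : `|A z - B z| <= K *+ 2 * (J z.1 != J z.2)%:R +
    (J z.1 == J z.2)%:R * `|xi (U z.1) (V z.1) - xi (U z.2) (V z.1)|.
  have bnd (D E t : R) : 0 <= D <= 1 -> 0 <= E <= 1 -> `|t| <= K -> `|D * E * t| <= K.
    move=> /andP[D0' D1] /andP[E0 E1] tK; rewrite normrM (@ger0_norm _ (D * E)) ?mulr_ge0//.
    by rewrite -[leRHS]mul1r ler_pM ?mulr_ge0 ?mulr_ile1.
  have [e|ne] := eqVneq (J z.1) (J z.2); rewrite /= ?mulr0 ?mul0r ?add0r ?addr0 ?mul1r ?mulr1.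
    rewrite /A /B e -mulrBr normrM ler_piMl//.
    have /andP[? ?] := Dp01 (J z.2); have /andP[? ?] := Df01 (phi z.1).
    by rewrite ger0_norm ?mulr_ge0 ?mulr_ile1.
  rewrite (le_trans (ler_normB _ _))// mulr2n lerD// bnd// trunc_le// ltW//.
have -> : mean P (fun x => Dp (J x) * Df (phi x) * xi (U x) (V x)) =
    mean Q (fun z => A z - B z) + mean (P \x P)%E B.
  by rewrite meanB// QA QB subrK.
rewrite (le_trans (ler_normD _ _))// lerD//.
rewrite (le_trans (mean_abs _ _))//; first by bdd_tac.
apply: le_trans (le_mean _ _ _ diff) _; [by bdd_tac|by bdd_tac|].
rewrite meanD; [|by bdd_tac|by bdd_tac].
rewrite lerD// meanZ// -mulrnAl ler_wpM2l// mulrn_wge0//.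
exact: ltW.
Qed.

(** Off the bad event, equal values of [J] put [U z.1] and [U z.2] within [q], where [hL] applies.
    Each of the two points is bad with probability [pr P B], at a cost of [2 * K]; hence the 4. *)
Lemma eta_bad_event (L q : R) (Q : probability (T * T)%type R) (B : set T) :
  half_product Q -> measurable B ->
  (forall x y, J x = J y -> ~ B x -> ~ B y -> `|U x - U y| <= q) ->
  (\int[Q]_z (`|h (U z.1, V z.1) - h (U z.2, V z.1)| *
     \1_[set z | (`|U z.1 - U z.2| <= q)%R] z)%:E <= L%:E)%E ->
  mean Q (fun z => (J z.1 == J z.2)%:R * `|xi (U z.1) (V z.1) - xi (U z.2) (V z.1)|)
  <= L + K * pr P B *+ 4.
Proof.
move=> [Q1 Q2] mB hB hL.
have [mU _] := lU; have [mV _] := lV.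
have bxi : bdd (fun x => xi (U x) (V x)).
  by apply: bdd_trunc; [exact: ltW|exact: (measurableT_comp mh measurable_pairU)].
have mUV : measurable_fun setT (fun z : T * T => (U z.2, V z.1)).
  apply: measurable_fun_pair; first exact: (measurableT_comp mU measurable_snd).
  exact: (measurableT_comp mV measurable_fst).
have bxi1 : bdd (fun z : T * T => xi (U z.1) (V z.1)) := bdd_fst bxi.
have bxi2 : bdd (fun z : T * T => xi (U z.2) (V z.1)).
  by apply: bdd_trunc; [exact: ltW|exact: (measurableT_comp mh mUV)].
have b1B : bdd (\1_B : T -> R) by exact: bdd_indic.
have bB1 := bdd_fst b1B; have bB2 := bdd_snd b1B.
have beq : bdd (fun z : T * T => (J z.1 == J z.2)%:R : R) := bdd_fibers2 (fun i j => (i == j)%:R).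
pose C := [set z : T * T | (`|U z.1 - U z.2| <= q)%R].
have mC : measurable C.
  have mf : measurable_fun setT (fun z : T * T => q - `|U z.1 - U z.2|).
    apply: measurable_funB => //; apply: measurableT_comp => //.
    apply: measurable_funB; [exact: (measurableT_comp mU measurable_fst)|].
    exact: (measurableT_comp mU measurable_snd).
  rewrite (_ : C = [set z | 0 <= q - `|U z.1 - U z.2|]); first exact: measurable_ge.
  by apply/seteqP; split => z; rewrite /C/= subr_ge0.
pose G (z : T * T) := `|xi (U z.1) (V z.1) - xi (U z.2) (V z.1)| * \1_C z.
have bC : bdd (\1_C : T * T -> R) by exact: bdd_indic.
have bG : bdd G by rewrite /G; bdd_tac.
have GL : mean Q G <= L.
  rewrite -lee_fin meanE//; apply: le_trans hL.
  apply: ge0_le_integral => //.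
  - by move=> z _; rewrite lee_fin mulr_ge0// indic_ge0.
  - by apply/measurable_EFinP; have [] := bG.
  - apply/measurable_EFinP; apply: measurable_funM; last by have [] := bC.
    apply: measurableT_comp => //; apply: measurable_funB.
      exact: (measurableT_comp (measurableT_comp mh measurable_pairU) measurable_fst).
    exact: (measurableT_comp mh mUV).
  - by move=> z _; rewrite lee_fin ler_wpM2r ?indic_ge0// trunc_lip.
have pt z : (J z.1 == J z.2)%:R * `|xi (U z.1) (V z.1) - xi (U z.2) (V z.1)| <=
    G z + K *+ 2 * (\1_B z.1 + \1_B z.2).
  have x0 : `|xi (U z.1) (V z.1) - xi (U z.2) (V z.1)| <= K *+ 2.
    by rewrite (le_trans (ler_normB _ _))// mulr2n lerD// trunc_le// ltW.
  have K20 : 0 <= K *+ 2 by rewrite mulrn_wge0// ltW.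
  have G0 : 0 <= G z by rewrite /G mulr_ge0// indic_ge0.
  have rhs0 : 0 <= K *+ 2 * (\1_B z.1 + \1_B z.2).
    by rewrite mulr_ge0// addr_ge0// indic_ge0.
  have [e|ne] := eqVneq (J z.1) (J z.2); last by rewrite mul0r addr_ge0.
  rewrite mul1r.
  have [B1|B1] := pselect (B z.1).
    rewrite [\1_B z.1]indicE mem_set// (le_trans x0)// ler_wpDl//.
    by rewrite -[leLHS]mulr1 ler_wpM2l// lerDl indic_ge0.
  have [B2|B2] := pselect (B z.2).
    rewrite [\1_B z.2]indicE mem_set// (le_trans x0)// ler_wpDl//.
    by rewrite -[leLHS]mulr1 ler_wpM2l// lerDr indic_ge0.
  have Cz : C z by exact: hB.
  by rewrite /G [\1_C z]indicE mem_set// mulr1 lerDl.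
have e2 : mean Q (fun z => \1_B z.2) = pr P B.
  rewrite (Q2 (fun z => \1_B z.2)); last exact: (bdd_comp measurable_snd b1B).
  have [-> _] := mean_prod P P bB2.
  rewrite -[RHS](mean_cst P); apply: eq_mean => x.
  by rewrite -mean_indic.
apply: le_trans (le_mean _ _ _ pt) _; [by bdd_tac|by bdd_tac|].
rewrite meanD ?meanZ ?meanD; [|by bdd_tac|by bdd_tac|by bdd_tac|by bdd_tac|by bdd_tac].
rewrite e2 (Q1 _ b1B) mean_indic// lerD//.
by rewrite (_ : _ *+ 4 = K *+ 2 * (pr P B + pr P B))//; ring.
Qed.

End event_bound.

(** * The two regularity conditions on the kernel *)

Section cells.
Context (R : realType).

Definition cell (s x : R) : int := Num.floor (x / s).

Lemma measurable_cell (s : R) (a : int) : 0 < s -> measurable [set x | cell s x = a].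
Proof.
move=> s0; rewrite (_ : [set x | _] = `[a%:~R * s, (a + 1)%:~R * s[%classic).
  exact: measurable_itv.
apply/seteqP; split => x /=; rewrite in_itv/=.
  by move/eqP; rewrite /cell floor_eq ler_pdivlMr// ltr_pdivrMr.
by move=> h; apply/eqP; rewrite /cell floor_eq ler_pdivlMr// ltr_pdivrMr.
Qed.

Lemma cell_eq (s x y : R) : 0 < s -> cell s x = cell s y -> `|x - y| <= s.
Proof.
move=> s0 e; have := floor_itv (x / s); have := floor_itv (y / s).
rewrite -/(cell s x) -/(cell s y) e.
rewrite !ler_pdivlMr// !ltr_pdivrMr// intrD mulrDl mul1r => /andP[? ?] /andP[? ?].
by rewrite ler_norml; apply/andP; split; lra.
Qed.

Lemma measurable_countable_preimage d (T : measurableType d) (I : countType) (c : T -> I)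
    (D : set I) : (forall i, measurable [set x | c x = i]) -> measurable (c @^-1` D).
Proof.
move=> mc; rewrite (_ : _ @^-1` _ = \bigcup_i (if i \in D then [set x | c x = i] else set0)).
  apply: countable_bigcupT_measurable => [|i]; last by case: ifP.
  exact: countableP.
apply/seteqP; split => x /=; first by move=> Dx; exists (c x) => //; rewrite mem_set.
by move=> [i _]; case: ifPn => // /set_mem Di /= cx; rewrite cx.
Qed.

Lemma measurable_countable_image d (T : measurableType d) (I : countType) (c : T -> I)
    (G : I -> \bar R) : (forall i, measurable [set x | c x = i]) ->
  measurable_fun setT (fun x => G (c x)).
Proof.
by move=> mc _ B mB; rewrite setTI; exact: (measurable_countable_preimage (G @^-1` B)).
Qed.

(** The integral of a nonnegative function is a supremum over the simple functions below it, and
    every one below [f] is below [g]. The form is suited to [oscillation], which is not known to be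
    Borel measurable. *)
Lemma ge0_le_integral_minorant d (T : measurableType d) (mu : measure T R)
    (f g : T -> \bar R) : (forall x, (0 <= f x)%E) -> (forall x, (f x <= g x)%E) ->
  (\int[mu]_x f x <= \int[mu]_x g x)%E.
Proof.
move=> f0 fg; have g0 x : (0 <= g x)%E := le_trans (f0 x) (fg x).
rewrite !ge0_integralTE//; apply: ge_ereal_sup => _ [s sf <-].
by apply: ereal_sup_ubound; exists s => // x; exact: le_trans (sf x) (fg x).
Qed.

End cells.

Section lipschitz.
Context (R : realType) d (T : measurableType d) (P : probability T R).
Variables (X : nat -> {RV P >-> R}) (h : R * R -> R).
Hypothesis mh : measurable_fun setT h.
Let mu : probability R R := distribution P (X 1%N).

(** The common consequence of both regularity conditions, shaped for couplings: the first pair may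
    have any admissible law, the second one has the product law. *)
Definition lipschitz_coupling (L : R) : Prop := forall eps : R, 0 < eps ->
  forall d' (T' : measurableType d') (Q : probability T' R) (U V U' : T' -> R),
    measurable_fun setT U -> measurable_fun setT V -> measurable_fun setT U' ->
    admissible_law X (fun A => Q [set w | A (U w, V w)]) ->
    (forall A, measurable A -> Q [set w | A (U' w, V w)] = (mu \x mu)%E A) ->
    (\int[Q]_w (`| h (U w, V w) - h (U' w, V w) |
       * \1_[set w' | (`|U w' - U' w'| <= eps)%R] w)%:E <= (L * eps)%:E)%E.

Lemma P_Lipschitz_coupling : P_Lipschitz X h ->
  exists2 L, 0 < L & lipschitz_coupling L.
Proof.
move=> [L L0 HL]; exists L => // eps eps0 d' T' Q U V U' mU mV mU' lUV lU'V.
apply: (HL eps eps0 d' T' Q (mfun_Sub (mem_set mU)) (mfun_Sub (mem_set mV))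
  (mfun_Sub (mem_set mU'))) => //.
by right.
Qed.

Lemma eucl_dist_cell (s : R) (p z z' : R * R) : 0 < s ->
  cell s z.1 = cell s z'.1 -> cell s z.2 = cell s z'.2 ->
  eucl_dist p z <= 2 * s -> eucl_dist p z' <= 4 * s.
Proof.
move=> s0 /(cell_eq s0) c1 /(cell_eq s0) c2.
have sq (a b : R) : 0 <= a -> 0 <= b -> (Num.sqrt a <= b) = (a <= b ^+ 2).
  by move=> a0 b0; rewrite -(ler_pXn2r (n := 2))// ?nnegrE ?sqrtr_ge0// sqr_sqrtr.
rewrite /eucl_dist !sq ?addr_ge0 ?sqr_ge0 ?mulr_ge0 ?(ltW s0)// => h1.
have sqs (a : R) : `|a| <= s -> a ^+ 2 <= s ^+ 2.
  by move=> ha; rewrite -[a ^+ 2]real_normK ?num_real// ler_pXn2r// nnegrE// ltW.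
have := sqs _ c1; have := sqs _ c2.
(* By [(a + b) ^ 2 <= 2 a ^ 2 + 2 b ^ 2] the squared distance is at most
   [2 * 4 s ^ 2 + 2 * 2 s ^ 2 = 12 s ^ 2], below [16 s ^ 2]. *)
have := sqr_ge0 ((p.1 - z.1) - (z.1 - z'.1)).
have := sqr_ge0 ((p.2 - z.2) - (z.2 - z'.2)).
move: h1; have := ltW s0; nra.
Qed.

(** The supremum of the oscillation over each cell of a grid of mesh [eps / 2] is a function of
    countably many cells, hence measurable, and lies between the oscillations at [eps] and at
    [2 * eps]. It can therefore be integrated under the law of [(U', V)], at the price of a factor
    2. *)
Lemma variation_condition_coupling : variation_condition X h ->
  exists2 L, 0 < L & lipschitz_coupling L.
Proof.
move=> [L0 HL0]; pose L := `|L0| + 1.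
have Lp : 0 < L by rewrite ltr_wpDl.
exists (2 * L); first by rewrite mulr_gt0.
move=> eps eps0 d' T' Q U V U' mU mV mU' _ lU'V.
pose s := eps / 2; have s0 : 0 < s by rewrite divr_gt0.
pose c (z : R * R) := (cell s z.1, cell s z.2).
pose F (i : int * int) := ereal_sup [set oscillation h eps z | z in [set z | c z = i]].
have osc0 e z : 0 <= e -> (0 <= oscillation h e z)%E.
  move=> e0; apply: ereal_sup_ubound; exists z, z.
  by rewrite /eucl_dist !subrr !expr0n addr0 sqrtr0; split => //; rewrite normr0.
have oscF z : (oscillation h eps z <= F (c z))%E.
  by apply: ereal_sup_ubound; exists z.
have Fosc z : (F (c z) <= oscillation h (2 * eps) z)%E.
  apply: ge_ereal_sup => _ [z' /= [c1 c2] <-].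
  apply: ge_ereal_sup => _ [p [q [hp hq ->]]].
  apply: ereal_sup_ubound; exists p, q; split => //.
    rewrite (_ : 2 * eps = 4 * s); last by rewrite /s; field.
    by apply: (eucl_dist_cell s0 c1 c2); rewrite (_ : 2 * s = eps)// /s; field.
  rewrite (_ : 2 * eps = 4 * s); last by rewrite /s; field.
  by apply: (eucl_dist_cell s0 c1 c2); rewrite (_ : 2 * s = eps)// /s; field.
have F0 z : (0 <= F (c z))%E := le_trans (osc0 _ _ (ltW eps0)) (oscF z).
have mF : measurable_fun setT (fun z => F (c z)).
  apply: (@measurable_countable_image _ _ _ _ c F) => -[i j].
  rewrite (_ : [set x | _] = [set x | cell s x = i] `*` [set x | cell s x = j]).
    by apply: measurableX; exact: measurable_cell.
  by apply/seteqP; split => -[x y]; rewrite /c/=; [case=> <- <-|case=> <- <-].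
have mpair (A B : T' -> R) : measurable_fun setT A -> measurable_fun setT B ->
    measurable_fun setT (fun w => (A w, B w)) by exact: measurable_fun_pair.
apply: (@le_trans _ _ (\int[Q]_w F (c (U' w, V w)))%E).
  apply: ge0_le_integral => //.
  - apply/measurable_EFinP; apply: measurable_funM.
      apply: measurableT_comp => //; apply: measurable_funB.
        exact: (measurableT_comp mh (mpair _ _ mU mV)).
      exact: (measurableT_comp mh (mpair _ _ mU' mV)).
    apply: measurable_indic.
    have mf : measurable_fun setT (fun w => eps - `|U w - U' w|).
      by apply: measurable_funB => //; apply: measurableT_comp => //; exact: measurable_funB.
    rewrite (_ : [set w | _] = [set w | 0 <= eps - `|U w - U' w|]); first exact: measurable_ge.
    by apply/seteqP; split => w /=; rewrite subr_ge0.
  - exact: (measurableT_comp mF (mpair _ _ mU' mV)).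
  - move=> w _; rewrite indicE; have [/set_mem/= wU|_] := boolP (w \in _); last by rewrite mulr0.
    rewrite mulr1; apply: le_trans (oscF _).
    apply: ereal_sup_ubound; exists (U w, V w), (U' w, V w); split => //=.
      by rewrite /eucl_dist/= subrr expr0n/= addr0 sqrtr_sqr.
    by rewrite /eucl_dist/= !subrr !expr0n/= addr0 sqrtr0 ltW.
have <- : (\int[(mu \x mu)%E]_z F (c z) = \int[Q]_w F (c (U' w, V w)))%E.
  by apply: (ge0_integral_map (phi := fun w => (U' w, V w))) => // [|B mB];
    [exact: mpair|exact: esym (lU'V _ mB)].
apply: (@le_trans _ _ (\int[(mu \x mu)%E]_z oscillation h (2 * eps) z)%E).
  exact: ge0_le_integral_minorant.
have eps20 : 0 < 2 * eps by rewrite mulr_gt0.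
apply: le_trans (HL0 _ eps20) _; rewrite lee_fin mulrA ler_wpM2r ?ltW//.
rewrite /L; have := ler_norm L0; lra.
Qed.

End lipschitz.

(** * Bounded kernels and finite partitions of the first variable *)

Section plane_approximation.
Context (R : realType) (pi1 pi2 : probability (R * R)%type R).

(** The substitute for regularity in the absolutely regular case: up to [e] in the mean, [g] depends
    on its first argument only through a finite partition, uniformly over all couplings with these
    two laws. *)
Definition approximable (g : R * R -> R) : Prop := forall e : R, 0 < e ->
  exists (N : nat) (J : R -> 'I_N), (forall j, measurable [set x | J x = j]) /\
    forall d (T : measurableType d) (Q : probability T R) (U V U' : T -> R),
      measurable_fun setT U -> measurable_fun setT V -> measurable_fun setT U' ->
      (forall A, measurable A -> Q [set w | A (U w, V w)] = pi1 A) ->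
      (forall A, measurable A -> Q [set w | A (U' w, V w)] = pi2 A) ->
      mean Q (fun w => (J (U w) == J (U' w))%:R * `|g (U w, V w) - g (U' w, V w)|) <= e.

Lemma bdd_eq_fibers d (T : measurableType d) N (J : R -> 'I_N) (U U' : T -> R) :
  (forall j, measurable [set x | J x = j]) ->
  measurable_fun setT U -> measurable_fun setT U' ->
  bdd (fun w => (J (U w) == J (U' w))%:R : R).
Proof.
move=> mJ mU mU'; have b2 := @bdd_fibers2 R _ _ _ _ mJ (fun i j => (i == j)%:R).
exact: (bdd_comp (measurable_fun_pair mU mU') b2).
Qed.

Lemma approximable_lim (g : R * R -> R) : bdd g ->
  (forall e : R, 0 < e -> exists g' : R * R -> R, [/\ bdd g', approximable g',
     mean pi1 (fun z => `|g z - g' z|) <= e & mean pi2 (fun z => `|g z - g' z|) <= e]) ->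
  approximable g.
Proof.
move=> bg lim e e0; have e30 : 0 < e / 3 by rewrite divr_gt0.
have [g' [bg' ag' h1 h2]] := lim _ e30.
have [N [J [mJ HJ]]] := ag' _ e30.
exists N, J; split => // d T Q U V U' mU mV mU' lUV lU'V.
have HQ := HJ _ _ Q U V U' mU mV mU' lUV lU'V.
have bJ := bdd_eq_fibers mJ mU mU'.
have mUV := measurable_fun_pair mU mV; have mU'V := measurable_fun_pair mU' mV.
have bdiff : bdd (fun z => `|g z - g' z|) by bdd_tac.
have e1 : mean Q (fun w => `|g (U w, V w) - g' (U w, V w)|) <= e / 3.
  rewrite -(mean_map (Q := pi1) mUV _ bdiff) // => B mB; exact: esym (lUV _ mB).
have e2 : mean Q (fun w => `|g (U' w, V w) - g' (U' w, V w)|) <= e / 3.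
  rewrite -(mean_map (Q := pi2) mU'V _ bdiff) // => B mB; exact: esym (lU'V _ mB).
have bgU := bdd_comp mUV bg; have bgU' := bdd_comp mU'V bg.
have bg'U := bdd_comp mUV bg'; have bg'U' := bdd_comp mU'V bg'.
rewrite (_ : e = e / 3 + e / 3 + e / 3); last by field.
apply: le_trans (lerD (lerD e1 e2) HQ).
rewrite -!meanD; [|by bdd_tac..].
apply: le_mean; [by bdd_tac|by bdd_tac|move=> w].
case: (_ == _); rewrite ?mul0r ?mul1r ?addr0 ?addr_ge0//.
set a := g (U w, V w); set b := g' (U w, V w); set c := g (U' w, V w); set dd := g' (U' w, V w).
rewrite (_ : a - c = (a - b) - (c - dd) + (b - dd)); last by ring.
by rewrite (le_trans (ler_normD _ _))// lerD2r ler_normB.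
Qed.

Lemma approximable0 : approximable (fun=> 0).
Proof.
move=> e e0; exists 1, (fun=> ord0); split => [j|].
  by rewrite (_ : [set x | _] = setT)//; apply/seteqP; split => // x _ /=; rewrite [j]ord1.
move=> d T Q U V U' *; rewrite (@eq_mean _ _ _ _ _ (fun=> 0)) ?mean_cst ?ltW// => w.
by rewrite subrr normr0 mulr0.
Qed.

Lemma approximableD (f g : R * R -> R) : bdd f -> bdd g ->
  approximable f -> approximable g -> approximable (fun z => f z + g z).
Proof.
move=> bf bg af ag e e0; have e20 : 0 < e / 2 by rewrite divr_gt0.
have [N [J [mJ HJ]]] := af _ e20; have [N' [J' [mJ' HJ']]] := ag _ e20.
pose JJ x := enum_rank (J x, J' x).
exists #|{: 'I_N * 'I_N'}|, JJ; split.
  move=> j; rewrite (_ : [set x | _] = [set x | J x = (enum_val j).1] `&` [set x | J' x = (enum_val j).2]).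
    exact: measurableI.
  apply/seteqP; split => x; rewrite /JJ/=; first by move=> <-; rewrite enum_rankK.
  by move=> [h1 h2]; apply/enum_val_inj; rewrite enum_rankK h1 h2 -surjective_pairing.
move=> d T Q U V U' mU mV mU' lUV lU'V.
have h1 := HJ _ _ Q U V U' mU mV mU' lUV lU'V.
have h2 := HJ' _ _ Q U V U' mU mV mU' lUV lU'V.
have bJ := bdd_eq_fibers mJ mU mU'; have bJ' := bdd_eq_fibers mJ' mU mU'.
have mUV := measurable_fun_pair mU mV; have mU'V := measurable_fun_pair mU' mV.
have bgU := bdd_comp mUV bg; have bgU' := bdd_comp mU'V bg.
have bfU := bdd_comp mUV bf; have bfU' := bdd_comp mU'V bf.
have JJE w : (JJ (U w) == JJ (U' w))%:R = (J (U w) == J (U' w))%:R * (J' (U w) == J' (U' w))%:R :> R.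
  by rewrite /JJ (inj_eq enum_rank_inj) xpair_eqE -natrM mulnb.
under eq_mean do rewrite JJE.
rewrite (_ : e = e / 2 + e / 2); last by field.
apply: le_trans (lerD h1 h2); rewrite -meanD; [|by bdd_tac..].
apply: le_mean; [by bdd_tac|by bdd_tac|move=> w].
set a := f _; set b := f _; set a' := g _; set b' := g _.
rewrite (_ : a + a' - (b + b') = (a - b) + (a' - b')); last by ring.
by case: (J (U w) == _); case: (J' (U w) == _); rewrite !(mul0r, mul1r, addr0, add0r)// ler_normD.
Qed.

Lemma approximableZ (r : R) (f : R * R -> R) : bdd f ->
  approximable f -> approximable (fun z => r * f z).
Proof.
move=> bf af e e0; pose t := `|r| + 1; have t0 : 0 < t by rewrite ltr_wpDl.
have [N [J [mJ HJ]]] := af _ (divr_gt0 e0 t0).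
exists N, J; split => // d T Q U V U' mU mV mU' lUV lU'V.
have h1 := HJ _ _ Q U V U' mU mV mU' lUV lU'V.
have bJ := bdd_eq_fibers mJ mU mU'.
have mUV := measurable_fun_pair mU mV; have mU'V := measurable_fun_pair mU' mV.
have bfU := bdd_comp mUV bf; have bfU' := bdd_comp mU'V bf.
rewrite ler_pdivlMr// mulrC in h1; apply: le_trans h1.
rewrite -meanZ; last by bdd_tac.
apply: le_mean; [by bdd_tac|by apply: bddZ; bdd_tac|move=> w].
rewrite -mulrBr normrM mulrCA ler_wpM2r ?mulr_ge0 ?lerDl//.
Qed.

Lemma approximable_sum (I : Type) (s : seq I) (F : I -> R * R -> R) :
  (forall i, bdd (F i)) -> (forall i, approximable (F i)) ->
  approximable (fun z => \sum_(i <- s) F i z).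
Proof.
move=> bF aF; elim: s => [|i s IH].
  by under eq_fun do rewrite big_nil; exact: approximable0.
under eq_fun do rewrite big_cons.
exact: (approximableD (bF i) (bdd_sum _ _ bF) (aF i) IH).
Qed.

(** For a rectangle the partition into its first side and the complement is exact. Complements,
    finite sums and L1 limits preserve the property, so Dynkin's lemma reaches all measurable
    sets. *)
Lemma approximable_indic (C : set (R * R)) : measurable C -> approximable \1_C.
Proof.
move=> mC; pose G := [set C : set (R * R) | exists2 A : set R, measurable A &
  exists2 B : set R, measurable B & A `*` B = C].
have ms : @measurable _ (R * R)%type = <<s G >> by exact: measurable_prod_measurableType.
rewrite ms in mC.
apply: (@dynkin_induction _ _ G [set C | approximable \1_C] ms _ _ _ _ _ C mC).
- move=> _ _ [A1 mA1 [A2 mA2 <-]] [B1 mB1 [B2 mB2 <-]].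
  exists (A1 `&` B1); first exact: measurableI.
  exists (A2 `&` B2); first exact: measurableI.
  by rewrite setXI.
- move=> e e0; have [N [J [mJ HJ]]] := approximable0 e0.
  exists N, J; split => // d T Q U V U' mU mV mU' lUV lU'V.
  apply: le_trans (HJ _ _ Q U V U' mU mV mU' lUV lU'V).
  by rewrite le_eqVlt; apply/orP; left; apply/eqP/eq_mean => w; rewrite !indic_setT !subrr.
- move=> _ [A mA [B mB <-]] e e0.
  pose J x : 'I_2 := if x \in A then ord0 else ord_max.
  exists 2%N, J; split.
    have JA : [set x | J x = ord0] = A.
      by apply/seteqP; split => x; rewrite /J/=; have [/set_mem//|/negP h] := boolP (x \in A) => // Ax; case: h; rewrite inE.
    move=> j; case: (eqVneq j ord0) => [->|j0]; first by rewrite JA.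
    rewrite (_ : [set x | _] = ~` [set x | J x = ord0]); first by rewrite JA; exact: measurableC.
    apply/seteqP; split => x /=; first by move=> -> /eqP; rewrite (negbTE j0).
    rewrite /J; case: ifP => // _ _; apply: val_inj => /=.
    by case: j j0 => -[|[|]].
  move=> d T Q U V U' mU mV mU' lUV lU'V.
  rewrite (@eq_mean _ _ _ _ _ (fun=> 0)) ?mean_cst ?ltW// => w.
  rewrite !indicE !in_setX/= /J.
  by case: (U w \in A); case: (U' w \in A); rewrite /= ?eqxx/= ?subrr ?normr0 ?mulr0 ?mul0r.
- move=> {mC}C mC aC e e0; have [N [J [mJ HJ]]] := aC _ e0.
  exists N, J; split => // d T Q U V U' mU mV mU' lUV lU'V.
  apply: le_trans (HJ _ _ Q U V U' mU mV mU' lUV lU'V).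
  rewrite le_eqVlt; apply/orP; left; apply/eqP/eq_mean => w; congr (_ * _).
  by rewrite !indic_setC opprB addrC addrA subrK distrC.
- move=> {mC C}F mF tF aF.
  pose S n := \bigcup_(i < n) F i; pose C := \bigcup_i F i.
  have mS n : measurable (S n) by apply: bigcup_measurable => i _; exact: mF.
  have mC : measurable C by apply: bigcup_measurable => i _; exact: mF.
  have SC n : S n `<=` C by apply: bigcup_sub => i _ x Fx; exists i.
  have SE n z : \1_(S n) z = \sum_(i <- iota 0 n) \1_(F i) z :> R.
    elim: n => [|n IH]; first by rewrite /S bigcup_mkord big_ord0 big_nil indic0.
    rewrite -addn1 iotaD big_cat/= big_cons big_nil addr0 add0n -IH.
    have SF : S n `&` F n = set0.
      apply/seteqP; split => x //= [[i /= lin Fi] Fn].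
      have /trivIsetP/(_ i n I I) := tF; rewrite ltn_eqF// => /(_ isT) h.
      by have : (F i `&` F n) x by []; rewrite h.
    have -> : S (n + 1)%N = S n `|` F n.
      apply/seteqP; split => x /=.
        move=> [i /= + Fi]; rewrite addn1 ltnS leq_eqVlt => /orP[/eqP <-|lin]; [by right|].
        by left; exists i.
      by case=> [[i /= lin Fi]|Fn]; [exists i => //=; lia|exists n => //=; lia].
    have : ~ (S n z /\ F n z) by move=> h; have : (S n `&` F n) z by []; rewrite SF.
    rewrite !indicE in_setU; case: (boolP (z \in S n)); case: (boolP (z \in F n)) => //=; rewrite ?addr0 ?add0r//.
    by move=> /set_mem ? /set_mem ? h; case: h.
  have conv (pi : probability (R * R)%type R) (e : R) : 0 < e ->
      \forall n \near \oo, mean pi (fun z => `|\1_C z - \1_(S n) z|) <= e.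
    move=> e0.
    have : (pr pi (S n)) @[n --> \oo] --> pr pi C.
      apply: fine_cvg; rewrite prE//.
      have := @nondecreasing_cvg_mu _ _ _ pi S mS; rewrite (_ : \bigcup_n S n = C).
        apply => //; apply/nondecreasing_seqP => n; apply/subsetPset => x [i /= lin Fi].
        by exists i => //=; exact: ltnW.
      apply/seteqP; split => x; first by move=> [n _ /SC].
      by move=> [i _ Fi]; exists i.+1 => //; exists i => /=.
    move=> /cvgrPdist_le /(_ _ e0); apply: filterS => n.
    have bC : bdd (\1_C : R * R -> R) by exact: bdd_indic.
    have bS : bdd (\1_(S n) : R * R -> R) by exact: bdd_indic.
    apply: le_trans; rewrite -!mean_indic// -meanB//.
    rewrite (_ : mean pi (fun z => `|_|) = mean pi (fun z => \1_C z - \1_(S n) z)) ?ler_norm//.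
    apply: eq_mean => z.
    rewrite ger0_norm// subr_ge0 !indicE; case: (boolP (z \in S n)) => [/set_mem/SC/mem_set ->|_] //.
  apply: approximable_lim; first exact: bdd_indic.
  move=> e e0; have := filterI (conv pi1 _ e0) (conv pi2 _ e0).
  move=> -[n _ /(_ n (leqnn n))[h1 h2]]; exists (\1_(S n)); split => //.
    exact: bdd_indic.
  rewrite (_ : \1_(S n) = (fun z => \sum_(i <- iota 0 n) \1_(F i) z)); last exact/funext.
  by apply: approximable_sum => // i; exact: bdd_indic.
Qed.

Lemma bdd_approximable (g : R * R -> R) : bdd g -> approximable g.
Proof.
move=> bg; have [M M0 gM] := bdd_bound bg.
apply: approximable_lim => // e e0.
(* Enough layers for the staircase approximation to be within [e] of [g]. *)
pose n := Num.truncn (2 * M / e); have n0 : 0 < n.+1%:R :> R by [].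
pose c z := (g z + M) / (2 * M) * n.+1%:R.
have mg := bdd_meas bg.
have mc : measurable_fun setT c.
  by apply: measurable_funM => //; apply: measurable_funM => //; exact: measurable_funD.
have c0n z : 0 <= c z <= n.+1%:R.
  have := gM z; rewrite ler_norml => /andP[? ?].
  rewrite /c mulr_ge0 ?divr_ge0//=; [|lra|lra].
  by rewrite ler_piMl// ler_pdivrMr; lra.
have n0' : n.+1%:R != 0 :> R by rewrite gt_eqF.
pose g' z := - M + (2 * M / n.+1%:R) * \sum_(i < n.+1) \1_[set z | i.+1%:R <= c z] z.
have mD (i : nat) : measurable [set z | i.+1%:R <= c z] by exact: measurable_ge.
have bD (i : nat) : bdd (\1_[set z | i.+1%:R <= c z] : R * R -> R) by exact: bdd_indic.
have bS : bdd (fun z => \sum_(i < n.+1) (\1_[set z | i.+1%:R <= c z] z : R)) by bdd_tac.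
have bg' : bdd g' by apply: bddD; [exact: bdd_cst|exact: bddZ].
have close z : `|g z - g' z| <= e.
  have := sum_thresholds (c0n z).
  have -> : \sum_(i < n.+1) (((i.+1%:R <= c z)%R)%:R : R) =
      \sum_(i < n.+1) \1_[set z | i.+1%:R <= c z] z.
    by apply: eq_bigr => i _; rewrite indicE mem_setE.
  rewrite /g'; set s := \sum_(i < _) _ => /andP[s1 s2].
  have -> : g z = - M + (2 * M / n.+1%:R) * c z.
    have aux (t m y : R) : t != 0 -> m != 0 -> y = - M + m / t * ((y + M) / m * t).
      by move=> t0 m0; field; rewrite t0 m0.
    by apply: aux => //; rewrite gt_eqF// mulr_gt0.
  rewrite opprD addrACA subrr add0r -mulrBr normrM.
  have M2 : 0 <= 2 * M / n.+1%:R by rewrite divr_ge0// mulr_ge0// ltW.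
  rewrite (ger0_norm M2) ger0_norm ?subr_ge0//.
  apply: (@le_trans _ _ (2 * M / n.+1%:R)); first by rewrite ler_piMr//; lra.
  rewrite ler_pdivrMr// [e * _]mulrC -ler_pdivrMr//.
  by rewrite ltW// /n truncnS_gt// divr_ge0// ?mulr_ge0// ltW.
exists g'; split => //; last 2 first.
- by apply: mean_le_cst => //; bdd_tac.
- by apply: mean_le_cst => //; bdd_tac.
apply: approximableD; [exact: bdd_cst|exact: bddZ| |].
  rewrite (_ : (fun=> - M) = (fun z => - M * \1_(setT : set (R * R)) z)).
    apply: approximableZ; first exact: bdd_indic.
    exact: approximable_indic.
  by apply/funext => z; rewrite indic_setT mulr1.
apply: approximableZ => //; apply: approximable_sum => i //.
exact: approximable_indic.
Qed.

End plane_approximation.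

(** * Truncated products and decoupling of a product of two kernels *)

Section layer.
Context (R : realType) d (T : measurableType d) (P : probability T R).
Variable delta : R.
Hypothesis d0 : 0 < delta.

Lemma mean_trunc_prod (f g : T -> R) (K M : R) : 0 < K ->
  measurable_fun setT f -> measurable_fun setT g ->
  (\int[P]_x (`|f x| `^ (2 + delta))%:E <= M%:E)%E ->
  (\int[P]_x (`|g x| `^ (2 + delta))%:E <= M%:E)%E ->
  P.-integrable setT (EFin \o (fun x => f x * g x)) /\
  `|mean P (fun x => f x * g x) - mean P (fun x => trunc K (f x) * trunc K (g x))|
  <= K `^ (- delta) * (2 * M).
Proof.
move=> K0 mf mg fM gM.
pose t x : R := trunc K (f x) * trunc K (g x).
pose D x : R := f x * g x - t x.
have bt : bdd t by apply: bddM; apply: bdd_trunc => //; exact: ltW.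
have mD : measurable_fun setT D.
  by apply: measurable_funB; [exact: measurable_funM|case: bt].
have Kp0 : 0 <= K `^ (- delta) by exact: powR_ge0.
have mp (u : T -> R) : measurable_fun setT u -> measurable_fun setT (fun x => (`|u x| `^ (2 + delta))%:E).
  by move=> mu; apply/measurable_EFinP; exact: measurable_powR_norm.
have p0 (u : T -> R) x : (0 <= (`|u x| `^ (2 + delta))%:E)%E by rewrite lee_fin powR_ge0.
have DM : (\int[P]_x `|(D x)%:E| <= (K `^ (- delta) * (2 * M))%:E)%E.
  apply: (@le_trans _ _ (\int[P]_x ((K `^ (- delta))%:E *
      ((`|f x| `^ (2 + delta))%:E + (`|g x| `^ (2 + delta))%:E)))%E).
    apply: ge0_le_integral => //.
    - by apply/measurable_EFinP; exact: measurableT_comp.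
    - apply: emeasurable_funM => //; apply: emeasurable_funD; exact: mp.
    - by move=> x _; rewrite -EFinD -EFinM/= lee_fin; exact: trunc_prod.
  rewrite ge0_integralZl//; last 2 first.
  - by apply: emeasurable_funD; exact: mp.
  - by move=> x _; rewrite adde_ge0.
  rewrite ge0_integralD//; [|exact: mp|exact: mp].
  rewrite EFinM lee_pmul//; first by rewrite adde_ge0// integral_ge0.
  by rewrite (_ : 2 * M = M + M) ?EFinD ?leeD//; ring.
have iD : P.-integrable setT (EFin \o D).
  apply/integrableP; split; first exact/measurable_EFinP.
  exact: le_lt_trans DM (ltry _).
have it := bdd_integrable P bt.
have ifg : P.-integrable setT (EFin \o (fun x => f x * g x)).
  rewrite (_ : EFin \o _ = ((EFin \o D) \+ (EFin \o t))%E).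
    exact: integrableD.
  by apply/funext => x /=; rewrite -EFinD /D subrK.
split => //; rewrite -RintegralB//.
rewrite -lee_fin; apply: le_trans DM.
rewrite -[X in (`|X|%:E <= _)%E]/(Rintegral P setT D) EFin_normr_Rintegral//.
exact: le_abse_integral (measurable_int _ iD).
Qed.

(** Writing [g] as [2 * K * c - K] with [c] in [0, 1], the first term contributes [2 * K * b]
    through layers and the second one [K * b], the whole space being a level set. *)
Lemma layer_prod (g xi : T -> R) (K b : R) : 0 < K ->
  measurable_fun setT g -> (forall x, `|g x| <= K) -> bdd xi ->
  (forall t : R, `|mean P (fun x => \1_[set x | t <= g x] x * xi x)| <= b) ->
  `|mean P (fun x => g x * xi x)| <= 3 * K * b.
Proof.
move=> K0 mg gK bxi hb.
pose c x : R := (g x + K) / (2 * K).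
have K20 : 0 < 2 * K by rewrite mulr_gt0.
have mc : measurable_fun setT c by apply: measurable_funM => //; exact: measurable_funD.
have c01 x : 0 <= c x <= 1.
  have := gK x; rewrite ler_norml => /andP[? ?].
  by rewrite /c divr_ge0 ?(ltW K20)//= ?ler_pdivrMr// ?mul1r; lra.
have bc : bdd c := bdd01 mc c01.
have h1 : `|mean P (fun x => c x * xi x)| <= b.
  apply: layer_transfer => // t; apply: le_trans (hb (t * (2 * K) - K)).
  rewrite le_eqVlt; apply/orP; left; apply/eqP; congr (`|_|).
  apply: eq_mean => x; congr (\1_ _ _ * _); apply/seteqP; split => y /=.
    by rewrite /c ler_pdivlMr// lerBlDr.
  by rewrite /c ler_pdivlMr// lerBlDr.
have h2 : `|mean P xi| <= b.
  apply: le_trans (hb (- K)); rewrite le_eqVlt; apply/orP; left; apply/eqP; congr (`|_|).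
  apply: eq_mean => x; rewrite indicE mem_set ?mul1r//=.
  by have := gK x; rewrite ler_norml => /andP[].
have -> : mean P (fun x => g x * xi x) =
    2 * K * mean P (fun x => c x * xi x) - K * mean P xi.
  rewrite -!meanZ -?meanB//; [|by apply: bddZ; exact: bddM|exact: bddZ|exact: bddM].
  by apply: eq_mean => x; rewrite /c; field; rewrite gt_eqF.
rewrite (le_trans (ler_normB _ _))// !normrM (gtr0_norm K0) ger0_norm//.
have Kh1 := ler_wpM2l (ltW K20) h1; have Kh2 := ler_wpM2l (ltW K0) h2.
by rewrite (_ : 3 * K * b = 2 * K * b + K * b) ?lerD// 1?mulrDr; ring.
Qed.

End layer.

Section sigma_algebras.
Context (T : Type) (F : set (set T)).
Hypothesis sF : sigma_algebra setT F.

Lemma salgC A : F A -> F (~` A).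
Proof. by move=> pA; have [_ + _] := sF => /(_ _ pA); rewrite setTD. Qed.

Lemma salgT : F setT.
Proof. by have [p0 _ _] := sF; rewrite -setC0; exact: salgC. Qed.

Lemma salgI A B : F A -> F B -> F (A `&` B).
Proof.
move=> pA pB; rewrite -[A]setCK -[B]setCK -setCU; apply: salgC.
rewrite -bigcup2E; have [p0 _ pU] := sF; apply: pU => -[|[|i]] //=; exact: salgC.
Qed.

End sigma_algebras.

Section sigma_algebra_unions.
Context (T : Type) (F : set (set T)).
Hypothesis sF : sigma_algebra setT F.

Lemma salg0 : F set0.
Proof. by have [] := sF. Qed.

Lemma salg_countU (I : countType) (A : I -> set T) : (forall i, F (A i)) -> F (\bigcup_i A i).
Proof.
move=> FA; have [_ _ sU] := sF.
pose G n := if unpickle n is Some i then A i else set0.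
rewrite (_ : \bigcup_i A i = \bigcup_n G n).
  by apply: sU => n; rewrite /G; case: unpickle => [i|]; [exact: FA|exact: salg0].
apply/seteqP; split => x.
  by move=> [i _ Ai]; exists (pickle i) => //; rewrite /G pickleK.
by move=> [n _]; rewrite /G; case: unpickle => // i Ai; exists i.
Qed.

Lemma salg_countI (I : countType) (A : I -> set T) : (forall i, F (A i)) -> F (\bigcap_i A i).
Proof.
move=> FA; rewrite -[X in F X]setCK setC_bigcap; apply: (salgC sF).
by apply: salg_countU => i; exact: (salgC sF).
Qed.

Lemma salg_fibers (I : countType) (c : T -> I) (D : set I) :
  (forall i, F [set x | c x = i]) -> F (c @^-1` D).
Proof.
move=> Fc; rewrite (_ : _ @^-1` _ = \bigcup_i (if i \in D then [set x | c x = i] else set0)).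
  by apply: salg_countU => i; case: ifP => // _; exact: salg0.
apply/seteqP; split => x /=; first by move=> Dx; exists (c x) => //; rewrite mem_set.
by move=> [i _]; case: ifPn => // /set_mem Di /= cx; rewrite cx.
Qed.

Lemma salg_code (I : finType) (A : I -> set T) (J : Type) (g : {ffun I -> bool} -> J) (j : J) :
  (forall i, F (A i)) -> F [set x | g [ffun i => x \in A i] = j].
Proof.
move=> FA; apply: (@salg_fibers _ (fun x => [ffun i => x \in A i]) [set b | g b = j]) => b.
rewrite (_ : [set x | _] = \bigcap_i (if b i then A i else ~` A i)).
  by apply: salg_countI => i; case: ifP => // _; exact: (salgC sF).
apply/seteqP; split => x /=.
  by move=> <- i _; rewrite ffunE; case: ifPn; [exact: set_mem|rewrite notin_setE].
move=> h; apply/ffunP => i; rewrite ffunE; have := h i Logic.I.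
by case: (b i) => Ai; [rewrite mem_set|rewrite memNset].
Qed.

End sigma_algebra_unions.

Section decoupling.
Context (R : realType) (mu : probability R R) (h : R * R -> R).
Hypothesis mh : measurable_fun setT h.
Hypothesis hsym : forall x y, h (x, y) = h (y, x).
Hypothesis hdeg : forall x : R, (\int[mu]_y (h (x, y))%:E = 0)%E.
Variables (delta M : R).
Hypothesis d0 : 0 < delta.
Hypothesis hmom : (\int[(mu \x mu)%E]_z (`|h z| `^ (2 + delta))%:E <= M%:E)%E.

Context d (T : measurableType d) d' (S : measurableType d') (P : probability T R).
Variables (past : set (set T)) (phi : T -> S) (r : nat -> R).
Hypothesis spast : sigma_algebra setT past.
Hypothesis mpast : past `<=` measurable.
Hypothesis mphi : measurable_fun setT phi.
Hypothesis dep : forall N (J : T -> 'I_N) (A : 'I_N -> set S),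
  (forall j, past [set x | J x = j]) -> (forall j, measurable (A j)) ->
  \sum_j (pr P ([set x | J x = j] `&` phi @^-1` (A j)) -
          pr P [set x | J x = j] * pr P (phi @^-1` (A j))) <= r N.

Variables (N : nat) (J : T -> 'I_N) (U : T -> R) (v : S -> R).
Hypothesis pJ : forall j, past [set x | J x = j].
Let V x := v (phi x).
Hypothesis lU : has_law mu P U.
Hypothesis mv : measurable_fun setT v.
Hypothesis lV : has_law mu P V.
Variables (K eta : R).
Hypothesis K0 : 0 < K.
Let xi x y := trunc K (h (x, y)).
Hypothesis Heta : forall Q, half_product P phi Q ->
  mean Q (fun z => (J z.1 == J z.2)%:R * `|xi (U z.1) (V z.1) - xi (U z.2) (V z.1)|) <= eta.

(** A past event enters by pairing [J] with its indicator, which doubles the number of values. A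
    future event enters as a function of [phi], and [J] is then paired with the indicator of the
    whole space. *)
Lemma decoupled_event (D : set T) :
  past D \/ (exists2 E, measurable E & D = phi @^-1` E) ->
  `|mean P (fun x => \1_D x * xi (U x) (V x))| <=
  K * r (N * 2)%N *+ 2 + eta + K `^ (- (1 + delta)) * M.
Proof.
move=> HD; pose A : set T := if pselect (past D) then D else setT.
have pA : past A by rewrite /A; case: (pselect (past D)) => pD /=; [exact: pD|exact: (salgT spast)].
pose enc (x : 'I_N * bool) : 'I_(N * 2) :=
  cast_ord (etrans (card_prod _ _) (congr2 muln (card_ord N) card_bool)) (enum_rank x).
pose dec (i : 'I_(N * 2)) : 'I_N * bool :=
  enum_val (cast_ord (esym (etrans (card_prod _ _) (congr2 muln (card_ord N) card_bool))) i).
have encK : cancel enc dec by move=> x; rewrite /enc/dec cast_ordK enum_rankK.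
have decK : cancel dec enc by move=> x; rewrite /enc/dec enum_valK cast_ordKV.
pose JA x := enc (J x, x \in A).
have pJA j : past [set x | JA x = j].
  rewrite (_ : [set x | _] = [set x | J x = (dec j).1] `&` (if (dec j).2 then A else ~` A)).
    by apply: (salgI spast) => //; case: ifP => // _; exact: (salgC spast).
  apply/seteqP; split => x /=.
    by move=> <-; rewrite /JA encK/=; split => //; case: ifPn; [exact: set_mem|rewrite notin_setE].
  move=> [Jx xA]; rewrite /JA -[RHS]decK; congr enc.
  rewrite [RHS]surjective_pairing Jx; congr pair.
  by move: xA; case: (dec j).2 => xA; [rewrite mem_set|rewrite memNset].
have mJA j : measurable [set x | JA x = j] := mpast (pJA j).
have depJA B : (forall j, measurable (B j)) -> _ := dep pJA.
have [Q [Q1 Q2 Q3 _]] := coupling_measure mphi mJA depJA.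
have bne : bdd (fun z : T * T => (J z.1 == J z.2)%:R : R).
  exact: (@bdd_fibers2 R _ _ _ _ (fun j => mpast (pJ j)) (fun i j => (i == j)%:R)).
have bneA : bdd (fun z : T * T => (JA z.1 == JA z.2)%:R : R).
  exact: (@bdd_fibers2 R _ _ _ _ mJA (fun i j => (i == j)%:R)).
have [mU _] := lU; have [mV _] := lV.
have bxi1 : bdd (fun z : T * T => xi (U z.1) (V z.1)).
  apply: bdd_trunc; first exact: ltW.
  apply: (measurableT_comp mh); apply: measurable_fun_pair.
    exact: (measurableT_comp mU measurable_fst).
  exact: (measurableT_comp mV measurable_fst).
have bxi2 : bdd (fun z : T * T => xi (U z.2) (V z.1)).
  apply: bdd_trunc; first exact: ltW.
  apply: (measurableT_comp mh); apply: measurable_fun_pair.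
    exact: (measurableT_comp mU measurable_snd).
  exact: (measurableT_comp mV measurable_fst).
have HA : mean Q (fun z => (JA z.1 == JA z.2)%:R * `|xi (U z.1) (V z.1) - xi (U z.2) (V z.1)|) <= eta.
  apply: le_trans (Heta (conj Q1 Q2)); apply: le_mean; [by bdd_tac|by bdd_tac|move=> z].
  rewrite ler_wpM2r// ler_nat /JA (can_eq encK) xpair_eqE.
  by case: (J z.1 == _) => //=; case: (_ == _).
case: (pselect (past D)) => pD.
  have AD : A = D by rewrite /A; case: pselect.
  have := event_bound mh hsym hdeg d0 hmom mphi mJA lU mv lV K0 (conj Q1 Q2) Q3
    (Dp := fun j => (dec j).2%:R) (Df := fun=> 1) _ _ _ (or_intror _) HA.
  under eq_mean do rewrite /JA encK /= mulr1 -indicE.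
  rewrite AD.
  by apply => //= [j||_]; [case: (_.2); rewrite /= ?lexx ?ler01|exact: bdd_cst|rewrite ler01 lexx].
case: HD => [//|[E mE DE]].
have := event_bound mh hsym hdeg d0 hmom mphi mJA lU mv lV K0 (conj Q1 Q2) Q3
    (Dp := fun=> 1) (Df := \1_E) _ (bdd_indic _ mE) _ (or_introl _) HA.
under eq_mean do rewrite mul1r.
under eq_mean do rewrite -indic_preimage -DE.
by apply => //= [_|s]; [rewrite ler01 lexx|rewrite indic_ge0 indic_le1].
Qed.

(** Both factors are truncated; then the first is replaced by the truncated kernel at [(U, V)] and
    the second by [g']. As [g'] is known from the past or from [phi], its level sets are events to
    which [decoupled_event] applies. *)
Lemma decoupled_product (f g g' : T -> R) (M1 e1 e2 : R) :
  measurable_fun setT f -> measurable_fun setT g -> measurable_fun setT g' ->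
  (\int[P]_x (`|f x| `^ (2 + delta))%:E <= M1%:E)%E ->
  (\int[P]_x (`|g x| `^ (2 + delta))%:E <= M1%:E)%E ->
  (forall x, `|g' x| <= K) ->
  (forall t : R, past [set x | t <= g' x]) \/
    (exists2 w : S -> R, measurable_fun setT w & g' =1 w \o phi) ->
  mean P (fun x => `|trunc K (f x) - xi (U x) (V x)|) <= e1 ->
  mean P (fun x => `|trunc K (g x) - g' x|) <= e2 ->
  `|mean P (fun x => f x * g x)| <= K `^ (- delta) * (2 * M1) + K * (e1 + e2) +
    3 * K * (K * r (N * 2)%N *+ 2 + eta + K `^ (- (1 + delta)) * M).
Proof.
move=> mf mg mg' fM gM g'K Hg' H1 H2.
have [_ H3] := mean_trunc_prod d0 K0 mf mg fM gM.
have [mU _] := lU; have [mV _] := lV.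
have bxi : bdd (fun x => xi (U x) (V x)).
  by apply: bdd_trunc; [exact: ltW|exact: (measurableT_comp mh (measurable_fun_pair mU mV))].
have btf : bdd (fun x => trunc K (f x)) by apply: bdd_trunc => //; exact: ltW.
have btg : bdd (fun x => trunc K (g x)) by apply: bdd_trunc => //; exact: ltW.
have bg' : bdd g' by exact: (@bdd_le _ _ _ _ K).
have H4 : `|mean P (fun x => g' x * xi (U x) (V x))| <=
    3 * K * (K * r (N * 2)%N *+ 2 + eta + K `^ (- (1 + delta)) * M).
  apply: layer_prod => // t; apply: decoupled_event.
  case: Hg' => [pg'|[w mw g'w]]; [by left|right].
  exists [set s | t <= w s]; first exact: measurable_ge.
  by apply/seteqP; split => x /=; rewrite g'w.
have H5 : `|mean P (fun x => trunc K (f x) * trunc K (g x)) -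
    mean P (fun x => g' x * xi (U x) (V x))| <= K * (e1 + e2).
  rewrite -meanB; [|by bdd_tac..].
  apply: le_trans (mean_abs _ _) _; first by bdd_tac.
  apply: (@le_trans _ _ (mean P (fun x => K * (`|trunc K (f x) - xi (U x) (V x)| +
     `|trunc K (g x) - g' x|)))).
    apply: le_mean; [by bdd_tac|by apply: bddZ; bdd_tac|move=> x].
    rewrite (_ : _ - _ = trunc K (g x) * (trunc K (f x) - xi (U x) (V x)) +
      (trunc K (g x) - g' x) * xi (U x) (V x)); last by ring.
    rewrite (le_trans (ler_normD _ _))// [leRHS]mulrDr !normrM; apply: lerD.
      by rewrite ler_wpM2r// trunc_le// ltW.
    by rewrite mulrC ler_wpM2r// trunc_le// ltW.
  rewrite meanZ; last by bdd_tac.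
  rewrite meanD; [|by bdd_tac..].
  by apply: ler_wpM2l; [exact: ltW|exact: lerD].
move: H3 H4 H5; set a := mean _ _; set b := mean _ _; set c := mean _ _.
move=> H3 H4 H5; rewrite (_ : a = (a - b) + (b - c) + c); last by ring.
by rewrite (le_trans (ler_normD _ _))// lerD// (le_trans (ler_normD _ _))// lerD.
Qed.

End decoupling.

Section adapted.
Context (T : Type) (F : set (set T)).
Hypothesis sF : sigma_algebra setT F.

Definition adapted d (S : measurableType d) (f : T -> S) : Prop :=
  forall B, measurable B -> F (f @^-1` B).

Lemma adapted_comp d (S : measurableType d) d' (S' : measurableType d')
    (f : T -> S) (g : S -> S') : adapted f -> measurable_fun setT g -> adapted (g \o f).
Proof.
move=> af mg B mB; rewrite comp_preimage; apply: af.
by rewrite -[X in measurable X]setTI; exact: mg.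
Qed.

Lemma adapted_pair d (S : measurableType d) d' (S' : measurableType d')
    (f : T -> S) (g : T -> S') : adapted f -> adapted g -> adapted (fun x => (f x, g x)).
Proof.
move=> af ag B; rewrite measurable_prod_measurableType.
have sub : <<s [set A `*` B | A in @measurable d S & B in @measurable d' S'] >> `<=`
    [set B | F ((fun x => (f x, g x)) @^-1` B)].
  apply: smallest_sub => [|_ [A1 mA1 [A2 mA2 <-]]].
    split => /=.
    - by rewrite preimage_set0; have [] := sF.
    - by move=> A hA; rewrite setTD -preimage_setC; exact: (salgC sF).
    - by move=> A hA; rewrite preimage_bigcup; have [_ _] := sF; apply.
  rewrite /= (_ : _ @^-1` _ = f @^-1` A1 `&` g @^-1` A2)//.
  by apply: (salgI sF); [exact: af|exact: ag].
exact: sub.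
Qed.

Lemma adapted_fibers d (S : measurableType d) (f : T -> S) N (J : S -> 'I_N) :
  adapted f -> (forall j, measurable [set x | J x = j]) ->
  forall j, F [set x | J (f x) = j].
Proof. by move=> af mJ j; exact: (af _ (mJ j)). Qed.

End adapted.

(** * Covariances of kernels through the first and the last gap *)

Section past_future.
Context (R : realType) (mu : probability R R) (h : R * R -> R).
Hypothesis mh : measurable_fun setT h.
Hypothesis hsym : forall x y, h (x, y) = h (y, x).
Hypothesis hdeg : forall x : R, (\int[mu]_y (h (x, y))%:E = 0)%E.
Variables (delta M : R).
Hypothesis d0 : 0 < delta.
Hypothesis hmom : (\int[(mu \x mu)%E]_z (`|h z| `^ (2 + delta))%:E <= M%:E)%E.

Context d (T : measurableType d) (P : probability T R).
Variables (past fut : nat -> set (set T)) (r : nat -> nat -> R).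
Hypothesis spast : forall n, sigma_algebra setT (past n).
Hypothesis mpast : forall n, past n `<=` measurable.
Hypothesis sfut : forall n, sigma_algebra setT (fut n).
Hypothesis dep : forall n k N (J : T -> 'I_N) (A : 'I_N -> set T),
  (1 <= n)%N -> (1 <= k)%N -> (forall j, past n [set x | J x = j]) ->
  (forall j, fut (n + k)%N (A j)) ->
  \sum_j (pr P ([set x | J x = j] `&` A j) - pr P [set x | J x = j] * pr P (A j)) <= r k N.

Variable X : nat -> T -> R.
Hypothesis lX : forall n, (1 <= n)%N -> has_law mu P (X n).
Hypothesis pX : forall i n, (1 <= i <= n)%N -> adapted (past n) (X i).
Hypothesis fX : forall i n, (n <= i)%N -> adapted (fut n) (X i).
Hypothesis momX : forall i j, (1 <= i < j)%N ->
  (\int[P]_x (`|h (X i x, X j x)| `^ (2 + delta))%:E <= M%:E)%E.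

Definition coupling_defect (K : R) N (pJ : R -> 'I_N) (i j : nat) (eta : R) :=
  forall d' (S : measurableType d') (phi : T -> S) (v : S -> R),
    measurable_fun setT phi -> measurable_fun setT v -> X j =1 v \o phi ->
    forall Q, half_product P phi Q ->
    mean Q (fun z => (pJ (X i z.1) == pJ (X i z.2))%:R *
      `|trunc K (h (X i z.1, X j z.1)) - trunc K (h (X i z.2, X j z.1))|) <= eta.

Variables (K : nat -> R) (c : R).
Hypothesis K0 : forall k, 0 < K k.
Hypothesis HK : forall k i j, (1 <= k)%N -> (1 <= i < j)%N -> exists N (pJ : R -> 'I_N) eta,
  [/\ forall j, measurable [set x | pJ x = j],
      coupling_defect (K k) pJ i j eta &
      K k * r k (N * 2)%N *+ 2 + eta <= c * K k `^ (- (1 + delta))].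

Let xi i j x : R := h (X i x, X j x).

(** Here the kernels are functions of the process itself, so that the two replacement errors of
    [decoupled_product] are 0 and only truncation and decoupling remain. *)
Lemma past_future_pair (i j i' j' n k : nat) d' (S : measurableType d') (phi : T -> S)
    (v : S -> R) :
  (1 <= i < j)%N -> (1 <= i' < j')%N -> (i <= n)%N -> (1 <= k)%N ->
  measurable_fun setT v -> X j =1 v \o phi -> measurable_fun setT phi ->
  adapted (fut (n + k)%N) phi ->
  (j' <= n)%N \/ (exists2 w : S -> R * R, measurable_fun setT w &
      (fun x => (X i' x, X j' x)) =1 w \o phi) ->
  `|mean P (fun x => xi i j x * xi i' j' x)| <= (2 * M + 3 * (c + M)) * K k `^ (- delta).
Proof.
move=> ij ij' iN k1 mv Xj mphi aphi Hg.
have i1 : (1 <= i)%N by case/andP: ij.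
have j1 : (1 <= j)%N by case/andP: ij => _ /(leq_ltn_trans _) ->.
have i'1 : (1 <= i')%N by case/andP: ij'.
have j'1 : (1 <= j')%N by case/andP: ij' => _ /(leq_ltn_trans _) ->.
have n1 : (1 <= n)%N by exact: leq_trans iN.
have [N [pJ [eta [mpJ Heta Hr]]]] := HK k1 ij.
have mxi a b : (1 <= a)%N -> (1 <= b)%N -> measurable_fun setT (xi a b).
  by move=> a1 b1; apply: (measurableT_comp mh); apply: measurable_fun_pair;
    [case: (lX a1)|case: (lX b1)].
have Xj' : X j = v \o phi by exact/funext.
have lV : has_law mu P (fun x => v (phi x)) by rewrite -[fun _ => _]/(v \o phi) -Xj'; exact: lX.
have pJX : forall j, past n [set x | pJ (X i x) = j].
  by apply: (adapted_fibers _ mpJ); apply: pX; rewrite i1.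
have depn N' (J : T -> 'I_N') (A : 'I_N' -> set S) : (forall j, past n [set x | J x = j]) ->
  (forall j, measurable (A j)) ->
  \sum_j (pr P ([set x | J x = j] `&` phi @^-1` (A j)) -
          pr P [set x | J x = j] * pr P (phi @^-1` (A j))) <= r k N'.
  by move=> pJ' mA; apply: (dep n1) => // l; exact: aphi.
have Hd Q : half_product P phi Q ->
  mean Q (fun z => (pJ (X i z.1) == pJ (X i z.2))%:R *
    `|trunc (K k) (h (X i z.1, v (phi z.1))) - trunc (K k) (h (X i z.2, v (phi z.1)))|) <= eta.
  move=> hQ; apply: le_trans (Heta _ _ phi v mphi mv Xj Q hQ).
  by rewrite Xj'.
have mg : measurable_fun setT (xi i' j') by exact: mxi.
have Hpast : (forall t : R, past n [set x | t <= trunc (K k) (xi i' j' x)]) \/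
    (exists2 w : S -> R, measurable_fun setT w &
      (fun x => trunc (K k) (xi i' j' x)) =1 w \o phi).
  case: Hg => [j'n|[w mw gw]]; [left => t|right].
    have aT : adapted (past n) (fun x => trunc (K k) (xi i' j' x)).
      apply: (adapted_comp (f := fun x => (X i' x, X j' x))
        (g := fun z => trunc (K k) (h z))).
        by apply: adapted_pair => //; apply: pX; lia.
      exact: (measurableT_comp (measurable_trunc _) mh).
    exact: (aT [set y | t <= y] (measurable_ge t (@measurable_id _ _ _))).
  exists (fun s => trunc (K k) (h (w s))).
    exact: (measurableT_comp (measurable_trunc _) (measurableT_comp mh mw)).
  by move=> x; rewrite /xi /= [(X i' x, X j' x)]gw.
have := @decoupled_product _ _ _ mh hsym hdeg _ _ d0 hmom _ _ _ _ P _ phi _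
  (spast n) (@mpast n) mphi depn N _ (X i) v pJX (lX i1) mv lV _ eta (K0 k) Hd
  (xi i j) (xi i' j') (fun x => trunc (K k) (xi i' j' x)) M 0 0
  (mxi _ _ i1 j1) mg _ (momX ij) (momX ij') _ Hpast _ _.
move=> /(_ (measurableT_comp (measurable_trunc _) mg) (fun x => trunc_le _ (ltW (K0 k)))).
have z1 : mean P (fun x => `|trunc (K k) (xi i j x) - trunc (K k) (h (X i x, v (phi x)))|) <= 0.
  rewrite (@eq_mean _ _ _ _ _ (fun=> 0)) ?mean_cst// => x.
  by rewrite /xi Xj' subrr normr0.
have z2 : mean P (fun x => `|trunc (K k) (xi i' j' x) - trunc (K k) (xi i' j' x)|) <= 0.
  by rewrite (@eq_mean _ _ _ _ _ (fun=> 0)) ?mean_cst// => x; rewrite subrr normr0.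
move=> /(_ z1 z2) /le_trans; apply.
rewrite addr0 mulr0 addr0.
(* The bound [K k] on the second truncated kernel turns the exponent [1 + delta] into [delta]. *)
have Kd : K k * K k `^ (- (1 + delta)) = K k `^ (- delta).
  rewrite -{1}[K k](powRr1 (ltW (K0 k))) -powRD; last by rewrite (gt_eqF (K0 k)) implybT.
  by congr (_ `^ _); ring.
apply: (@le_trans _ _ (K k `^ (- delta) * (2 * M) +
  3 * K k * (c * K k `^ (- (1 + delta)) + K k `^ (- (1 + delta)) * M))).
  by rewrite lerD2l ler_wpM2l ?mulr_ge0 ?lerD2r// ltW.
rewrite (_ : 3 * K k * _ = 3 * (c + M) * (K k * K k `^ (- (1 + delta)))); last by ring.
by rewrite Kd le_eqVlt; apply/orP; left; apply/eqP; ring.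
Qed.

(** Here [i] is the smallest index: the past is cut right after it, and the three other variables
    together form the future. *)
Lemma past_future_left (i j i' j' : nat) : (1 <= i < j)%N -> (1 <= i' < j')%N ->
  (i < i')%N ->
  `|mean P (fun x => xi i j x * xi i' j' x)| <=
  (2 * M + 3 * (c + M)) * K (minn j i' - i)%N `^ (- delta).
Proof.
move=> ij ij' ii'; set k := (minn j i' - i)%N.
apply: (@past_future_pair i j i' j' i k _ _ (fun x => (X j x, (X i' x, X j' x))) fst) => //.
- by rewrite /k; lia.
- have mX l : (1 <= l)%N -> measurable_fun setT (X l) by move=> l1; case: (lX l1).
  by apply: measurable_fun_pair; [|apply: measurable_fun_pair]; apply: mX; lia.
- by apply: adapted_pair => //; [|apply: adapted_pair => //]; apply: fX; rewrite /k; lia.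
- by right; exists snd.
Qed.

(** Here [j] is the largest index: [X j] alone is the future, and the second kernel belongs to the
    past. *)
Lemma past_future_right (i j i' j' : nat) : (1 <= i < j)%N -> (1 <= i' < j')%N ->
  (j' < j)%N ->
  `|mean P (fun x => xi i j x * xi i' j' x)| <=
  (2 * M + 3 * (c + M)) * K (j - maxn i j')%N `^ (- delta).
Proof.
move=> ij ij' jj'; set k := (j - maxn i j')%N.
apply: (@past_future_pair i j i' j' (maxn i j') k _ _ (X j) id) => //.
- by rewrite leq_maxl.
- by rewrite /k; lia.
- by have [] := lX (n := j) ltac:(lia).
- by apply: fX; rewrite /k; lia.
- by left; rewrite leq_maxr.
Qed.

End past_future.

Section transfer.
Context (R : realType).

Lemma ge0_integral_transfer d (T : measurableType d) d' (T' : measurableType d')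
    d'' (S : measurableType d'') (P : probability T R) (P' : probability T' R)
    (phi : T -> S) (phi' : T' -> S) (f : S -> \bar R) :
  measurable_fun setT phi -> measurable_fun setT phi' ->
  (forall B, measurable B -> P (phi @^-1` B) = P' (phi' @^-1` B)) ->
  measurable_fun setT f -> (forall s, (0 <= f s)%E) ->
  (\int[P]_x f (phi x) = \int[P']_x f (phi' x))%E.
Proof.
move=> mphi mphi' PP' mf f0.
pose Q : probability S R := distribution P (mfun_Sub (mem_set mphi) : {RV P >-> S}).
rewrite -(ge0_integral_map (Q := Q) mphi _ mf f0) //.
by apply: ge0_integral_map => // B mB; rewrite -PP'.
Qed.

Lemma mean_transfer d (T : measurableType d) d' (T' : measurableType d')
    d'' (S : measurableType d'') (P : probability T R) (P' : probability T' R)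
    (phi : T -> S) (phi' : T' -> S) (f : S -> R) :
  measurable_fun setT phi -> measurable_fun setT phi' ->
  (forall B, measurable B -> P (phi @^-1` B) = P' (phi' @^-1` B)) ->
  measurable_fun setT f ->
  mean P (fun x => f (phi x)) = mean P' (fun x => f (phi' x)).
Proof.
move=> mphi mphi' PP' mf; rewrite /mean /Rintegral; congr fine.
have mf' : measurable_fun setT (EFin \o f) by exact/measurable_EFinP.
rewrite [LHS]integralE [RHS]integralE; congr (_ - _)%E.
  transitivity (\int[P]_x funepos (EFin \o f) (phi x))%E.
    by apply: eq_integral => x _; rewrite !funeposE.
  rewrite (ge0_integral_transfer mphi mphi' PP' (measurable_funepos mf'))//.
  by apply: eq_integral => x _; rewrite !funeposE.
transitivity (\int[P]_x funeneg (EFin \o f) (phi x))%E.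
  by apply: eq_integral => x _; rewrite !funenegE.
rewrite (ge0_integral_transfer mphi mphi' PP' (measurable_funeneg mf'))//.
by apply: eq_integral => x _; rewrite !funenegE.
Qed.

End transfer.

Section half_product_laws.
Context (R : realType) (mu : probability R R).
Context d (T : measurableType d) d' (S : measurableType d') (P : probability T R).
Variables (phi : T -> S) (U : T -> R) (v : S -> R) (Q : probability (T * T)%type R).
Let V x := v (phi x).
Hypothesis mv : measurable_fun setT v.
Hypothesis lU : has_law mu P U.
Hypothesis lV : has_law mu P V.
Hypothesis hQ : half_product P phi Q.

Lemma half_product_law1 (A : set (R * R)) : measurable A ->
  Q [set z | A (U z.1, V z.1)] = P [set x | A (U x, V x)].
Proof.
move=> mA; have [mU _] := lU; have [mV _] := lV; have [Q1 _] := hQ.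
have mB : measurable [set x | A (U x, V x)].
  by have := measurable_fun_pair mU mV; move=> /(_ measurableT A mA); rewrite setTI.
have mB1 : measurable [set z : T * T | A (U z.1, V z.1)].
  rewrite (_ : [set z | _] = fst @^-1` [set x | A (U x, V x)])//.
  by rewrite -[X in measurable X]setTI; exact: measurable_fst.
rewrite -(prE Q mB1) -(prE P mB) -!mean_indic//; congr EFin.
exact: (Q1 \1_[set x | A (U x, V x)] (bdd_indic _ mB)).
Qed.

Lemma half_product_law2 (A : set (R * R)) : measurable A ->
  Q [set z | A (U z.2, V z.1)] = (mu \x mu)%E A.
Proof.
move=> mA; have [mU _] := lU; have [mV _] := lV; have [_ Q2] := hQ.
have [mUV lUV] := has_law_prod lU lV.
have mW : measurable_fun setT (fun z : S * T => (U z.2, v z.1)).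
  apply: measurable_fun_pair; first exact: (measurableT_comp mU measurable_snd).
  exact: (measurableT_comp mv measurable_fst).
have mW' : measurable_fun setT (fun z : T * T => (U z.2, V z.1)).
  apply: measurable_fun_pair; first exact: (measurableT_comp mU measurable_snd).
  exact: (measurableT_comp mV measurable_fst).
have bA : bdd (\1_A : R * R -> R) by exact: bdd_indic.
have mB : measurable [set z : T * T | A (U z.2, V z.1)].
  by have := mW' measurableT A mA; rewrite setTI.
rewrite -(prE Q mB) -(prE (mu \x mu)%E mA) -!mean_indic//; congr EFin.
rewrite (mean_map mUV lUV bA).
have := Q2 (fun z => \1_A (U z.2, v z.1)) (bdd_comp mW bA); rewrite /= => q2.
transitivity (mean Q (fun z => \1_A (U z.2, v (phi z.1)))) => //.
rewrite q2.
have [_ ->] := mean_prod P P (bdd_comp mW' bA).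
by have [-> _] := mean_prod P P (bdd_comp mUV bA).
Qed.

End half_product_laws.

(** * Growth conditions, stationarity and rates *)

Section growth.
Context (R : realType).

Definition grows (tau : R) (psi : nat -> R) : Prop :=
  (forall k, 0 <= psi k) /\ exists C : R, 0 <= C /\ forall n : nat, (1 <= n)%N ->
    \sum_(0 <= k < n.+1) k%:R * psi k <= C * n%:R `^ tau.

Lemma sum_mul_nondecreasing (a : nat -> R) (m n : nat) : (forall k, 0 <= a k) -> (m <= n)%N ->
  \sum_(0 <= k < m.+1) k%:R * a k <= \sum_(0 <= k < n.+1) k%:R * a k.
Proof.
move=> a0 mn; rewrite (@big_cat_nat _ _ _ m.+1 0 n.+1)//=.
by rewrite lerDl sumr_ge0// => k _; rewrite mulr_ge0.
Qed.

(** The constant absorbs the finitely many [n] before the asymptotic bound, where [n ^ tau] is at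
    least 1. *)
Lemma bigO_grows (tau : R) (a : nat -> R) : 0 <= tau -> (forall k, 0 <= a k) ->
  (fun n : nat => \sum_(0 <= k < n.+1) k%:R * a k) =O_\oo (fun n : nat => n%:R `^ tau) ->
  grows tau a.
Proof.
move=> tau0 a0 /eqOP[C0 [_ /(_ (C0 + 1))]]; rewrite ltrDl ltr01 => /(_ isT) [N _ HN].
split => //.
pose s n := \sum_(0 <= k < n.+1) k%:R * a k.
have s0 n : 0 <= s n by rewrite sumr_ge0// => k _; rewrite mulr_ge0.
exists (`|C0 + 1| + s N); split; first by rewrite addr_ge0.
move=> n n1.
have nt : 1 <= n%:R `^ tau.
  by rewrite -[leLHS](powRr0 n%:R) ler_powR// ler1n.
have [nN|Nn] := leqP n N.
  apply: (@le_trans _ _ (s N * 1)); first by rewrite mulr1; exact: sum_mul_nondecreasing.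
  by rewrite ler_pM// lerDr.
have := HN n (ltnW Nn); rewrite /= ger0_norm ?s0// ger0_norm ?powR_ge0// => /le_trans; apply.
by rewrite ler_wpM2r ?powR_ge0// (le_trans (ler_norm _))// lerDl.
Qed.

Lemma sum_inv_cube (n : nat) :
  \sum_(0 <= k < n.+1) k%:R * (k.+1%:R ^- 3 : R) <= 1 - n.+1%:R^-1.
Proof.
have aux (t : R) : 0 < t -> 1 - t^-1 + t * (t + 1) ^- 3 <= 1 - (t + 1)^-1.
  move=> t0; have t1 : 0 < t + 1 by lra.
  have -> : t * (t + 1) ^- 3 = t / (t + 1) ^+ 2 * (t + 1)^-1.
    by field; rewrite gt_eqF.
  have -> : 1 - (t + 1)^-1 = 1 - t^-1 + t^-1 * (t + 1)^-1.
    by field; rewrite !gt_eqF.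
  rewrite lerD2l; apply: ler_wpM2r; first by rewrite invr_ge0 ltW.
  rewrite ler_pdivrMr ?exprn_gt0// mulrC ler_pdivlMr//; nra.
elim: n => [|n IH]; first by rewrite big_nat1 mul0r invr1 subrr.
rewrite big_nat_recr//=; apply: le_trans (lerD IH (lexx _)) _.
have -> : n.+2%:R = n.+1%:R + 1 :> R by rewrite -[in LHS]addn1 natrD.
exact: aux.
Qed.

(** The cube is the price of a positive rate; its sum weighted by [k] stays below 1, hence below
    [n ^ tau]. *)
Lemma growsD_cube (tau : R) (a psi : nat -> R) : 0 <= tau -> grows tau a ->
  (forall k, 0 <= psi k) -> (forall k, psi k <= a k + k.+1%:R ^- 3) -> grows tau psi.
Proof.
move=> tau0 [a0 [C [C0 HC]]] p0 pa; split => //.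
exists (C + 1); split => [|n n1]; first by rewrite addr_ge0.
apply: (@le_trans _ _ (\sum_(0 <= k < n.+1) (k%:R * a k + k%:R * k.+1%:R ^- 3))).
  by apply: ler_sum => k _; rewrite -mulrDr ler_wpM2l.
rewrite big_split/= mulrDl mul1r lerD ?HC//.
apply: le_trans (sum_inv_cube n) _.
apply: (@le_trans _ _ 1); first by rewrite lerBlDr lerDl.
by rewrite -[leLHS](powRr0 n%:R) ler_powR// ler1n.
Qed.

Lemma growsZ (tau c : R) (psi : nat -> R) : 0 <= c -> grows tau psi ->
  grows tau (fun k => c * psi k).
Proof.
move=> c0 [p0 [C [C0 HC]]]; split; first by move=> k; rewrite mulr_ge0.
exists (c * C); split; first by rewrite mulr_ge0.
move=> n n1; rewrite -mulrA; apply: le_trans (ler_wpM2l c0 (HC n n1)).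
by rewrite mulr_sumr; apply: ler_sum => k _; rewrite mulrCA.
Qed.

End growth.

Section process_laws.
Context (R : realType) d (T : measurableType d) (P : probability T R).

Lemma cyl_sigma_algebra (I : Type) : sigma_algebra setT (@cyl_sigma R I).
Proof. exact: smallest_sigma_algebra. Qed.

Lemma cyl_adapted (I : Type) (i : I) : adapted (@cyl_sigma R I) (fun x : I -> R => x i).
Proof. by move=> B mB; apply: sub_sigma_algebra; exists i, B. Qed.

Lemma sigma_gen_algebra (I : Type) (V : I -> T -> R) (J : set I) :
  sigma_algebra setT (sigma_gen V J).
Proof. exact: smallest_sigma_algebra. Qed.

Lemma sigma_gen_adapted (I : Type) (V : I -> T -> R) (J : set I) (i : I) :
  J i -> adapted (sigma_gen V J) (V i).
Proof. by move=> Ji B mB; apply: sub_sigma_algebra; exists i, B. Qed.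

Variables (X : nat -> {RV P >-> R}) (h : R * R -> R).
Hypothesis sX : stationary_nat X.
Let mu : probability R R := distribution P (X 1%N).

Lemma stationary_law (n : nat) : (1 <= n)%N -> has_law mu P (X n).
Proof.
move=> n1; split => // B mB.
have := sX n.-1 (cyl_adapted 0 mB); rewrite /= => e.
rewrite /mu /= /distribution /pushforward.
transitivity (P [set w | B (X (0 + n.-1).+1 w)]) => //.
by rewrite add0n prednK.
Qed.

Lemma stationary_pair (i j : nat) (B : set (R * R)) : (1 <= i < j)%N -> measurable B ->
  P [set w | B (X i w, X j w)] = P [set w | B (X 1%N w, X (j - i).+1 w)].
Proof.
move=> /andP[i1 ij] mB.
have aB := adapted_pair (cyl_sigma_algebra nat) (cyl_adapted 0) (cyl_adapted (j - i)%N) mB.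
have := sX i.-1 aB; rewrite /= => e.
transitivity (P [set w | B (X (0 + i.-1).+1 w, X ((j - i)%N + i.-1).+1 w)]).
  by congr (P _); apply/seteqP; split => w /=; rewrite add0n prednK//;
    rewrite (_ : ((j - i)%N + i.-1).+1 = j)//; lia.
exact: e.
Qed.

Lemma measurable_RV_pair (i j : nat) : measurable_fun setT (fun w => (X i w, X j w)).
Proof. exact: measurable_fun_pair. Qed.

Lemma stationary_admissible (i j : nat) (nu : set (R * R) -> \bar R) : (1 <= i < j)%N ->
  (forall A, measurable A -> nu A = P [set w | A (X i w, X j w)]) ->
  admissible_law X nu.
Proof.
move=> ij nuE; left; exists (j - i).+1 => // A mA.
by rewrite nuE// stationary_pair.
Qed.

Lemma stationary_moment (m M : R) (i j : nat) : measurable_fun setT h -> (1 <= i < j)%N ->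
  (forall k : nat, (1 <= k)%N ->
     (\int[P]_w (`|h (X 1%N w, X k w)| `^ m)%:E <= M%:E)%E) ->
  (\int[P]_w (`|h (X i w, X j w)| `^ m)%:E <= M%:E)%E.
Proof.
move=> mh ij HM; apply: le_trans (HM (j - i).+1 isT).
rewrite le_eqVlt; apply/orP; left; apply/eqP.
apply: (@ge0_integral_transfer _ _ _ _ _ _ _ P P (fun w => (X i w, X j w))
  (fun w => (X 1%N w, X (j - i).+1 w)) (fun z => (`|h z| `^ m)%:E)).
- exact: measurable_RV_pair.
- exact: measurable_RV_pair.
- by move=> B mB; exact: stationary_pair.
- by apply/measurable_EFinP; exact: measurable_powR_norm.
- by move=> s; rewrite lee_fin powR_ge0.
Qed.

End process_laws.

Section array_decay.
Context (R : realType) d (T : measurableType d) (P : probability T R).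

(** In the first clause [i] is the smallest of the four indices and [psi] is taken at the first gap;
    in the second [j] is the largest and [psi] is taken at the last gap. *)
Definition array_decay (xi : nat -> nat -> T -> R) (psi : nat -> R) (C : R) : Prop :=
  (forall i j i' j' : nat, (1 <= i < j)%N -> (1 <= i' < j')%N -> (i < i')%N ->
     `|mean P (fun x => xi i j x * xi i' j' x)| <= C * psi (minn j i' - i)%N) /\
  (forall i j i' j' : nat, (1 <= i < j)%N -> (1 <= i' < j')%N -> (j' < j)%N ->
     `|mean P (fun x => xi i j x * xi i' j' x)| <= C * psi (j - maxn i j')%N).

End array_decay.

Section rate.
Context (R : realType) (b : nat -> R) (p : R).
Hypothesis p0 : 0 < p.

(* The power of [k.+1] keeps the rate positive when [b k] vanishes. *)
Definition rate (k : nat) : R := Num.max (b k) (k.+1%:R `^ (- (3 / p))).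

Lemma rate_gt0 k : 0 < rate k.
Proof. by rewrite lt_max powR_gt0// orbT. Qed.

Lemma rate_ge k : b k <= rate k.
Proof. by rewrite le_max lexx. Qed.

(** The exponent [3 / p] in [rate] is chosen so that the added term becomes the inverse cube that
    [growsD_cube] absorbs. *)
Lemma rate_pow k : rate k `^ p <= b k `^ p + k.+1%:R ^- 3.
Proof.
have cube : (k.+1%:R `^ (- (3 / p))) `^ p = k.+1%:R ^- 3 :> R.
  rewrite -powRrM (_ : - (3 / p) * p = - 3); last by field; rewrite gt_eqF.
  by rewrite powRN -powR_mulrn.
rewrite /rate /Num.max; case: ifP => _; first by rewrite cube lerDr powR_ge0.
by rewrite lerDl invr_ge0 exprn_ge0.
Qed.

Lemma rate_le1 k : b k <= 1 -> rate k <= 1.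
Proof.
move=> b1; rewrite ge_max b1/= powRN invf_le1 ?powR_gt0//.
by rewrite -[leLHS](powRr0 k.+1%:R) ler_powR ?ler1n// divr_ge0// ltW.
Qed.

End rate.

(** * Absolutely regular processes *)

Section absolutely_regular_case.
Context (R : realType) d (T : measurableType d) (P : probability T R).
Variables (X : nat -> {RV P >-> R}) (h : R * R -> R) (delta tau M : R).
Let mu : probability R R := distribution P (X 1%N).
Hypothesis sX : stationary_nat X.
Hypothesis mh : measurable_fun setT h.
Hypothesis hsym : forall x y, h (x, y) = h (y, x).
Hypothesis hdeg : forall x : R, (\int[mu]_y (h (x, y))%:E = 0)%E.
Hypothesis d0 : 0 < delta.
Hypothesis tau0 : 0 <= tau.
Hypothesis hmom : (\int[(mu \x mu)%E]_z (`|h z| `^ (2 + delta))%:E <= M%:E)%E.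
Hypothesis hmomX : forall k : nat, (1 <= k)%N ->
  (\int[P]_w (`|h (X 1%N w, X k w)| `^ (2 + delta))%:E <= M%:E)%E.

(** The bound [beta k] does not grow with the number of values of [J], so the partition given by
    [bdd_approximable] may be as fine as the truncated kernel demands. *)
Lemma abs_reg_decay : cond_abs_reg X delta tau -> exists psi C,
  grows tau psi /\ array_decay P (fun i j x => h (X i x, X j x)) psi C.
Proof.
move=> [d' [T' [P' [X' [[sX' ext] _ Hgr]]]]].
pose beta k := beta_reg X' k; pose e := delta / (2 + delta).
have d20 : 0 < 2 + delta by rewrite addr_gt0.
have e0 : 0 < e by rewrite divr_gt0.
(* At this level [K * x] equals [K ^ -(1 + delta)], and [K ^ -delta] is the power
   [delta / (2 + delta)] of the rate. *)
pose x := rate beta e; pose K k := x k `^ (- (2 + delta)^-1).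
have x0 k : 0 < x k := rate_gt0 beta e k.
have K0 k : 0 < K k by rewrite powR_gt0.
have Kpow k s : K k `^ (- s) = x k `^ (s / (2 + delta)).
  by rewrite /K -powRrM; congr (_ `^ _); field; rewrite gt_eqF.
pose psi k := K k `^ (- delta).
have gpsi : grows tau psi.
  apply: (@growsD_cube _ tau (fun k => beta k `^ e)) => //.
  - by apply: bigO_grows => // k; exact: powR_ge0.
  - by move=> k; exact: powR_ge0.
  - by move=> k; rewrite /psi Kpow; exact: rate_pow.
pose Y n : T' -> R := X' n%:Z.
have lawY n : (1 <= n)%N -> has_law mu P' (Y n).
  move=> n1; split=> [|B mB]; first exact: measurable_funPT.
  have [_ <-//] := stationary_law sX n1.
  have := ext _ (cyl_adapted n.-1 mB); rewrite /= (prednK n1) => <-//.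
have aQ i j i' j' : adapted (@cyl_sigma R nat)
    (fun z : nat -> R => ((z i.-1, z j.-1), (z i'.-1, z j'.-1))).
  have s := @cyl_sigma_algebra R nat.
  by apply: adapted_pair => //; apply: adapted_pair => //; exact: cyl_adapted.
(* The covariances are computed for the two-sided copy on its own space; the laws of quadruples
   carry them back to [X]. *)
have quad i j i' j' B : (1 <= i)%N -> (1 <= j)%N -> (1 <= i')%N -> (1 <= j')%N -> measurable B ->
    P [set w | B ((X i w, X j w), (X i' w, X j' w))] =
    P' [set w | B ((Y i w, Y j w), (Y i' w, Y j' w))].
  move=> i1 j1 i'1 j'1 mB; have := ext _ (aQ i j i' j' B mB).
  by rewrite /= !prednK.
have mY n : measurable_fun setT (Y n) by exact: measurable_funPT.
have mYY i j : measurable_fun setT (fun w => (Y i w, Y j w)) by exact: measurable_fun_pair.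
have momY i j : (1 <= i < j)%N ->
    (\int[P']_w (`|h (Y i w, Y j w)| `^ (2 + delta))%:E <= M%:E)%E.
  move=> ij; have [i1 j1] : (1 <= i)%N /\ (1 <= j)%N by lia.
  apply: le_trans (stationary_moment sX mh ij hmomX).
  rewrite le_eqVlt; apply/orP; left; apply/eqP/esym.
  apply: (@ge0_integral_transfer _ _ _ _ _ _ _ P P' (fun w => (X i w, X j w))
    (fun w => (Y i w, Y j w)) (fun z => (`|h z| `^ (2 + delta))%:E)) => //.
  - exact: measurable_RV_pair.
  - move=> B mB; have mB' : measurable [set z : (R * R) * (R * R) | B z.1].
      by rewrite -[X in measurable X]setTI; exact: measurable_fst.
    exact: (quad i j i j _ i1 j1 i1 j1 mB').
  - by apply/measurable_EFinP; exact: measurable_powR_norm.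
pose past n := sigma_gen X' [set i | i <= n%:Z].
pose fut n := sigma_gen X' [set i | n%:Z <= i].
have spast n : sigma_algebra setT (past n) := sigma_gen_algebra _ _.
have sfut n : sigma_algebra setT (fut n) := sigma_gen_algebra _ _.
have mpast n : past n `<=` measurable by move=> A; exact: sigma_gen_measurable.
have dep n k N (J : T' -> 'I_N) (A : 'I_N -> set T') :
  (1 <= n)%N -> (1 <= k)%N -> (forall j, past n [set x | J x = j]) ->
  (forall j, fut (n + k)%N (A j)) ->
  \sum_j (pr P' ([set x | J x = j] `&` A j) - pr P' [set x | J x = j] * pr P' (A j)) <= beta k.
  move=> n1 _ pJ fA; apply: (beta_reg_dependence n1 pJ fA) => i j ij.
  by apply/seteqP; split => // w [/= -> /eqP]; rewrite (negbTE ij).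
have pY i n : (1 <= i <= n)%N -> adapted (past n) (Y i).
  by move=> /andP[_ lein]; apply: sigma_gen_adapted => /=; rewrite lez_nat.
have fY i n : (n <= i)%N -> adapted (fut n) (Y i).
  by move=> lein; apply: sigma_gen_adapted => /=; rewrite lez_nat.
(* Of the constant 3, two units pay for decoupling and one for the partition. *)
have HK k i j : (1 <= k)%N -> (1 <= i < j)%N -> exists N (pJ : R -> 'I_N) eta,
  [/\ forall j, measurable [set x | pJ x = j],
      coupling_defect h P' Y (K k) pJ i j eta &
      K k * beta k *+ 2 + eta <= 3 * K k `^ (- (1 + delta))].
  move=> k1 ij; have [i1 j1] : (1 <= i)%N /\ (1 <= j)%N by lia.
  pose pi1 : probability (R * R)%type R :=
    distribution P' (mfun_Sub (mem_set (mYY i j)) : {RV P' >-> (R * R)%type}).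
  have bh : bdd (fun z => trunc (K k) (h z)) by apply: bdd_trunc => //; exact: ltW.
  have Kp0 : 0 < K k `^ (- (1 + delta)) by rewrite powR_gt0.
  have [N [pJ [mpJ HpJ]]] := @bdd_approximable R pi1 (mu \x mu)%E _ bh _ Kp0.
  exists N, pJ, (K k `^ (- (1 + delta))); split => //.
    move=> d'' S phi v mphi mv Yj Q hQ.
    have Yj' : Y j = (fun w => v (phi w)) by exact/funext.
    have lV : has_law mu P' (fun w => v (phi w)) by rewrite -Yj'; exact: lawY.
    apply: (HpJ _ _ Q (fun z => Y i z.1) (fun z => Y j z.1) (fun z => Y i z.2)).
    - exact: (measurableT_comp (mY i) measurable_fst).
    - exact: (measurableT_comp (mY j) measurable_fst).
    - exact: (measurableT_comp (mY i) measurable_snd).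
    - move=> A mA; transitivity (P' [set x | A (Y i x, Y j x)]) => //; rewrite Yj'.
      exact: (half_product_law1 (lawY _ i1) lV hQ mA).
    - move=> A mA; rewrite Yj'.
      exact: (half_product_law2 mv (lawY _ i1) lV hQ mA).
  have Kb : K k * beta k <= K k `^ (- (1 + delta)).
    apply: (@le_trans _ _ (K k * x k)); first by rewrite ler_wpM2l ?(ltW (K0 k))// rate_ge.
    rewrite Kpow /K -{2}[x k](powRr1 (ltW (x0 k))) -powRD; last by rewrite (gt_eqF (x0 k)) implybT.
    by rewrite le_eqVlt; apply/orP; left; apply/eqP; congr (_ `^ _); field; rewrite gt_eqF.
  by rewrite mulr2n; lra.
exists psi, (2 * M + 3 * (3 + M)); split => //; split.
- move=> i j i' j' ij ij' ii'.
  have [i1 j1 i'1 j'1] : [/\ (1 <= i)%N, (1 <= j)%N, (1 <= i')%N & (1 <= j')%N] by split; lia.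
  have := past_future_left mh hsym hdeg d0 hmom spast mpast sfut dep lawY pY fY momY K0 HK ij ij' ii'.
  apply: le_trans; rewrite le_eqVlt; apply/orP; left; apply/eqP; congr (`|_|).
  apply: (@mean_transfer _ _ _ _ _ _ _ P P' (fun w => ((X i w, X j w), (X i' w, X j' w)))
    (fun w => ((Y i w, Y j w), (Y i' w, Y j' w))) (fun z => h z.1 * h z.2)).
  - by apply: measurable_fun_pair; exact: measurable_RV_pair.
  - exact: measurable_fun_pair.
  - by move=> B mB; exact: quad.
  - by apply: measurable_funM; exact: measurableT_comp.
- move=> i j i' j' ij ij' jj'.
  have [i1 j1 i'1 j'1] : [/\ (1 <= i)%N, (1 <= j)%N, (1 <= i')%N & (1 <= j')%N] by split; lia.
  have := past_future_right mh hsym hdeg d0 hmom spast mpast dep lawY pY fY momY K0 HK ij ij' jj'.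
  apply: le_trans; rewrite le_eqVlt; apply/orP; left; apply/eqP; congr (`|_|).
  apply: (@mean_transfer _ _ _ _ _ _ _ P P' (fun w => ((X i w, X j w), (X i' w, X j' w)))
    (fun w => ((Y i w, Y j w), (Y i' w, Y j' w))) (fun z => h z.1 * h z.2)).
  - by apply: measurable_fun_pair; exact: measurable_RV_pair.
  - exact: measurable_fun_pair.
  - by move=> B mB; exact: quad.
  - by apply: measurable_funM; exact: measurableT_comp.
Qed.

End absolutely_regular_case.

(** * Strongly mixing processes *)

Section alpha_dependence.
Context (R : realType) d (T : measurableType d) (P : probability T R).
Variable X : nat -> {RV P >-> R}.

Let corr k := [set r | exists (n : nat) (A B : set T),
    [/\ (1 <= n)%N,
        sigma_gen X [set i | (1 <= i <= n)%N] A,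
        sigma_gen X [set i | (n + k <= i)%N] B &
        r = `| fine (P (A `&` B)) - fine (P A) * fine (P B) | ] ].

Let corr_le1 k r : corr k r -> r <= 1.
Proof.
move=> [n [A [B [_ pA fB ->]]]].
have mA := sigma_gen_measurable pA; have mB := sigma_gen_measurable fB.
have mAB := measurableI _ _ mA mB.
rewrite -/(pr P _) -/(pr P A) -/(pr P B).
have := pr_ge0 P (A `&` B); have := pr_le1 P mAB.
have := pr_ge0 P A; have := pr_le1 P mA; have := pr_ge0 P B; have := pr_le1 P mB.
move=> b1 b0 a1 a0 c1 c0; rewrite ler_norml.
have := mulr_ge0 a0 b0; have := mulr_ile1 a0 b0 a1 b1.
by move=> *; apply/andP; split; lra.
Qed.

Let corr0 k : corr k 0.
Proof.
exists 1%N, set0, set0; split => //; last by rewrite set0I measure0 mul0r subrr normr0.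
- by have [+ _ _] := sigma_gen_algebra (R := R) (fun i => X i : T -> R) [set i | (1 <= i <= 1)%N].
- by have [+ _ _] := sigma_gen_algebra (R := R) (fun i => X i : T -> R) [set i | (1 + k <= i)%N].
Qed.

Lemma alpha_mix_le1 k : alpha_mix X k <= 1.
Proof. by apply: ge_sup => [|r]; [exists 0; exact: corr0|exact: corr_le1]. Qed.

Lemma alpha_mix_ge k r : corr k r -> r <= alpha_mix X k.
Proof. by move=> cr; apply: ub_le_sup cr; exists 1 => s; exact: corr_le1. Qed.

Lemma alpha_mix_ge0 k : 0 <= alpha_mix X k.
Proof. exact: alpha_mix_ge (corr0 k). Qed.

(** The future sigma-algebra is made the measurable structure of the target, so that the identity
    serves as [phi] and the events [A j] are its measurable sets. *)
Lemma alpha_mix_dependence (n k N : nat) (J : T -> 'I_N) (A : 'I_N -> set T) : (1 <= n)%N ->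
  (forall j, sigma_gen X [set i | (1 <= i <= n)%N] [set x | J x = j]) ->
  (forall j, sigma_gen X [set i | (n + k <= i)%N] (A j)) ->
  \sum_j (pr P ([set x | J x = j] `&` A j) - pr P [set x | J x = j] * pr P (A j)) <=
  10 * Num.sqrt N%:R * alpha_mix X k.
Proof.
move=> n1 pJ fA.
pose C := [set A | exists i B, [/\ (n + k <= i)%N, measurable B & A = X i @^-1` B]].
pose S : measurableType _ := g_sigma_algebraType C.
have mid : measurable_fun [set: T] (fun x : T => x : S).
  by move=> _ B mB; rewrite setTI; exact: (sigma_gen_measurable (P := P) (V := X) mB).
have mJ j : measurable [set x | J x = j] := sigma_gen_measurable (pJ j).
apply: (@alpha_dependence_fibers R _ T _ S P N J (fun x => x) mid mJ (alpha_mix X k)).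
- move=> D B mB; apply: alpha_mix_ge; exists n, (J @^-1` D), B; split => //.
  exact: (salg_fibers (sigma_gen_algebra _ _) D pJ).
- by move=> j; exact: fA.
Qed.

End alpha_dependence.

Section line_partition.
Context (R : realType).

(** Cells of width [q] cover the interval from [-B] to [B]; one further value, [ord_max], stands for
    everything outside. *)
Lemma line_partition (B q : R) : 0 < B -> 0 < q -> exists N (pJ : R -> 'I_N),
  [/\ forall j, measurable [set x | pJ x = j], N%:R <= 2 * B / q + 2 &
      forall x y, pJ x = pJ y -> `|x| < B -> `|y| < B -> `|x - y| <= q].
Proof.
move=> B0 q0; pose m := Num.truncn (2 * B / q).
have t0 : 0 <= 2 * B / q by rewrite divr_ge0// ?mulr_ge0// ltW.
have /andP[mt tm] := truncn_itv t0.
pose c x := (cell q (x + B), `|x| < B).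
have cm x : `|x| < B -> 0 <= cell q (x + B) /\ (`|cell q (x + B)| <= m)%N.
  move=> xB; have := xB; rewrite ltr_norml => /andP[x1 x2].
  have z0 : 0 <= (x + B) / q by rewrite divr_ge0 ?(ltW q0)//; lra.
  have c0 : 0 <= cell q (x + B) by rewrite /cell floor_ge0.
  split => //; rewrite -ltnS -(ltr_nat R).
  apply: le_lt_trans tm; rewrite -[_%:R]/((`|cell q (x + B)|%N)%:~R) gez0_abs//.
  apply: (@le_trans _ _ ((x + B) / q)); first exact: floor_le.
  by rewrite ler_wpM2r ?invr_ge0 ?(ltW q0)//; lra.
pose code (i : int * bool) : 'I_m.+2 := if i.2 then inord `|i.1|%N else ord_max.
exists m.+2, (code \o c); split.
- move=> j; apply: (@measurable_countable_preimage _ _ _ c [set i | code i = j]) => -[a b].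
  rewrite (_ : [set x | _] = [set x | cell q (x + B) = a] `&` [set x | (`|x| < B) = b]).
    apply: measurableI.
      rewrite (_ : [set x | _] = (fun x => x + B) @^-1` [set x | cell q x = a])//.
      rewrite -[X in measurable X]setTI.
      by apply: measurable_funD => //; exact: measurable_cell.
    have mB : measurable [set x : R | B <= `|x|] by apply: (measurable_ge B); exact: normr_measurable.
    case: b.
      rewrite (_ : [set x | _] = ~` [set x : R | B <= `|x|]); first exact: measurableC.
      by apply/seteqP; split => x /=; rewrite ltNge; move/negP.
    rewrite (_ : [set x | _] = [set x : R | B <= `|x|])//.
    by apply/seteqP; split => x /=; rewrite leNgt; [move=> ->|move/negbTE].
  by apply/seteqP; split => x; rewrite /c/= => -[-> ->].
- by rewrite -addn2 natrD lerD2r.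
- move=> x y /=; rewrite /code/c/= => + xB yB; rewrite xB yB.
  have [cx0 cxm] := cm _ xB; have [cy0 cym] := cm _ yB.
  move/(congr1 val); rewrite /= !inordK ?ltnS ?(leq_trans cxm) ?(leq_trans cym)// => e.
  have ec : cell q (x + B) = cell q (y + B).
    by rewrite -(gez0_abs cx0) -(gez0_abs cy0) e.
  by have := cell_eq q0 ec; rewrite opprD addrACA subrr addr0.
Qed.

Lemma moment_tail d (T : measurableType d) (P : probability T R) (f : T -> R) (g B M : R) :
  measurable_fun setT f -> 0 < B -> 0 < g ->
  (\int[P]_x (`|f x| `^ g)%:E <= M%:E)%E ->
  pr P [set x | B <= `|f x|] <= B `^ (- g) * M.
Proof.
move=> mf B0 g0 HM; have mA : measurable [set x | B <= `|f x|].
  by apply: measurable_ge; exact: measurableT_comp.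
rewrite powRN ler_pdivlMl ?powR_gt0// -mean_indic// -meanZ; last exact: bdd_indic.
rewrite -lee_fin meanE; last by apply: bddZ; exact: bdd_indic.
apply: le_trans HM; apply: ge0_le_integral => //.
- by move=> x _; rewrite lee_fin mulr_ge0 ?powR_ge0// indic_ge0.
- by apply/measurable_EFinP; apply: measurable_funM => //; exact: measurable_indic.
- by apply/measurable_EFinP; exact: measurable_powR_norm.
- move=> x _; rewrite lee_fin indicE; have [/set_mem/= Bx|_] := boolP (x \in _).
    by rewrite mulr1 ge0_ler_powR ?nnegrE ?(ltW B0) ?(ltW g0).
  by rewrite mulr0 powR_ge0.
Qed.

End line_partition.

Section lipschitz_defect.
Context (R : realType) d (T : measurableType d) (P : probability T R).
Variables (X : nat -> {RV P >-> R}) (h : R * R -> R) (L : R).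
Let mu : probability R R := distribution P (X 1%N).
Hypothesis mh : measurable_fun setT h.
Hypothesis lip : lipschitz_coupling X h L.
Context d0 (T0 : measurableType d0) (P0 : probability T0 R).
Variables (U V : T0 -> R).
Hypothesis lU : has_law mu P0 U.
Hypothesis lV : has_law mu P0 V.
Hypothesis adm : admissible_law X (fun A => P0 [set w | A (U w, V w)]).

Lemma lipschitz_defect d' (S : measurableType d') (phi : T0 -> S) (v : S -> R)
    N (J : T0 -> 'I_N) (B : set T0) (K q : R) Q :
  measurable_fun setT v -> V =1 v \o phi ->
  (forall j, measurable [set x | J x = j]) -> measurable B -> 0 < K -> 0 < q ->
  (forall x y, J x = J y -> ~ B x -> ~ B y -> `|U x - U y| <= q) ->
  half_product P0 phi Q ->
  mean Q (fun z => (J z.1 == J z.2)%:R *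
    `|trunc K (h (U z.1, V z.1)) - trunc K (h (U z.2, V z.1))|) <=
  L * q + K * pr P0 B *+ 4.
Proof.
move=> mv Vv mJ mB K0 q0 close hQ.
have Vv' : V = (fun w => v (phi w)) by exact/funext.
have lV' : has_law mu P0 (fun w => v (phi w)) by rewrite -Vv'.
rewrite Vv'; apply: (eta_bad_event mh mJ lU lV' K0 hQ mB close).
have [mU _] := lU; have [mV _] := lV'.
apply: (lip q0 (Q := Q) (U := fun z => U z.1) (V := fun z => v (phi z.1)) (U' := fun z => U z.2)).
- exact: (measurableT_comp mU measurable_fst).
- exact: (measurableT_comp mV measurable_fst).
- exact: (measurableT_comp mU measurable_snd).
- have lawE A : measurable A ->
      Q [set z | A (U z.1, v (phi z.1))] = P0 [set w | A (U w, V w)].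
    by move=> mA; rewrite Vv'; exact: (half_product_law1 lU lV' hQ mA).
  case: adm => [[k k1 admk]|admp]; [left; exists k => // A mA|right=> A mA].
    by rewrite -(admk _ mA) -lawE.
  by rewrite -(admp _ mA) -lawE.
- by move=> A mA; exact: (half_product_law2 mv lU lV' hQ mA).
Qed.

End lipschitz_defect.

Section strong_mixing_case.
Context (R : realType) d (T : measurableType d) (P : probability T R).
Variables (X : nat -> {RV P >-> R}) (h : R * R -> R) (delta tau M : R).
Let mu : probability R R := distribution P (X 1%N).
Hypothesis sX : stationary_nat X.
Hypothesis mh : measurable_fun setT h.
Hypothesis hsym : forall x y, h (x, y) = h (y, x).
Hypothesis hdeg : forall x : R, (\int[mu]_y (h (x, y))%:E = 0)%E.
Hypothesis d0 : 0 < delta.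
Hypothesis tau0 : 0 <= tau.
Hypothesis hmom : (\int[(mu \x mu)%E]_z (`|h z| `^ (2 + delta))%:E <= M%:E)%E.
Hypothesis hmomX : forall k : nat, (1 <= k)%N ->
  (\int[P]_w (`|h (X 1%N w, X k w)| `^ (2 + delta))%:E <= M%:E)%E.

(** The origin of the mixing exponent. Cells of width [K ^ -(1 + delta)] on an interval of
    half-length [K ^ ((2 + delta) / g)] number about [K ^ e]. With [x = K ^ -E] the product is of
    order [K ^ (1 + e / 2 - E)], and [E] is chosen to make this exponent [-(1 + delta)]. *)
Lemma sqrt_rate_bound (g K x a N : R) : 0 < g -> 1 <= K ->
  x = K `^ (- ((3 * g * delta + delta + 5 * g + 2) / (2 * g))) -> 0 <= a <= x ->
  0 <= N <= 2 * K `^ ((2 + delta) / g) / K `^ (- (1 + delta)) + 2 ->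
  K * (10 * Num.sqrt (N * 2) * a) <= 30 * K `^ (- (1 + delta)).
Proof.
move=> g0 K1 xE /andP[a0 ax] /andP[N0 NK]; have K0 : 0 < K := lt_le_trans ltr01 K1.
have KD s t : K `^ s * K `^ t = K `^ (s + t).
  by rewrite -powRD// (gt_eqF K0) implybT.
rewrite -mulrA -powRN KD opprK in NK.
set e := (2 + delta) / g + (1 + delta) in NK.
have e0 : 0 <= e by rewrite addr_ge0 ?divr_ge0 ?addr_ge0// ltW.
have Ke1 : 1 <= K `^ e by rewrite -[leLHS](powRr0 K) ler_powR.
(* [N * 2] is at most [4 * K ^ e + 4], hence at most [9 * K ^ e]. *)
have sqN : Num.sqrt (N * 2) <= 3 * K `^ (e / 2).
  rewrite powRrM powR12_sqrt ?powR_ge0//.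
  rewrite -[3]ger0_norm// -sqrtr_sqr -sqrtrM ?sqr_ge0// ler_wsqrtr//.
  by move: NK Ke1; generalize (K `^ e) => t; lra.
apply: (@le_trans _ _ (K * (10 * (3 * K `^ (e / 2)) * x))).
  apply: ler_wpM2l; first exact: ltW.
  by apply: ler_pM; rewrite ?mulr_ge0 ?sqrtr_ge0// ler_wpM2l.
rewrite xE (_ : K * _ = 30 * (K `^ 1 * K `^ (e / 2) *
   K `^ (- ((3 * g * delta + delta + 5 * g + 2) / (2 * g))))); last by rewrite (powRr1 (ltW K0)); ring.
rewrite !KD (_ : 1 + _ + _ = - (1 + delta))//.
by rewrite /e; field; rewrite gt_eqF.
Qed.

Lemma P_Lipschitz_or_variation : P_Lipschitz X h \/ variation_condition X h ->
  exists2 L, 0 < L & lipschitz_coupling X h L.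
Proof.
by case; [exact: P_Lipschitz_coupling|exact: (variation_condition_coupling mh)].
Qed.

Lemma strong_mix_decay : cond_strong_mix X h delta tau -> exists psi C,
  grows tau psi /\ array_decay P (fun i j x => h (X i x, X j x)) psi C.
Proof.
move=> [_ [g [g0 Eg /P_Lipschitz_or_variation [L L0 lip] Hgr]]].
pose D := 3 * g * delta + delta + 5 * g + 2.
have gd0 : 0 < g * delta by rewrite mulr_gt0.
have D0 : 0 < D by rewrite /D !addr_gt0// !mulr_gt0.
pose th := 2 * g * delta / D.
have th0 : 0 < th by rewrite divr_gt0// -mulrA mulr_gt0.
rewrite -/D -/th in Hgr.
pose alpha k := alpha_mix X k.
(* The level is chosen so that [K ^ -delta = x ^ th]. It is at least 1, because the mixing
   coefficients are at most 1. *)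
pose x := rate alpha th; pose K k := x k `^ (- (th / delta)).
have x0 k : 0 < x k := rate_gt0 alpha th k.
have x1 k : x k <= 1 by apply: rate_le1 => //; exact: alpha_mix_le1.
have K0 k : 0 < K k by rewrite powR_gt0.
have Kpow k s : K k `^ s = x k `^ (- (th / delta) * s) by rewrite /K -powRrM.
have Kpos k s : 0 < K k `^ s by rewrite powR_gt0.
have KD k s t : K k `^ s * K k `^ t = K k `^ (s + t).
  by rewrite -powRD// (gt_eqF (K0 k)) implybT.
have K1 k : 1 <= K k.
  rewrite /K powRN invf_ge1 ?powR_gt0//.
  rewrite -[leRHS](powRr0 (x k)); apply: ger_powR; first by rewrite x0 x1.
  by rewrite divr_ge0// ltW.
pose psi k := K k `^ (- delta).
have psiE k : psi k = x k `^ th.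
  by rewrite /psi Kpow; congr (_ `^ _); field; rewrite gt_eqF.
have gpsi : grows tau psi.
  apply: (@growsD_cube _ tau (fun k => alpha k `^ th)) => //.
  - by apply: bigO_grows => // k; exact: powR_ge0.
  - by move=> k; exact: powR_ge0.
  - by move=> k; rewrite psiE; exact: rate_pow.
pose Mg := fine (\int[P]_w (`|X 1%N w| `^ g)%:E)%E.
have Mg0 : 0 <= Mg by rewrite fine_ge0// integral_ge0// => w _; rewrite lee_fin powR_ge0.
have EgE : (\int[P]_w (`|X 1%N w| `^ g)%:E <= Mg%:E)%E.
  rewrite fineK// ge0_fin_numE// integral_ge0// => w _; rewrite lee_fin powR_ge0//.
pose past n := sigma_gen X [set i | (1 <= i <= n)%N].
pose fut n := sigma_gen X [set i | (n <= i)%N].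
have spast n : sigma_algebra setT (past n) := sigma_gen_algebra _ _.
have sfut n : sigma_algebra setT (fut n) := sigma_gen_algebra _ _.
have mpast n : past n `<=` measurable by move=> A; exact: sigma_gen_measurable.
have dep n k N (J : T -> 'I_N) (A : 'I_N -> set T) :
  (1 <= n)%N -> (1 <= k)%N -> (forall j, past n [set x | J x = j]) ->
  (forall j, fut (n + k)%N (A j)) ->
  \sum_j (pr P ([set x | J x = j] `&` A j) - pr P [set x | J x = j] * pr P (A j)) <=
  10 * Num.sqrt N%:R * alpha k.
  by move=> n1 _ pJ fA; exact: (alpha_mix_dependence n1 pJ fA).
have lawX n : (1 <= n)%N -> has_law mu P (X n) := stationary_law sX (n := n).
have pX i n : (1 <= i <= n)%N -> adapted (past n) (X i : T -> R).
  by move=> lein; exact: (@sigma_gen_adapted R _ T nat (fun i => X i : T -> R)).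
have fX i n : (n <= i)%N -> adapted (fut n) (X i : T -> R).
  by move=> lein; exact: (@sigma_gen_adapted R _ T nat (fun i => X i : T -> R)).
have momX i j : (1 <= i < j)%N ->
    (\int[P]_w (`|h (X i w, X j w)| `^ (2 + delta))%:E <= M%:E)%E.
  by move=> ij; exact: (stationary_moment sX mh ij hmomX).
(* 60 pays for decoupling, [L] for the width of the cells, and [4 * Mg] for large values of the
   process at the two points of the coupling. *)
pose c := 60 + L + 4 * Mg.
have HK k i j : (1 <= k)%N -> (1 <= i < j)%N -> exists N (pJ : R -> 'I_N) eta,
  [/\ forall j, measurable [set x | pJ x = j],
      coupling_defect h P (fun i => X i : T -> R) (K k) pJ i j eta &
      K k * (10 * Num.sqrt (N * 2)%:R * alpha k) *+ 2 + eta <= c * K k `^ (- (1 + delta))].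
  move=> k1 ij; have [i1 j1] : (1 <= i)%N /\ (1 <= j)%N by move: ij; clear; lia.
  (* With this [B], the event that the process exceeds [B] has probability at most
     [K ^ -(2 + delta) * Mg], which after multiplication by [K] is of the order of [q]. *)
  pose q := K k `^ (- (1 + delta)); pose B := K k `^ ((2 + delta) / g).
  have q0 : 0 < q by exact: Kpos.
  have B0 : 0 < B by exact: Kpos.
  have [N [pJ [mpJ NB close]]] := line_partition B0 q0.
  have mbad : measurable [set w | B <= `|X i w|].
    by apply: (measurable_ge B); exact: measurableT_comp.
  have tail : pr P [set w | B <= `|X i w|] <= K k `^ (- (2 + delta)) * Mg.
    rewrite (_ : K k `^ (- (2 + delta)) = B `^ (- g)); last first.
      by rewrite /B -powRrM; congr (_ `^ _); field; rewrite gt_eqF.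
    apply: (moment_tail (measurable_funPT (X i)) B0 g0); apply: le_trans EgE.
    rewrite le_eqVlt; apply/orP; left; apply/eqP.
    apply: (@ge0_integral_transfer _ _ _ _ _ _ _ P P (X i) (X 1%N)
      (fun y => (`|y| `^ g)%:E)); [exact: measurable_funPT|exact: measurable_funPT| | |].
    - by move=> A mA; have [_ ->] := lawX i i1.
    - by apply/measurable_EFinP; apply: measurable_powR_norm.
    - by move=> s; rewrite lee_fin powR_ge0.
  exists N, pJ, (L * q + K k * pr P [set w | B <= `|X i w|] *+ 4); split => //.
    move=> d' S phi v mphi mv Xj Q hQ.
    apply: (lipschitz_defect mh lip (lawX i i1) (lawX j j1) (stationary_admissible sX ij _)
      mv Xj (J := fun w => pJ (X i w)) _ mbad (K0 k) q0) => //.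
    - by move=> l; rewrite -[X in measurable X]setTI; have [mXi _] := lawX i i1; exact: (mXi measurableT _ (mpJ l)).
    - by move=> y z e yB zB; apply: close => //; rewrite ltNge; apply/negP.
  have e1 : K k * pr P [set w | B <= `|X i w|] <= Mg * q.
    apply: le_trans (ler_wpM2l (ltW (K0 k)) tail) _.
    rewrite mulrA -{1}[K k](powRr1 (ltW (K0 k))) KD mulrC /q.
    by rewrite (_ : 1 - (2 + delta) = - (1 + delta)); [|ring].
  have e2 : K k * (10 * Num.sqrt (N * 2)%:R * alpha k) <= 30 * q.
    rewrite natrM; apply: (@sqrt_rate_bound g (K k) (x k) (alpha k) N%:R) => //.
    - rewrite Kpow (_ : _ * _ = 1) ?(powRr1 (ltW (x0 k)))//.
      rewrite /th; move: D0; rewrite /D => D0; field.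
      by rewrite !gt_eqF.
    - by rewrite alpha_mix_ge0 rate_ge.
    - by rewrite ler0n/=; exact: NB.
  rewrite /c mulr2n -/q; move: e1 e2; rewrite -[_ *+ 4]mulr_natl.
  by generalize (K k * (10 * Num.sqrt (N * 2)%:R * alpha k)) => u; lra.
exists psi, (2 * M + 3 * (c + M)); split => //; split.
- move=> i j i' j' ij ij' ii'.
  exact: (past_future_left mh hsym hdeg d0 hmom spast mpast sfut dep lawX pX fX momX K0 HK ij ij' ii').
- move=> i j i' j' ij ij' jj'.
  exact: (past_future_right mh hsym hdeg d0 hmom spast mpast dep lawX pX fX momX K0 HK ij ij' jj').
Qed.

End strong_mixing_case.

(** * Functionals: approximation by finitely many values of a window *)

Section sequence_space.
Context (R : realType) (S I : Type).

Lemma sigma_gen_pull (V : I -> S -> R) (J : set I) (G : set (set S)) (A : set (I -> R)) :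
  sigma_algebra setT G -> (forall i, J i -> adapted G (V i)) ->
  sigma_gen (fun i (z : I -> R) => z i) J A -> G [set s | A (fun i => V i s)].
Proof.
move=> sG aV.
have sub : sigma_gen (fun i (z : I -> R) => z i) J `<=` [set A | G [set s | A (fun i => V i s)]].
  apply: smallest_sub => [|_ [i [B [Ji mB ->]]]]; last exact: (aV i Ji B mB).
  split => /=.
  - exact: (salg0 sG).
  - move=> B GB; rewrite (_ : [set s | _] = ~` [set s | B (fun i => V i s)]).
      exact: (salgC sG GB).
    by apply/seteqP; split => s //= -[].
  - move=> B GB; rewrite (_ : [set s | _] = \bigcup_k [set s | B k (fun i => V i s)])//.
    by have [_ _] := sG; apply.
exact: sub.
Qed.

(** Lifting events to the sequence space is what allows them to be shifted in time. *)
Lemma sigma_gen_factor (V : I -> S -> R) (J : set I) (A : set S) : sigma_gen V J A ->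
  exists2 A' : set (I -> R), sigma_gen (fun i (z : I -> R) => z i) J A' &
    A = [set s | A' (fun i => V i s)].
Proof.
have s := @smallest_sigma_algebra (I -> R) setT
  [set A | exists i B, [/\ J i, measurable B & A = (fun z : I -> R => z i) @^-1` B]].
have sub : sigma_gen V J `<=` [set A | exists2 A' : set (I -> R),
   sigma_gen (fun i (z : I -> R) => z i) J A' & A = [set s | A' (fun i => V i s)]].
  apply: smallest_sub => [|_ [i [B [Ji mB ->]]]].
    split => /=.
    - by exists set0 => //; have [] := s.
    - move=> B [B' gB' ->]; exists (~` B'); first exact: (salgC s).
      by rewrite setTD.
    - move=> B HB; have /choice[B' HB'] : forall k, exists A' : set (I -> R),
        sigma_gen (fun i (z : I -> R) => z i) J A' /\ B k = [set s | A' (fun i => V i s)].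
        by move=> k; have [B' ? ?] := HB k; exists B'.
      exists (\bigcup_k B' k); first by have [_ _] := s; apply => k; have [] := HB' k.
      by apply/seteqP; split => x [k _]; have [_ e] := HB' k; rewrite ?e => h; exists k => //; rewrite ?e.
  exists ((fun z : I -> R => z i) @^-1` B) => //.
  by apply: sub_sigma_algebra; exists i, B.
exact: sub.
Qed.

End sequence_space.

Section finite_approximation.
Context (R : realType) d (T : measurableType d) (P : probability T R).

Lemma tail_small (f : T -> R) (e : R) : measurable_fun setT f -> 0 < e ->
  exists2 B, 0 < B & pr P [set x | B <= `|f x|] <= e.
Proof.
move=> mf e0; pose S (n : nat) := [set x | n%:R <= `|f x|].
have mS n : measurable (S n) by apply: measurable_ge; exact: measurableT_comp.
have S0 : \bigcap_n S n = set0.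
  apply/seteqP; split => // x Sx; have := Sx (Num.truncn `|f x|).+1 Logic.I.
  by rewrite /S/= leNgt truncnS_gt.
have : pr P (S n) @[n --> \oo] --> (0 : R).
  rewrite (_ : 0 = fine (P (\bigcap_n S n))); last by rewrite S0 measure0.
  apply: fine_cvg; rewrite fineK; last by rewrite S0 measure0.
  apply: nonincreasing_cvg_mu => //.
  - by rewrite (le_lt_trans (probability_le1 P _))// ltry.
  - by rewrite S0.
  - apply/nonincreasing_seqP => n; apply/subsetPset => x; rewrite /S/=.
    by apply: le_trans; rewrite ler_nat.
move=> /cvgrPdist_le /(_ _ e0)[N _ HN]; exists N.+1%:R => //.
by have := HN N.+1 (leqnSn _); rewrite /= sub0r normrN; apply: le_trans; exact: ler_norm.
Qed.

Lemma markov1 (f : T -> R) (q a : R) : measurable_fun setT f -> 0 < q ->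
  (\int[P]_x (`|f x|)%:E <= a%:E)%E -> pr P [set x | q <= `|f x|] <= a / q.
Proof.
move=> mf q0 fa; have := @moment_tail _ _ _ P f 1 q a mf q0 ltr01.
rewrite powR_inv1 ?(ltW q0)// mulrC; apply.
by under eq_integral do rewrite powRr1//.
Qed.

Lemma cond_exp_adapted (G : set (set T)) (V : T -> R) : sigma_algebra setT G ->
  adapted G (cond_exp P G V).
Proof.
move=> sG; rewrite /cond_exp; case: xgetP => [Y _ [_ _ aY _]|_]; first exact: aY.
move=> B mB; have [B0|B0] := pselect (B 0).
  rewrite (_ : _ @^-1` B = setT); first exact: (salgT sG).
  by apply/seteqP; split.
rewrite (_ : _ @^-1` B = set0); first exact: (salg0 sG).
by apply/seteqP; split.
Qed.

Variables (Z : int -> {RV P >-> R}) (X : nat -> {RV P >-> R}).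
Variable F : (int -> R) -> R.
Hypothesis cF : adapted (@cyl_sigma R int) F.
Hypothesis XF : forall n w, (1 <= n)%N -> X n w = F (fun i => Z (i + n.-1%:Z) w).

(** The conditional expectation given the window is discretized, and its cell is read off finitely
    many events. The code [c] lives on the sequence space, so that one partition serves all times.
    Markov's inequality at [q / 4] yields [4 * a / q]; the term [e] pays for large values of the
    conditional expectation. *)
Lemma finite_approximation (l : nat) (a q e : R) : 0 < q -> 0 < e ->
  ('N[P]_(1%:E)[EFin \o (X 1%N \- cond_exp P (sigma_gen Z [set i | (0 <= i <= l%:Z)]) (X 1%N))%R]
     <= a%:E)%E ->
  exists (N : nat) (c : (int -> R) -> 'I_N) (B : set (int -> R)),
    [/\ forall j, sigma_gen (fun i (z : int -> R) => z i) [set i | (0 <= i <= l%:Z)] [set z | c z = j],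
        @cyl_sigma R int B,
        forall z z', c z = c z' -> ~ B z -> ~ B z' -> `|F z - F z'| <= q &
        pr P [set w | B (fun i => Z i w)] <= 4 * a / q + e].
Proof.
move=> q0 e0 Ha; pose W := [set i | (0 <= i <= l%:Z)].
pose G := sigma_gen Z W.
have sG : sigma_algebra setT G := sigma_gen_algebra _ _.
have sW := @smallest_sigma_algebra (int -> R) setT
  [set A | exists i B, [/\ W i, measurable B & A = (fun z : int -> R => z i) @^-1` B]].
pose Y := cond_exp P G (X 1%N).
have aY : adapted G Y by exact: cond_exp_adapted.
have mY : measurable_fun setT Y.
  by move=> _ B mB; rewrite setTI; exact: (sigma_gen_measurable (aY B mB)).
have Ya : (\int[P]_w (`|X 1%N w - Y w|)%:E <= a%:E)%E by move: Ha; rewrite Lnorm1.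
have [b b0 hb] := tail_small mY e0.
have q4 : 0 < q / 4 by rewrite divr_gt0.
have [N [pJ [mpJ _ close]]] := line_partition b0 q4.
(* One point per cell, taken inside the interval where [|u| < b]; the default 0 concerns the cells
   that contain no such point. *)
pose y j : R := xget 0 [set u | pJ u = j /\ `|u| < b].
have yP u : `|u| < b -> `|u - y (pJ u)| <= q / 4.
  move=> ub; have : [set u' | pJ u' = pJ u /\ `|u'| < b] (y (pJ u)).
    by apply: xgetPex; exists u.
  by move=> [e1 e2]; apply: close.
have /choice[A HA] : forall j, exists A' : set (int -> R),
    sigma_gen (fun i (z : int -> R) => z i) W A' /\
    [set w | pJ (Y w) = j] = [set w | A' (fun i => Z i w)].
  move=> j; have := aY _ (mpJ j); move/sigma_gen_factor => [A' ? ?]; by exists A'.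
(* Along the process exactly one of the events [A j] occurs and [g] returns its index; for other
   sequences any value will do, provided it depends on these events only. *)
pose g (v : {ffun 'I_N -> bool}) : 'I_N := odflt (pJ 0) [pick j | v j].
pose c z := g [ffun j => z \in A j].
have cE w : c (fun i => Z i w) = pJ (Y w).
  rewrite /c /g; case: pickP => [j|/(_ (pJ (Y w)))]; rewrite ffunE.
    move=> /set_mem Aj; have [_ e1] := HA j.
    by have : [set w | pJ (Y w) = j] w by rewrite e1.
  have [_ e1] := HA (pJ (Y w)).
  by rewrite mem_set//; have : [set w' | pJ (Y w') = pJ (Y w)] w by []; rewrite e1.
have mc j : sigma_gen (fun i (z : int -> R) => z i) W [set z | c z = j].
  by apply: salg_code => // i; have [] := HA i.
have sC := @cyl_sigma_algebra R int.
have mcc j : @cyl_sigma R int [set z | c z = j].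
  by apply: sigma_gen_sub (mc j).
pose B := [set z | q / 2 < `|F z - y (c z)|].
have cB : @cyl_sigma R int B.
  rewrite (_ : B = \bigcup_(j : 'I_N) ([set z | c z = j] `&` F @^-1` [set u | q / 2 < `|u - y j|])).
    apply: (salg_countU sC) => j; apply: (salgI sC) => //; apply: cF.
    rewrite (_ : [set u | _] = ~` [set u | `|u - y j| <= q / 2]).
      apply: measurableC.
      rewrite (_ : [set u | _] = [set u | 0 <= q / 2 - `|u - y j|]).
        apply: measurable_ge; apply: measurable_funB => //.
        by apply: measurableT_comp => //; exact: measurable_funB.
      by apply/seteqP; split => u /=; rewrite subr_ge0.
    by apply/seteqP; split => u /=; rewrite ltNge => /negP.
  apply/seteqP; split => z; first by move=> Bz; exists (c z).
  by move=> [j _ [/= <-]].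
exists N, c, B; split => //.
- move=> z z' cc; rewrite /B/= => /negP; rewrite -leNgt => h1 /negP; rewrite -leNgt => h2.
  rewrite (_ : _ - _ = (F z - y (c z)) - (F z' - y (c z'))); last by rewrite cc; ring.
  by rewrite (le_trans (ler_normB _ _))// (_ : q = q / 2 + q / 2) ?lerD//; field.
- have mXY : measurable_fun setT (fun w => X 1%N w - Y w) by exact: measurable_funB.
  have m1 : measurable [set w | q / 4 <= `|X 1%N w - Y w|].
    by apply: measurable_ge; exact: measurableT_comp.
  have m2 : measurable [set w | b <= `|Y w|] by apply: measurable_ge; exact: measurableT_comp.
  have mB : measurable [set w | B (fun i => Z i w)].
    apply: (@sigma_gen_measurable _ _ _ _ P Z setT).
    apply: (sigma_gen_pull (sigma_gen_algebra _ _) _ cB) => i _.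
    exact: sigma_gen_adapted.
  apply: (@le_trans _ _ (pr P ([set w | q / 4 <= `|X 1%N w - Y w|] `|` [set w | b <= `|Y w|]))).
    apply: le_pr => //; first exact: measurableU.
    move=> w; rewrite /B/= cE => h1; apply: contrapT => /not_orP[/negP + /negP].
    rewrite -!ltNge => h2 h3.
    have h4 := yP _ h3.
    have FX : F (fun i => Z i w) = X 1%N w.
      by rewrite XF//=; congr F; apply/funext => i; rewrite addr0.
    move: h1; rewrite FX ltNge => /negP; apply.
    rewrite (_ : _ - _ = (X 1%N w - Y w) + (Y w - y (pJ (Y w)))); last by ring.
    rewrite (le_trans (ler_normD _ _))// (_ : q / 2 = q / 4 + q / 4); last by field.
    by rewrite lerD// ltW.
  have h1 := markov1 mXY q4 Ya.
  rewrite (_ : 4 * a / q = a / (q / 4)); last by field; rewrite gt_eqF.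
  apply: le_trans (lerD h1 hb).
  rewrite -lee_fin EFinD !prE//; [|exact: measurableU].
  exact: measureU2.
Qed.

End finite_approximation.

(** * Replacing both arguments of the kernel by representatives *)

Section representatives.
Context (R : realType) d (T : measurableType d) d' (S : measurableType d') (P : probability T R).
Variables (phi : T -> S) (N : nat) (J : T -> 'I_N) (theta : R).
Hypothesis mphi : measurable_fun setT phi.
Hypothesis mJ : forall j, measurable [set x | J x = j].
Hypothesis dep : forall A : 'I_N -> set S, (forall j, measurable (A j)) ->
  \sum_j (pr P ([set x | J x = j] `&` phi @^-1` (A j)) -
          pr P [set x | J x = j] * pr P (phi @^-1` (A j))) <= theta.

Lemma mean_fibers (g : 'I_N -> R) :
  mean P (fun x => g (J x)) = \sum_j pr P [set x | J x = j] * g j.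
Proof.
transitivity (mean P (fun x => \sum_j \1_[set x | J x = j] x * g j)).
  apply: eq_mean => x; rewrite (bigD1 (J x))//= indicE mem_set// mul1r big1 ?addr0// => i iJ.
  by rewrite indicE memNset ?mul0r//= => e; rewrite e eqxx in iJ.
have b1 j : bdd (\1_[set x | J x = j] : T -> R) by exact: bdd_indic.
rewrite mean_sum; last by move=> j; bdd_tac.
apply: eq_bigr => j _; under eq_mean do rewrite mulrC.
by rewrite meanZ// mean_indic// mulrC.
Qed.

(** In the coupling nothing changes where the two values of [J] agree, and they differ with
    probability at most [theta]; the second value is independent of [phi]. *)
Lemma dependence_mean (Phi : 'I_N -> S -> R) (K : R) :
  (forall j, measurable_fun setT (Phi j)) -> (forall j s, 0 <= Phi j s <= K) ->
  mean P (fun x => Phi (J x) (phi x)) <=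
  \sum_j pr P [set x | J x = j] * mean P (fun x => Phi j (phi x)) + K * theta.
Proof.
move=> mPhi Phi0K.
have bPhi j : bdd (Phi j).
  by apply: (@bdd_le _ _ _ _ K) => // s; have /andP[? ?] := Phi0K j s; rewrite ger0_norm.
have [Q [Q1 Q2 Q3 _]] := coupling_measure mphi mJ dep.
have b1 : bdd (fun x => Phi (J x) (phi x)).
  apply: (@bdd_ext _ _ _ (fun x => \sum_j (J x == j)%:R * Phi j (phi x))).
    move=> x; rewrite (bigD1 (J x))//= eqxx mul1r big1 ?addr0// => i iJ.
    by rewrite eq_sym (negbTE iJ) mul0r.
  apply: bdd_sum => j; apply: bddM; first exact: (bdd_fibers mJ (fun i => (i == j)%:R)).
  exact: (bdd_comp mphi).
have b2 : bdd (fun z : S * T => Phi (J z.2) z.1).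
  apply: (@bdd_ext _ _ _ (fun z : S * T => \sum_j (J z.2 == j)%:R * Phi j z.1)).
    move=> x; rewrite (bigD1 (J x.2))//= eqxx mul1r big1 ?addr0// => i iJ.
    by rewrite eq_sym (negbTE iJ) mul0r.
  apply: bdd_sum => j; apply: bddM; last exact: (bdd_comp measurable_fst).
  exact: (bdd_comp measurable_snd (bdd_fibers mJ (fun i => (i == j)%:R))).
have bne : bdd (fun z : T * T => (J z.1 != J z.2)%:R : R) := bdd_fibers2 mJ (fun i j => (i != j)%:R).
have mpp : measurable_fun setT (fun z : T * T => (phi z.1, z.2)).
  by apply: measurable_fun_pair => //; exact: (measurableT_comp mphi measurable_fst).
have b3 : bdd (fun z : T * T => Phi (J z.2) (phi z.1)) := bdd_comp mpp b2.
have b4 : bdd (fun z : T * T => Phi (J z.1) (phi z.1)) := bdd_fst b1.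
have K0 : 0 <= K.
  have := pr_setT P; have [x _|T0] := pselect (exists x : T, True); last first.
    by rewrite (_ : setT = set0) /pr ?measure0/=; [move/eqP; rewrite eq_sym oner_eq0|apply/seteqP; split => x // _; apply: T0; exists x].
  by have [x0 _] := x; have /andP[? ?] := Phi0K (J x0) (phi x0); lra.
rewrite -(Q1 _ b1).
apply: (@le_trans _ _ (mean Q (fun z => Phi (J z.2) (phi z.1) + K * (J z.1 != J z.2)%:R))).
  apply: le_mean => //; first by apply: bddD => //; exact: bddZ.
  move=> z; have [->|ne] := eqVneq (J z.1) (J z.2); first by rewrite mulr0 addr0.
  have /andP[_ ?] := Phi0K (J z.1) (phi z.1); have /andP[? _] := Phi0K (J z.2) (phi z.1).
  by rewrite mulr1 (le_trans (y := K))// lerDr.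
rewrite meanD//; last exact: bddZ.
rewrite meanZ// lerD//; last exact: ler_wpM2l.
rewrite (Q2 (fun z => Phi (J z.2) z.1) b2).
by have [_ ->] := mean_prod P P b3; rewrite -(mean_fibers (fun j => mean P (fun x => Phi j (phi x)))).
Qed.

End representatives.

Section representative_step.
Context (R : realType) d (T : measurableType d) (P : probability T R).
Variables (X : nat -> {RV P >-> R}) (h : R * R -> R) (L : R).
Let mu : probability R R := distribution P (X 1%N).
Hypothesis mh : measurable_fun setT h.
Hypothesis hsym : forall x y, h (x, y) = h (y, x).
Hypothesis lip : lipschitz_coupling X h L.
Variables (K q : R).
Hypothesis K0 : 0 < K.
Hypothesis q0 : 0 < q.
Let xi x y := trunc K (h (x, y)).

Let mxi : measurable_fun setT (fun z : R * R => trunc K (h z)).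
Proof. exact: (measurableT_comp (measurable_trunc K)). Qed.

(** The pair formed by a representative of [U] and the actual [V] has a law that [lip] does not
    cover. In the coupling the second point is random and its pair with [V] has the product law, so
    [lip] bounds the mean error; a good fixed choice then exists by averaging. [F2] is carried along
    so that one choice serves two purposes. *)
Lemma representative_step d0 (T0 : measurableType d0) (P0 : probability T0 R)
    d' (S : measurableType d') (U V : T0 -> R) (phi : T0 -> S) (v : S -> R)
    (N : nat) (J : T0 -> 'I_N) (B : set T0) (theta : R) (F2 : T0 -> R) :
  has_law mu P0 U -> has_law mu P0 V ->
  admissible_law X (fun A => P0 [set w | A (U w, V w)]) ->
  measurable_fun setT phi -> measurable_fun setT v -> V =1 v \o phi ->
  (forall j, measurable [set x | J x = j]) -> measurable B ->
  (forall x y, J x = J y -> ~ B x -> ~ B y -> `|U x - U y| <= q) ->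
  (forall A : 'I_N -> set S, (forall j, measurable (A j)) ->
  \sum_j (pr P0 ([set x | J x = j] `&` phi @^-1` (A j)) -
          pr P0 [set x | J x = j] * pr P0 (phi @^-1` (A j))) <= theta) ->
  bdd F2 ->
  exists y : 'I_N -> T0,
    mean P0 (fun w => `|xi (U w) (V w) - xi (U (y (J w))) (V w)|) +
    \sum_j pr P0 [set x | J x = j] * F2 (y j) <=
    L * q + K * pr P0 B *+ 4 + mean P0 F2 + 2 * K * theta.
Proof.
move=> lU lV adm mphi mv Vv mJ mB close dep bF2.
have [mU _] := lU; have [mV _] := lV.
have [Q [Q1 Q2 _ Q4]] := coupling_measure mphi mJ dep.
have Hd := lipschitz_defect mh lip lU lV adm mv Vv mJ mB K0 q0 close (conj Q1 Q2).
pose F (z : T0 * T0) : R := `|xi (U z.1) (V z.1) - xi (U z.2) (V z.1)|.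
have bxi1 : bdd (fun z : T0 * T0 => xi (U z.1) (V z.1)).
  apply: bdd_trunc; first exact: ltW.
  apply: (measurableT_comp mh); apply: measurable_fun_pair.
    exact: (measurableT_comp mU measurable_fst).
  exact: (measurableT_comp mV measurable_fst).
have bxi2 : bdd (fun z : T0 * T0 => xi (U z.2) (V z.1)).
  apply: bdd_trunc; first exact: ltW.
  apply: (measurableT_comp mh); apply: measurable_fun_pair.
    exact: (measurableT_comp mU measurable_snd).
  exact: (measurableT_comp mV measurable_fst).
have bF : bdd F by rewrite /F; bdd_tac.
have F2K z : 0 <= F z <= 2 * K.
  rewrite normr_ge0/= (le_trans (ler_normB _ _))// (_ : 2 * K = K + K); last by ring.
  by rewrite lerD// trunc_le// ltW.
have [y Hy] := Q4 F F2 (2 * K) bF bF2 F2K.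
by exists y; apply: le_trans Hy _; rewrite !lerD2r.
Qed.

Lemma product_admissible d0 (T0 : measurableType d0) (P0 : probability T0 R) (U V : T0 -> R) :
  has_law mu P0 U -> has_law mu P0 V ->
  [/\ has_law mu (P0 \x P0)%E (U \o fst), has_law mu (P0 \x P0)%E (V \o snd) &
    admissible_law X (fun A => (P0 \x P0)%E [set z | A (V z.2, U z.1)])].
Proof.
move=> lU lV; have [mU eU] := lU; have [mV eV] := lV.
have [mUV lUV] := has_law_prod lU lV.
have pre1 (A : set R) : measurable A -> (P0 \x P0)%E ((U \o fst) @^-1` A) = mu A.
  move=> mA; have mA' : measurable (A `*` setT : set (R * R)) by exact: measurableX.
  have e : (mu \x mu)%E (A `*` setT) = mu A.
    have := product_measure1E mu mu mA (@measurableT _ R) => ->.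
    by rewrite -[RHS]mule1; congr (_ * _)%E; exact: probability_setT.
  rewrite -e (lUV _ mA'); congr (_ _).
  by apply/seteqP; split => z //= [].
have pre2 (A : set R) : measurable A -> (P0 \x P0)%E ((V \o snd) @^-1` A) = mu A.
  move=> mA; have mA' : measurable (setT `*` A : set (R * R)) by exact: measurableX.
  have e : (mu \x mu)%E (setT `*` A) = mu A.
    have := product_measure1E mu mu (@measurableT _ R) mA => ->.
    by rewrite -[RHS]mul1e; congr (_ * _)%E; exact: probability_setT.
  rewrite -e (lUV _ mA'); congr (_ _).
  by apply/seteqP; split => z //= [].
split.
- by split => //; exact: (measurableT_comp mU measurable_fst).
- by split => //; exact: (measurableT_comp mV measurable_snd).
right => A mA; rewrite -/mu.
have msw : measurable_fun setT (fun z : R * R => (z.2, z.1)) by apply: measurable_fun_pair.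
have bA : bdd (\1_A : R * R -> R) by exact: bdd_indic.
have mVU : measurable_fun setT (fun z : T0 * T0 => (V z.2, U z.1)).
  apply: measurable_fun_pair; first exact: (measurableT_comp mV measurable_snd).
  exact: (measurableT_comp mU measurable_fst).
have mB : measurable [set z : T0 * T0 | A (V z.2, U z.1)].
  by rewrite -[X in measurable X]setTI; exact: mVU.
rewrite -(prE (P0 \x P0)%E mB) -(prE (mu \x mu)%E mA) -!mean_indic//; congr EFin.
have [_ ->] := mean_prod mu mu bA.
have b1 := bdd_mean2 mu bA.
rewrite (mean_map (P := P0) (Q := mu) mU _ b1); last by move=> B mB'; rewrite eU.
have [-> _] := mean_prod P0 P0 (bdd_comp mVU bA).
apply: eq_mean => x /=.
by rewrite (mean_map (P := P0) (Q := mu) mV _ (bdd_comp (pair2_measurable (U x)) bA))// => B mB'; rewrite eV.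
Qed.

(** First [y] is chosen against an independent copy of [X i], where no decoupling cost arises. Then
    [x] is chosen so that the error caused by [y] stays small at the points [x k]. Finally
    [dependence_mean] carries this error from independent arguments to the actual pair. *)
Lemma representatives (i j : nat) (N : nat) (Ji Jj : T -> 'I_N) (Bi Bj : set T)
    (theta bad : R) : stationary_nat X ->
  (1 <= i < j)%N ->
  (forall k, measurable [set x | Ji x = k]) -> (forall k, measurable [set x | Jj x = k]) ->
  measurable Bi -> measurable Bj -> pr P Bi <= bad -> pr P Bj <= bad ->
  (forall x y, Ji x = Ji y -> ~ Bi x -> ~ Bi y -> `|X i x - X i y| <= q) ->
  (forall x y, Jj x = Jj y -> ~ Bj x -> ~ Bj y -> `|X j x - X j y| <= q) ->
  (forall (y : 'I_N -> R) (A : 'I_N -> set (R * R)), (forall k, measurable (A k)) ->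
  \sum_k (pr P ([set x | Ji x = k] `&` (fun x => (X j x, y (Jj x))) @^-1` (A k)) -
     pr P [set x | Ji x = k] * pr P ((fun x => (X j x, y (Jj x))) @^-1` (A k))) <= theta) ->
  exists x y : 'I_N -> R,
    mean P (fun w => `|xi (X i w) (X j w) - xi (x (Ji w)) (y (Jj w))|) <=
    2 * (L * q) + 8 * (K * bad) + 4 * (K * theta).
Proof.
move=> sX ij mJi mJj mBi mBj pBi pBj ci cj dep.
have arith (u1 u2 u3 u4 a k b bi bj t : R) : u1 + u2 <= a + k * bi *+ 4 + u4 + 2 * k * t ->
    u3 <= u2 + 2 * k * t -> u4 <= a + k * bj *+ 4 -> k * bi <= k * b -> k * bj <= k * b ->
    u1 + u3 <= 2 * a + 8 * (k * b) + 4 * (k * t).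
  by lra.
have [i1 j1] : (1 <= i)%N /\ (1 <= j)%N by move: ij; clear; lia.
have lU := stationary_law sX i1; have lV := stationary_law sX j1.
have [lU' lV' adm'] := product_admissible lU lV.
have [mU _] := lU; have [mV _] := lV.
have mJj' k : measurable [set z : T * T | Jj z.2 = k].
  by rewrite -[X in measurable X]setTI; exact: (@measurable_snd _ _ T T measurableT _ (mJj k)).
have mBj' : measurable [set z : T * T | Bj z.2].
  by rewrite -[X in measurable X]setTI; exact: (@measurable_snd _ _ T T measurableT _ mBj).
have prX (A B : set T) : measurable A -> measurable B ->
    pr (P \x P)%E (A `*` B) = pr P A * pr P B.
  move=> mA mB; rewrite /pr -fineM ?fin_num_measure//; congr fine.
  exact: (product_measure1E P P mA mB).
(* On the product space the code of the second point is independent of the first point, so the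
   dependence is 0. *)
have dep0 (A : 'I_N -> set T) : (forall k, measurable (A k)) ->
  \sum_k (pr (P \x P)%E ([set z | Jj z.2 = k] `&` fst @^-1` (A k)) -
     pr (P \x P)%E [set z | Jj z.2 = k] * pr (P \x P)%E (fst @^-1` (A k))) <= 0.
  move=> mA; rewrite big1// => k _.
  rewrite (_ : _ `&` _ = A k `*` [set x | Jj x = k]); last first.
    by apply/seteqP; split => z //= [].
  rewrite (_ : [set z | _] = setT `*` [set x | Jj x = k]); last first.
    by apply/seteqP; split => z //= [].
  rewrite (_ : _ @^-1` _ = A k `*` setT); last first.
    by apply/seteqP; split => z //= [].
  by rewrite !prX// !pr_setT mul1r mulr1 mulrC subrr.
have [r1 Hr1] := representative_step (U := X j \o snd) (V := X i \o fst) (v := X i)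
  lV' lU' adm' measurable_fst mU (fun=> erefl) mJj' mBj'
  (fun z z' => cj z.2 z'.2) dep0 (bdd_cst _ 0).
have pBj' : pr (P \x P)%E [set z : T * T | Bj z.2] = pr P Bj.
  rewrite (_ : [set z | _] = setT `*` Bj); last by apply/seteqP; split => z //= [].
  by rewrite prX// pr_setT mul1r.
rewrite mean_cst pBj' mulr0 !addr0 big1 ?addr0 in Hr1; last by move=> k _; rewrite mulr0.
pose y k := X j (r1 k).2.
have mphi : measurable_fun setT (fun x => (X j x, y (Jj x))).
  by apply: measurable_fun_pair => //; case: (bdd_fibers mJj y).
(* The error caused by [y] when the first argument is frozen at [X i w]; this is the second
   functional in the choice of [x]. *)
pose F2 w := mean P (fun w' => `|xi (X i w) (X j w') - xi (X i w) (y (Jj w'))|).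
have mP1 : measurable_fun setT (fun z : T * T => (X i z.1, X j z.2)).
  apply: measurable_fun_pair; first exact: (measurableT_comp mU measurable_fst).
  exact: (measurableT_comp mV measurable_snd).
have mP2 : measurable_fun setT (fun z : T * T => (X i z.1, y (Jj z.2))).
  apply: measurable_fun_pair; first exact: (measurableT_comp mU measurable_fst).
  by apply: (measurableT_comp (f := fun x => y (Jj x)) _ measurable_snd); case: (bdd_fibers mJj y).
have bH : bdd (fun z : T * T => `|xi (X i z.1) (X j z.2) - xi (X i z.1) (y (Jj z.2))|).
  apply: bdd_norm; apply: bddB; apply: bdd_trunc; try exact: ltW.
    exact: (measurableT_comp mh mP1).
  exact: (measurableT_comp mh mP2).
have bF2 : bdd F2 by exact: (bdd_mean1 P bH).
have mF2 : mean P F2 <= L * q + K * pr P Bj *+ 4.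
  have [<- _] := mean_prod P P bH.
  apply: le_trans Hr1; rewrite le_eqVlt; apply/orP; left; apply/eqP; apply: eq_mean => z /=.
  by rewrite /xi /y hsym [h (X i z.1, _)]hsym.
have adm : admissible_law X (fun A => P [set w | A (X i w, X j w)]).
  exact: (stationary_admissible sX ij).
have [r2 Hr2] := representative_step (U := X i) (V := X j) (v := fst) (phi := fun x => (X j x, y (Jj x)))
  lU lV adm mphi measurable_fst (fun=> erefl) mJi mBi ci (dep y) bF2.
pose x k := X i (r2 k).
pose Phi k (s : R * R) : R := `|xi (x k) s.1 - xi (x k) s.2|.
have mPhi k : measurable_fun setT (Phi k).
  apply: measurableT_comp => //; apply: measurable_funB.
    apply: (measurableT_comp mxi (g := fun s : R * R => (x k, s.1))).
    exact: measurable_fun_pair.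
  apply: (measurableT_comp mxi (g := fun s : R * R => (x k, s.2))).
  exact: measurable_fun_pair.
have Phi0K k s : 0 <= Phi k s <= 2 * K.
  rewrite normr_ge0/= (le_trans (ler_normB _ _))// (_ : 2 * K = K + K); last by ring.
  by rewrite lerD// trunc_le// ltW.
have H3 := dependence_mean mphi mJi (dep y) mPhi Phi0K.
exists x, y.
have bxi1 : bdd (fun w => xi (X i w) (X j w)).
  by apply: bdd_trunc; [exact: ltW|exact: (measurableT_comp mh (measurable_fun_pair mU mV))].
have mxJ : measurable_fun setT (fun w => x (Ji w)) by case: (bdd_fibers mJi x).
have myJ : measurable_fun setT (fun w => y (Jj w)) by case: (bdd_fibers mJj y).
have bxi2 : bdd (fun w => xi (x (Ji w)) (X j w)).
  by apply: bdd_trunc; [exact: ltW|exact: (measurableT_comp mh (measurable_fun_pair mxJ mV))].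
have bxi3 : bdd (fun w => xi (x (Ji w)) (y (Jj w))).
  by apply: bdd_trunc; [exact: ltW|exact: (measurableT_comp mh (measurable_fun_pair mxJ myJ))].
apply: (@le_trans _ _ (mean P (fun w => `|xi (X i w) (X j w) - xi (x (Ji w)) (X j w)| +
    Phi (Ji w) (X j w, y (Jj w))))).
  apply: le_mean => [| |w]; first by bdd_tac.
    by apply: bddD; rewrite /Phi/=; bdd_tac.
  rewrite /Phi/= (le_trans _ (ler_normD _ _))// le_eqVlt; apply/orP; left; apply/eqP.
  by congr (`|_|); ring.
rewrite meanD; [|by bdd_tac|by rewrite /Phi/=; bdd_tac].
have e3 : \sum_k pr P [set x0 | Ji x0 = k] * F2 (r2 k) =
   \sum_k pr P [set x0 | Ji x0 = k] * mean P (fun x0 => Phi k (X j x0, y (Jj x0))) by [].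
rewrite -e3 in H3.
have Kb1 : K * pr P Bi <= K * bad by rewrite ler_wpM2l// ltW.
have Kb2 : K * pr P Bj <= K * bad by rewrite ler_wpM2l// ltW.
exact: (arith _ _ _ _ _ _ _ _ _ _ Hr2 H3 mF2 Kb1 Kb2).
Qed.

End representative_step.

(** * Window kernels and their covariances *)

Section functional_windows.
Context (R : realType) d (T : measurableType d) (P : probability T R).
Variables (X : nat -> {RV P >-> R}) (Z : int -> {RV P >-> R}) (h : R * R -> R).
Variables (delta M L : R) (a x : nat -> R) (f : (nat -> R) -> R).
Let mu : probability R R := distribution P (X 1%N).
Hypothesis sX : stationary_nat X.
Hypothesis mh : measurable_fun setT h.
Hypothesis hsym : forall x y, h (x, y) = h (y, x).
Hypothesis hdeg : forall x : R, (\int[mu]_y (h (x, y))%:E = 0)%E.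
Hypothesis d0 : 0 < delta.
Hypothesis hmom : (\int[(mu \x mu)%E]_z (`|h z| `^ (2 + delta))%:E <= M%:E)%E.
Hypothesis hmomX : forall k : nat, (1 <= k)%N ->
  (\int[P]_w (`|h (X 1%N w, X k w)| `^ (2 + delta))%:E <= M%:E)%E.
Hypothesis L0 : 0 < L.
Hypothesis lip : lipschitz_coupling X h L.
Hypothesis sZ : stationary_int Z.
Hypothesis cf : forall B : set R, measurable B -> cyl_sigma (f @^-1` B).
Hypothesis Xf : forall (n : nat) (w : T), (1 <= n)%N -> X n w = f (fun k => Z (n + k)%:Z w).
Hypothesis approx : forall l : nat,
  ('N[P]_(1%:E)[EFin \o (X 1%N \- cond_exp P (sigma_gen Z [set i | (0 <= i <= l%:Z)]) (X 1%N))%R]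
     <= (a l)%:E)%E.
Hypothesis x01 : forall l, 0 < x l <= 1.
Hypothesis x_dec : forall l m, (l <= m)%N -> x m <= x l.
Hypothesis x_beta : forall l, 1 <= x l \/ exists2 k, (k <= l)%N & beta_reg Z k <= x l.
Hypothesis x_approx : forall l, 1 <= x l \/ 2 * a l <= x l ^+ 2.

Let K l := x l `^ (- (2 + delta)^-1).
Let q l := K l `^ (- (1 + delta)).

Let x0 l : 0 < x l. Proof. by case/andP: (x01 l). Qed.
Let x1 l : x l <= 1. Proof. by case/andP: (x01 l). Qed.
Let d20 : 0 < 2 + delta. Proof. by rewrite addr_gt0. Qed.
Let K0 l : 0 < K l. Proof. by rewrite powR_gt0. Qed.
Let q0 l : 0 < q l. Proof. by rewrite powR_gt0. Qed.

Lemma level_pow l s : K l `^ (- s) = x l `^ (s / (2 + delta)).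
Proof. by rewrite /K -powRrM; congr (_ `^ _); field; rewrite gt_eqF. Qed.

Lemma level_mul l : K l * x l = q l.
Proof.
rewrite /q level_pow /K -{2}[x l](powRr1 (ltW (x0 l))) -powRD; last first.
  by rewrite (gt_eqF (x0 l)) implybT.
by congr (_ `^ _); field; rewrite gt_eqF.
Qed.

Lemma width_ge l : x l <= q l.
Proof.
rewrite /q level_pow -[leLHS](powRr1 (ltW (x0 l))); apply: ger_powR; first exact: x01.
by rewrite ler_pdivrMr// mul1r; lra.
Qed.

Lemma level_nondecreasing l m : (l <= m)%N -> K l <= K m.
Proof.
move=> lm; rewrite /K !powRN lef_pV2 ?posrE ?powR_gt0//.
by rewrite ge0_ler_powR ?nnegrE ?(ltW (x0 _)) ?x_dec// invr_ge0 ltW.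
Qed.

Lemma width_nonincreasing l m : (l <= m)%N -> q m <= q l.
Proof.
move=> lm; rewrite /q !level_pow ge0_ler_powR ?nnegrE ?(ltW (x0 _)) ?x_dec//.
by rewrite divr_ge0 ?addr_ge0// ltW.
Qed.

Let past n := sigma_gen Z [set i | i <= n%:Z].
Let fut n := sigma_gen Z [set i | n%:Z <= i].

(** A coefficient of smaller index also bounds the dependence at distance [l], because the future
    shrinks with the distance. In the other case of [x_beta] the bound is that of a sum of
    probabilities of disjoint events. *)
Lemma dependence_window (n l N : nat) (J : T -> 'I_N) (A : 'I_N -> set T) : (1 <= n)%N ->
  (forall j, past n [set w | J w = j]) -> (forall j, fut (n + l)%N (A j)) ->
  \sum_j (pr P ([set w | J w = j] `&` A j) - pr P [set w | J w = j] * pr P (A j)) <= x l.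
Proof.
move=> n1 pJ fA.
have mJ j : measurable [set w | J w = j] := sigma_gen_measurable (pJ j).
have mA j : measurable (A j) := sigma_gen_measurable (fA j).
case: (x_beta l) => [x1'|[k kl bk]].
  apply: le_trans x1'; rewrite -(sum_pr_fibers P mJ); apply: ler_sum => j _.
  rewrite lerBlDr (le_trans (le_pr P (measurableI _ _ (mJ j) (mA j)) (mJ j) (@subIsetl _ _ _)))//.
  by rewrite lerDl mulr_ge0// pr_ge0.
apply: le_trans bk; apply: (beta_reg_dependence n1 pJ) => [j|i j ij].
  apply: sigma_gen_sub (fA j) => i /=; apply: le_trans.
  by rewrite lez_nat leq_add2l.
by apply/seteqP; split => // w [/= -> /eqP]; rewrite (negbTE ij).
Qed.

Lemma functional_future (n m : nat) : (1 <= n)%N -> (m <= n)%N -> adapted (fut m) (X n : T -> R).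
Proof.
move=> n1 mn B mB.
rewrite (_ : _ @^-1` B = [set w | (f @^-1` B) (fun k => Z (n + k)%:Z w)]); last first.
  by apply/seteqP; split => w; rewrite /= Xf.
apply: (sigma_gen_pull (V := fun (k : nat) w => Z (n + k)%:Z w) (sigma_gen_algebra _ _) _ (cf mB)).
move=> k _; apply: (@sigma_gen_adapted R _ T int (fun i => Z i : T -> R)) => /=.
by rewrite lez_nat; exact: leq_trans (leq_addr _ _).
Qed.

(** The conditioning starts at [Z 0] while [X 1] starts at [Z 1], hence the window from [n.-1] on.
    In [3 * x l], two units come from Markov's inequality, by [2 * a l <= x l ^ 2 <= x l * q l], and
    one is the [e] of [finite_approximation]. *)
Lemma window_partition (l : nat) : exists (N : nat) (J : nat -> T -> 'I_N) (B : nat -> set T),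
  forall n, (1 <= n)%N ->
  [/\ forall j, sigma_gen Z [set i | (n.-1%:Z <= i <= (n.-1 + l)%:Z)] [set w | J n w = j],
      measurable (B n), pr P (B n) <= 3 * x l &
      forall w w', J n w = J n w' -> ~ B n w -> ~ B n w' -> `|X n w - X n w'| <= q l].
Proof.
pose F (z : int -> R) := f (fun k => z (1 + k)%:Z).
have cF : adapted (@cyl_sigma R int) F.
  move=> B mB; apply: (sigma_gen_pull (V := fun (k : nat) (z : int -> R) => z (1 + k)%:Z)
    (@cyl_sigma_algebra R int) _ (cf mB)) => k _.
  exact: cyl_adapted.
have XF n w : (1 <= n)%N -> X n w = F (fun i => Z (i + n.-1%:Z) w).
  move=> n1; rewrite Xf// /F; congr f; apply/funext => k.
  by rewrite -PoszD; congr (Z _ w); congr Posz; move: n1; clear; lia.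
have [N [c [B [mc cB close pB]]]] := finite_approximation cF XF (q0 l) (x0 l) (approx l).
exists N, (fun n w => c (fun i => Z (i + n.-1%:Z) w)), (fun n => [set w | B (fun i => Z (i + n.-1%:Z) w)]).
move=> n n1.
have mB : measurable [set w | B (fun i => Z (i + n.-1%:Z) w)].
  apply: (@sigma_gen_measurable _ _ _ _ P Z setT).
  apply: (sigma_gen_pull (V := fun i w => Z (i + n.-1%:Z) w) (sigma_gen_algebra _ _) _ cB) => i _.
  exact: sigma_gen_adapted.
have pBn : pr P [set w | B (fun i => Z (i + n.-1%:Z) w)] <= 3 * x l.
  have [x1'|ax] := x_approx l; first by have := pr_le1 P mB; lra.
  rewrite /pr (sZ n.-1%:Z cB) -/(pr P _); apply: le_trans pB _.
  have : 4 * a l / q l <= 2 * x l.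
    rewrite ler_pdivrMr//.
    have := ler_wpM2l (ltW (x0 l)) (width_ge l); move: ax; rewrite expr2.
    by move: (a l) (x l) (q l) => u v t; lra.
  by move: (4 * a l / q l) => u; lra.
split => //.
- move=> j; apply: (sigma_gen_pull (V := fun i w => Z (i + n.-1%:Z) w) (sigma_gen_algebra _ _) _ (mc j)).
  move=> i /= /andP[i0 il]; apply: (@sigma_gen_adapted R _ T int (fun i => Z i : T -> R)) => /=.
  by rewrite PoszD [n.-1%:Z + l%:Z]addrC lerD2r il andbT lerDr.
- by move=> w w' cc Bw Bw'; rewrite !XF//; exact: close.
Qed.

(** Of the 28, a part 24 is due to bad events of probability at most [3 * x l] in [representatives]
    and a part 4 to decoupling; [K l * x l = q l] turns both into multiples of [q l]. *)
Definition window_kernel (l i j : nat) (g : T -> R) : Prop :=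
  [/\ forall w, `|g w| <= K l,
      adapted (sigma_gen Z [set m | (i.-1%:Z <= m <= (j.-1 + l)%:Z)]) g &
      mean P (fun w => `|trunc (K l) (h (X i w, X j w)) - g w|) <= (2 * L + 28) * q l].

(** The window of [X i] has length [l] and must be followed by a gap [l]; one more unit is needed
    because the window of [X j] starts at [j.-1]. *)
Lemma window_kernel_exists (l i j : nat) : (1 <= i)%N -> (i + 2 * l + 1 <= j)%N ->
  exists g, window_kernel l i j g.
Proof.
move=> i1 ij; have ij' : (1 <= i < j)%N by move: i1 ij; clear; lia.
have j1 : (1 <= j)%N by move: i1 ij; clear; lia.
have [N [J [B HJ]]] := window_partition l.
have [cJi mBi pBi ci] := HJ i i1; have [cJj mBj pBj cj] := HJ j j1.
have mJi k : measurable [set w | J i w = k] := sigma_gen_measurable (cJi k).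
have mJj k : measurable [set w | J j w = k] := sigma_gen_measurable (cJj k).
have dep (y : 'I_N -> R) (A : 'I_N -> set (R * R)) : (forall k, measurable (A k)) ->
  \sum_k (pr P ([set w | J i w = k] `&` (fun w => (X j w, y (J j w))) @^-1` (A k)) -
     pr P [set w | J i w = k] * pr P ((fun w => (X j w, y (J j w))) @^-1` (A k))) <= x l.
  move=> mA; apply: (@dependence_window (i + l)%N l); first by rewrite (leq_trans i1)// leq_addr.
    move=> k; apply: sigma_gen_sub (cJi k) => m /= /andP[_]; move/le_trans; apply.
    by rewrite lez_nat; move: i1; clear; lia.
  move=> k; have sfut := @sigma_gen_algebra R _ T int (fun i => Z i : T -> R) [set m | (i + l + l)%:Z <= m].
  apply: (adapted_pair sfut (f := X j : T -> R) (g := fun w => y (J j w)) _ _ (mA k)).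
    by apply: functional_future => //; move: ij; clear; lia.
  move=> C mC; apply: (salg_fibers sfut (c := J j) [set m | C (y m)]) => m.
  apply: sigma_gen_sub (cJj m) => m' /= /andP[+ _]; apply: le_trans.
  by rewrite lez_nat; move: ij; clear; lia.
have [xr [yr Hg]] := representatives mh hsym lip (K0 l) (q0 l) sX ij' mJi mJj mBi mBj pBi pBj ci cj dep.
exists (fun w => trunc (K l) (h (xr (J i w), yr (J j w)))); split.
- by move=> w; apply: trunc_le; exact: ltW.
- move=> C mC.
  have sW := @sigma_gen_algebra R _ T int (fun i => Z i : T -> R) [set m | (i.-1%:Z <= m <= (j.-1 + l)%:Z)].
  apply: (salg_fibers sW (c := fun w => (J i w, J j w))
    [set m | C (trunc (K l) (h (xr m.1, yr m.2)))]) => -[m m'].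
  rewrite (_ : [set w | _] = [set w | J i w = m] `&` [set w | J j w = m']); last first.
    by apply/seteqP; split => w /=; [case=> <- <-|case=> <- <-].
  apply: (salgI sW).
    apply: sigma_gen_sub (cJi m) => u /= /andP[-> /le_trans]; apply.
    by rewrite lez_nat; move: ij'; clear; lia.
  apply: sigma_gen_sub (cJj m') => u /= /andP[+ ->]; rewrite andbT; apply: le_trans.
  by rewrite lez_nat; move: ij'; clear; lia.
- apply: le_trans Hg _; rewrite mulrCA level_mul.
  by rewrite (_ : 8 * _ = 24 * (K l * x l)); [rewrite level_mul; lra|ring].
Qed.

Lemma momX i j : (1 <= i < j)%N ->
  (\int[P]_w (`|h (X i w, X j w)| `^ (2 + delta))%:E <= M%:E)%E.
Proof. by move=> ij; exact: (stationary_moment sX mh ij hmomX). Qed.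

Lemma measurable_hX i j : measurable_fun setT (fun w => h (X i w, X j w)).
Proof. by apply: (measurableT_comp mh); exact: measurable_RV_pair. Qed.

Lemma powR_normD (u v s : R) : 0 <= s ->
  `|u + v| `^ s <= 2 `^ s * (`|u| `^ s + `|v| `^ s).
Proof.
move=> s0; pose t := Num.max `|u| `|v|.
have t0 : 0 <= t by rewrite le_max normr_ge0.
apply: (@le_trans _ _ ((2 * t) `^ s)).
  rewrite ge0_ler_powR ?nnegrE ?mulr_ge0// (le_trans (ler_normD _ _))//.
  by rewrite (_ : 2 * t = t + t) ?lerD ?le_max ?lexx ?orbT//; ring.
rewrite powRM// ler_wpM2l ?powR_ge0// /t /Num.max.
by case: ifP => _; rewrite ?lerDl ?lerDr powR_ge0.
Qed.

Let C1 := 2 * L + 28.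
Let C10 : 0 < C1. Proof. by rewrite addr_gt0// mulr_gt0. Qed.

Lemma window_kernel_measurable l i j g : window_kernel l i j g -> measurable_fun setT g.
Proof.
move=> [_ ag _] _ B mB; rewrite setTI; exact: (sigma_gen_measurable (P := P) (V := Z) (ag B mB)).
Qed.

Lemma window_kernel_diff_bdd l i j g : window_kernel l i j g ->
  bdd (fun w => trunc (K l) (h (X i w, X j w)) - g w).
Proof.
move=> wg; have mg := window_kernel_measurable wg; have [gK _ _] := wg.
apply: bddB; last exact: (@bdd_le _ _ _ _ (K l)).
by apply: bdd_trunc; [exact: ltW|exact: measurable_hX].
Qed.

Lemma window_kernel_diff_le l i j g w : window_kernel l i j g ->
  `|trunc (K l) (h (X i w, X j w)) - g w| <= 2 * K l.
Proof.
move=> [gK _ _]; rewrite (le_trans (ler_normB _ _))// (_ : 2 * K l = K l + K l); last by ring.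
by rewrite lerD// trunc_le// ltW.
Qed.

(** Interpolation between the uniform bound [2 * K l] and the bound in mean by a multiple of
    [q l]. *)
Lemma window_kernel_diff_pow l i j g (s : R) : 0 <= s -> window_kernel l i j g ->
  (\int[P]_w (`|trunc (K l) (h (X i w, X j w)) - g w| `^ (1 + s))%:E <=
   ((2 * K l) `^ s * (C1 * q l))%:E)%E.
Proof.
move=> s0 wg; have [_ _ m1] := wg.
have bD := bdd_norm (window_kernel_diff_bdd wg).
have K20 : 0 <= 2 * K l by rewrite mulr_ge0// ltW.
apply: (@le_trans _ _ (\int[P]_w ((2 * K l) `^ s * `|trunc (K l) (h (X i w, X j w)) - g w|)%:E)%E).
  apply: ge0_le_integral => //.
  - by apply/measurable_EFinP; apply: measurable_powR_norm; case: (window_kernel_diff_bdd wg).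
  - by apply/measurable_EFinP; apply: measurable_funM => //; case: bD.
  - move=> w _; rewrite lee_fin; set u := `|_|.
    have u0 : 0 <= u by exact: normr_ge0.
    rewrite powRD; last by rewrite gt_eqF// ltr_pwDl.
    rewrite powRr1// mulrC ler_wpM2r// ge0_ler_powR ?nnegrE//.
    exact: (window_kernel_diff_le w wg).
rewrite -meanE; last exact: bddZ.
by rewrite meanZ// lee_fin ler_wpM2l ?powR_ge0.
Qed.

Definition window_moment : R := 2 `^ (2 + delta) * (M + 2 `^ (1 + delta) * C1).

(** The bound is uniform in the level because [K l ^ (1 + delta) * q l = 1]. *)
Lemma window_kernel_moment l i j g : (1 <= i < j)%N -> window_kernel l i j g ->
  (\int[P]_w (`|g w| `^ (2 + delta))%:E <= window_moment%:E)%E.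
Proof.
move=> ij wg; have mg := window_kernel_measurable wg.
have mD : measurable_fun setT (fun w => trunc (K l) (h (X i w, X j w)) - g w).
  by case: (window_kernel_diff_bdd wg).
have c0 : 0 <= 2 `^ (2 + delta) :> R by exact: powR_ge0.
apply: (@le_trans _ _ (\int[P]_w ((2 `^ (2 + delta))%:E *
    ((`|h (X i w, X j w)| `^ (2 + delta))%:E +
     (`|trunc (K l) (h (X i w, X j w)) - g w| `^ (2 + delta))%:E)))%E).
  apply: ge0_le_integral => //.
  - by apply/measurable_EFinP; exact: measurable_powR_norm.
  - apply: emeasurable_funM => //; apply: emeasurable_funD; apply/measurable_EFinP;
      apply: measurable_powR_norm => //; exact: measurable_hX.
  - move=> w _; rewrite -EFinD -EFinM lee_fin.
    set t := trunc _ _.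
    have e : g w = t + - (t - g w) by ring.
    rewrite [in leLHS]e.
    apply: le_trans (powR_normD _ _ (ltW d20)) _.
    rewrite normrN ler_wpM2l// lerD2r ge0_ler_powR ?nnegrE ?(ltW d20)//.
    rewrite /t; have [s /andP[s0 s1] ->] := trunc_factor (h (X i w, X j w)) (ltW (K0 l)).
    by rewrite normrM (ger0_norm s0) ler_piMl.
have mh' : measurable_fun setT (fun w => (`|h (X i w, X j w)| `^ (2 + delta))%:E).
  by apply/measurable_EFinP; apply: measurable_powR_norm; exact: measurable_hX.
have mD' : measurable_fun setT (fun w => (`|trunc (K l) (h (X i w, X j w)) - g w| `^ (2 + delta))%:E).
  by apply/measurable_EFinP; exact: measurable_powR_norm.
rewrite ge0_integralZl//; last 2 first.
- exact: emeasurable_funD.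
- by move=> w _; rewrite adde_ge0// lee_fin powR_ge0.
rewrite ge0_integralD//; [|by move=> w _; rewrite lee_fin powR_ge0..].
rewrite EFinM lee_pmul//; first by rewrite adde_ge0// integral_ge0// => w _; rewrite lee_fin powR_ge0.
rewrite EFinD leeD//; first exact: momX.
have -> : 2 + delta = 1 + (1 + delta) by ring.
apply: le_trans (window_kernel_diff_pow _ wg) _; first by rewrite addr_ge0// ltW.
rewrite lee_fin powRM ?(ltW (K0 l))//.
rewrite (_ : _ * (C1 * q l) = 2 `^ (1 + delta) * C1 * (K l `^ (1 + delta) * q l)); last by ring.
by rewrite /q powRN mulfV ?mulr1// gt_eqF// powR_gt0.
Qed.

(** The error splits into the part of [h] cut off by the truncation and the difference between the
    truncation and [g]; the latter has mean square of order [K l * q l], which is again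
    [K l ^ -delta]. *)
Lemma window_kernel_error l i j g : (1 <= i < j)%N -> window_kernel l i j g ->
  (\int[P]_w ((h (X i w, X j w) - g w) ^+ 2)%:E <= ((2 * M + 4 * C1) * K l `^ (- delta))%:E)%E.
Proof.
move=> ij wg; have mg := window_kernel_measurable wg.
have Kd : 0 <= K l `^ (- delta) by exact: powR_ge0.
have bD := window_kernel_diff_bdd wg.
pose t w := trunc (K l) (h (X i w, X j w)).
apply: (@le_trans _ _ (\int[P]_w ((2 * K l `^ (- delta))%:E *
    (`|h (X i w, X j w)| `^ (2 + delta))%:E + 2%:E * (`|t w - g w| `^ (1 + 1))%:E))%E).
  apply: ge0_le_integral => //.
  - by move=> w _; rewrite lee_fin sqr_ge0.
  - apply/measurable_EFinP; apply: measurable_funX; apply: measurable_funB => //.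
    exact: measurable_hX.
  - apply: emeasurable_funD; apply: emeasurable_funM => //; apply/measurable_EFinP;
      apply: measurable_powR_norm; [exact: measurable_hX|by case: bD].
  - move=> w _; rewrite -!EFinM -EFinD lee_fin.
    rewrite (_ : 1 + 1 = 2%:R :> R)// powR_mulrn// -/(t w).
    set u := h _; have -> : u - g w = (u - t w) + (t w - g w) by ring.
    rewrite -[2 * K l `^ _ * _]mulrA -mulrDr.
    apply: (@le_trans _ _ (2 * ((u - t w) ^+ 2 + `|t w - g w| ^+ 2))).
      rewrite real_normK ?num_real//; have := sqr_ge0 ((u - t w) - (t w - g w)); nra.
    rewrite ler_wpM2l// lerD2r /t -/u.
    have [uK|uK] := leP `|u| (K l).
      by rewrite trunc_id// subrr expr0n/= mulr_ge0// powR_ge0.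
    apply: le_trans (sqr_tail d0 (K0 l) (ltW uK)).
    rewrite -[leLHS]real_normK ?num_real// ler_pXn2r ?nnegrE//.
    have [s /andP[s0 s1] ->] := trunc_factor u (ltW (K0 l)).
    rewrite -[X in `|X - _|]mul1r -mulrBl normrM ler_piMl// ger0_norm; lra.
rewrite ge0_integralD//; last 3 first.
- by move=> w _; rewrite mule_ge0 ?lee_fin ?mulr_ge0 ?powR_ge0.
- apply: emeasurable_funM => //; apply/measurable_EFinP; apply: measurable_powR_norm.
  exact: measurable_hX.
- by apply: emeasurable_funM => //; apply/measurable_EFinP; apply: measurable_powR_norm; case: bD.
have scale (c s : R) (u : T -> R) : 0 <= c -> measurable_fun setT u ->
    (\int[P]_w (c%:E * (`|u w| `^ s)%:E) = c%:E * \int[P]_w (`|u w| `^ s)%:E)%E.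
  move=> c0 mu'; rewrite ge0_integralZl//; apply/measurable_EFinP; exact: measurable_powR_norm.
rewrite (scale _ _ (fun w => h (X i w, X j w))) ?mulr_ge0//; last exact: measurable_hX.
rewrite (scale _ _ (fun w => t w - g w))//; last by case: bD.
have h1 := momX ij; have h2 := window_kernel_diff_pow ler01 wg.
apply: (@le_trans _ _ ((2 * K l `^ (- delta))%:E * M%:E + 2%:E * ((2 * K l) `^ 1 * (C1 * q l))%:E)%E).
  by apply: leeD; rewrite lee_wpmul2l// lee_fin// mulr_ge0.
rewrite -!EFinM -EFinD lee_fin powRr1 ?mulr_ge0 ?(ltW (K0 l))//.
rewrite (_ : 2 * (2 * K l * (C1 * q l)) = 4 * C1 * (K l * q l)); last by ring.
rewrite (_ : K l * q l = K l `^ (- delta)); last first.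
  rewrite /q -{1}[K l](powRr1 (ltW (K0 l))) -powRD; last by rewrite (gt_eqF (K0 l)) implybT.
  by congr (_ `^ _); ring.
by rewrite le_eqVlt; apply/orP; left; apply/eqP; ring.
Qed.

Lemma level_width l : K l * q l = K l `^ (- delta).
Proof.
rewrite /q -{1}[K l](powRr1 (ltW (K0 l))) -powRD; last by rewrite (gt_eqF (K0 l)) implybT.
by congr (_ `^ _); ring.
Qed.

Lemma trunc_trunc (A B u : R) : 0 <= A -> A <= B -> trunc A (trunc B u) = trunc A u.
Proof.
move=> A0 AB; rewrite /trunc /Num.max /Num.min.
do ! case: ifP; rewrite ?ltNge => *; repeat match goal with
   | H : (~~ (_ <= _)) = true |- _ => rewrite -ltNge in H
   | H : (~~ (_ <= _)) = false |- _ => move/negbFE : H => H end; lra.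
Qed.

Lemma window_kernel_trunc l m i j g : (l <= m)%N -> window_kernel m i j g ->
  mean P (fun w => `|trunc (K l) (g w) - trunc (K l) (h (X i w, X j w))|) <= C1 * q l.
Proof.
move=> lm wg; have [_ _ H] := wg; have mg := window_kernel_measurable wg.
have bD := bdd_norm (window_kernel_diff_bdd wg).
apply: (@le_trans _ _ (C1 * q m)); last by apply: ler_wpM2l; [exact: ltW|exact: width_nonincreasing].
apply: le_trans H; apply: le_mean => [||w] //.
  apply: bdd_norm; apply: bddB; apply: bdd_trunc; rewrite ?(ltW (K0 l))//.
  exact: measurable_hX.
rewrite -(trunc_trunc (h (X i w, X j w)) (ltW (K0 l)) (level_nondecreasing lm)).
by rewrite (le_trans (trunc_lip _ _ _))// distrC.
Qed.

(** The summands stem from truncating the product, from replacement errors [C1 * q] and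
    [2 * C1 * q], and from decoupling, where [L + 14] is 2 for the dependence plus the [L + 12] of
    the coupling defect. *)
Definition window_constant : R := 2 * window_moment + 3 * C1 + 3 * (L + 14 + M).

(** [X i] depends on the whole future of [Z], but only its code [J i] has to belong to the past. The
    code is known at time [i + l], hence at time [n], and the gap from [n] to [n + l] is left for
    mixing. *)
Lemma functional_pair (i j n l m : nat) d' (S : measurableType d') (phi : T -> S) (v : S -> R)
    (gij gc g' : T -> R) :
  (1 <= i < j)%N -> (i + l <= n)%N -> (l <= m)%N -> window_kernel m i j gij ->
  measurable_fun setT gc -> (\int[P]_w (`|gc w| `^ (2 + delta))%:E <= window_moment%:E)%E ->
  measurable_fun setT phi -> measurable_fun setT v -> (X j : T -> R) =1 v \o phi ->
  adapted (fut (n + l)%N) phi ->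
  measurable_fun setT g' -> (forall w, `|g' w| <= K l) ->
  (forall t : R, past n [set w | t <= g' w]) \/
    (exists2 w : S -> R, measurable_fun setT w & g' =1 w \o phi) ->
  mean P (fun w => `|trunc (K l) (gc w) - g' w|) <= 2 * C1 * q l ->
  `|mean P (fun w => gij w * gc w)| <= window_constant * K l `^ (- delta).
Proof.
move=> ij iln lm wg mgc Mgc mphi mv Xj aphi mg' g'K Hg' He2.
have i1 : (1 <= i)%N by case/andP: ij.
have j1 : (1 <= j)%N by move: ij; clear; lia.
have n1 : (1 <= n)%N by move: i1 iln; clear; lia.
have [N [J [B HJ]]] := window_partition l.
have [cJ mB pB close] := HJ i i1.
have pJ k : past n [set w | J i w = k].
  apply: sigma_gen_sub (cJ k) => u /= /andP[_ /le_trans]; apply.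
  by rewrite lez_nat; move: iln; clear; lia.
have mJ k : measurable [set w | J i w = k] := sigma_gen_measurable (cJ k).
have lU := stationary_law sX i1; have lV := stationary_law sX j1.
have Xj' : (X j : T -> R) = (fun w => v (phi w)) by exact/funext.
have lV' : has_law mu P (fun w => v (phi w)) by rewrite -Xj'.
have adm : admissible_law X (fun A => P [set w | A (X i w, X j w)]).
  exact: (stationary_admissible sX ij).
have dep N' (J' : T -> 'I_N') (A : 'I_N' -> set S) : (forall k, past n [set w | J' w = k]) ->
  (forall k, measurable (A k)) ->
  \sum_k (pr P ([set w | J' w = k] `&` phi @^-1` (A k)) -
          pr P [set w | J' w = k] * pr P (phi @^-1` (A k))) <= x l.
  by move=> pJ' mA; apply: (dependence_window n1 pJ') => k; exact: aphi.
have Heta Q : half_product P phi Q ->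
  mean Q (fun z => (J i z.1 == J i z.2)%:R *
    `|trunc (K l) (h (X i z.1, v (phi z.1))) - trunc (K l) (h (X i z.2, v (phi z.1)))|) <=
  (L + 12) * q l.
  move=> hQ; have := lipschitz_defect mh lip lU lV adm mv Xj mJ mB (K0 l) (q0 l) close hQ.
  rewrite Xj' => /le_trans; apply; rewrite mulrDl lerD2l.
  rewrite (_ : K l * _ *+ 4 = 4 * (K l * pr P (B i))); last by ring.
  rewrite (_ : 12 * q l = 4 * (3 * (K l * x l))); last by rewrite level_mul; ring.
  by rewrite ler_wpM2l// mulrCA ler_wpM2l// ltW.
have spast : sigma_algebra setT (past n) := sigma_gen_algebra _ _.
have mpast : past n `<=` measurable by move=> A; exact: sigma_gen_measurable.
have He1 : mean P (fun w => `|trunc (K l) (gij w) - trunc (K l) (h (X i w, v (phi w)))|) <= C1 * q l.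
  by have := window_kernel_trunc lm wg; rewrite Xj'.
have := @decoupled_product _ _ _ mh hsym hdeg _ _ d0 hmom _ _ _ _ P _ phi (fun=> x l)
  spast mpast mphi dep N _ (X i) v pJ lU mv lV' _ _ (K0 l) Heta
  gij gc g' window_moment (C1 * q l) (2 * C1 * q l)
  (window_kernel_measurable wg) mgc mg' (window_kernel_moment ij wg) Mgc g'K Hg' He1 He2.
move=> /le_trans; apply; rewrite level_mul -/(q l).
rewrite (_ : K l * _ = 3 * C1 * (K l * q l)); last by ring.
rewrite (_ : 3 * K l * _ = 3 * (L + 14 + M) * (K l * q l)); last by ring.
by rewrite level_width /window_constant le_eqVlt; apply/orP; left; apply/eqP; ring.
Qed.

(** A level equal to a third of the gap leaves room for a window and for a mixing gap of that
    length. Each kernel is built at the level of its own pair, so that the array does not depend on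
    the product in which a kernel occurs. *)
Lemma functional_decay : exists g : nat -> nat -> T -> R,
  (forall i j, (1 <= i < j)%N -> window_kernel ((j - i) %/ 3) i j (g i j)) /\
  array_decay P g (fun k => K (k %/ 3) `^ (- delta)) window_constant.
Proof.
have /choice[g0 Hg0] : forall ij : nat * nat, exists g, (1 <= ij.1 < ij.2)%N ->
    window_kernel ((ij.2 - ij.1) %/ 3) ij.1 ij.2 g.
  move=> [i j] /=; have [ij|ij] := boolP (1 <= i < j)%N; last by exists (fun=> 0).
  have [||g Hg] := @window_kernel_exists ((j - i) %/ 3) i j; first by case/andP: ij.
    by move: ij (leq_divM (j - i) 3); clear; lia.
  by exists g.
pose g i j := g0 (i, j).
have Hg i j : (1 <= i < j)%N -> window_kernel ((j - i) %/ 3) i j (g i j) by move=> ij; exact: (Hg0 (i, j)).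
have sfut n : sigma_algebra setT (fut n) := sigma_gen_algebra _ _.
exists g; split => //; split => i j i' j' ij ij' lt_ii'.
- set k := (minn j i' - i)%N; pose l := (k %/ 3)%N.
  have j1 : (1 <= j)%N by move: ij; clear; lia.
  have l3 : (3 * l <= k)%N by rewrite mulnC; exact: leq_divM.
  have wg := Hg _ _ ij; have wg' := Hg _ _ ij'.
  have mg' := window_kernel_measurable wg'.
  have lm : (l <= (j - i) %/ 3)%N by apply: leq_div2r; rewrite /k; clear; lia.
  have [_ ag' _] := wg'.
  have mXj : measurable_fun setT (X j) by [].
  have mtr : measurable_fun setT (fun w => trunc (K l) (g i' j' w)).
    exact: (measurableT_comp (measurable_trunc _) mg').
  apply: (@functional_pair i j (i + l)%N l _ _ _ (fun w => (X j w, g i' j' w)) fst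
    (g i j) (g i' j') (fun w => trunc (K l) (g i' j' w)) ij (leqnn _) lm wg mg'
    (window_kernel_moment ij' wg') _ measurable_fst) => //.
  + exact: measurable_fun_pair.
  + apply: adapted_pair => //.
      by apply: functional_future => //; move: l3 ij lt_ii'; rewrite /k; clear; lia.
    move=> C mC; apply: sigma_gen_sub (ag' C mC) => u /= /andP[+ _]; apply: le_trans.
    by rewrite lez_nat; move: l3 ij lt_ii'; rewrite /k; clear; lia.
  + by move=> w; apply: trunc_le; exact: ltW.
  + by right; exists (fun s => trunc (K l) s.2) => //; exact: (measurableT_comp (measurable_trunc _) measurable_snd).
  + rewrite (@eq_mean _ _ _ _ _ (fun=> 0)) ?mean_cst; last by move=> w; rewrite subrr normr0.
    by rewrite !mulr_ge0 ?ltW.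
- set k := (j - maxn i j')%N; pose l := (k %/ 3)%N.
  have j1 : (1 <= j)%N by move: ij; clear; lia.
  have l3 : (3 * l <= k)%N by rewrite mulnC; exact: leq_divM.
  have wg := Hg _ _ ij; have wg' := Hg _ _ ij'.
  have mg' := window_kernel_measurable wg'.
  have lm : (l <= (j - i) %/ 3)%N by apply: leq_div2r; rewrite /k; clear; lia.
  have iln : (i + l <= maxn i j' + l)%N by rewrite leq_add2r leq_maxl.
  have aphi : adapted (fut (maxn i j' + l + l)%N) (X j : T -> R).
    by apply: functional_future => //; move: l3 ij lt_ii'; rewrite /k; clear; lia.
  have ge_past (c : T -> R) : adapted (past (maxn i j' + l)%N) c ->
      forall t : R, past (maxn i j' + l)%N [set w | t <= c w].
    by move=> ac t; exact: (ac [set y | t <= y] (measurable_ge t (@measurable_id _ _ _))).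
  have win (m : nat) c : (m <= l)%N -> adapted (sigma_gen Z [set u | i'.-1%:Z <= u <= (j'.-1 + m)%:Z]) c ->
      adapted (past (maxn i j' + l)%N) (c : T -> R).
    move=> ml ac C mC; apply: sigma_gen_sub (ac C mC) => u /= /andP[_ /le_trans]; apply.
    by rewrite lez_nat; move: ml; clear; lia.
  (* If the level of the second kernel exceeds [l], its window may reach beyond the past. A kernel
     of level [l] then replaces it, at a cost in mean of at most [2 * C1 * q l]. *)
  have [small|big] := leqP ((j' - i') %/ 3) l.
    have [_ ag' _] := wg'.
    have mtr : measurable_fun setT (fun w => trunc (K l) (g i' j' w)).
      exact: (measurableT_comp (measurable_trunc _) mg').
    apply: (@functional_pair i j (maxn i j' + l)%N l _ _ _ (X j) id
      (g i j) (g i' j') (fun w => trunc (K l) (g i' j' w)) ij iln lm wg mg'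
      (window_kernel_moment ij' wg')) => //.
    + by move=> w; apply: trunc_le; exact: ltW.
    + left; apply: ge_past; apply: (adapted_comp (f := g i' j')); last exact: measurable_trunc.
      exact: win ag'.
    + rewrite (@eq_mean _ _ _ _ _ (fun=> 0)) ?mean_cst; last by move=> w; rewrite subrr normr0.
      by rewrite !mulr_ge0 ?ltW.
  have [||c wc] := @window_kernel_exists l i' j'; first by case/andP: ij'.
    by move: ij' big (leq_divM (j' - i') 3); clear; lia.
  have [cK ac mc] := wc; have mmc := window_kernel_measurable wc.
  apply: (@functional_pair i j (maxn i j' + l)%N l _ _ _ (X j) id
      (g i j) (g i' j') c ij iln lm wg mg' (window_kernel_moment ij' wg')) => //.
  + by left; apply: ge_past; exact: win ac.
  + have h1 := window_kernel_trunc (ltnW big) wg'.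
    have b1 := bdd_trunc (ltW (K0 l)) mg'.
    have b2 := bdd_trunc (ltW (K0 l)) (measurable_hX i' j').
    have b3 : bdd c by exact: (@bdd_le _ _ _ _ (K l)).
    rewrite (_ : 2 * C1 * q l = C1 * q l + C1 * q l); last by ring.
    apply: le_trans (lerD h1 mc); rewrite -meanD; [|by bdd_tac..].
    apply: le_mean; [by bdd_tac|by bdd_tac|move=> w].
    rewrite (le_trans _ (ler_normD _ _))// le_eqVlt; apply/orP; left; apply/eqP.
    by congr (`|_|); ring.
Qed.

End functional_windows.

(** * Rates for functionals and the decomposition of the kernel *)

Section tail_sums.
Context (R : realType) (a : nat -> R).
Hypothesis a0 : forall l, 0 <= a l.
Hypothesis ca : cvgn (series a).

Let tail L := \big[+%R/0]_(L <= i <oo) a i.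

Let tail_cvg L : cvgn (fun n => \sum_(L <= i < n) a i).
Proof.
apply: nondecreasing_is_cvgn => [m n mn|].
  have [mL|Lm] := leqP m L.
    by rewrite (big_geq mL) sumr_ge0.
  by rewrite (@big_cat_nat _ _ _ m L n)//= ?(ltnW Lm)// lerDl sumr_ge0.
exists (limn (series a)) => _ [n _ <-].
apply: (@le_trans _ _ (series a (maxn n L))).
  rewrite /series/= (@big_cat_nat _ _ _ L 0 (maxn n L))//= ?leq_maxr//.
  apply: (@le_trans _ _ (\sum_(L <= i < maxn n L) a i)); last by rewrite lerDr sumr_ge0.
  have [nL|Ln] := leqP n L; first by rewrite (big_geq nL) sumr_ge0.
  by rewrite ?lexx// (maxn_idPl (ltnW Ln)).
apply: nondecreasing_cvgn_le => // m n' mn'.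
by rewrite /series/= (@big_cat_nat _ _ _ m 0 n')//= lerDl sumr_ge0.
Qed.

Lemma tail_ge L : a L <= tail L.
Proof.
apply: limr_ge; first exact: tail_cvg.
near=> n; rewrite big_ltn; last by near: n; exact: nbhs_infty_gt.
by rewrite lerDl sumr_ge0.
Unshelve. all: by end_near.
Qed.

Lemma tail_nonincreasing L L' : (L <= L')%N -> tail L' <= tail L.
Proof.
move=> LL'; apply: ler_lim; [exact: tail_cvg|exact: tail_cvg|].
near=> n; rewrite (@big_cat_nat _ _ _ L' L n)//= ?lerDr ?sumr_ge0//.
by near: n; exact: nbhs_infty_ge.
Unshelve. all: by end_near.
Qed.

Lemma alpha_sub_nonincreasing L L' : (L <= L')%N -> alpha_sub a L' <= alpha_sub a L.
Proof.
by move=> LL'; rewrite /alpha_sub ler_wsqrtr// ler_wpM2l//; exact: tail_nonincreasing.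
Qed.

(** This is what [alpha_sub] is made for: at width [alpha_sub a L], Markov's inequality bounds a
    deviation of mean [2 * a L] by a probability of the same size as the width. *)
Lemma alpha_sub_sqr L : 2 * a L <= alpha_sub a L ^+ 2.
Proof.
have t0 : 0 <= tail L := le_trans (a0 L) (tail_ge L).
by rewrite /alpha_sub sqr_sqrtr ?mulr_ge0// ler_wpM2l//; exact: tail_ge.
Qed.

End tail_sums.

Section running_minimum.
Context (R : realType) (b : nat -> R).

(** It yields the nonincreasing rate that [functional_decay] asks for, while staying below the
    coefficients whose growth is assumed. *)
Fixpoint running_min (l : nat) : R :=
  if l is m.+1 then Num.min (running_min m) (b l) else b 0%N.

Lemma running_min_le l : running_min l <= b l.
Proof. by case: l => [|l] /=; rewrite ?lexx// ge_min lexx orbT. Qed.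

Lemma running_min_ex l : exists2 k, (k <= l)%N & running_min l = b k.
Proof.
elim: l => [|l [k kl IH]] /=; first by exists 0%N.
by rewrite /Num.min; case: ifP => _; [exists k => //; exact: leqW|exists l.+1].
Qed.

Lemma running_min_nonincreasing l m : (l <= m)%N -> running_min m <= running_min l.
Proof.
elim: m => [|m IH]; first by rewrite leqn0 => /eqP ->.
rewrite leq_eqVlt => /orP[/eqP ->//|lm] /=.
by rewrite ge_min IH.
Qed.

End running_minimum.

Section growth_third.
Context (R : realType).

(** Three consecutive integers share the same third [l], and their weights add up to [9 * l + 3]. *)
Lemma sum_third (psi : nat -> R) (n : nat) : (forall k, 0 <= psi k) ->
  \sum_(0 <= k < 3 * n) k%:R * psi (k %/ 3)%N <= 9 * \sum_(0 <= l < n) l.+1%:R * psi l.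
Proof.
move=> p0; elim: n => [|n IH]; first by rewrite !big_geq// mulr0.
rewrite [in leRHS]big_nat_recr//= mulrDr; apply: le_trans (lerD IH (lexx _)).
rewrite (_ : 3 * n.+1 = (3 * n).+3)%N; last by lia.
rewrite !big_nat_recr//= -!addrA lerD2l.
rewrite (_ : (3 * n) %/ 3 = n)%N; last by rewrite mulKn.
rewrite (_ : (3 * n).+1 %/ 3 = n)%N; last by lia.
rewrite (_ : (3 * n).+2 %/ 3 = n)%N; last by lia.
rewrite -!mulrDl mulrA ler_wpM2r// -!natrD -natrM ler_nat; lia.
Qed.

Lemma grows_third (tau : R) (psi : nat -> R) : 0 <= tau -> grows tau psi ->
  grows tau (fun k => psi (k %/ 3)%N).
Proof.
move=> tau0 [p0 [C [C0 HC]]]; split => [k|]; first exact: p0.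
exists (18 * C + 9 * psi 0%N); split; first by rewrite addr_ge0 ?mulr_ge0.
move=> n n1.
have nt : 1 <= n%:R `^ tau.
  by rewrite -[leLHS](powRr0 n%:R) ler_powR// ler1n.
apply: (@le_trans _ _ (\sum_(0 <= k < 3 * n.+1) k%:R * psi (k %/ 3)%N)).
  rewrite [leRHS](@big_cat_nat _ _ _ n.+1 0)//=; last by lia.
  by rewrite lerDl sumr_ge0// => k _; rewrite mulr_ge0.
apply: le_trans (sum_third _ p0) _.
apply: (@le_trans _ _ (9 * (psi 0%N + 2 * \sum_(0 <= l < n.+1) l%:R * psi l))).
  rewrite ler_wpM2l// [leLHS]big_nat_recl// [in leRHS]big_nat_recl// mul1r mul0r add0r lerD2l.
  rewrite mulr_sumr; apply: ler_sum => k _; rewrite mulrA ler_wpM2r// -natrM ler_nat; lia.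
have := HC n n1; move: nt (p0 0%N); generalize (n%:R `^ tau : R) (psi 0%N).
by move=> t p t1 p00; generalize (\sum_(0 <= k < n.+1) k%:R * psi k); move=> s sC; nra.
Qed.

End growth_third.

Section kernel_decomposition.
Context (R : realType) d (T : measurableType d) (P : probability T R).
Variables (X : nat -> {RV P >-> R}) (h : R * R -> R) (delta tau M : R).
Let mu : probability R R := distribution P (X 1%N).
Hypothesis sX : stationary_nat X.
Hypothesis mh : measurable_fun setT h.
Hypothesis hsym : forall x y, h (x, y) = h (y, x).
Hypothesis hdeg : forall x : R, (\int[mu]_y (h (x, y))%:E = 0)%E.
Hypothesis d0 : 0 < delta.
Hypothesis tau0 : 0 <= tau.
Hypothesis hmom : (\int[(mu \x mu)%E]_z (`|h z| `^ (2 + delta))%:E <= M%:E)%E.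
Hypothesis hmomX : forall k : nat, (1 <= k)%N ->
  (\int[P]_w (`|h (X 1%N w, X k w)| `^ (2 + delta))%:E <= M%:E)%E.

(** The array [g] carries the covariance bounds, and the remainder is controlled in mean square
    through the distance [j - i]. Only functionals have a remainder; in the other two cases [g] is
    the kernel itself. *)
Definition decomposed (g : nat -> nat -> T -> R) (psi : nat -> R) (C : R) : Prop :=
  [/\ grows tau psi, array_decay P g psi C &
    forall i j, (1 <= i < j)%N ->
      [/\ measurable_fun setT (g i j),
          (\int[P]_w (`|g i j w| `^ (2 + delta))%:E <= C%:E)%E &
          (\int[P]_w ((h (X i w, X j w) - g i j w) ^+ 2)%:E <= (C * psi (j - i)%N)%:E)%E]].

Lemma array_decay_le (xi : nat -> nat -> T -> R) (psi : nat -> R) (C C' : R) :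
  (forall k, 0 <= psi k) -> C <= C' -> array_decay P xi psi C -> array_decay P xi psi C'.
Proof.
move=> p0 CC' [HA HB]; split=> i j i' j' ij ij' l.
  by apply: le_trans (HA _ _ _ _ ij ij' l) _; rewrite ler_wpM2r.
by apply: le_trans (HB _ _ _ _ ij ij' l) _; rewrite ler_wpM2r.
Qed.

Lemma decay_decomposed (psi : nat -> R) (C : R) : grows tau psi ->
  array_decay P (fun i j x => h (X i x, X j x)) psi C -> exists g psi C, decomposed g psi C.
Proof.
move=> gpsi dec; have [p0 _] := gpsi; exists (fun i j x => h (X i x, X j x)), psi, (`|C| + `|M|).
split => //; first by apply: array_decay_le dec => //; rewrite (le_trans (ler_norm _))// lerDl.
move=> i j ij; split.
- by apply: (measurableT_comp mh); exact: measurable_RV_pair.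
- apply: le_trans (stationary_moment sX mh ij hmomX) _.
  by rewrite lee_fin (le_trans (ler_norm _))// lerDr.
- rewrite (_ : (fun _ => _) = cst 0%E); first by rewrite integral0 lee_fin mulr_ge0// addr_ge0.
  by apply/funext => w; rewrite subrr expr0n.
Qed.

Lemma beta_reg_ge0 (Z : int -> {RV P >-> R}) k : 0 <= beta_reg Z k.
Proof.
have := @beta_reg_dependence R d T P Z 1 k 0 (fun=> set0) (fun=> set0) (leqnn _).
by rewrite big_ord0; apply => -[].
Qed.

Lemma functional_decomposed : cond_functional X h delta tau ->
  exists g psi C, decomposed g psi C.
Proof.
move=> [Z [a [[sZ _] [_ [f cf Xf] _ approx] lipX ca Hgr]]].
have [L L0 lip] := P_Lipschitz_or_variation mh lipX.
have a0 l : 0 <= a l by rewrite -lee_fin; apply: le_trans (approx l); exact: Lnorm_ge0.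
pose p := delta / (2 + delta).
have d20 : 0 < 2 + delta by rewrite addr_gt0.
have p0 : 0 < p by rewrite divr_gt0.
pose al := alpha_sub a.
have al0 l : 0 <= al l by exact: sqrtr_ge0.
pose b := running_min (beta_reg Z).
have b0 l : 0 <= b l by rewrite /b; have [k _ ->] := running_min_ex (beta_reg Z) l; exact: beta_reg_ge0.
(* The cap keeps the rate in (0, 1]; where it is attained, the first alternatives of [x_beta] and
   [x_approx] hold. *)
pose bb l := Num.min 1 (b l + al l).
pose x := rate bb p.
have bb0 l : 0 <= bb l by rewrite le_min ler01 addr_ge0.
have x01 l : 0 < x l <= 1 by rewrite rate_gt0 rate_le1// ge_min lexx.
have bb_dec l m : (l <= m)%N -> bb m <= bb l.
  move=> lm; rewrite /bb le_min !ge_min lexx/=; apply/orP; right.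
  by apply: lerD; [exact: running_min_nonincreasing|exact: alpha_sub_nonincreasing].
have x_dec l m : (l <= m)%N -> x m <= x l.
  move=> lm; rewrite /x /rate ge_max !le_max bb_dec//=; apply/orP; right.
  rewrite !powRN lef_pV2 ?posrE ?powR_gt0//; apply: ge0_ler_powR; rewrite ?nnegrE ?ler0n ?ler_nat//.
  by rewrite divr_ge0// ltW.
have x_bb l : bb l <= x l := rate_ge bb p l.
have x_beta l : 1 <= x l \/ exists2 k, (k <= l)%N & beta_reg Z k <= x l.
  have := x_bb l; rewrite /bb /Num.min; case: ifP => _ h1; [by left|right].
  have [k kl bk] := running_min_ex (beta_reg Z) l; exists k => //.
  by rewrite -bk; apply: le_trans h1; rewrite lerDl.
have x_approx l : 1 <= x l \/ 2 * a l <= x l ^+ 2.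
  have := x_bb l; rewrite /bb /Num.min; case: ifP => _ h1; [by left|right].
  apply: le_trans (alpha_sub_sqr a0 ca l) _.
  have /andP[xl0 _] := x01 l.
  rewrite ler_pXn2r ?nnegrE ?al0 ?(ltW xl0)//.
  by apply: le_trans h1; rewrite lerDr.
have [g [wg dec]] := functional_decay sX mh hsym hdeg d0 hmom hmomX L0 lip sZ cf Xf approx
  x01 x_dec x_beta x_approx.
pose K l := x l `^ (- (2 + delta)^-1).
pose psi k := K (k %/ 3)%N `^ (- delta).
have psi0 k : 0 <= psi k by exact: powR_ge0.
have gpsi : grows tau psi.
  suff g1 : grows tau (fun k => K k `^ (- delta)) by exact: (grows_third tau0 g1).
  apply: (@growsD_cube _ tau (fun k => 2 `^ p * (beta_reg Z k `^ p + al k `^ p))); first exact: tau0.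
  - apply: growsZ; first exact: powR_ge0.
    by apply: bigO_grows => // k; rewrite addr_ge0// powR_ge0.
  - by move=> k; exact: powR_ge0.
  - move=> k; rewrite (level_pow x d0)//.
    apply: le_trans (rate_pow bb p0 k) _; rewrite lerD2r.
    apply: (@le_trans _ _ ((b k + al k) `^ p)).
      by rewrite ge0_ler_powR ?nnegrE ?(ltW p0) ?addr_ge0// ge_min lexx orbT.
    have := powR_normD (b k) (al k) (ltW p0).
    rewrite !ger0_norm ?addr_ge0// => /le_trans; apply.
    rewrite ler_wpM2l ?powR_ge0// lerD2r ge0_ler_powR ?nnegrE ?(ltW p0) ?beta_reg_ge0//.
    exact: running_min_le.
pose C := `|window_constant delta M L| + `|window_moment delta M L| +
   `|2 * M + 4 * (2 * L + 28)|.
exists g, psi, C; split => //.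
  apply: array_decay_le dec => //.
  by rewrite (le_trans (ler_norm _))// /C -addrA lerDl addr_ge0.
move=> i j ij; have wgij := wg i j ij; split.
- exact: (window_kernel_measurable wgij).
- apply: le_trans (window_kernel_moment sX mh d0 hmomX x01 ij wgij) _.
  by rewrite lee_fin (le_trans (ler_norm _))// /C -addrA addrCA lerDl addr_ge0.
- apply: le_trans (window_kernel_error sX mh d0 hmomX x01 ij wgij) _.
  rewrite lee_fin ler_wpM2r ?powR_ge0//.
  by rewrite (le_trans (ler_norm _))// /C lerDr addr_ge0.
Qed.

Lemma kernel_decomposition :
  cond_abs_reg X delta tau \/ cond_strong_mix X h delta tau \/ cond_functional X h delta tau ->
  exists g psi C, decomposed g psi C.
Proof.
case=> [c1|[c2|c3]]; last exact: functional_decomposed.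
- have [psi [C [gpsi dec]]] := abs_reg_decay sX mh hsym hdeg d0 tau0 hmom hmomX c1.
  exact: decay_decomposed gpsi dec.
- have [psi [C [gpsi dec]]] := strong_mix_decay sX mh hsym hdeg d0 tau0 hmom hmomX c2.
  exact: decay_decomposed gpsi dec.
Qed.

End kernel_decomposition.

(** * Counting indices by their gaps *)

Section gap_sums.
Context (R : realType).
Implicit Types (F psi : nat -> R).

Definition gap (i j : nat) : nat := (i - j + (j - i))%N.

Lemma sum_nat_le F (m n : nat) : (forall k, 0 <= F k) -> (m <= n)%N ->
  \sum_(0 <= k < m) F k <= \sum_(0 <= k < n) F k.
Proof.
move=> F0 mn; rewrite [leRHS](@big_cat_nat _ _ _ m 0 n)//= lerDl.
by rewrite sumr_ge0.
Qed.

Lemma sum_gap_row F (N i : nat) : (forall k, 0 <= F k) -> (i < N)%N ->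
  \sum_(0 <= j < N) F (gap i j) <= 2 * \sum_(0 <= k < N) F k.
Proof.
move=> F0 iN; rewrite (@big_cat_nat _ _ _ i 0 N)//= ?(ltnW iN)//.
rewrite (_ : 2 * _ = \sum_(0 <= k < N) F k + \sum_(0 <= k < N) F k); last by ring.
apply: lerD.
  rewrite big_nat_rev/= add0n.
  rewrite (@eq_big_nat _ _ _ _ _ _ (fun j => F j.+1)); last first.
    by move=> j /andP[_ ji]; congr F; rewrite /gap; move: ji; clear; lia.
  apply: (@le_trans _ _ (\sum_(0 <= k < i.+1) F k)); last exact: sum_nat_le.
  by rewrite big_nat_recl// lerDr.
rewrite -{1}[i]add0n big_addn.
rewrite (@eq_big_nat _ _ _ _ _ _ F); last first.
  by move=> j _; congr F; rewrite /gap; clear; lia.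
by apply: sum_nat_le => //; exact: leq_subr.
Qed.

Lemma sum_gap F (N : nat) : (forall k, 0 <= F k) ->
  \sum_(0 <= i < N) \sum_(0 <= j < N) F (gap i j) <= 2 * N%:R * \sum_(0 <= k < N) F k.
Proof.
move=> F0; apply: (@le_trans _ _ (\sum_(0 <= i < N) 2 * \sum_(0 <= k < N) F k)).
  by apply: ler_sum_nat => i /andP[_ iN]; exact: sum_gap_row.
rewrite sumr_const_nat subn0 -[leLHS]mulr_natl.
by rewrite le_eqVlt; apply/orP; left; apply/eqP; ring.
Qed.

Lemma sum_gap2 (G : nat -> nat -> R) (N : nat) : (forall k m, 0 <= G k m) ->
  \sum_(0 <= i < N) \sum_(0 <= i' < N) \sum_(0 <= j < N) \sum_(0 <= j' < N)
    G (gap i i') (gap j j') <=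
  4 * N%:R ^+ 2 * \sum_(0 <= k < N) \sum_(0 <= m < N) G k m.
Proof.
move=> G0; pose F k := 2 * N%:R * \sum_(0 <= m < N) G k m.
have F0 k : 0 <= F k by rewrite mulr_ge0 ?mulr_ge0// sumr_ge0.
apply: (@le_trans _ _ (\sum_(0 <= i < N) \sum_(0 <= i' < N) F (gap i i'))).
  by apply: ler_sum => i _; apply: ler_sum => i' _; exact: sum_gap.
apply: le_trans (sum_gap N F0) _; rewrite /F -mulr_sumr.
by rewrite le_eqVlt; apply/orP; left; apply/eqP; ring.
Qed.

(** At most [k + 1] indices do not exceed [k]; the factor 2 accounts for the two places where the
    maximum may be attained. *)
Lemma sum_max psi (N : nat) : (forall k, 0 <= psi k) ->
  \sum_(0 <= k < N) \sum_(0 <= m < N) psi (maxn k m) <=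
  2 * \sum_(0 <= k < N) k.+1%:R * psi k.
Proof.
move=> p0.
have count k : \sum_(0 <= m < N) ((m <= k)%N%:R : R) <= k.+1%:R.
  have : forall n, \sum_(0 <= m < n) ((m <= k)%N%:R : R) = (minn n k.+1)%:R.
    elim=> [|n IH]; first by rewrite big_geq.
    by rewrite big_nat_recr//= IH -natrD; congr _%:R; clear; lia.
  by move=> ->; rewrite ler_nat geq_minr.
have half : \sum_(0 <= k < N) \sum_(0 <= m < N) (m <= k)%N%:R * psi k <=
    \sum_(0 <= k < N) k.+1%:R * psi k.
  by apply: ler_sum => k _; rewrite -mulr_suml ler_wpM2r.
apply: (@le_trans _ _ (\sum_(0 <= k < N) \sum_(0 <= m < N)
    ((m <= k)%N%:R * psi k + (k <= m)%N%:R * psi m))).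
  apply: ler_sum => k _; apply: ler_sum => m _.
  have [mk|km] := leqP m k; first by rewrite mul1r lerDl mulr_ge0.
  by rewrite (ltnW km) mul1r lerDr mulr_ge0.
under eq_bigr do rewrite big_split/=.
rewrite big_split/= [X in _ + X]exchange_big/=.
by rewrite (_ : 2 * _ = \sum_(0 <= k < N) k.+1%:R * psi k + \sum_(0 <= k < N) k.+1%:R * psi k) ?lerD//; ring.
Qed.

Lemma AM_GM (u v t : R) : 0 <= u -> 0 <= v -> t ^+ 2 <= u * v -> t + t <= u + v.
Proof.
move=> u0 v0 key; have [t0|t0] := leP (t + t) 0; first by rewrite (le_trans t0)// addr_ge0.
rewrite -(@ler_pXn2r _ 2) ?nnegrE ?addr_ge0//; [|lra..].
have := sqr_ge0 (u - v); nra.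
Qed.

Lemma weighted_Cauchy_Schwarz (I : Type) (s : seq I) (c a : I -> R) : (forall i, 0 < c i) ->
  (\sum_(i <- s) a i) ^+ 2 <= (\sum_(i <- s) c i) * \sum_(i <- s) (c i)^-1 * a i ^+ 2.
Proof.
move=> c0; elim: s => [|i s IH]; first by rewrite !big_nil expr0n mul0r.
rewrite !big_cons; set A := \sum_(_ <- _) a _ in IH *; set B := \sum_(_ <- _) c _ in IH *.
set D := \sum_(_ <- _) _ in IH *.
have B0 : 0 <= B by rewrite sumr_ge0// => j _; exact: ltW.
have D0 : 0 <= D by rewrite sumr_ge0// => j _; rewrite mulr_ge0 ?sqr_ge0 ?invr_ge0 ?ltW.
have ci := c0 i.
rewrite mulrDl !mulrDr mulrA mulfV ?gt_eqF// mul1r sqrrD.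
rewrite -!addrA lerD2l addrA [leRHS]addrA; apply: lerD => //.
have key : (a i * A) ^+ 2 <= (c i * D) * (B * ((c i)^-1 * a i ^+ 2)).
  rewrite (_ : c i * D * _ = a i ^+ 2 * (B * D)); last by field; rewrite gt_eqF.
  by rewrite exprMn ler_wpM2l// sqr_ge0.
have u0 : 0 <= c i * D by rewrite mulr_ge0// ltW.
have v0 : 0 <= B * ((c i)^-1 * a i ^+ 2).
  by apply: mulr_ge0 => //; apply: mulr_ge0; [rewrite invr_ge0 ltW|exact: sqr_ge0].
exact: AM_GM u0 v0 key.
Qed.

(** Each dyadic block of the harmonic sum contributes at most 1. *)
Lemma harmonic_dyadic (k : nat) : \sum_(0 <= m < 2 ^ k) (m.+1%:R^-1 : R) <= k.+1%:R.
Proof.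
elim: k => [|k IH]; first by rewrite expn0 big_nat1 invr1.
rewrite (@big_cat_nat _ _ _ (2 ^ k) 0 (2 ^ k.+1))//=; last by rewrite leq_exp2l.
rewrite -[k.+2%:R]natr1; apply: lerD IH _.
apply: (@le_trans _ _ (\sum_(2 ^ k <= m < 2 ^ k.+1) (2 ^ k)%:R^-1)).
  apply: ler_sum_nat => m /andP[km _]; rewrite lef_pV2 ?posrE ?ltr0n ?expn_gt0// ler_nat.
  exact: leqW.
rewrite sumr_const_nat expnS mul2n -addnn addnK -[leLHS]mulr_natl mulfV//.
Qed.

End gap_sums.

(** * The maximal inequality of Rademacher and Menshov *)

Section dyadic_maximal.
Context (R : realType).
Variable S : nat -> R.

(** The sum of the squared increments of [S] over all dyadic blocks contained in the block number
    [c] of length [2 ^ k]. *)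
Fixpoint dyadic_energy (k c : nat) : R :=
  (S (c.+1 * 2 ^ k) - S (c * 2 ^ k)) ^+ 2 +
  (if k is k'.+1 then dyadic_energy k' (2 * c) + dyadic_energy k' (2 * c).+1 else 0).

Lemma dyadic_energy_ge0 k c : 0 <= dyadic_energy k c.
Proof.
elim: k c => [|k IH] c /=; rewrite addr_ge0 ?sqr_ge0//.
by rewrite addr_ge0.
Qed.

(* Descending the dyadic tree uses at most one block per level. *)
Lemma dyadic_maximal k c t : (t <= 2 ^ k)%N ->
  (S (c * 2 ^ k + t)%N - S (c * 2 ^ k)%N) ^+ 2 <= k.+1%:R * dyadic_energy k c.
Proof.
elim: k c t => [|k IH] c t.
  rewrite expn0 muln1; case: t => [|[|//]] _ /=.
    by rewrite addn0 subrr expr0n mul1r addr0 sqr_ge0.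
  by rewrite !muln1 mul1r addr0 addn1.
move=> tk; rewrite [dyadic_energy _ _]/=.
set a2 := (S (c.+1 * 2 ^ k.+1) - S (c * 2 ^ k.+1)) ^+ 2; have a20 : 0 <= a2 by exact: sqr_ge0.
have El := dyadic_energy_ge0 k (2 * c); have Er := dyadic_energy_ge0 k (2 * c).+1.
have cE : (c * 2 ^ k.+1 = 2 * c * 2 ^ k)%N by rewrite expnS mulnA [(c * 2)%N]mulnC.
have [tk'|kt] := leqP t (2 ^ k).
  rewrite cE; apply: le_trans (IH (2 * c)%N t tk') _.
  apply: ler_pM => //; first by rewrite ler_nat.
  by rewrite addrA addrAC lerDr addr_ge0.
have t' : (t - 2 ^ k <= 2 ^ k)%N by move: tk; rewrite expnS; clear; lia.
have := IH (2 * c).+1 (t - 2 ^ k)%N t'.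
have -> : ((2 * c).+1 * 2 ^ k + (t - 2 ^ k) = c * 2 ^ k.+1 + t)%N.
  by rewrite mulSn -cE addnAC subnKC 1?addnC// ltnW.
have top : (S ((2 * c).+1 * 2 ^ k) - S (2 * c * 2 ^ k)) ^+ 2 <= dyadic_energy k (2 * c).
  by case: (k) => [|k'] /=; rewrite lerDl// addr_ge0// dyadic_energy_ge0.
rewrite cE in top *.
set u := S (2 * c * 2 ^ k + t); set v := S ((2 * c).+1 * 2 ^ k); set w := S (2 * c * 2 ^ k).
move=> h1; rewrite (_ : u - w = (u - v) + (v - w)); last by ring.
have k0 : 0 < k.+1%:R :> R by [].
rewrite -[k.+2%:R]natr1.
move: top h1 El Er; rewrite -/v -/w; generalize (dyadic_energy k (2 * c)) (dyadic_energy k (2 * c).+1).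
move: k0; generalize (k.+1%:R : R) (u - v) (v - w) => n y z n0 A B top h1 A0 B0.
(* The full left half and the path inside the right half are combined by [(y + z) ^ 2 <= (n + 1) *
   (y ^ 2 / n + z ^ 2)], where [n] is the number of levels below; equality holds for [y = n * z]. *)
have h2 : (n + 1) * (y ^+ 2 / n + z ^+ 2) <= (n + 1) * (a2 + (A + B)).
  apply: ler_wpM2l; first by lra.
  have : y ^+ 2 / n <= B by rewrite ler_pdivrMr// mulrC.
  lra.
apply: le_trans h2.
rewrite -subr_ge0 (_ : _ - _ = (y - n * z) ^+ 2 / n); last by field; rewrite gt_eqF.
by rewrite divr_ge0 ?sqr_ge0// ltW.
Qed.

End dyadic_maximal.

Section integrable_functions.
Context (R : realType) d (T : measurableType d) (P : probability T R).
Implicit Types f g : T -> R.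

Let integ f := P.-integrable setT (EFin \o f).

Lemma integrable_fun0 : integ (fun=> 0).
Proof. exact: bdd_integrable (bdd_cst _ 0). Qed.

Lemma integrable_funD f g : integ f -> integ g -> integ (fun x => f x + g x).
Proof. by move=> jf jg; exact: (integrableD measurableT jf jg). Qed.

Lemma integrable_funZ (c : R) f : integ f -> integ (fun x => c * f x).
Proof. by move=> jf; exact: (integrableZl measurableT c jf). Qed.

Lemma mean_integrableZ (c : R) f : integ f -> mean P (fun x => c * f x) = c * mean P f.
Proof. by move=> jf; exact: (RintegralZl c measurableT jf). Qed.

Lemma integrable_fun_sum (I : Type) (s : seq I) (F : I -> T -> R) :
  (forall i, integ (F i)) -> integ (fun x => \sum_(i <- s) F i x).
Proof.
move=> jF; elim: s => [|i s IH].
  by under eq_fun do rewrite big_nil; exact: integrable_fun0.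
by under eq_fun do rewrite big_cons; exact: integrable_funD.
Qed.

Lemma mean_integrableD f g : integ f -> integ g ->
  mean P (fun x => f x + g x) = mean P f + mean P g.
Proof. by move=> jf jg; exact: (RintegralD measurableT jf jg). Qed.

Lemma mean_integrable_sum (I : Type) (s : seq I) (F : I -> T -> R) :
  (forall i, integ (F i)) ->
  mean P (fun x => \sum_(i <- s) F i x) = \sum_(i <- s) mean P (F i).
Proof.
move=> jF; elim: s => [|i s IH].
  by under eq_mean do rewrite big_nil; rewrite big_nil mean_cst.
under eq_mean do rewrite big_cons; rewrite big_cons -IH.
by apply: mean_integrableD => //; exact: integrable_fun_sum.
Qed.

Lemma integrable_meanE f : integ f -> (mean P f)%:E = (\int[P]_x (f x)%:E)%E.
Proof. by move=> jf; rewrite /mean /Rintegral fineK// integrable_fin_num. Qed.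

End integrable_functions.

Section energy.
Context (R : realType) d (T : measurableType d) (P : probability T R).
Variable Y : nat -> T -> R.
Hypothesis jY : forall j j', P.-integrable setT (EFin \o (fun x => Y j x * Y j' x)).

Let S x m : R := \sum_(0 <= j < m) Y j x.

(** With absolute values the sum is superadditive over adjacent blocks, so that each of the [k + 1]
    dyadic levels contributes at most the value for the whole block. *)
Definition correlation_sum (a b : nat) : R :=
  \sum_(a <= j < b) \sum_(a <= j' < b) `|mean P (fun x => Y j x * Y j' x)|.

Lemma correlation_sum_cat (a b c : nat) : (a <= b <= c)%N ->
  correlation_sum a b + correlation_sum b c <= correlation_sum a c.
Proof.
move=> /andP[ab bc]; rewrite /correlation_sum [leRHS](@big_cat_nat _ _ _ b a c)//=.
apply: lerD; apply: ler_sum => j _; rewrite [leRHS](@big_cat_nat _ _ _ b a c)//=.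
  by rewrite lerDl sumr_ge0.
by rewrite lerDr sumr_ge0.
Qed.

Let block_sqr a b x : (a <= b)%N -> (S x b - S x a) ^+ 2 =
  \sum_(a <= j < b) \sum_(a <= j' < b) Y j x * Y j' x.
Proof.
move=> ab; rewrite /S (@big_cat_nat _ _ _ a 0 b)//= addrAC subrr add0r.
by rewrite expr2 mulr_suml; apply: eq_bigr => j _; rewrite mulr_sumr.
Qed.

Lemma integrable_block a b : (a <= b)%N ->
  P.-integrable setT (EFin \o (fun x => (S x b - S x a) ^+ 2)).
Proof.
move=> ab; under eq_fun do rewrite block_sqr//.
by apply: integrable_fun_sum => j; exact: integrable_fun_sum.
Qed.

Lemma mean_block a b : (a <= b)%N ->
  mean P (fun x => (S x b - S x a) ^+ 2) <= correlation_sum a b.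
Proof.
move=> ab; under eq_mean do rewrite block_sqr//.
rewrite mean_integrable_sum; last by move=> j; exact: integrable_fun_sum.
apply: ler_sum => j _; rewrite mean_integrable_sum//; apply: ler_sum => j' _.
exact: ler_norm.
Qed.

Let le_block k c : (c * 2 ^ k <= c.+1 * 2 ^ k)%N.
Proof. by rewrite leq_mul2r leqnSn orbT. Qed.

Lemma integrable_energy k c : P.-integrable setT (EFin \o (fun x => dyadic_energy (S x) k c)).
Proof.
elim: k c => [|k IH] c; rewrite /=.
  by apply: integrable_funD; [exact: integrable_block|exact: integrable_fun0].
by apply: integrable_funD; [exact: integrable_block|exact: integrable_funD].
Qed.

Lemma mean_energy k c :
  mean P (fun x => dyadic_energy (S x) k c) <=
  k.+1%:R * correlation_sum (c * 2 ^ k) (c.+1 * 2 ^ k).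
Proof.
elim: k c => [|k IH] c.
  rewrite /= mean_integrableD; [|exact: integrable_block|exact: integrable_fun0].
  by rewrite mean_cst addr0 mul1r; exact: mean_block.
have jE := integrable_energy k.
rewrite [dyadic_energy]lock /= -lock.
rewrite (_ : mean P _ = mean P (fun x => (S x (c.+1 * 2 ^ k.+1)%N - S x (c * 2 ^ k.+1)%N) ^+ 2) +
   (mean P (fun x => dyadic_energy (S x) k (2 * c)) +
    mean P (fun x => dyadic_energy (S x) k (2 * c).+1))); last first.
  rewrite -mean_integrableD// -mean_integrableD//; [exact: integrable_block|exact: integrable_funD].
rewrite -[k.+2%:R]natr1 mulrDl mul1r addrC; apply: lerD; last exact: mean_block.
apply: le_trans (lerD (IH _) (IH _)) _; rewrite -mulrDr ler_wpM2l//.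
have e1 : (c * 2 ^ k.+1 = 2 * c * 2 ^ k)%N by rewrite expnS mulnA [(c * 2)%N]mulnC.
have e2 : (c.+1 * 2 ^ k.+1 = (2 * c).+2 * 2 ^ k)%N by rewrite expnS mulnA; congr (_ * _)%N; lia.
by rewrite e1 e2; apply: correlation_sum_cat; rewrite !le_block.
Qed.

End energy.

(** * Second moments: summation over quadruples *)

Section quadruples.
Context (R : realType) d (T : measurableType d) (P : probability T R).
Variables (delta tau : R) (g : nat -> nat -> T -> R) (psi : nat -> R) (C : R).
Hypothesis d0 : 0 < delta.
Hypothesis gpsi : grows tau psi.
Hypothesis tau0 : 0 <= tau.
Hypothesis dec : array_decay P g psi C.
Hypothesis mg : forall i j, (1 <= i < j)%N -> measurable_fun setT (g i j).
Hypothesis Mg : forall i j, (1 <= i < j)%N ->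
  (\int[P]_w (`|g i j w| `^ (2 + delta))%:E <= C%:E)%E.

Let p0 : forall k, 0 <= psi k. Proof. by case: gpsi. Qed.

Definition restricted (i j : nat) (w : T) : R := if (1 <= i < j)%N then g i j w else 0.

Let C' := 1 + 2 * `|C|.

Lemma restricted_integrable i j i' j' :
  P.-integrable setT (EFin \o (fun w => restricted i j w * restricted i' j' w)).
Proof.
rewrite /restricted; have [ij|ij] := boolP (1 <= i < j)%N => /=; last first.
  by under eq_fun do rewrite mul0r; exact: integrable_fun0.
have [ij'|ij'] := boolP (1 <= i' < j')%N => /=; last first.
  by under eq_fun do rewrite mulr0; exact: integrable_fun0.
by have [] := mean_trunc_prod d0 ltr01 (mg ij) (mg ij') (Mg ij) (Mg ij').
Qed.

Lemma moment_bound i j i' j' : (1 <= i < j)%N -> (1 <= i' < j')%N ->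
  `|mean P (fun w => g i j w * g i' j' w)| <= C'.
Proof.
move=> ij ij'; have [_ h1] := mean_trunc_prod d0 ltr01 (mg ij) (mg ij') (Mg ij) (Mg ij').
have b1 i1 j1 : (1 <= i1 < j1)%N -> bdd (fun w => trunc 1 (g i1 j1 w)).
  by move=> h; apply: bdd_trunc => //; exact: mg.
have bT := bddM (b1 _ _ ij) (b1 _ _ ij').
have h2 : `|mean P (fun w => trunc 1 (g i j w) * trunc 1 (g i' j' w))| <= 1.
  apply: le_trans (mean_abs _ bT) _; apply: mean_le_cst; first by bdd_tac.
  by move=> w; rewrite normrM mulr_ile1// trunc_le.
move: h1 h2; rewrite powR1 mul1r; set u := mean _ _; set v := mean _ _ => h1 h2.
rewrite (_ : u = (u - v) + v); last by ring.
rewrite (le_trans (ler_normD _ _))// /C' addrC lerD// (le_trans h1)//.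
by rewrite ler_wpM2l// ler_norm.
Qed.

(** The unit at 0 takes care of the quadruples with [i = i'] and [j = j'], for which only the moment
    bound is available. *)
Let psi' k := psi k + (k == 0%N)%:R.
Let p0' k : 0 <= psi' k. Proof. by rewrite addr_ge0. Qed.

(** The larger of the first and the last gap is used. For nested or overlapping pairs these gaps are
    the distances from [i] to [i'] and from [j] to [j']; for disjoint pairs they are the lengths of
    the two pairs. The two terms cover both configurations. *)
Lemma restricted_correlation i j i' j' :
  `|mean P (fun w => restricted i j w * restricted i' j' w)| <=
  C' * (psi' (maxn (gap i i') (gap j j')) + psi' (maxn (gap i j) (gap i' j'))).
Proof.
have C'0 : 0 <= C' by rewrite addr_ge0// mulr_ge0.
have rhs0 k m : 0 <= C' * (psi' k + psi' m) by rewrite mulr_ge0// addr_ge0.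
have C_C' : C <= C'.
  have := ler_norm C; have := normr_ge0 C; rewrite /C'; lra.
rewrite /restricted; have [ij|ij] := boolP (1 <= i < j)%N => /=; last first.
  by under eq_mean do rewrite mul0r; rewrite mean_cst normr0.
have [ij'|ij'] := boolP (1 <= i' < j')%N => /=; last first.
  by under eq_mean do rewrite mulr0; rewrite mean_cst normr0.
have comm (G H : T -> R) : mean P (fun w => G w * H w) = mean P (fun w => H w * G w).
  by apply: eq_mean => w; rewrite mulrC.
have [decA decB] := dec.
have fin (u : R) k a b : (k = a \/ k = b) -> u <= C * psi k -> u <= C' * (psi' a + psi' b).
  move=> kab /le_trans; apply; apply: (@le_trans _ _ (C' * psi k)); first by rewrite ler_wpM2r.
  rewrite ler_wpM2l//; case: kab => ->; rewrite /psi'; have := p0 a; have := p0 b.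
    by have := ler0n R (a == 0)%N; have := ler0n R (b == 0)%N; lra.
  by have := ler0n R (a == 0)%N; have := ler0n R (b == 0)%N; lra.
have [/andP[/eqP ii /eqP jj]|neq] := boolP ((i == i') && (j == j')).
  apply: le_trans (moment_bound ij ij') _; rewrite ler_peMr//.
  rewrite {1}/psi' ii jj /gap !subnn/=; have := p0 0; have := p0' (maxn (gap i' j') (gap i' j')).
  by rewrite /gap; lra.
have [c1|c1] := ltnP i i'; have [c2|c2] := ltnP j' j.
- have [le|lt] := leqP (gap j j') (gap i i').
    apply: fin (decA _ _ _ _ ij ij' c1); left; move: le ij ij' c1 c2; rewrite /gap; clear; lia.
  apply: fin (decB _ _ _ _ ij ij' c2); left; move: lt ij ij' c1 c2; rewrite /gap; clear; lia.
- have [ov|dj] := ltnP i' j.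
    have [le|lt] := leqP (gap j j') (gap i i').
      apply: fin (decA _ _ _ _ ij ij' c1); left; move: ov le ij ij' c1 c2; rewrite /gap; clear; lia.
    have c2' : (j < j')%N by move: lt ij ij' c1 c2; rewrite /gap; clear; lia.
    rewrite (comm (g i j) (g i' j')); apply: fin (decB _ _ _ _ ij' ij c2'); left; move: ov lt ij ij' c1 c2; rewrite /gap; clear; lia.
  have c2' : (j < j')%N by move: dj ij ij' c1 c2; clear; lia.
  have [le|lt] := leqP (j' - i') (j - i).
    apply: fin (decA _ _ _ _ ij ij' c1); right; move: dj le ij ij' c1 c2; rewrite /gap; clear; lia.
  rewrite (comm (g i j) (g i' j')); apply: fin (decB _ _ _ _ ij' ij c2'); right; move: dj lt ij ij' c1 c2; rewrite /gap; clear; lia.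
- have [ov|dj] := ltnP i j'.
    have [le|lt] := leqP (gap i i') (gap j j').
      apply: fin (decB _ _ _ _ ij ij' c2); left; move: ov le ij ij' c1 c2; rewrite /gap; clear; lia.
    have c1' : (i' < i)%N by move: lt ij ij' c1 c2; rewrite /gap; clear; lia.
    rewrite (comm (g i j) (g i' j')); apply: fin (decA _ _ _ _ ij' ij c1'); left; move: ov lt ij ij' c1 c2; rewrite /gap; clear; lia.
  have c1' : (i' < i)%N by move: dj ij ij' c1 c2; clear; lia.
  have [le|lt] := leqP (j' - i') (j - i).
    apply: fin (decB _ _ _ _ ij ij' c2); right; move: dj le ij ij' c1 c2; rewrite /gap; clear; lia.
  rewrite (comm (g i j) (g i' j')); apply: fin (decA _ _ _ _ ij' ij c1'); right; move: dj lt ij ij' c1 c2; rewrite /gap; clear; lia.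
- have [le|lt] := leqP (gap j j') (gap i i').
    have c1' : (i' < i)%N by move: neq le ij ij' c1 c2; rewrite /gap; clear; lia.
    rewrite (comm (g i j) (g i' j')); apply: fin (decA _ _ _ _ ij' ij c1'); left; move: le ij ij' c1 c2; rewrite /gap; clear; lia.
  have c2' : (j < j')%N by move: lt ij ij' c1 c2; rewrite /gap; clear; lia.
  rewrite (comm (g i j) (g i' j')); apply: fin (decB _ _ _ _ ij' ij c2'); left; move: lt ij ij' c1 c2; rewrite /gap; clear; lia.
Qed.

Lemma sum_rate : exists2 D : R, 0 <= D & forall N : nat, (1 <= N)%N ->
  \sum_(0 <= k < N) k.+1%:R * psi' k <= D * N%:R `^ tau.
Proof.
have [_ [D [D0 HD]]] := gpsi.
exists (1 + psi 0%N + 2 * D); first by rewrite !addr_ge0// mulr_ge0.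
case=> // N _; have Nt : 1 <= N.+1%:R `^ tau :> R.
  by rewrite -[leLHS](powRr0 N.+1%:R) ler_powR// ler1n.
have h1 : \sum_(0 <= k < N.+1) k.+1%:R * psi' k <=
    1 + psi 0%N + 2 * \sum_(0 <= k < N.+1) k%:R * psi k.
  rewrite big_nat_recl// [in leRHS]big_nat_recl// mul1r mul0r add0r /psi' eqxx.
  rewrite [psi 0%N + _]addrC lerD2l mulr_sumr; apply: ler_sum => k _.
  by rewrite addr0 mulrA ler_wpM2r// -natrM ler_nat; clear; lia.
apply: le_trans h1 _; have h2 := HD N.+1 isT.
have h3 := sum_nat_le (F := fun k => k%:R * psi k) (fun k => mulr_ge0 (ler0n _ k) (p0 k)) (leqnSn N.+1).
have h4 : \sum_(0 <= k < N.+1) k%:R * psi k <= D * N.+1%:R `^ tau := le_trans h3 h2.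
have aux (t u v : R) : 1 <= t -> v <= D * t -> 0 <= u -> 1 + u + 2 * v <= (1 + u + 2 * D) * t.
  by nra.
exact: aux Nt h4 (p0 0%N).
Qed.

Definition column (j : nat) (w : T) : R := \sum_(0 <= i < j) restricted i j w.

Lemma column_integrable j j' : P.-integrable setT (EFin \o (fun w => column j w * column j' w)).
Proof.
under eq_fun do rewrite /column mulr_suml.
apply: integrable_fun_sum => i; under eq_fun do rewrite mulr_sumr.
by apply: integrable_fun_sum => i'; exact: restricted_integrable.
Qed.

Lemma column_correlation j j' (N : nat) : (j < N)%N -> (j' < N)%N ->
  `|mean P (fun w => column j w * column j' w)| <=
  \sum_(0 <= i < N) \sum_(0 <= i' < N)
    `|mean P (fun w => restricted i j w * restricted i' j' w)|.
Proof.
move=> jN j'N; pose c i i' := `|mean P (fun w => restricted i j w * restricted i' j' w)|.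
apply: (@le_trans _ _ (\sum_(0 <= i < j) \sum_(0 <= i' < j') c i i')).
  rewrite (_ : mean P _ = \sum_(0 <= i < j) \sum_(0 <= i' < j')
      mean P (fun w => restricted i j w * restricted i' j' w)).
    by apply: le_trans (ler_norm_sum _ _ _) _; apply: ler_sum => i _; exact: ler_norm_sum.
  under eq_mean do rewrite /column mulr_suml.
  rewrite mean_integrable_sum; last first.
    move=> i; under eq_fun do rewrite mulr_sumr.
    by apply: integrable_fun_sum => i'; exact: restricted_integrable.
  apply: eq_bigr => i _; under eq_mean do rewrite mulr_sumr.
  by rewrite mean_integrable_sum// => i'; exact: restricted_integrable.
apply: (@le_trans _ _ (\sum_(0 <= i < N) \sum_(0 <= i' < j') c i i')).
  apply: sum_nat_le; [by move=> k; apply: sumr_ge0 => i _; exact: normr_ge0|exact: ltnW].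
apply: ler_sum => i _; apply: (sum_nat_le (F := c i)); [by move=> k; exact: normr_ge0|exact: ltnW].
Qed.

(** After reordering, both terms of [restricted_correlation] give the same sum: two gaps leave two
    free indices, hence [N ^ 2], and the maximum of the gaps produces the weight [k] of the growth
    condition. *)
Lemma correlation_sum_bound : exists2 D : R, 0 <= D & forall N : nat, (1 <= N)%N ->
  correlation_sum P column 0 N <= D * (N%:R ^+ 2 * N%:R `^ tau).
Proof.
have [D D0 HD] := sum_rate; have C'0 : 0 <= C' by rewrite addr_ge0// mulr_ge0.
exists (16 * C' * D); first by rewrite !mulr_ge0.
move=> N N1; pose Th k m := psi' (maxn k m).
have Th0 k m : 0 <= Th k m by exact: p0'.
pose X4 := \sum_(0 <= i < N) \sum_(0 <= i' < N) \sum_(0 <= j < N) \sum_(0 <= j' < N)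
  Th (gap i i') (gap j j').
have hX4 : X4 <= 4 * N%:R ^+ 2 * (2 * (D * N%:R `^ tau)).
  apply: le_trans (sum_gap2 N Th0) _; rewrite ler_wpM2l ?mulr_ge0 ?sqr_ge0//.
  by apply: le_trans (sum_max N p0') _; rewrite ler_wpM2l// HD.
apply: (@le_trans _ _ (C' * (X4 + X4))); last first.
  rewrite (_ : 16 * C' * D * _ = C' * (2 * (4 * N%:R ^+ 2 * (2 * (D * N%:R `^ tau))))); last by ring.
  rewrite ler_wpM2l// (_ : 2 * (_ * _) = 4 * N%:R ^+ 2 * (2 * (D * N%:R `^ tau)) +
     4 * N%:R ^+ 2 * (2 * (D * N%:R `^ tau))) ?lerD//; ring.
apply: (@le_trans _ _ (\sum_(0 <= j < N) \sum_(0 <= j' < N) \sum_(0 <= i < N) \sum_(0 <= i' < N)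
   C' * (Th (gap i i') (gap j j') + Th (gap i j) (gap i' j')))).
  apply: ler_sum_nat => j /andP[_ jN]; apply: ler_sum_nat => j' /andP[_ j'N].
  apply: le_trans (column_correlation jN j'N) _.
  by apply: ler_sum => i _; apply: ler_sum => i' _; exact: restricted_correlation.
rewrite le_eqVlt; apply/orP; left; apply/eqP.
under eq_bigr do under eq_bigr do under eq_bigr do rewrite -mulr_sumr.
under eq_bigr do under eq_bigr do rewrite -mulr_sumr.
under eq_bigr do rewrite -mulr_sumr.
rewrite -mulr_sumr; congr (_ * _).
under eq_bigr do under eq_bigr do under eq_bigr do rewrite big_split/=.
under eq_bigr do under eq_bigr do rewrite big_split/=.
under eq_bigr do rewrite big_split/=.
rewrite big_split/=; congr (_ + _).
  under eq_bigr do rewrite exchange_big/=.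
  rewrite exchange_big/= /X4; apply: eq_bigr => i _.
  under eq_bigr do rewrite exchange_big/=.
  rewrite exchange_big/=; apply: eq_bigr => i' _.
  by [].
under eq_bigr do rewrite exchange_big/=.
rewrite exchange_big/= /X4; apply: eq_bigr => i _; apply: eq_bigr => j _.
by rewrite exchange_big.
Qed.

End quadruples.

(** * Almost sure convergence along dyadic scales and the normalization *)

Section almost_sure.
Context (R : realType) d (T : measurableType d) (P : probability T R).

(** The series of the [W k] has a finite mean, so it converges almost surely and its terms tend to
    0. *)
Lemma summable_means_ae (W : nat -> T -> R) (u : nat -> R) (c : R) :
  (forall k w, 0 <= W k w) -> (forall k, P.-integrable setT (EFin \o W k)) ->
  (forall k, mean P (W k) <= u k) -> (forall n, \sum_(0 <= k < n) u k <= c) ->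
  {ae P, forall w, W k w @[k --> \oo] --> (0 : R)}.
Proof.
move=> W0 jW Wu uc.
have mW k : measurable_fun setT (fun w => (W k w)%:E) := measurable_int _ (jW k).
have W0E k w : (0 <= (W k w)%:E)%E by rewrite lee_fin.
pose F w := (\big[+%E/0%R]_(0 <= k <oo) (W k w)%:E)%E.
have mF : measurable_fun setT F by apply: ge0_emeasurable_sum => //.
have F0 w : (0 <= F w)%E by exact: nneseries_ge0.
have Fc : (\int[P]_w F w <= c%:E)%E.
  rewrite integral_nneseries//; apply: lime_le.
    by apply: is_cvg_nneseries => k _ _; exact: integral_ge0.
  apply: nearW => n; rewrite (eq_bigr (fun k => (mean P (W k))%:E)); last first.
    by move=> k _; rewrite (integrable_meanE (jW k)).
  rewrite sumEFin lee_fin; apply: le_trans (uc n).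
  exact: ler_sum.
have jF : P.-integrable setT F.
  apply/integrableP; split => //.
  under eq_integral do rewrite gee0_abs//.
  exact: le_lt_trans Fc (ltry _).
apply: filterS (integrable_ae measurableT jF) => w /(_ Logic.I) Fw.
apply: cvg_series_cvg_0; apply: nondecreasing_is_cvgn => [m n mn|].
  by rewrite /series/= (@big_cat_nat _ _ _ m 0 n)//= lerDl sumr_ge0.
exists (fine (F w)) => _ [n _ <-].
rewrite -lee_fin fineK// /series/= -sumEFin.
by apply: nneseries_lim_ge => k _ _.
Qed.

Lemma ln_gt0S k : 0 < ln k.+2%:R :> R.
Proof. by rewrite ln_gt0// ltr1n. Qed.

(** A summable weight of order [1 / (k * ln k ^ 2)], shifted so that the logarithm is positive from
    the start. *)
Definition log_weight (k : nat) : R := (k.+3%:R * ln k.+3%:R ^+ 2)^-1.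

Lemma log_weight_gt0 k : 0 < log_weight k.
Proof. by rewrite invr_gt0 mulr_gt0// exprn_gt0// ln_gt0S. Qed.

(* [1 / ln x] telescopes: its increments dominate [1 / (x (ln x) ^ 2)]. *)
Lemma log_weight_sum n : \sum_(0 <= k < n) log_weight k <= (ln 2%:R)^-1.
Proof.
suff : \sum_(0 <= k < n) log_weight k <= (ln 2%:R)^-1 - (ln n.+2%:R)^-1.
  by move=> /le_trans; apply; rewrite lerBlDr lerDl invr_ge0 ltW// ln_gt0S.
elim: n => [|n IH]; first by rewrite big_geq// subrr.
rewrite big_nat_recr//=; apply: le_trans (lerD IH (lexx _)) _.
have la := ln_gt0S n; have lb := ln_gt0S n.+1.
have incr : n.+3%:R^-1 <= ln n.+3%:R - ln n.+2%:R :> R.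
  have n3 : (0 : R) < n.+3%:R by [].
  have e : n.+2%:R = n.+3%:R * (1 - n.+3%:R^-1) :> R.
    by rewrite mulrBr mulr1 mulfV ?gt_eqF// -[n.+3%:R]natr1 addrK.
  have p1 : 0 < 1 - n.+3%:R^-1 :> R by rewrite subr_gt0 invf_lt1// ltr1n.
  rewrite e lnM ?posrE// opprD addrA subrr sub0r lerNr.
  by apply: le_trans (le_ln1Dx _) _; rewrite ?ltrN2 ?invf_lt1 ?ltr1n.
have lab : ln n.+2%:R <= ln n.+3%:R :> R by rewrite ler_ln ?posrE// ler_nat.
rewrite -addrA lerD2l -lerBrDl opprK addrC.
rewrite (_ : _ - _ = (ln n.+3%:R - ln n.+2%:R) / (ln n.+2%:R * ln n.+3%:R)); last first.
  by field; rewrite !gt_eqF.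
rewrite /log_weight invfM; apply: ler_pM; rewrite ?invr_ge0 ?sqr_ge0//.
rewrite lef_pV2 ?posrE ?mulr_gt0 ?exprn_gt0// expr2.
by rewrite ler_wpM2r// ltW.
Qed.

End almost_sure.

Section normalization.
Context (R : realType).

Lemma ln2_ge_half : 2^-1 <= ln 2 :> R.
Proof.
have h : ln (2^-1) = - ln 2 :> R by rewrite lnV// posrE.
have := @le_ln1Dx R (- 2^-1) ltac:(lra).
rewrite (_ : 1 + - 2^-1 = 2^-1); last by lra.
by rewrite h lerN2.
Qed.

Lemma ln_dyadic_ge (k n : nat) : (2 ^ k <= n)%N -> k%:R / 2 <= ln n%:R :> R.
Proof.
move=> kn; have n0 : (0 < n)%N by apply: leq_trans kn; rewrite expn_gt0.
apply: (@le_trans _ _ (ln (2 ^ k)%:R)); last by rewrite ler_ln ?posrE ?ltr0n ?expn_gt0// ler_nat.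
by rewrite natrX lnXn// -[leRHS]mulr_natl ler_wpM2l// ln2_ge_half.
Qed.

Lemma bin2_ge (n : nat) : (2 <= n)%N -> (n ^ 2 <= 4 * 'C(n, 2))%N.
Proof.
case: n => [|[|n]]// _; elim: n => [//|n IH].
rewrite binS bin1 mulnDr; move: IH; rewrite !expnS !expn0 !muln1.
by generalize ('C(n.+2, 2)) => c; nia.
Qed.

Lemma dyadic_scale (n : nat) : (1 <= n)%N -> exists k,
  (n.+1 <= 2 ^ k.+1)%N /\ (2 ^ k <= n)%N.
Proof.
move=> n1; have := up_log_bounds (isT : (1 < 2)%N) (n1 : (1 < n.+1)%N) => /=.
have : (0 < up_log 2 n.+1)%N by rewrite up_log_gt0.
case: (up_log 2 n.+1) => [//|k _] /= /andP[h1 h2].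
by exists k.
Qed.

(** The scale contributes [(k + 4) ^ 3 * ln (k + 4) ^ 2], comparable with
    [ln n ^ 3 * ln (ln n) ^ 2], whose square root is the logarithmic normalization. In the constant,
    16 comes from the binomial coefficient, [2 ^ 2] and [2 ^ tau] from [2 ^ (k + 1) <= 2 * n], and
    256 from the logarithms. The bound [8 <= k] ensures [4 <= ln n], so that additive constants can
    be absorbed. *)
Lemma normalized_sqr_le (tau D W B : R) (n k : nat) : 0 <= tau -> (8 <= k)%N ->
  (2 ^ k <= n)%N -> (n.+1 <= 2 ^ k.+1)%N -> D ^+ 2 <= B ->
  B = W * ((2 ^ k.+1)%:R ^+ 2 * (2 ^ k.+1)%:R `^ tau * k.+4%:R ^+ 2 / log_weight R k.+1) ->
  (n%:R `^ (1 - tau / 2) / (ln n%:R `^ (3 / 2) * ln (ln n%:R)) * ('C(n, 2)%:R^-1 * D)) ^+ 2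
  <= 16 * 2 ^+ 2 * 2 `^ tau * 256 * W.
Proof.
move=> tau0 k8 kn nk DB BW.
have n2 : (2 <= n)%N.
  by apply: leq_trans kn; rewrite (leq_trans _ (ltn_expl k (ltnSn 1)))//; move: k8; clear; lia.
have n0 : 0 < n%:R :> R by rewrite ltr0n; move: n2; clear; lia.
set x : R := n%:R in n0 *.
pose l := ln x; pose m := ln l.
have l_ge : k%:R / 2 <= l := ln_dyadic_ge kn.
have k8' : 8 <= k%:R :> R by rewrite (ler_nat _ 8).
have l4 : 4 <= l by apply: le_trans l_ge; lra.
have l0 : 0 < l by lra.
have kl : k.+4%:R <= 4 * l.
  have -> : k.+4%:R = k%:R + 4 :> R by rewrite -natrD addnC.
  lra.
have m4 : ln 4 <= m by rewrite ler_ln ?posrE.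
have ln4 : 0 < ln 4 :> R by rewrite ln_gt0// ltr1n.
have m0 : 0 < m := lt_le_trans ln4 m4.
have lnk : ln k.+4%:R <= 2 * m.
  apply: (@le_trans _ _ (ln (4 * l))); first by rewrite ler_ln ?posrE ?mulr_gt0.
  by rewrite lnM ?posrE// -/m; lra.
have lnk0 : 0 < ln k.+4%:R :> R by exact: ln_gt0S.
have W0 : 0 <= W.
  have pos : 0 < (2 ^ k.+1)%:R ^+ 2 * (2 ^ k.+1)%:R `^ tau * k.+4%:R ^+ 2 / log_weight R k.+1.
    have N0 : 0 < (2 ^ k.+1)%:R :> R by rewrite ltr0n expn_gt0.
    by rewrite divr_gt0 ?log_weight_gt0// !mulr_gt0 ?exprn_gt0// powR_gt0.
  rewrite -(pmulr_lge0 _ pos) -BW; exact: le_trans (sqr_ge0 _) DB.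
have bin4 : 'C(n, 2)%:R^-1 <= 4 / x ^+ 2.
  have := bin2_ge n2; rewrite -(ler_nat R) natrX natrM -/x => h.
  have c0 : 0 < 'C(n, 2)%:R :> R by rewrite ltr0n bin_gt0.
  by rewrite ler_pdivlMr ?exprn_gt0// mulrC ler_pdivrMr.
have lhsE : (x `^ (1 - tau / 2) / (l `^ (3 / 2) * m) * ('C(n, 2)%:R^-1 * D)) ^+ 2 =
    x ^+ 2 / x `^ tau / (l ^+ 3 * m ^+ 2) * ('C(n, 2)%:R^-1 ^+ 2 * D ^+ 2).
  have e1 : (x `^ (1 - tau / 2)) ^+ 2 = x ^+ 2 / x `^ tau.
    rewrite -powR_mulrn ?powR_ge0// -powRrM (_ : (1 - tau / 2) * 2 = 2 - tau); last by field.
    rewrite powRB; last by rewrite (gt_eqF n0) implybT.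
    by rewrite powR_mulrn// ltW.
  have e2 : (l `^ (3 / 2)) ^+ 2 = l ^+ 3.
    rewrite -powR_mulrn ?powR_ge0// -powRrM (_ : 3 / 2 * 2 = 3); last by field.
    by rewrite powR_mulrn// ltW.
  by rewrite !exprMn !exprVn !exprMn e1 e2.
rewrite -/l -/m lhsE.
have N2x : (2 ^ k.+1)%:R <= 2 * x.
  by rewrite /x -natrM ler_nat expnS leq_mul2l kn orbT.
have N0 : 0 <= (2 ^ k.+1)%:R :> R by [].
have hB : B <= W * ((2 * x) ^+ 2 * (2 * x) `^ tau * (4 * l) ^+ 2 * (4 * l * (2 * m) ^+ 2)).
  rewrite BW ler_wpM2l// /log_weight invrK.
  have s (u v : R) : 0 <= u -> u <= v -> u ^+ 2 <= v ^+ 2.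
    by move=> u0 uv; rewrite ler_pXn2r ?nnegrE// (le_trans u0).
  have a0 : 0 <= (2 ^ k.+1)%:R ^+ 2 * (2 ^ k.+1)%:R `^ tau :> R.
    by rewrite mulr_ge0 ?sqr_ge0 ?powR_ge0.
  apply: ler_pM.
  - by rewrite mulr_ge0 ?sqr_ge0.
  - by rewrite mulr_ge0 ?sqr_ge0.
  - apply: ler_pM; [exact: a0|exact: sqr_ge0| |exact: s].
    apply: ler_pM; [exact: sqr_ge0|exact: powR_ge0|exact: s|].
    by rewrite ge0_ler_powR ?nnegrE ?mulr_ge0// ltW.
  - by apply: ler_pM; [|exact: sqr_ge0| |apply: s => //; exact: ltW].
have D_le := le_trans DB hB.
have xt0 : 0 < x `^ tau by rewrite powR_gt0.
rewrite powRM ?(ltW n0)// in D_le.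
apply: (@le_trans _ _ (x ^+ 2 / x `^ tau / (l ^+ 3 * m ^+ 2) * ((4 / x ^+ 2) ^+ 2 *
   (W * ((2 * x) ^+ 2 * (2 `^ tau * x `^ tau) * (4 * l) ^+ 2 * (4 * l * (2 * m) ^+ 2)))))).
  apply: ler_wpM2l.
    by rewrite !divr_ge0 ?mulr_ge0 ?exprn_ge0 ?(ltW n0) ?(ltW xt0) ?(ltW l0) ?(ltW m0).
  apply: ler_pM; rewrite ?sqr_ge0//.
  by rewrite ler_pXn2r ?nnegrE ?invr_ge0 ?divr_ge0 ?sqr_ge0.
rewrite le_eqVlt; apply/orP; left; apply/eqP.
move: xt0; generalize (x `^ tau) (2 `^ tau : R) => y z y0.
by field; rewrite !gt_eqF.
Qed.

End normalization.

Section convergence.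
Context (R : realType) d (T : measurableType d) (P : probability T R).

Lemma normalized_convergence (tau C : R) (D B : nat -> T -> R) : 0 <= tau ->
  (forall k w, 0 <= B k w) -> (forall k, P.-integrable setT (EFin \o B k)) ->
  (forall k, mean P (B k) <= C * (k.+1%:R ^+ 2 * ((2 ^ k)%:R ^+ 2 * (2 ^ k)%:R `^ tau))) ->
  (forall k n w, (n.+1 <= 2 ^ k)%N -> D n w ^+ 2 <= B k w) ->
  {ae P, forall w,
    n%:R `^ (1 - tau / 2) / (ln n%:R `^ (3 / 2) * ln (ln n%:R)) *
      ('C(n, 2)%:R^-1 * D n w) @[n --> \oo] --> (0 : R)}.
Proof.
move=> tau0 B0 jB mB DB.
(* The growth allowed for the mean of [B k], divided by the summable weight; [B k / s k] then has
   summable means. *)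
pose s k : R := (2 ^ k)%:R ^+ 2 * (2 ^ k)%:R `^ tau * k.+3%:R ^+ 2 / log_weight R k.
have s0 k : 0 < s k.
  have N0 : 0 < (2 ^ k)%:R :> R by rewrite ltr0n expn_gt0.
  by rewrite divr_gt0 ?log_weight_gt0// !mulr_gt0 ?exprn_gt0// powR_gt0.
pose W k w := (s k)^-1 * B k w.
have W0 k w : 0 <= W k w by rewrite mulr_ge0// invr_ge0 ltW.
have jW k : P.-integrable setT (EFin \o W k).
  exact: integrable_funZ.
have mW k : mean P (W k) <= `|C| * log_weight R k.
  have -> : mean P (W k) = (s k)^-1 * mean P (B k) by exact: mean_integrableZ.
  rewrite mulrC ler_pdivrMr//; apply: le_trans (mB k) _.
  have N0 : 0 < (2 ^ k)%:R :> R by rewrite ltr0n expn_gt0.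
  rewrite (_ : `|C| * log_weight R k * s k =
     `|C| * (k.+3%:R ^+ 2 * ((2 ^ k)%:R ^+ 2 * (2 ^ k)%:R `^ tau))); last first.
    by rewrite /s; have := log_weight_gt0 R k => w0; field; rewrite gt_eqF.
  have r0 : 0 <= (2 ^ k)%:R ^+ 2 * (2 ^ k)%:R `^ tau :> R by rewrite mulr_ge0 ?sqr_ge0 ?powR_ge0.
  apply: (@le_trans _ _ (`|C| * (k.+1%:R ^+ 2 * ((2 ^ k)%:R ^+ 2 * (2 ^ k)%:R `^ tau)))).
    by rewrite ler_wpM2r ?ler_norm// mulr_ge0// sqr_ge0.
  rewrite ler_wpM2l// ler_wpM2r// ler_pXn2r ?nnegrE// ler_nat.
  by clear; lia.
have sumW n : \sum_(0 <= k < n) `|C| * log_weight R k <= `|C| * (ln 2%:R)^-1.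
  by rewrite -mulr_sumr ler_wpM2l// log_weight_sum.
apply: filterS (summable_means_ae W0 jW mW sumW) => w Wcvg.
pose c : R := 16 * 2 ^+ 2 * 2 `^ tau * 256.
have c0 : 0 < c by rewrite /c !mulr_gt0 ?exprn_gt0 ?powR_gt0.
apply/cvgrPdist_le => e e0.
have /cvgrPdist_le /(_ _ (divr_gt0 (exprn_gt0 2 e0) c0)) [K _ HK] := Wcvg.
exists (2 ^ (K + 8))%N => // n /= Kn.
have n1 : (1 <= n)%N by apply: leq_trans Kn; rewrite expn_gt0.
have [k [nk kn]] := dyadic_scale n1.
have Kk : (K + 8 <= k)%N.
  have : (2 ^ (K + 8) < 2 ^ k.+1)%N by apply: leq_ltn_trans Kn _; exact: nk.
  by rewrite ltn_exp2l// ltnS.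
have k8 : (8 <= k)%N by move: Kk; clear; lia.
rewrite sub0r normrN -(@ler_pXn2r _ 2) ?nnegrE ?(ltW e0)//.
rewrite real_normK ?num_real//.
have BW : B k.+1 w = W k.+1 w * s k.+1 by rewrite /W mulrAC mulVf ?mul1r// gt_eqF.
apply: le_trans (normalized_sqr_le tau0 k8 kn nk (DB k.+1 n w nk) BW) _.
rewrite -/c mulrC -ler_pdivlMr//.
have := HK k.+1 ltac:(rewrite /=; move: Kk; clear; lia).
by rewrite sub0r normrN ger0_norm// W0.
Qed.

End convergence.

(** * The remainder, summed in absolute value *)

Section error_energy.
Context (R : realType) d (T : measurableType d) (P : probability T R).
Variables (tau : R) (e : nat -> nat -> T -> R) (psi : nat -> R) (C : R).
Hypothesis me : forall i j, measurable_fun setT (e i j).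
Hypothesis Me : forall i j, (i < j)%N ->
  (\int[P]_w ((e i j w) ^+ 2)%:E <= (C * psi (j - i)%N)%:E)%E.

(** The weight [j - i] matches the factor [k] of the growth condition, and the dual weights
    [1 / (j - i)] in the Cauchy-Schwarz inequality sum to [N] times a logarithm only. *)
Definition error_energy (N : nat) (w : T) : R :=
  \sum_(0 <= j < N) \sum_(0 <= i < j) (j - i)%:R * e i j w ^+ 2.

Lemma error_energy_ge0 N w : 0 <= error_energy N w.
Proof.
by rewrite sumr_ge0// => j _; rewrite sumr_ge0// => i _; rewrite mulr_ge0// sqr_ge0.
Qed.

Lemma error_sqr_le k m w : (m <= 2 ^ k)%N ->
  (\sum_(0 <= j < m) \sum_(0 <= i < j) `|e i j w|) ^+ 2 <=
  (2 ^ k)%:R * k.+1%:R * error_energy (2 ^ k) w.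
Proof.
move=> mk; set N := (2 ^ k)%N.
pose s := [seq (j, i) | j <- index_iota 0 N, i <- index_iota 0 j].
(* For [i < j] this is [1 / (j - i)]; the predecessor followed by the successor keeps the weight
   positive at all other pairs. *)
pose c (p : nat * nat) : R := (p.1 - p.2).-1.+1%:R^-1.
have c0 p : 0 < c p by rewrite invr_gt0.
have CS := weighted_Cauchy_Schwarz s (fun p => `|e p.2 p.1 w|) c0.
have sumE (F : nat * nat -> R) : \sum_(p <- s) F p =
    \sum_(0 <= j < N) \sum_(0 <= i < j) F (j, i).
  by rewrite /s big_allpairs_dep.
rewrite !sumE in CS.
apply: (@le_trans _ _ ((\sum_(0 <= j < N) \sum_(0 <= i < j) `|e i j w|) ^+ 2)).
  have nn m' : 0 <= \sum_(0 <= j < m') \sum_(0 <= i < j) `|e i j w|.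
    by apply: sumr_ge0 => j _; apply: sumr_ge0 => i _; exact: normr_ge0.
  rewrite ler_pXn2r ?nnegrE ?nn//; apply: sum_nat_le => // j.
  by apply: sumr_ge0 => i _; exact: normr_ge0.
apply: le_trans CS _; apply: ler_pM.
- by apply: sumr_ge0 => j _; apply: sumr_ge0 => i _; exact: ltW.
- by apply: sumr_ge0 => j _; apply: sumr_ge0 => i _; rewrite mulr_ge0 ?invr_ge0 ?sqr_ge0// ltW.
- apply: (@le_trans _ _ (\sum_(0 <= j < N) k.+1%:R)); last first.
    by rewrite sumr_const_nat subn0 -[leLHS]mulr_natl.
  apply: ler_sum_nat => j /andP[_ jN]; apply: le_trans (harmonic_dyadic R k).
  apply: (@le_trans _ _ (\sum_(0 <= i < j) (i.+1%:R^-1 : R))).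
    rewrite big_nat_rev/= add0n; apply: ler_sum_nat => i /andP[_ ij].
    by rewrite /c/= (_ : (j - (j - i.+1)).-1 = i)//; move: ij; clear; lia.
  by apply: sum_nat_le => [l|]; [rewrite invr_ge0|exact: ltnW].
- apply: ler_sum_nat => j _; apply: ler_sum_nat => i /andP[_ ij].
  rewrite /c invrK/= real_normK ?num_real//.
  by rewrite prednK// subn_gt0.
Qed.

Lemma error_sqr_integrable i j : (i < j)%N -> P.-integrable setT (EFin \o (fun w => e i j w ^+ 2)).
Proof.
move=> ij; apply/integrableP; split.
  by apply/measurable_EFinP; exact: measurable_funX.
under eq_integral do rewrite gee0_abs ?lee_fin ?sqr_ge0//.
exact: le_lt_trans (Me ij) (ltry _).
Qed.

Lemma error_energy_integrable N : P.-integrable setT (EFin \o error_energy N).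
Proof.
rewrite /error_energy; elim: N => [|N IH].
  by under eq_fun do rewrite big_geq//; exact: integrable_fun0.
under eq_fun do rewrite big_nat_recr//=.
apply: integrable_funD => //.
have : forall m, (m <= N)%N -> P.-integrable setT
    (EFin \o (fun w => \sum_(0 <= i < m) (N - i)%:R * e i N w ^+ 2)).
  elim=> [|m IHm] mN; first by under eq_fun do rewrite big_geq//; exact: integrable_fun0.
  under eq_fun do rewrite big_nat_recr//=.
  apply: integrable_funD; first exact: (IHm (ltnW mN)).
  by apply: integrable_funZ; exact: error_sqr_integrable.
exact.
Qed.

Hypothesis gpsi : grows tau psi.

Lemma mean_error_energy : exists2 D : R, 0 <= D & forall N : nat, (1 <= N)%N ->
  mean P (error_energy N) <= D * (N%:R * N%:R `^ tau).
Proof.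
have [p0 [D [D0 HD]]] := gpsi.
exists (`|C| * D); first by rewrite mulr_ge0.
move=> N N1.
have colI (j : nat) : P.-integrable setT (EFin \o (fun w => \sum_(0 <= i < j) (j - i)%:R * e i j w ^+ 2)) /\
    mean P (fun w => \sum_(0 <= i < j) (j - i)%:R * e i j w ^+ 2) <=
    \sum_(0 <= i < j) (j - i)%:R * (`|C| * psi (j - i)%N).
  have : forall m, (m <= j)%N -> P.-integrable setT
     (EFin \o (fun w => \sum_(0 <= i < m) (j - i)%:R * e i j w ^+ 2)) /\
     mean P (fun w => \sum_(0 <= i < m) (j - i)%:R * e i j w ^+ 2) <=
     \sum_(0 <= i < m) (j - i)%:R * (`|C| * psi (j - i)%N).
    elim=> [|m IHm] mj.
      split; first by under eq_fun do rewrite big_geq//; exact: integrable_fun0.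
      by under eq_mean do rewrite big_geq//; rewrite mean_cst big_geq.
    have [j1 h1] := IHm (ltnW mj).
    have je := error_sqr_integrable mj.
    have jZ : P.-integrable setT (EFin \o (fun w => (j - m)%:R * e m j w ^+ 2)).
      exact: integrable_funZ.
    split; first by under eq_fun do rewrite big_nat_recr//=; exact: integrable_funD.
    under eq_mean do rewrite big_nat_recr//=.
    rewrite big_nat_recr//= mean_integrableD//; apply: lerD => //.
    have -> : mean P (fun w => (j - m)%:R * e m j w ^+ 2) = (j - m)%:R * mean P (fun w => e m j w ^+ 2).
      exact: mean_integrableZ.
    rewrite ler_wpM2l// -lee_fin integrable_meanE//.
    apply: le_trans (Me mj) _; rewrite lee_fin ler_wpM2r//; exact: ler_norm.
  by apply.
rewrite /error_energy mean_integrable_sum; last by move=> j; have [] := colI j.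
apply: (@le_trans _ _ (\sum_(0 <= j < N) `|C| * (D * N%:R `^ tau))); last first.
  rewrite sumr_const_nat subn0 -[leLHS]mulr_natl le_eqVlt; apply/orP; left; apply/eqP; ring.
apply: ler_sum_nat => j /andP[_ jN]; have [_ h] := colI j; apply: le_trans h _.
apply: le_trans (ler_wpM2l (normr_ge0 C) (HD N N1)).
rewrite mulr_sumr big_nat_rev/= add0n.
apply: (@le_trans _ _ (\sum_(0 <= i < j) `|C| * (i.+1%:R * psi i.+1))).
  apply: ler_sum_nat => i /andP[_ ij].
  rewrite (_ : (j - (j - i.+1) = i.+1)%N); last by move: ij; clear; lia.
  by rewrite mulrCA.
apply: (@le_trans _ _ (\sum_(0 <= i < j.+1) `|C| * (i%:R * psi i))).
  by rewrite [leRHS]big_nat_recl// mul0r mulr0 add0r.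
by apply: sum_nat_le => [l|]; [rewrite !mulr_ge0|exact: leqW].
Qed.

End error_energy.

(** * Assembly of the U-statistic *)

(** Summation by columns exhibits the double sum as partial sums over the larger index, the form to
    which the maximal inequality applies. *)
Lemma triangle_sum (R : realType) (F : nat -> nat -> R) (n : nat) :
  \sum_(1 <= i < n.+1) \sum_(i.+1 <= j < n.+1) F i j =
  \sum_(0 <= j < n.+1) \sum_(0 <= i < j) (if (1 <= i < j)%N then F i j else 0).
Proof.
pose r i j := if (1 <= i < j)%N then F i j else 0.
transitivity (\sum_(0 <= i < n.+1) \sum_(0 <= j < n.+1) r i j).
  rewrite [RHS]big_ltn// [X in _ = X + _]big1 ?add0r; last first.
    by move=> j _; rewrite /r.
  apply: eq_big_nat => i /andP[i1 iN].
  rewrite [RHS](@big_cat_nat _ _ _ i.+1 0 n.+1)//= [X in _ = X + _]big_nat [X in _ = X + _]big1 ?add0r; last first.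
    by move=> j /andP[_ ji]; rewrite /r ifF//; apply/negbTE; move: ji; clear; lia.
  by apply: eq_big_nat => j /andP[ij _]; rewrite /r i1 ij.
rewrite exchange_big/=; apply: eq_big_nat => j /andP[_ jN].
rewrite (@big_cat_nat _ _ _ j 0 n.+1)//= ?(ltnW jN)//.
rewrite [X in _ + X]big_nat [X in _ + X]big1 ?addr0// => i /andP[ji _].
by rewrite /r ifF//; apply/negbTE; move: ji; clear; lia.
Qed.

Theorem theorem1 (R : realType) (d : measure_display) (T : measurableType d)
    (P : probability T R) (X : nat -> {RV P >-> R}) (h : R * R -> R)
    (delta tau : R) :
  stationary_nat X ->
  kernel_fun h ->
  degenerate X h ->
  centered X h ->
  0 < delta ->
  uniform_moments (2 + delta) X h ->
  0 <= tau ->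
  cond_abs_reg X delta tau \/
  cond_strong_mix X h delta tau \/
  cond_functional X h delta tau ->
  {ae P, forall w,
    (n%:R `^ (1 - tau / 2) / (ln n%:R `^ (3 / 2) * ln (ln n%:R))
       * Ustat h (fun i => X i w) n) @[n --> \oo] --> (0 : R)}.
Proof.
move=> sX [mh hsym] hdeg _ d0 [M [hmom hmomX]] tau0 cond.
have [g [psi [C [gpsi dec Hg]]]] := kernel_decomposition sX mh hsym hdeg d0 tau0 hmom hmomX cond.
have mg i j : (1 <= i < j)%N -> measurable_fun setT (g i j) by case/Hg.
have Mg i j : (1 <= i < j)%N -> (\int[P]_w (`|g i j w| `^ (2 + delta))%:E <= C%:E)%E by case/Hg.
have [p0 _] := gpsi.
pose r i j w : R := if (1 <= i < j)%N then h (X i w, X j w) - g i j w else 0.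
have mr i j : measurable_fun setT (r i j).
  rewrite /r; have [ij|_] := boolP (1 <= i < j)%N => //=.
  by apply: measurable_funB; [apply: (measurableT_comp mh); exact: measurable_RV_pair|exact: mg].
have Mr i j : (i < j)%N -> (\int[P]_w ((r i j w) ^+ 2)%:E <= (`|C| * psi (j - i)%N)%:E)%E.
  move=> _; rewrite /r; have [ij|_] := boolP (1 <= i < j)%N => /=; last first.
    under eq_integral do rewrite expr0n/=.
    by rewrite integral0 lee_fin mulr_ge0.
  have [_ _ h1] := Hg _ _ ij; apply: le_trans h1 _.
  by rewrite lee_fin ler_wpM2r// ler_norm.
have [D1 D10 HD1] := correlation_sum_bound d0 gpsi tau0 dec mg Mg.
have [D2 D20 HD2] := mean_error_energy mr Mr gpsi.
pose S w m := \sum_(0 <= j < m) column g j w.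
pose D n w := \sum_(1 <= i < n.+1) \sum_(i.+1 <= j < n.+1) h (X i w, X j w).
(* One bound for all [n < 2 ^ k]: the maximal inequality for the decaying part and the absolute sum
   for the remainder, joined by [(a + b) ^ 2 <= 2 a ^ 2 + 2 b ^ 2]. *)
pose B k w := 2 * (k.+1%:R * dyadic_energy (S w) k 0) +
  2 * ((2 ^ k)%:R * k.+1%:R * error_energy r (2 ^ k) w).
have jY := column_integrable d0 mg Mg.
have jE k : P.-integrable setT (EFin \o (fun w => dyadic_energy (S w) k 0)) := integrable_energy jY k 0.
have jR k : P.-integrable setT (EFin \o error_energy r (2 ^ k)) := error_energy_integrable mr Mr _.
apply: (@normalized_convergence _ _ _ P tau (2 * D1 + 2 * D2) D B tau0).
- move=> k w; rewrite addr_ge0// !mulr_ge0// ?dyadic_energy_ge0// error_energy_ge0//.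
- by move=> k; apply: integrable_funD; do ?apply: integrable_funZ.
- move=> k; rewrite mean_integrableD; [|by do ?apply: integrable_funZ|by do ?apply: integrable_funZ].
  rewrite !mean_integrableZ//; [|exact: integrable_funZ|exact: integrable_funZ].
  have N1 : (1 <= 2 ^ k)%N by rewrite expn_gt0.
  have h1 := mean_energy jY k 0; rewrite mul0n mul1n in h1.
  have h2 : mean P (fun w => dyadic_energy (S w) k 0) <=
      k.+1%:R * (D1 * ((2 ^ k)%:R ^+ 2 * (2 ^ k)%:R `^ tau)).
    exact: le_trans h1 (ler_wpM2l (ler0n _ _) (HD1 _ N1)).
  have h3 := HD2 _ N1.
  have k1 : 1 <= k.+1%:R :> R by rewrite ler1n.
  have x0 : 0 <= (2 ^ k)%:R :> R by [].
  have t0 : 0 <= (2 ^ k)%:R `^ tau :> R by exact: powR_ge0.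
  move: h2 h3 k1 x0 t0.
  generalize (mean P (fun w => dyadic_energy (S w) k 0)) (mean P (error_energy r (2 ^ k)))
    (k.+1%:R : R) ((2 ^ k)%:R : R) ((2 ^ k)%:R `^ tau : R).
  move=> u v n x t h2 h3 n1 x0 t0.
  have n0 : 0 <= n by lra.
  apply: (@le_trans _ _ (2 * (n * (n * (D1 * (x ^+ 2 * t)))) + 2 * (x * n * (D2 * (x * t))))).
    apply: lerD; apply: ler_wpM2l => //.
      exact: ler_wpM2l.
    by apply: ler_wpM2l => //; exact: mulr_ge0.
  have y0 : 0 <= x ^+ 2 * t by rewrite mulr_ge0// sqr_ge0.
  rewrite (_ : x * n * (D2 * (x * t)) = D2 * (n * (x ^+ 2 * t))); last by ring.
  rewrite (_ : n * (n * (D1 * _)) = D1 * (n ^+ 2 * (x ^+ 2 * t))); last by ring.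
  rewrite (_ : (2 * D1 + 2 * D2) * _ = 2 * (D1 * (n ^+ 2 * (x ^+ 2 * t))) +
    2 * (D2 * (n ^+ 2 * (x ^+ 2 * t)))); last by ring.
  (* The remainder carries one factor [n = k + 1] where the first part carries two, and this factor
     is at least 1. *)
  rewrite lerD2l ler_wpM2l// ler_wpM2l// ler_wpM2r// expr2.
  by rewrite ler_peMl.
- move=> k n w nk.
  have S0 : S w 0%N = 0 by rewrite /S big_geq.
  have h1 := dyadic_maximal (S w) 0 nk; rewrite mul0n add0n S0 subr0 in h1.
  have h2 := error_sqr_le r w nk.
  pose G := \sum_(0 <= j < n.+1) \sum_(0 <= i < j) r i j w.
  have DE : D n w = S w n.+1 + G.
    rewrite /D triangle_sum /S /G -big_split/=; apply: eq_bigr => j _.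
    rewrite /column -big_split/=; apply: eq_bigr => i _.
    by rewrite /restricted /r; case: ifP => _; rewrite ?addr0// addrC subrK.
  have GG : G ^+ 2 <= (\sum_(0 <= j < n.+1) \sum_(0 <= i < j) `|r i j w|) ^+ 2.
    rewrite -real_normK ?num_real// ler_pXn2r ?nnegrE//.
      by apply: le_trans (ler_norm_sum _ _ _) _; apply: ler_sum => j _; exact: ler_norm_sum.
    by apply: sumr_ge0 => j _; apply: sumr_ge0 => i _; exact: normr_ge0.
  rewrite DE /B; apply: (@le_trans _ _ (2 * (S w n.+1) ^+ 2 + 2 * G ^+ 2)).
    by have := sqr_ge0 (S w n.+1 - G); nra.
  by apply: lerD; rewrite ler_wpM2l//; apply: le_trans GG h2.
Qed.
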